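(* Suppose that the subtorus $K$ satisfies $$t^N_{\mathbb Z}=k_{\mathbb Z}+\sum_{i\notin J}\mathbb ZX_i\quad\text{for every }J\subset\{1,\dots,N\}\text{ such that }\{\iota^*u_i: i\in J\}\text{ is a basis of }k^*.$$ Fix $\beta\in k_{\mathbb C}^*$ and consider the chamber structure $k^*\setminus\bigcup_{s\in S_\beta}W_s$ for $\beta$. Suppose that the chamber $\mathcal C_-$ is next to the chamber $\mathcal C_+$ across the wall $W_{s_0}$ ($s_0\in S_\beta$). Let $H_{s_0}^{(1)}$ be the 1-dimensional isotropy subgroup corresponding to $W_{s_0}$, let $Y_{s_0}$ be a non-zero element of $\mathrm{Lie}H_{s_0}^{(1)}$, and set $J_{s_0}=\{i\in\{1,\dots,N\}:\langle u_i,Y_{s_0}\rangle\neq0\}$. Fix $\alpha_+\in\mathcal C_+$, $\alpha_-\in\mathcal C_-$, and $\alpha\in\overline{\mathcal C_+}\cap W_{s_0}$ such that $\alpha\notin W_s$ for any $s\in S_\beta\setminus\{s_0\}$. Then: (1) If we set $V_0=\{[z,w]\in X(\alpha,\beta):(z,w)\zeta=(z,w)\text{ for all }\zeta\in H_{s_0}^{(1)}\}$, then $V_0$ is a toric hyperkähler manifold. (2) $\mu_{\mathbb C}^{-1}(\beta)^{\alpha_+\text{-}ss}\subset\mu_{\mathbb C}^{-1}(\beta)^{\alpha\text{-}ss}$ and $\mu_{\mathbb C}^{-1}(\beta)^{\alpha_-\text{-}ss}\subset\mu_{\mathbb C}^{-1}(\beta)^{\alpha\text{-}ss}$. So there are natural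 morphisms $\pi_\pm:(X(\alpha_\pm,\beta),I_1)\to(X(\alpha,\beta),I_1)$. (3) If we set $V_\pm=\pi_\pm^{-1}(V_0)$, then $\pi_\pm|_{V_\pm}:V_\pm\to V_0$ is a fiber bundle whose fiber is biholomorphic to $\mathbb CP^{\#J_{s_0}-1}$. Moreover, the (complex) codimension of $V_\pm$ in $X(\alpha_\pm,\beta)$ is $\#J_{s_0}-1$, where $\#J_{s_0}$ is the number of elements of $J_{s_0}$. (4) The restriction $\pi_\pm|_{X(\alpha_\pm,\beta)\setminus V_\pm}:X(\alpha_\pm,\beta)\setminus V_\pm\to X(\alpha,\beta)\setminus V_0$ is a biholomorphic map.
   Context: Identify $\mathbb H^N$ with $\mathbb C^N\times\mathbb C^N\ni(z,w)$. $T^N=\{\zeta\in\mathbb C^N:|\zeta_i|=1\}$ acts on the right by $(z,w)\zeta=(z\zeta,w\zeta^{-1})$. Let $K\subset T^N$ be a connected subtorus with Lie algebra $k$, inclusion $\iota:k\to t^N$, dual $\iota^*:(t^N)^*\to k^*$; $k_{\mathbb C}=k\otimes\mathbb C$, and $K_{\mathbb C}$ is the complexification of $K$, acting by the same formula. $\{u_i\}\subset(t^N)^*$ is dual to the standard basis $\{X_i\}$ of $t^N$; $t^N_{\mathbb Z}=\sum\mathbb ZX_i$, $k_{\mathbb Z}=k\cap t^N_{\mathbb Z}$. The hyperkähler moment map is $\mu=(\mu_1,\mu_{\mathbb C}):\mathbb H^N\to k^*\times k_{\mathbb C}^*$, $$\mu_1(z,w)=\pi\sum_i(|z_i|^2-|w_i|^2)\iota^*u_i,\qquad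 \mu_{\mathbb C}(z,w)=-2\pi\sqrt{-1}\sum_iz_iw_i\,\iota^*u_i.$$ A toric hyperkähler variety is a hyperkähler quotient $X(\alpha,\beta)=\mu^{-1}(\alpha,\beta)/K$ of this kind (for some $N$, $K$, $(\alpha,\beta)$); when it is a smooth hyperkähler manifold it is called a toric hyperkähler manifold. $I_1$ is the complex structure induced by $(z,w)\mapsto(\sqrt{-1}z,\sqrt{-1}w)$. For $\alpha\in k^*$, $(z,w)\in\mu_{\mathbb C}^{-1}(\beta)$ is $\alpha$-semi-stable if $\alpha\in\sum_i\mathbb R_{\ge0}|z_i|^2\iota^*u_i+\sum_i\mathbb R_{\ge0}|w_i|^2(-\iota^*u_i)$; the set of these is $\mu_{\mathbb C}^{-1}(\beta)^{\alpha\text{-}ss}$. One identifies $(X(\alpha,\beta),I_1)$ with the categorical quotient $\mu_{\mathbb C}^{-1}(\beta)^{\alpha\text{-}ss}/\!/K_{\mathbb C}$, whose points are the $K_{\mathbb C}$-orbits closed in $\mu_{\mathbb C}^{-1}(\beta)^{\alpha\text{-}ss}$ (each meets $\mu_1^{-1}(\alpha)$ in one $K$-orbit). If $\mu_{\mathbb C}^{-1}(\beta)^{\alpha'\text{-}ss}\subset\mu_{\mathbb C}^{-1}(\beta)^{\alpha\text{-}ss}$, the induced map $X(\alpha',\beta)\to X(\alpha,\beta)$ of quotients is the natural morphism; it sends the class of $(z,w)$ to the point represented by the unique closed $K_{\mathbb C}$-orbit in the closure of $(z,w)K_{\mathbb C}$ in $\mu_{\mathbb C}^{-1}(\beta)^{\alpha\text{-}ss}$.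 Let $\{H_1^{(1)},\dots,H_l^{(1)}\}$ be the set of 1-dimensional subgroups of $K$ occurring as isotropy subgroups of points of $\mathbb H^N$, and $W_s=\{v\in k^*:\langle v,\mathrm{Lie}H_s^{(1)}\rangle=0\}$ the corresponding walls. Put $S_\beta=\{s:\beta\in W_s\otimes\mathbb C\}$. A chamber (for $\beta$) is a connected component of $k^*\setminus\bigcup_{s\in S_\beta}W_s$. ''$\mathcal C_-$ is next to $\mathcal C_+$ across $W_{s_0}$'' means that they are distinct chambers sharing a common codimension-one face contained in $W_{s_0}$. *)

(* Defs.v *)
From mathcomp Require Import all_boot all_order all_algebra.
From mathcomp Require Import complex.
From mathcomp Require Import all_classical all_reals all_analysis.
Set Implicit Arguments.
Unset Strict Implicit.
Unset Printing Implicit Defensive.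
Import Order.TTheory GRing.Theory Num.Theory.
Import numFieldNormedType.Exports.
Local Open Scope classical_set_scope.
Local Open Scope ring_scope.

(* The named constant lets the normed-module structures of a numFieldType be
   found on complex vectors; they are not inferred on [R[i]] itself. *)
Definition Cx (R : realType) : numClosedFieldType := R[i].

Definition cre (R : realType) (c : Cx R) : R := complex.Re c.
Definition cim (R : realType) (c : Cx R) : R := complex.Im c.
Definition cof (R : realType) (a b : R) : Cx R := (a +i* b)%C.

(* |c|^2 as a real number *)
Definition sqn (R : realType) (c : Cx R) : R := cre c ^+ 2 + cim c ^+ 2.

Section Torus.
Variable R : realType.

Definition HN (N : nat) : Type := ('rV[Cx R]_N * 'rV[Cx R]_N)%type.

(* exp : t^N -> T^N, normalised so that its kernel is t^N_Z = Z^N *)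
Definition texp N (X : 'rV[R]_N) : 'rV[Cx R]_N :=
  \row_i cof (cos (2 * pi * X 0 i)) (sin (2 * pi * X 0 i)).

Definition tmul N (g h : 'rV[Cx R]_N) : 'rV[Cx R]_N := map2_mx *%R g h.
Definition tinv N (g : 'rV[Cx R]_N) : 'rV[Cx R]_N := map_mx GRing.inv g.

Definition act N (p : HN N) (g : 'rV[Cx R]_N) : HN N :=
  (tmul p.1 g, tmul p.2 (tinv g)).

(* A connected subtorus of T^N of dimension d, together with a basis of its
   Lie algebra k (the rows of [tlie], in the coordinates of t^N = R^N).  The
   basis identifies k with 'rV_d through y |-> y *m tlie (this is iota), k^*
   with 'rV[R]_d by dual coordinates, and k_C^* = k^* (x) C with 'rV[C]_d. *)
Record subtorus (N d : nat) := Subtorus {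
  torus : set 'rV[Cx R]_N;
  tlie : 'M[R]_(d, N);
  torus_unit : forall g, torus g -> forall i, `|g 0 i| = 1;
  torus1 : torus (const_mx 1);
  torusM : forall g h, torus g -> torus h -> torus (tmul g h);
  torusV : forall g, torus g -> torus (tinv g);
  torus_closed : closed torus;
  torus_connected : connected torus;
  tlie_free : row_free tlie;
  tlieP : forall X : 'rV[R]_N,
    (X <= tlie)%MS <-> (forall t : R, torus (texp (t *: X)))
}.

Section Quotients.
Variables (N d : nat) (K : subtorus N d).

Definition k_incl (y : 'rV[R]_d) : 'rV[R]_N := y *m tlie K.

(* iota^* u_i *)
Definition iotau (i : 'I_N) : 'rV[R]_d := (col i (tlie K))^T.

Definition pairing (v y : 'rV[R]_d) : R := \sum_j v 0 j * y 0 j.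

Definition integral_vector n (X : 'rV[R]_n) : Prop :=
  forall i, X 0 i \is a Num.int.

(* t^N_Z = k_Z + sum_(i \notin J) Z X_i whenever (iota^* u_i)_(i in J) is a
   basis of k^* *)
Definition unimodular_subtorus : Prop :=
  forall J : {set 'I_N},
    basis_of {: 'rV[R]_d} [seq iotau i | i in J] ->
    forall X : 'rV[R]_N, integral_vector X <->
      exists (y : 'rV[R]_d) (c : 'rV[R]_N),
        [/\ integral_vector (k_incl y), integral_vector c,
            (forall i, i \in J -> c 0 i = 0) & X = k_incl y + c].

Definition mu1 (p : HN N) : 'rV[R]_d :=
  pi *: \sum_i (sqn (p.1 0 i) - sqn (p.2 0 i)) *: iotau i.

Definition muC (p : HN N) : 'rV[Cx R]_d :=
  (- 2 * cof pi 0 * 'i) *: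
    \sum_i (p.1 0 i * p.2 0 i) *: map_mx (fun t => cof t 0) (iotau i).

Definition level (al : 'rV[R]_d) (be : 'rV[Cx R]_d) : set (HN N) :=
  [set p | mu1 p = al /\ muC p = be].

Definition korb (p : HN N) : set (HN N) :=
  [set q | exists2 g, torus K g & q = act p g].

(* K_C, by its polar decomposition K_C = K exp(sqrt(-1) k) in (C^x)^N *)
Definition torusC : set 'rV[Cx R]_N :=
  [set c | exists g (y : 'rV[R]_d), torus K g /\
    c = tmul g (map_mx (fun t => cof (expR t) 0) (k_incl y))].

Definition corb (p : HN N) : set (HN N) :=
  [set q | exists2 g, torusC g & q = act p g].

(* alpha-semi-stable points of mu_C^{-1}(beta) *)
Definition ss (al : 'rV[R]_d) (be : 'rV[Cx R]_d) : set (HN N) :=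
  [set p | muC p = be /\
    exists a b : 'I_N -> R, [/\ forall i, 0 <= a i, forall i, 0 <= b i &
      al = \sum_i (a i * sqn (p.1 0 i)) *: iotau i
         + \sum_i (b i * sqn (p.2 0 i)) *: - iotau i]].

(* the closed K_C-orbits of mu_C^{-1}(beta)^{alpha-ss} *)
Definition closed_corb al be (O : set (HN N)) : Prop :=
  [/\ exists2 q, ss al be q & O = corb q,
      O `<=` ss al be & closure O `&` ss al be `<=` O].

(* the closed orbit in the closure of p K_C *)
Definition limit_corb al be (p : HN N) : set (HN N) :=
  xget set0 [set O | closed_corb al be O /\ O `<=` closure (corb p)].

(* The quotient map from mu_C^{-1}(beta)^{alpha-ss} to
   X(alpha, beta) = mu^{-1}(alpha, beta) / K: a closed K_C-orbit is
   represented by the K-orbit in which it meets mu_1^{-1}(alpha). *)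
Definition cls al be (p : HN N) : set (HN N) :=
  limit_corb al be p `&` [set q | mu1 q = al].

(* the map X(alpha', beta) -> X(alpha, beta) sending the class of p to the
   class of p, for O a K-orbit in mu^{-1}(alpha', beta) *)
Definition natural_map al be (O : set (HN N)) : set (HN N) :=
  \bigcup_(p in O) cls al be p.

Definition isotropy (p : HN N) : set 'rV[Cx R]_N :=
  [set g | torus K g /\ act p g = p].

Definition lie_of (H : set 'rV[Cx R]_N) : set 'rV[R]_d :=
  [set y | forall t : R, H (texp (t *: k_incl y))].

(* the 1-dimensional isotropy subgroups H_s^(1); they serve as their own
   indices s *)
Definition isotropy1 (H : set 'rV[Cx R]_N) : Prop :=
  (exists p, H = isotropy p) /\
  exists2 Y : 'rV[R]_d, Y != 0 & lie_of H = [set c *: Y | c in [set: R]].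

Definition wall (H : set 'rV[Cx R]_N) : set 'rV[R]_d :=
  [set v | forall y, lie_of H y -> pairing v y = 0].

Definition wallC (H : set 'rV[Cx R]_N) : set 'rV[Cx R]_d :=
  [set v | wall H (map_mx (@cre R) v) /\ wall H (map_mx (@cim R) v)].

Definition Swalls (be : 'rV[Cx R]_d) : set (set 'rV[Cx R]_N) :=
  [set H | isotropy1 H /\ wallC H be].

Definition generic_locus be : set 'rV[R]_d := ~` \bigcup_(H in Swalls be) wall H.

Definition chamber be (Ch : set 'rV[R]_d) : Prop :=
  exists2 v, generic_locus be v & Ch = connected_component (generic_locus be) v.

(* F is a codimension-one face of the closed convex cone [closure Ch] *)
Definition facet (F Ch : set 'rV[R]_d) : Prop :=
  (exists l : 'rV[R]_d, [/\ l != 0,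
     forall v, closure Ch v -> 0 <= pairing v l &
     F = closure Ch `&` [set v | pairing v l = 0]]) /\
  (exists A : 'M[R]_(d.-1, d), row_free A /\ forall j, F (row j A)).

Definition next_across (H : set 'rV[Cx R]_N) (Ch Ch' : set 'rV[R]_d) : Prop :=
  Ch <> Ch' /\ exists F, [/\ F `<=` wall H, facet F Ch & facet F Ch'].

Definition fixed_by (H : set 'rV[Cx R]_N) : set (HN N) :=
  [set p | forall g, H g -> act p g = p].

End Quotients.
End Torus.

(* Reduced complex spaces, as sets with a topology and a sheaf of C-valued
   functions.  The points form a subset [pts] of the carrier [T]; functions
   are total on [T] and only their values on the given open set matter. *)
Section ComplexSpaces.
Variable R : realType.

Record cspace (T : Type) := CSpace {
  pts : set T;
  opn : set (set T);
  hol : set T -> (T -> Cx R) -> Prop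
}.

Definition holomorphic_on (E : normedModType (Cx R)) (O : set E)
    (F : E -> Cx R) : Prop :=
  open O /\ forall p, O p -> differentiable (F : E -> (Cx R)^o) p.

(* The quotient of a locally closed S by the fibres of c: U is open (resp. f
   is holomorphic) iff its pull-back to S is relatively open (resp. is locally
   the restriction of a holomorphic function of the ambient space). *)
Definition quot_space (E : normedModType (Cx R)) (S : set E) (T : Type)
    (c : E -> T) : cspace T := {|
  pts := c @` S;
  opn := [set U | U `<=` c @` S /\
            exists2 O : set E, open O & S `&` c @^-1` U = S `&` O];
  hol := fun U f => forall p, S p -> U (c p) ->
           exists (O : set E) (F : E -> Cx R),
             [/\ holomorphic_on O F, O p &
                 forall q, O q -> S q -> U (c q) -> F q = f (c q)]
|}.

Definition sub_space (T : Type) (X : cspace T) (V : set T) : cspace T := {|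
  pts := pts X `&` V;
  opn := [set U | exists2 U', opn X U' & U = U' `&` V];
  hol := fun U f => forall x, U x ->
           exists (U' : set T) (g : T -> Cx R),
             [/\ opn X U', U' x, hol X U' g &
                 forall y, U' y -> U y -> g y = f y]
|}.

Definition hol_map (T T' : Type) (X : cspace T) (Y : cspace T') (f : T -> T')
    : Prop :=
  [/\ forall x, pts X x -> pts Y (f x),
      forall U, opn Y U -> opn X (pts X `&` f @^-1` U) &
      forall U g, opn Y U -> hol Y U g ->
        hol X (pts X `&` f @^-1` U) (g \o f)].

Definition biholomorphic (T T' : Type) (X : cspace T) (Y : cspace T')
    (f : T -> T') : Prop :=
  hol_map X Y f /\
  exists g : T' -> T, [/\ hol_map Y X g,
    forall x, pts X x -> g (f x) = x & forall y, pts Y y -> f (g y) = y].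

Definition cdomain n (Om : set 'rV[Cx R]_n) : cspace 'rV[Cx R]_n :=
  quot_space Om id.

Definition chart (T : Type) (X : cspace T) n (U : set T) (Om : set 'rV[Cx R]_n)
    (phi : T -> 'rV[Cx R]_n) : Prop :=
  [/\ opn X U, open Om & biholomorphic (sub_space X U) (cdomain Om) phi].

(* Product of two complex manifolds: holomorphy is tested in product charts. *)
Definition prod_space (T T' : Type) (X : cspace T) (Y : cspace T')
    : cspace (T * T') := {|
  pts := pts X `*` pts Y;
  opn := [set W | forall x y, W (x, y) ->
            exists U V, [/\ opn X U, opn Y V, U x, V y & U `*` V `<=` W]];
  hol := fun W f => forall x y, W (x, y) ->
    exists m n U V (Om : set 'rV[Cx R]_m) (Om' : set 'rV[Cx R]_n)
           (phi : T -> 'rV[Cx R]_m) (psi : T' -> 'rV[Cx R]_n)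
           (g : 'rV[Cx R]_m * 'rV[Cx R]_n -> Cx R),
      [/\ chart X U Om phi, chart Y V Om' psi, (U `*` V) (x, y),
          holomorphic_on (Om `*` Om') g &
          forall x' y', U x' -> V y' -> W (x', y') ->
            f (x', y') = g (phi x', psi y')]
|}.

(* CP^n; a point is the set of its homogeneous coordinate vectors *)
Definition line n (v : 'rV[Cx R]_n.+1) : set 'rV[Cx R]_n.+1 :=
  [set c *: v | c in [set c | c != 0]].

Definition CP n : cspace (set 'rV[Cx R]_n.+1) :=
  quot_space [set v : 'rV[Cx R]_n.+1 | v != 0] (@line n).

(* holomorphic fibre bundle: f is locally over Z the projection of a product *)
Definition fiber_bundle (T T' T'' : Type) (Y : cspace T) (Z : cspace T')
    (F : cspace T'') (f : T -> T') : Prop :=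
  hol_map Y Z f /\
  forall x, pts Z x -> exists (U : set T') (Phi : T -> T' * T''),
    [/\ opn Z U, U x,
        biholomorphic (sub_space Y (f @^-1` U))
          (prod_space (sub_space Z U) F) Phi &
        forall y, pts Y y -> U (f y) -> (Phi y).1 = f y].

(* V is a complex submanifold of codimension c of X *)
Definition has_codim (T : Type) (X : cspace T) (V : set T) (c : nat) : Prop :=
  V `<=` pts X /\
  forall x, V x -> exists m U (Om : set 'rV[Cx R]_(c + m)) phi,
    [/\ chart X U Om phi, U x &
        forall y, U y -> (V y <-> lsubmx (phi y) = 0)].

End ComplexSpaces.

Section Hyperkahler.
Variable R : realType.

(* H^N as a real vector space: the rows are Re z, Im z, Re w, Im w *)
Definition quat N (q : 'M[R]_(4, N)) : HN R N :=
  (\row_i cof (q 0 i) (q 1 i), \row_i cof (q 2%:R i) (q 3%:R i)).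

Definition unquat N (p : HN R N) : 'M[R]_(4, N) :=
  \matrix_(r < 4, i < N)
    [:: cre (p.1 0 i); cim (p.1 0 i); cre (p.2 0 i); cim (p.2 0 i)]`_r.

(* I_1, I_2, I_3: left multiplication by i, j, k on z + w j *)
Definition cstr N (a : 'I_3) (p : HN R N) : HN R N :=
  let I1 (p : HN R N) := ('i *: p.1, 'i *: p.2) in
  let I2 (p : HN R N) := (- map_mx Num.conj p.2, map_mx Num.conj p.1) in
  match val a with 0%N => I1 p | 1%N => I2 p | _ => I1 (I2 p) end.

Definition rcstr N (a : 'I_3) (q : 'M[R]_(4, N)) : 'M[R]_(4, N) :=
  unquat (cstr a (quat q)).

Definition dotq N (p q : 'M[R]_(4, N)) : R := \sum_r \sum_i p r i * q r i.

Definition smooth_on (E F : normedModType R) (O : set E) (f : E -> F) : Prop :=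
  open O /\ forall (vs : seq E) (x : E), O x ->
    differentiable (foldr (fun v (g : E -> F) y => 'D_v g y) f vs) x.

Definition tangent N (S : set 'M[R]_(4, N)) (p v : 'M[R]_(4, N)) : Prop :=
  exists gam : R -> 'M[R]_(4, N),
    [/\ gam 0 = p, forall t, S (gam t) & is_derive (0 : R) (1 : R) gam v].

(* A subset Z of H^N (in real coordinates) together with the orbits of a group
   acting on it by isometries commuting with I_1, I_2, I_3. *)
Section OneQuotient.
Variables (N : nat) (Z : set 'M[R]_(4, N)).
Variable orb : 'M[R]_(4, N) -> set 'M[R]_(4, N).

Definition vertical (p v : 'M[R]_(4, N)) : Prop := tangent (orb p) p v.

Definition horizontal (p h : 'M[R]_(4, N)) : Prop :=
  tangent Z p h /\ forall v, vertical p v -> dotq h v = 0.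

(* [phi] parametrises an open subset of the orbit space, with smooth local
   inverses [psi]. *)
Definition quotient_chart m (Om : set 'rV[R]_m) (phi : 'rV[R]_m -> 'M[R]_(4, N))
    : Prop :=
  [/\ smooth_on Om phi, phi @` Om `<=` Z,
      forall x y, Om x -> Om y -> orb (phi x) (phi y) -> x = y &
      forall x, Om x -> exists (O : set 'M[R]_(4, N)) (psi : 'M[R]_(4, N) -> 'rV[R]_m),
        [/\ smooth_on O psi, O (phi x) &
            forall q, O q -> Z q -> Om (psi q) /\ orb q (phi (psi q))]].

(* In a chart, the tangent vector u of the orbit space at x has the horizontal
   lift [lift x u].  The quotient metric, complex structures and Kaehler forms
   are g(u, v) = <lift u, lift v>, lift (I_a u) = I_a (lift u) and
   omega_a(u, v) = <I_a lift u, lift v>; [Gam] is a torsion-free connection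
   (Christoffel symbols at x), hence the Levi-Civita one, for which g and all
   the I_a (equivalently omega_a) are parallel. *)
Definition hyperkahler_chart m (Om : set 'rV[R]_m)
    (phi : 'rV[R]_m -> 'M[R]_(4, N)) : Prop :=
  exists lift : 'rV[R]_m -> 'rV[R]_m -> 'M[R]_(4, N),
  (forall u, smooth_on Om (lift ^~ u)) /\
  forall x, Om x ->
  [/\ forall u, horizontal (phi x) (lift x u) /\
                vertical (phi x) ('D_u phi x - lift x u),
      injective (lift x),
      forall h, horizontal (phi x) h -> exists u, h = lift x u,
      forall a h, horizontal (phi x) h -> horizontal (phi x) (rcstr a h) &
      exists Gam : 'rV[R]_m -> 'rV[R]_m -> 'rV[R]_m,
      [/\ forall u v, Gam u v = Gam v u,
          forall u v w,
            'D_u (fun y => dotq (lift y v) (lift y w) : R^o) x =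
            dotq (lift x (Gam u v)) (lift x w) +
            dotq (lift x v) (lift x (Gam u w)) &
          forall a u v w,
            'D_u (fun y => dotq (rcstr a (lift y v)) (lift y w) : R^o) x =
            dotq (rcstr a (lift x (Gam u v))) (lift x w) +
            dotq (rcstr a (lift x v)) (lift x (Gam u w))]].

(* The orbit space is a smooth hyperkaehler manifold for the quotient
   structure.  (It is Hausdorff and second countable in the applications, the
   group being compact.) *)
Definition hyperkahler_quotient : Prop :=
  exists m : nat, forall p, Z p ->
    exists (Om : set 'rV[R]_m) (phi : 'rV[R]_m -> 'M[R]_(4, N)),
      [/\ quotient_chart Om phi, hyperkahler_chart Om phi &
          exists2 x, Om x & orb p (phi x)].

End OneQuotient.

(* f induces an isomorphism of hyperkaehler manifolds between the orbit spaces: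
   a bijection which has smooth local lifts F, and whose differential D (on
   horizontal vectors) is an isometry onto commuting with the I_a. *)
Definition hyperkahler_iso N N' (Z : set 'M[R]_(4, N))
    (orb : 'M[R]_(4, N) -> set 'M[R]_(4, N)) (Z' : set 'M[R]_(4, N'))
    (orb' : 'M[R]_(4, N') -> set 'M[R]_(4, N'))
    (f : 'M[R]_(4, N) -> 'M[R]_(4, N')) : Prop :=
  [/\ forall q, Z q -> Z' (f q),
      forall p q, Z p -> Z q -> (orb p q <-> orb' (f p) (f q)),
      forall q', Z' q' -> exists2 q, Z q & orb' (f q) q' &
      forall q, Z q ->
        exists (O : set 'M[R]_(4, N)) (F : 'M[R]_(4, N) -> 'M[R]_(4, N'))
               (D : 'M[R]_(4, N) -> 'M[R]_(4, N')),
        [/\ smooth_on O F, O q,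
            forall p, O p -> Z p -> Z' (F p) /\ orb' (f p) (F p),
            forall h, horizontal Z orb q h ->
              [/\ horizontal Z' orb' (F q) (D h),
                  vertical orb' (F q) ('D_h F q - D h),
                  forall k, horizontal Z orb q k ->
                    dotq (D h) (D k) = dotq h k &
                  forall a, D (rcstr a h) = rcstr a (D h)] &
            forall h', horizontal Z' orb' (F q) h' ->
              exists2 h, horizontal Z orb q h & h' = D h]].

Definition rset N (Z : set (HN R N)) : set 'M[R]_(4, N) := @quat N @^-1` Z.

Definition rorb N d (K : subtorus R N d) (q : 'M[R]_(4, N)) : set 'M[R]_(4, N) :=
  rset (korb K (quat q)).

(* Z / K, with the structure induced from H^N, is (isomorphic to) a toric
   hyperkaehler manifold X(alpha', beta') *)
Definition toric_hyperkahler_manifold N d (K : subtorus R N d)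
    (Z : set (HN R N)) : Prop :=
  exists N' d' (K' : subtorus R N' d') (al' : 'rV[R]_d') (be' : 'rV[Cx R]_d'),
    hyperkahler_quotient (rset (level K' al' be')) (rorb K') /\
    exists f, hyperkahler_iso (rset Z) (rorb K)
                (rset (level K' al' be')) (rorb K') f.

End Hyperkahler.

(* X(alpha, beta) with the complex structure I_1, as the categorical quotient;
   its points are the K-orbits in mu^{-1}(alpha, beta). *)
Definition Xspace (R : realType) (N d : nat) (K : subtorus R N d)
    (al : 'rV[R]_d) (be : 'rV[Cx R]_d) : cspace R (set (HN R N)) :=
  quot_space (ss K al be) (cls K al be).

(* Main.v *)
(* Written in the 2N coordinates of H^N, K_C acts linearly with the weights
   +-iota^* u_i, and semistability of a point says that alpha lies in the cone
   spanned by the weights of its support.  Inside the closure of its orbit the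
   closed orbit of a point p is that of the restriction of p to the minimal face
   of this cone containing alpha; by Kempf-Ness it meets the level set of mu_1.
   A hyperplane spanned by weights and containing alpha and beta is a wall of
   S_beta, so at alpha the minimal face either spans, and then semistability for
   alpha and for alpha_+- agree near p, or spans W_{s_0}, and these are the points
   over V_0.  At the latter, unimodularity gives a basis of weights made of the
   face and one weight off the wall, in which all other weights are integral
   monomials: normalising the basis coordinates to 1 and solving mu_C = beta for
   their partners yields slices near each point.  In them pi_+- is visibly a product over
   V_0 with the projective space of the #J_{s_0} coordinates with positive weight,
   since the product of a coordinate and its partner vanishes there.

   For (1), V_0 is the level set of the torus generated by K and by T^{J_{s_0}},
   whose moment map equations force the coordinates in J_{s_0} to vanish.  On the
   slice the equation mu_1 = alpha has a smooth solution in the exponent of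
   exp(sqrt(-1) k).  The horizontal lift of a tangent vector is cut out by
   equations invariant under I_1, I_2, I_3, and projecting the derivative of the
   lifts, corrected by the infinitesimal action of K, to the horizontal space gives
   a torsion-free connection for which the metric and the I_a are parallel. *)

Require Import Defs.
From HB Require Import structures.
From mathcomp Require Import all_boot all_order all_algebra.
From mathcomp Require Import complex.
From mathcomp Require Import all_classical all_reals all_analysis.
From mathcomp Require Import ring lra.
Set Implicit Arguments.
Unset Strict Implicit.
Unset Printing Implicit Defensive.
Import Order.TTheory GRing.Theory Num.Theory.
Import numFieldNormedType.Exports.
Local Open Scope classical_set_scope.
Local Open Scope ring_scope.

(** [K] is given only as a closed connected group with a Lie algebra, while a slice needs it as a
    group of [d] free parameters acting through Laurent monomials. Unimodularity makes the exponents
    integral and connectedness excludes further components. Hence weights are always handled with a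
    basis [kap] of them and the dual basis [Y]; the dual vectors off a face also produce the walls.
    Cone arguments go through Farkas' lemma, so that a minimal face comes with two certificates: a
    representation positive on it and a functional vanishing exactly on it. In (1) the obstacle is
    the smoothness of the implicitly defined exponent. Convexity gives its existence, an exact
    difference equation gives its first derivative, and this derivative is a rational expression in
    exponentials of the solution itself; a class of functions closed under differentiation then
    contains all higher derivatives. On the wall the equation degenerates along [Y0]. It is made
    definite by adding a constant to the coefficients of the two opposite weights at one index of
    [J_{s_0}]; at the solution the two additions cancel. *)

Section ComplexNumbers.
Variable R : realType.
Implicit Types (c : Cx R) (a b : R).

Lemma cofK c : cof (cre c) (cim c) = c. Proof. by case: c. Qed.

Lemma cofD a b a' b' : cof a b + cof a' b' = cof (a + a') (b + b').
Proof. by []. Qed.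

Lemma cofM a b a' b' : cof a b * cof a' b' = cof (a * a' - b * b') (a * b' + b * a').
Proof. by []. Qed.

Lemma cofN a b : - cof a b = cof (- a) (- b). Proof. by []. Qed.

Lemma cof_inj a b a' b' : cof a b = cof a' b' -> a = a' /\ b = b'.
Proof. by case. Qed.

Lemma Cx_eqP c c' : cre c = cre c' -> cim c = cim c' -> c = c'.
Proof. by move=> h h'; rewrite -(cofK c) h h' cofK. Qed.

Lemma creD c c' : cre (c + c') = cre c + cre c'. Proof. by case: c; case: c'. Qed.
Lemma cimD c c' : cim (c + c') = cim c + cim c'. Proof. by case: c; case: c'. Qed.
Lemma creN c : cre (- c) = - cre c. Proof. by case: c. Qed.
Lemma cimN c : cim (- c) = - cim c. Proof. by case: c. Qed.
Lemma creB c c' : cre (c - c') = cre c - cre c'. Proof. by rewrite creD creN. Qed.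
Lemma cimB c c' : cim (c - c') = cim c - cim c'. Proof. by rewrite cimD cimN. Qed.
Lemma creM c c' : cre (c * c') = cre c * cre c' - cim c * cim c'.
Proof. by case: c; case: c'. Qed.
Lemma cimM c c' : cim (c * c') = cre c * cim c' + cim c * cre c'.
Proof. by case: c; case: c'. Qed.

Lemma cre_sum (I : Type) (r : seq I) (P : pred I) (F : I -> Cx R) :
  cre (\sum_(i <- r | P i) F i) = \sum_(i <- r | P i) cre (F i).
Proof. by elim/big_rec2: _ => // i x y _ <-; rewrite creD. Qed.

Lemma cim_sum (I : Type) (r : seq I) (P : pred I) (F : I -> Cx R) :
  cim (\sum_(i <- r | P i) F i) = \sum_(i <- r | P i) cim (F i).
Proof. by elim/big_rec2: _ => // i x y _ <-; rewrite cimD. Qed.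

Definition rC a : Cx R := cof a 0.

Lemma rC0 : rC 0 = 0. Proof. by []. Qed.
Lemma rC1 : rC 1 = 1. Proof. by []. Qed.
Lemma rCD a b : rC (a + b) = rC a + rC b. Proof. by rewrite /rC cofD addr0. Qed.
Lemma rCN a : rC (- a) = - rC a. Proof. by rewrite /rC cofN oppr0. Qed.
Lemma rCM a b : rC (a * b) = rC a * rC b.
Proof. by rewrite /rC cofM !mulr0 mul0r subr0 addr0. Qed.
Lemma rC_inj : injective rC. Proof. by move=> a b []. Qed.
Lemma rC_eq0 a : (rC a == 0) = (a == 0).
Proof. by rewrite -rC0 (inj_eq rC_inj). Qed.
Lemma rCV a : rC a^-1 = (rC a)^-1.
Proof.
have [->|a0] := eqVneq a 0; first by rewrite invr0 rC0 invr0.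
by apply: (mulfI (_ : rC a != 0)); rewrite ?rC_eq0 // -rCM !divff ?rC_eq0.
Qed.
Lemma rC_sum (I : Type) (r : seq I) (P : pred I) (F : I -> R) :
  rC (\sum_(i <- r | P i) F i) = \sum_(i <- r | P i) rC (F i).
Proof. by elim/big_rec2: _ => // i x y _ <-; rewrite rCD. Qed.
Lemma rC_prod (I : Type) (r : seq I) (P : pred I) (F : I -> R) :
  rC (\prod_(i <- r | P i) F i) = \prod_(i <- r | P i) rC (F i).
Proof. by elim/big_rec2: _ => // i x y _ <-; rewrite rCM. Qed.
Lemma rCX a n : rC (a ^+ n) = rC a ^+ n.
Proof. by elim: n => [|n IH]; rewrite ?expr0 // !exprS rCM IH. Qed.
Lemma rC_expz a (n : int) : rC (a ^ n) = rC a ^ n.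
Proof. by case: n => n; rewrite /exprz ?rCV rCX. Qed.
Lemma rC_le a b : (rC a <= rC b) = (a <= b).
Proof. exact: lecR. Qed.
Lemma rC_lt a b : (rC a < rC b) = (a < b).
Proof. exact: ltcR. Qed.
Lemma creZ a c : cre (rC a * c) = a * cre c.
Proof. by rewrite creM /= mul0r subr0. Qed.
Lemma cimZ a c : cim (rC a * c) = a * cim c.
Proof. by rewrite cimM /= mul0r addr0. Qed.
Lemma rC_pos (e : Cx R) : 0 < e -> exists2 a, 0 < a & e = rC a.
Proof. by case: e => a b; rewrite ltcE /= => /andP[/eqP -> a0]; exists a. Qed.

Lemma sqn_ge0 c : 0 <= sqn c. Proof. by rewrite addr_ge0 ?sqr_ge0. Qed.

Lemma sqn_eq0 c : (sqn c == 0) = (c == 0).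
Proof.
by rewrite paddr_eq0 ?sqr_ge0 // !sqrf_eq0 eq_complex.
Qed.

Lemma sqn_gt0 c : (0 < sqn c) = (c != 0).
Proof. by rewrite lt_neqAle sqn_ge0 andbT eq_sym sqn_eq0. Qed.

Lemma sqnM c c' : sqn (c * c') = sqn c * sqn c'.
Proof. by rewrite /sqn creM cimM; ring. Qed.

Lemma sqn_rC a : sqn (rC a) = a ^+ 2.
Proof. by rewrite /sqn /= expr0n addr0. Qed.

Definition cabs c : R := Num.sqrt (sqn c).

Lemma norm_cabs c : `|c| = rC (cabs c). Proof. by case: c. Qed.

Lemma cabs_ge0 c : 0 <= cabs c. Proof. exact: sqrtr_ge0. Qed.

Lemma cabs_eq0 c : (cabs c == 0) = (c == 0).
Proof. by rewrite -rC_eq0 -norm_cabs normr_eq0. Qed.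

Lemma cabs_gt0 c : (0 < cabs c) = (c != 0).
Proof. by rewrite lt_neqAle cabs_ge0 andbT eq_sym cabs_eq0. Qed.

Lemma cabsM c c' : cabs (c * c') = cabs c * cabs c'.
Proof. by rewrite /cabs sqnM sqrtrM ?sqn_ge0. Qed.

Lemma cabs_rC a : cabs (rC a) = `|a|.
Proof. by rewrite /cabs sqn_rC sqrtr_sqr. Qed.

Lemma cabs_sqr c : cabs c ^+ 2 = sqn c. Proof. by rewrite sqr_sqrtr ?sqn_ge0. Qed.

Lemma cabsD c c' : cabs (c + c') <= cabs c + cabs c'.
Proof. by rewrite -rC_le rCD -!norm_cabs ler_normD. Qed.

Lemma cre_le_cabs c : `|cre c| <= cabs c.
Proof. by rewrite -sqrtr_sqr ler_wsqrtr // lerDl sqr_ge0. Qed.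

Lemma cim_le_cabs c : `|cim c| <= cabs c.
Proof. by rewrite -sqrtr_sqr ler_wsqrtr // lerDr sqr_ge0. Qed.

Lemma cabs_le c : cabs c <= `|cre c| + `|cim c|.
Proof.
rewrite -{1}(cofK c); have -> : cof (cre c) (cim c) = rC (cre c) + cof 0 (cim c).
  by rewrite cofD addr0 add0r.
rewrite (le_trans (cabsD _ _)) // cabs_rC lerD2l.
by rewrite /cabs /sqn /= expr0n add0r sqrtr_sqr.
Qed.

Lemma norm1_sqn c : `|c| = 1 <-> sqn c = 1.
Proof.
rewrite -cabs_sqr norm_cabs -rC1; split => [/rC_inj ->|h]; first by rewrite expr1n.
by congr rC; apply/eqP; rewrite -sqrp_eq1 ?cabs_ge0 // h.
Qed.

(** The norm of [Cx R] takes its values in [Cx R], so balls have complex radii; this trades them for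
    real ones. *)
Lemma nbhs_cabsP c (A : set (Cx R)) :
  nbhs c A <-> exists2 e : R, 0 < e & forall c', cabs (c' - c) < e -> A c'.
Proof.
split => [/nbhs_ballP[e /= /rC_pos[a a0 ->] h]|[e e0 h]].
  exists a => // c' cc'; apply: h; rewrite -ball_normE /= distrC norm_cabs.
  by rewrite rC_lt.
apply/nbhs_ballP; exists (rC e) => /=; first by rewrite -rC0 rC_lt.
by move=> c'; rewrite -ball_normE /= distrC norm_cabs rC_lt => /h.
Qed.

Lemma cre_continuous : continuous (@cre R).
Proof.
move=> c A /nbhs_ballP[e /= e0 hA]; apply/nbhs_cabsP; exists e => // c' h.
by apply: hA; rewrite -ball_normE /= distrC -creB (le_lt_trans (cre_le_cabs _)).
Qed.

Lemma cim_continuous : continuous (@cim R).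
Proof.
move=> c A /nbhs_ballP[e /= e0 hA]; apply/nbhs_cabsP; exists e => // c' h.
by apply: hA; rewrite -ball_normE /= distrC -cimB (le_lt_trans (cim_le_cabs _)).
Qed.

Lemma continuous_cof (T : topologicalType) (f g : T -> R) x :
  {for x, continuous f} -> {for x, continuous g} ->
  {for x, continuous (fun t => cof (f t) (g t) : Cx R)}.
Proof.
move=> cf cg A /nbhs_cabsP[e e0 h].
have e2 : 0 < e / 2 by rewrite divr_gt0.
have /cvgrPdist_lt/(_ _ e2) nf := cf; have /cvgrPdist_lt/(_ _ e2) ng := cg.
near=> t; apply: h; rewrite (le_lt_trans (cabs_le _)) // creB cimB /=.
rewrite [ltRHS](splitr e) ltrD // distrC; [near: t; exact: nf|near: t; exact: ng].
Unshelve. all: by end_near. Qed.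

Lemma cabs_continuous : continuous cabs.
Proof.
move=> c A /nbhs_ballP[e /= e0 hA]; apply/nbhs_cabsP; exists e => // c' h.
apply: hA; rewrite -ball_normE /= (le_lt_trans _ h) // ler_norml; apply/andP; split.
  by rewrite lerNl opprB lerBlDr -{1}(subrK c c') cabsD.
rewrite lerBlDr -[c' - c]opprB.
have -> : cabs (- (c - c')) = cabs (c - c') by rewrite /cabs /sqn creN cimN !sqrrN.
by rewrite -{1}(subrK c' c) cabsD.
Qed.

Lemma open_neq0 (T : topologicalType) (f : T -> Cx R) x :
  {for x, continuous f} -> f x != 0 -> \forall t \near x, f t != 0.
Proof.
move=> cf fx; have : nbhs (f x) [set c | c != 0].
  apply/nbhs_cabsP; exists (cabs (f x)); first by rewrite cabs_gt0.
  move=> c h; apply: contraTneq h => ->; rewrite sub0r -leNgt.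
  by rewrite /cabs /sqn creN cimN !sqrrN.
by move=> /cf.
Qed.

Lemma unit_cos_sin a b : a ^+ 2 + b ^+ 2 = 1 -> exists t, a = cos t /\ b = sin t.
Proof.
move=> h; have a1 : -1 <= a <= 1.
  by rewrite -ler_norml -(@ler_pXn2r _ 2) ?nnegrE // real_normK ?num_real // expr1n -h lerDl sqr_ge0.
have s2 : sin (acos a) ^+ 2 = b ^+ 2.
  by have := cos2Dsin2 (acos a); rewrite acosK // -h => /addrI.
have {}s2 : sin (acos a) = `|b|.
  rewrite -sqrtr_sqr -s2 sqrtr_sqr ger0_norm //; apply: sin_ge0_pi.
  by rewrite acos_ge0 ?acos_lepi.
have [b0|b0] := leP 0 b.
  by exists (acos a); rewrite acosK // s2 ger0_norm.
by exists (- acos a); rewrite cosN sinN acosK // s2 ltr0_norm // opprK.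
Qed.

End ComplexNumbers.

(** * Complex coordinates on [H^N], indexed by the weights *)

Section Coordinates.
Variables (R : realType) (N : nat).

Definition sidx := ('I_N * bool)%type.
Definition crd (p : HN R N) (k : sidx) : Cx R := if k.2 then p.2 0 k.1 else p.1 0 k.1.
Definition mkp (c : sidx -> Cx R) : HN R N :=
  (\row_i c (i, false), \row_i c (i, true)).

Lemma crd_mkp c k : crd (mkp c) k = c k.
Proof. by case: k => i [] /=; rewrite /crd /mkp /= mxE. Qed.

Lemma crd_inj p q : (forall k, crd p k = crd q k) -> p = q.
Proof.
case: p => p1 p2; case: q => q1 q2 h; congr pair; apply/rowP => i.
  exact: (h (i, false)).
exact: (h (i, true)).
Qed.

(* HN as a normed module, to fix the structure used by type inference *)
Definition HNn : normedModType (Cx R) := ('rV[Cx R]_N * 'rV[Cx R]_N)%type.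

Lemma crd_continuous k : continuous (fun p : HNn => crd p k).
Proof.
move=> p; case: k => i [] /=; rewrite /crd /=.
  apply: (cvg_comp (fun q : HN R N => q.2) (fun M : 'rV[Cx R]_N => M 0 i)).
    exact: cvg_snd.
  exact: coord_continuous.
apply: (cvg_comp (fun q : HN R N => q.1) (fun M : 'rV[Cx R]_N => M 0 i)).
  exact: cvg_fst.
exact: coord_continuous.
Qed.

Lemma big_sidx (V : nmodType) (F : sidx -> V) :
  \sum_k F k = \sum_i (F (i, false) + F (i, true)).
Proof.
rewrite (eq_bigr (fun i => \sum_b F (i, b))); last by move=> i _; rewrite big_bool addrC.
by rewrite pair_big /=; apply: eq_bigr => -[].
Qed.

End Coordinates.

(** * Polyhedral cones *)

Section Pairing.
Variables (R : realType) (d : nat).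
Implicit Types u v w y : 'rV[R]_d.

Lemma pairingC v y : pairing v y = pairing y v.
Proof. by apply: eq_bigr => j _; rewrite mulrC. Qed.

Lemma pairingDl u v y : pairing (u + v) y = pairing u y + pairing v y.
Proof. by rewrite -big_split; apply: eq_bigr => j _; rewrite mxE mulrDl. Qed.

Lemma pairingZl c v y : pairing (c *: v) y = c * pairing v y.
Proof. by rewrite mulr_sumr; apply: eq_bigr => j _; rewrite mxE mulrA. Qed.

Lemma pairing0l y : pairing 0 y = 0.
Proof. by rewrite -(scale0r 0) pairingZl mul0r. Qed.

Lemma pairingNl v y : pairing (- v) y = - pairing v y.
Proof. by rewrite -scaleN1r pairingZl mulN1r. Qed.

Lemma pairingBl u v y : pairing (u - v) y = pairing u y - pairing v y.
Proof. by rewrite pairingDl pairingNl. Qed.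

Lemma pairing_suml (I : Type) (r : seq I) (P : pred I) (F : I -> 'rV[R]_d) y :
  pairing (\sum_(i <- r | P i) F i) y = \sum_(i <- r | P i) pairing (F i) y.
Proof.
elim/big_rec2: _ => [|i a b _ <-]; first exact: pairing0l.
by rewrite pairingDl.
Qed.

Lemma pairingDr v x y : pairing v (x + y) = pairing v x + pairing v y.
Proof. by rewrite !(pairingC v) pairingDl. Qed.

Lemma pairingZr c v y : pairing v (c *: y) = c * pairing v y.
Proof. by rewrite !(pairingC v) pairingZl. Qed.

Lemma pairing0r v : pairing v 0 = 0.
Proof. by rewrite pairingC pairing0l. Qed.

Lemma pairingNr v y : pairing v (- y) = - pairing v y.
Proof. by rewrite !(pairingC v) pairingNl. Qed.

Lemma pairingBr v x y : pairing v (x - y) = pairing v x - pairing v y.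
Proof. by rewrite pairingDr pairingNr. Qed.

Lemma pairing_sumr (I : Type) (r : seq I) (P : pred I) (F : I -> 'rV[R]_d) v :
  pairing v (\sum_(i <- r | P i) F i) = \sum_(i <- r | P i) pairing v (F i).
Proof. by rewrite pairingC pairing_suml; apply: eq_bigr => i _; rewrite pairingC. Qed.

Lemma pairing_ge0 y : 0 <= pairing y y.
Proof. by apply: sumr_ge0 => i _; rewrite -expr2 sqr_ge0. Qed.

Lemma pairing_eq0 y : (pairing y y == 0) = (y == 0).
Proof.
rewrite psumr_eq0; last by move=> i _; rewrite -expr2 sqr_ge0.
apply/allP/eqP => [h|-> i _]; last by rewrite mxE mulr0 eqxx.
by apply/rowP => j; have /eqP := h j (mem_index_enum j); rewrite mxE -expr2 => /eqP; rewrite sqrf_eq0 => /eqP.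
Qed.

End Pairing.

Section Farkas.
Variables (R : realType) (d : nat) (I : finType).
Implicit Types (v : I -> 'rV[R]_d) (b y : 'rV[R]_d) (P : pred I).

(* Bartl's induction: a vector [y0] separating b from the other generators is
   used to project along the last generator. *)
Lemma farkas_seq (r : seq I) v b :
  (exists2 c : I -> R, (forall i, 0 <= c i) & b = \sum_(i <- r) c i *: v i) \/
  (exists2 y, (forall i, i \in r -> 0 <= pairing (v i) y) & pairing b y < 0).
Proof.
elim: r v b => [|k r IH] v b.
  have [->|b0] := eqVneq b 0; first by left; exists (fun=> 0); rewrite ?big_nil.
  right; exists (- b) => //; rewrite pairingNr oppr_lt0 lt_neqAle pairing_ge0.
  by rewrite eq_sym pairing_eq0 b0.
have [[c c0 ->]|[y0 y0r y0b]] := IH v b.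
  left; have [kr|kr] := boolP (k \in r); last first.
    exists (fun i => if i == k then 0 else c i) => [i|]; first by case: ifP.
    rewrite big_cons eqxx scale0r add0r; apply: eq_big_seq => i ir.
    by case: eqP ir kr => // -> ->.
  (* Coefficients are indexed by elements of [I], not by positions in the list. If [k] already
     occurs in [r], its total coefficient has to be shared by one more occurrence. *)
  exists (fun i => if i == k then c k * (count_mem k r)%:R / (count_mem k r).+1%:R else c i) => [i|].
    by case: ifP => // _; rewrite divr_ge0 ?mulr_ge0.
  rewrite big_cons eqxx.
  have E (f : I -> R) : \sum_(i <- r) f i *: v i =
     (f k * (count_mem k r)%:R) *: v k + \sum_(i <- r | i != k) f i *: v i.
    rewrite (bigID (pred1 k)) /=; congr (_ + _).
    rewrite (eq_bigr (fun=> f k *: v k)); last by move=> i /eqP ->.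
    by rewrite big_const_seq iter_addr_0 -scaler_nat scalerA mulrC.
  rewrite !E eqxx addrA -scalerDl; congr (_ *: _ + _); last first.
    by apply: eq_bigr => i /negPf ->.
  by field; rewrite addrC natr1 pnatr_eq0.
have [yk|yk] := leP 0 (pairing (v k) y0).
  right; exists y0 => // i; rewrite inE => /orP[/eqP ->|] //; exact: y0r.
pose t := - (pairing (v k) y0); have t0 : 0 < t by rewrite oppr_gt0.
pose y1 := t^-1 *: y0.
have y1r i : i \in r -> 0 <= pairing (v i) y1.
  by move=> ir; rewrite pairingZr mulr_ge0 ?invr_ge0 ?y0r // ltW.
have y1b : pairing b y1 < 0 by rewrite pairingZr pmulr_rlt0 ?invr_gt0.
have y1k : pairing (v k) y1 = -1.
  by rewrite pairingZr -[pairing (v k) y0]opprK -/t mulrN mulVf ?gt_eqF.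
pose v' i := v i + pairing (v i) y1 *: v k.
have [[c c0 bE]|[y yr yb]] := IH v' (b + pairing b y1 *: v k).
  have cs : 0 <= \sum_(i <- r) c i * pairing (v i) y1.
    by rewrite big_seq; apply: sumr_ge0 => i ir; rewrite mulr_ge0 ?y1r.
  pose s := \sum_(i <- r) c i * pairing (v i) y1 - pairing b y1.
  have s0 : 0 < s by rewrite /s subr_gt0 (lt_le_trans y1b).
  have {}bE : b = s *: v k + \sum_(i <- r) c i *: v i.
    rewrite (canRL (addrK _) bE) /s scalerBl.
    under eq_bigr do rewrite scalerDr scalerA.
    by rewrite big_split /= -scaler_suml -addrA addrC.
  left.
  exists (fun i => if i == k then (s + c k * (count_mem k r)%:R) / (count_mem k r).+1%:R else c i) => [i|].
    by case: ifP => // _; rewrite divr_ge0 // addr_ge0 ?mulr_ge0 // ltW.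
  rewrite big_cons eqxx {1}bE.
  have E (f : I -> R) : \sum_(i <- r) f i *: v i =
     (f k * (count_mem k r)%:R) *: v k + \sum_(i <- r | i != k) f i *: v i.
    rewrite (bigID (pred1 k)) /=; congr (_ + _).
    rewrite (eq_bigr (fun=> f k *: v k)); last by move=> i /eqP ->.
    by rewrite big_const_seq iter_addr_0 -scaler_nat scalerA mulrC.
  rewrite !E eqxx !addrA -!scalerDl; congr (_ *: _ + _); last first.
    by apply: eq_bigr => i /negPf ->.
  by field; rewrite addrC natr1 pnatr_eq0.
right; exists (y + pairing (v k) y *: y1) => [i|]; last first.
  by rewrite pairingDr pairingZr mulrC -pairingZl -pairingDl.
rewrite inE => /orP[/eqP ->|ir].
  by rewrite pairingDr pairingZr y1k mulrN1 subrr.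
rewrite pairingDr pairingZr mulrC -pairingZl -pairingDl; exact: yr.
Qed.

Definition in_cone v P b := exists c : I -> R,
  [/\ forall i, 0 <= c i, forall i, ~~ P i -> c i = 0 & b = \sum_i c i *: v i].

Lemma farkas v P b :
  in_cone v P b \/
  (exists2 y, (forall i, P i -> 0 <= pairing (v i) y) & pairing b y < 0).
Proof.
have [[c c0 bE]|[y yr yb]] := farkas_seq (enum P) v b; [left|right]; last first.
  by exists y => // i Pi; apply: yr; rewrite mem_enum.
exists (fun i => if P i then c i else 0); split => [i|i /negPf -> //|].
  by case: ifP.
rewrite bE big_enum /= big_mkcond; apply: eq_bigr => i _.
by rewrite unfold_in; case: ifP => // _; rewrite scale0r.
Qed.

Lemma in_cone_ge0 v P b y : in_cone v P b ->
  (forall i, P i -> 0 <= pairing (v i) y) -> 0 <= pairing b y.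
Proof.
move=> [c [c0 cP ->]] h; rewrite pairing_suml; apply: sumr_ge0 => i _.
rewrite pairingZl; have [Pi|Pi] := boolP (P i); first by rewrite mulr_ge0 ?h.
by rewrite cP // mul0r.
Qed.

End Farkas.

Section MinFace.
Variables (R : realType) (d : nat) (I : finType).
Implicit Types (v : I -> 'rV[R]_d) (b y : 'rV[R]_d) (P : pred I).

(* the indices with a positive coefficient in some representation of b: the
   generators on the minimal face of the cone containing b *)
Definition min_face v P b : {set I} :=
  [set i | `[< P i /\ exists c : I -> R, [/\ forall j, 0 <= c j,
      forall j, ~~ P j -> c j = 0, 0 < c i & b = \sum_j c j *: v j] >] ]%SET.

Lemma min_faceP v P b i : reflect (exists c : I -> R, [/\ forall j, 0 <= c j,
      forall j, ~~ P j -> c j = 0, 0 < c i & b = \sum_j c j *: v j])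
   (i \in min_face v P b).
Proof.
rewrite inE; apply: (iffP (asboolP _)) => [[]//|[c [c0 cP ci bE]]]; split.
  by apply: contraTT ci => /cP ->; rewrite ltxx.
by exists c.
Qed.

Lemma min_face_sub v P b i : i \in min_face v P b -> P i.
Proof. by rewrite inE => /asboolP[]. Qed.

(** The representations of [b] form a convex set. Averaging in one witness for each index of the
    face makes all these coefficients positive simultaneously. *)
Lemma min_face_coef v P b : in_cone v P b -> exists c : I -> R,
  [/\ forall i, 0 <= c i, forall i, (0 < c i) = (i \in min_face v P b) &
      b = \sum_i c i *: v i].
Proof.
move=> [c0 [c00 c0P bE0]]; set F := min_face v P b.
suff [c [cge cF cP bE]] : exists c : I -> R, [/\ forall i, 0 <= c i,
    forall i, i \in enum F -> 0 < c i, forall i, ~~ P i -> c i = 0 &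
    b = \sum_i c i *: v i].
  exists c; split => // i; apply/idP/idP => [ci|iF]; last by rewrite cF ?mem_enum.
  by apply/min_faceP; exists c.
have : {subset enum F <= F} by move=> i; rewrite mem_enum.
elim: (enum F) => [|k r IH] sF; first by exists c0; split.
have [|c [cge cF cP bE]] := IH; first by move=> i ir; apply: sF; rewrite inE ir orbT.
have /min_faceP[e [e0 eP ek eE]] : k \in F by apply: sF; rewrite mem_head.
exists (fun i => 2^-1 * c i + 2^-1 * e i); split => [i|i|i Pi|].
- by rewrite addr_ge0 ?mulr_ge0 ?invr_ge0.
- rewrite inE => /orP[/eqP ->|ir].
    by rewrite ltr_wpDl ?mulr_ge0 ?mulr_gt0 ?invr_gt0 ?invr_ge0.
  by rewrite ltr_pwDl ?mulr_ge0 ?mulr_gt0 ?invr_gt0 ?invr_ge0 ?cF.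
- by rewrite cP ?eP ?mulr0 ?addr0.
transitivity (2^-1 *: b + 2^-1 *: b); first by rewrite -scalerDl -div1r -splitr scale1r.
rewrite {1}bE eE !scaler_sumr -big_split; apply: eq_bigr => i _.
by rewrite !scalerA scalerDl.
Qed.

(** For [j] off the face, [- v j] is not in the cone spanned by the generators and [- b], since such
    a relation would give [b] a representation charging [j]. Farkas' lemma then yields a functional
    that is positive at [j], nonnegative on all generators and nonpositive at [b]; the sum of these
    over [j] is [y]. *)
Lemma min_face_sep v P b : in_cone v P b -> exists y,
  [/\ forall i, i \in min_face v P b -> pairing (v i) y = 0,
      forall i, P i -> i \notin min_face v P b -> 0 < pairing (v i) y &
      pairing b y = 0].
Proof.
move=> Cb; set F := min_face v P b.
have [c [c0 cF bE]] := min_face_coef Cb.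
have cP i : ~~ P i -> c i = 0.
  move=> Pi; apply/eqP; rewrite eq_le c0 andbT leNgt cF.
  by apply: contra Pi => /min_face_sub.
have one j : P j -> j \notin F -> exists y,
    [/\ forall i, P i -> 0 <= pairing (v i) y, pairing b y <= 0 & 0 < pairing (v j) y].
  move=> Pj jF.
  pose v' (o : option I) := if o is Some i then v i else - b.
  pose P' (o : option I) := if o is Some i then P i else true.
  have [[e [e0 eP eE]]|[y yP yj]] := farkas v' P' (- v j); last first.
    exists y; split; first by move=> i; exact: (yP (Some i)).
      by have := yP None isT; rewrite pairingNl oppr_ge0.
    by move: yj; rewrite pairingNl oppr_lt0.
  exfalso; move: eE.
  have -> : \sum_o e o *: v' o = - (e None *: b) + \sum_i e (Some i) *: v i.
    by rewrite (bigD1 None) //= scalerN; congr (_ + _); rewrite (reindex_omap Some id) //=; [apply: eq_bigl => i; rewrite eqxx | case].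
  move/eqP; rewrite addrC eq_sym subr_eq addrC => /eqP eE.
  case/negP: jF; apply/min_faceP.
  have ej i : ~~ P i -> e (Some i) = 0 by move=> Pi; apply: (eP (Some i)).
  (* If [b] occurs in the relation, solve for it. Otherwise the relation is a nonnegative
     combination equal to 0 that charges [j], and it is added to the representation [c]. *)
  have [t0|t0] := ltP 0 (e None).
    exists (fun i => (e None)^-1 * (e (Some i) + (i == j)%:R)); split.
    - by move=> i; rewrite mulr_ge0 ?invr_ge0 ?addr_ge0.
    - move=> i Pi; rewrite ej // add0r; case: eqP Pi => [->|_ _]; first by rewrite Pj.
      by rewrite mulr0.
    - by rewrite eqxx mulr_gt0 ?invr_gt0 // ltr_wpDl.
    have en : e None != 0 by rewrite gt_eqF.
    apply: (scalerI en); rewrite scaler_sumr.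
    under eq_bigr do rewrite scalerA mulVKf // scalerDl.
    rewrite big_split /= [X in _ + X](bigD1 j) //= eqxx scale1r.
    rewrite [X in _ + (_ + X)]big1 ?addr0; last by move=> i /negPf ->; rewrite scale0r.
    by rewrite eE subrK.
  have t00 : e None = 0 by apply/eqP; rewrite eq_le e0 t0.
  exists (fun i => c i + (e (Some i) + (i == j)%:R)); split.
  - by move=> i; rewrite !addr_ge0.
  - move=> i Pi; rewrite ej // cP // !add0r; case: eqP Pi => // ->.
    by rewrite Pj.
  - by rewrite eqxx ltr_wpDl ?addr_ge0 // ltr_wpDl.
  under eq_bigr do rewrite !scalerDl.
  rewrite !big_split /= -bE [X in _ + (_ + X)](bigD1 j) //= eqxx scale1r.
  rewrite [X in _ + (_ + (_ + X))]big1 ?addr0; last by move=> i /negPf ->; rewrite scale0r.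
  by rewrite eE t00 scale0r sub0r addNr addr0.
have /choice[Y YP] : forall j, exists y, P j -> j \notin F -> 
    [/\ forall i, P i -> 0 <= pairing (v i) y, pairing b y <= 0 & 0 < pairing (v j) y].
  move=> j; have [Pj|Pj] := boolP (P j); last by exists 0.
  have [jF|jF] := boolP (j \in F); first by exists 0.
  by have [y yP] := one j Pj jF; exists y.
pose y := \sum_(j | P j && (j \notin F)) Y j.
have y0 i : P i -> 0 <= pairing (v i) y.
  move=> Pi; rewrite pairing_sumr; apply: sumr_ge0 => j /andP[Pj jF].
  by have [h _ _] := YP j Pj jF; exact: h.
have yb : pairing b y = 0.
  apply/eqP; rewrite eq_le; apply/andP; split.
    rewrite pairing_sumr; apply: sumr_le0 => j /andP[Pj jF].
    by have [_ h _] := YP j Pj jF; exact: h.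
  exact: in_cone_ge0 y0.
exists y; split => //.
  move=> i iF; have : \sum_j c j * pairing (v j) y = 0.
    by rewrite -[RHS]yb [in RHS]bE pairing_suml; apply: eq_bigr => j _; rewrite pairingZl. 
  move/eqP; rewrite psumr_eq0; last first.
    move=> j _; have [Pj|Pj] := boolP (P j); first by rewrite mulr_ge0 ?y0.
    by rewrite cP // mul0r.
  move/allP/(_ i (mem_index_enum i)); rewrite mulf_eq0 => /orP[/eqP ci|/eqP //].
  by move: iF; rewrite -cF ci ltxx.
move=> i Pi iF; rewrite pairing_sumr (bigD1 i) ?Pi //=.
have [_ _ h] := YP i Pi iF.
rewrite ltr_pwDl //; apply: sumr_ge0 => j /andP[/andP[Pj jF] _].
by have [h' _ _] := YP j Pj jF; exact: h'.
Qed.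

(** The pair [c], [y] certifies [F]: since [y] vanishes at [b], no nonnegative representation of [b]
    can charge a generator on which [y] is positive. *)
Lemma min_face_eq v P (F : {set I}) b (c : I -> R) y :
  (forall i, i \in F -> P i) -> (forall i, 0 <= c i) ->
  (forall i, (0 < c i) = (i \in F)) -> b = \sum_i c i *: v i ->
  (forall i, i \in F -> pairing (v i) y = 0) ->
  (forall i, P i -> i \notin F -> 0 < pairing (v i) y) ->
  min_face v P b = F.
Proof.
move=> FP c0 cF bE yF yP; apply/setP => i; apply/idP/idP; last first.
  move=> iF; apply/min_faceP; exists c; split => // [j Pj|]; last by rewrite cF.
  apply/eqP; rewrite eq_le c0 andbT leNgt cF; apply: contra Pj; exact: FP.
move=> iM; have Pi := min_face_sub iM; case/min_faceP: iM => e [e0 eP ei eE].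
apply: contraLR ei => iF; rewrite -leNgt.
have b0 : pairing b y = 0.
  rewrite bE pairing_suml big1 // => j _; rewrite pairingZl.
  have [jF|] := boolP (j \in F); first by rewrite yF ?mulr0.
  rewrite -cF -leNgt => cj; have -> : c j = 0 by apply/eqP; rewrite eq_le cj c0.
  by rewrite mul0r.

have : \sum_j e j * pairing (v j) y = 0.
  by rewrite -[RHS]b0 [in RHS]eE pairing_suml; apply: eq_bigr => j _; rewrite pairingZl.
move/eqP; rewrite psumr_eq0; last first.
  move=> j _; have [Pj|Pj] := boolP (P j); last by rewrite eP // mul0r.
  rewrite mulr_ge0 //; have [jF|jF] := boolP (j \in F); first by rewrite yF.
  by rewrite ltW ?yP.
move/allP/(_ i (mem_index_enum i)); rewrite mulf_eq0 => /orP[/eqP -> //|/eqP h].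
by have := yP i Pi iF; rewrite h ltxx.
Qed.

End MinFace.

(** * Weights of the torus action *)

Section WeightBases.
Variables (R : realType) (N d : nat) (K : subtorus R N d).

Definition wt (k : sidx N) : 'rV[R]_d := if k.2 then - iotau K k.1 else iotau K k.1.

Lemma pairing_iotau i y : pairing (iotau K i) y = k_incl K y 0 i.
Proof. by rewrite mxE; apply: eq_bigr => j _; rewrite !mxE mulrC. Qed.

Lemma pairing_wt k y : pairing (wt k) y = if k.2 then - k_incl K y 0 k.1 else k_incl K y 0 k.1.
Proof. by rewrite /wt; case: ifP => _; rewrite ?pairingNl pairing_iotau. Qed.

Lemma wt_negb i b : wt (i, ~~ b) = - wt (i, b).
Proof. by case: b; rewrite /wt /= ?opprK. Qed.

Lemma wt_sep y : (forall k, pairing (wt k) y = 0) -> y = 0.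
Proof.
move=> h; have: k_incl K y = k_incl K 0.
  by apply/rowP => i; rewrite -!pairing_iotau (h (i, false)) pairing0r.
by move/(row_free_inj (tlie_free K)).
Qed.

Lemma free_extract (vT : vectType R) (I : eqType) (w : I -> vT) (s b : seq I) :
  free (map w b) -> exists c : seq I,
    [/\ {subset c <= s}, free (map w (c ++ b)) &
        forall i, i \in s -> w i \in <<map w (c ++ b)>>%VS].
Proof.
elim: s b => [|x s IH] b fb; first by exists [::].
have [xb|xb] := boolP (w x \in <<map w b>>%VS).
  have [c [cs fc sc]] := IH b fb; exists c; split => // [i ic|i].
    by rewrite inE cs ?orbT.
  rewrite inE => /orP[/eqP ->|]; last exact: sc.
  by move: xb; apply: subvP; apply: sub_span => y; rewrite map_cat mem_cat => ->; rewrite orbT.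
have [|c [cs fc sc]] := IH (x :: b); first by rewrite /= free_cons xb.
have pe : perm_eq (c ++ x :: b) ((x :: c) ++ b) by rewrite -cat1s perm_catCA.
exists (x :: c); split => [i|//|i].
- by rewrite !inE => /orP[->//|/cs ->]; rewrite orbT.
- by rewrite -(perm_free (perm_map w pe)).
rewrite -(eq_span (perm_mem (perm_map w pe))) inE => /orP[/eqP ->|]; last exact: sc.
by apply/memv_span/map_f; rewrite mem_cat mem_head orbT.
Qed.

(* [Y] is the basis of k dual to the basis [wt \o kap] of k^* *)
Definition wbasis (kap : 'I_d -> sidx N) (Y : 'I_d -> 'rV[R]_d) :=
  (forall l m, pairing (wt (kap l)) (Y m) = (l == m)%:R) /\
  (forall v, v = \sum_l pairing v (Y l) *: wt (kap l)).

Lemma wbasis_unit (kap : 'I_d -> sidx N) :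
  (forall u : 'rV[R]_d, \sum_l u 0 l *: wt (kap l) = 0 -> u = 0) ->
  exists Y, wbasis kap Y.
Proof.
move=> h; pose B : 'M[R]_d := \matrix_l wt (kap l).
have BE (u : 'rV_d) : u *m B = \sum_l u 0 l *: wt (kap l).
  by rewrite mulmx_sum_row; apply: eq_bigr => l _; rewrite rowK.
have uB : B \in unitmx.
  rewrite -row_free_unit -kermx_eq0; apply/eqP/row_matrixP => i.
  by rewrite row0; apply: h; rewrite -BE -row_mul mulmx_ker row0.
exists (fun l => (col l (invmx B))^T).
have P v l : pairing v (col l (invmx B))^T = (v *m invmx B) 0 l.
  by rewrite mxE; apply: eq_bigr => j _; rewrite !mxE.
split=> [l m|v].
  by rewrite P -(rowK (fun l => wt (kap l)) l) -/B -row_mul mulmxV // !mxE.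
by rewrite -[LHS](mulmxKV uB) BE; apply: eq_bigr => l _; rewrite P.
Qed.

(** Farkas' lemma for all weights at once: the set of weights is stable under negation, so a
    functional nonnegative on it vanishes on it, and cannot separate. *)
Lemma wt_span v : exists c : sidx N -> R, v = \sum_k c k *: wt k.
Proof.
have [[c [_ _ ->]]|[y yV]] := farkas wt xpredT v; first by exists c.
rewrite (@wt_sep y) ?pairing0r ?ltxx // => -[i b].
apply/eqP; rewrite eq_le yV // andbT -oppr_ge0 -pairingNl -wt_negb.
exact: yV.
Qed.

(** [L] marks the basis weights taken from [V]. As these span [V], the dual vectors [Y l] with [l]
    outside [L] form a basis of the annihilator of [V]; this is how faces give rise to isotropy
    subalgebras. *)
Lemma extend_wbasis (V : pred (sidx N)) : exists kap Y (L : {set 'I_d}),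
  [/\ wbasis kap Y, forall l, l \in L -> V (kap l) &
      forall k, V k -> forall l, l \notin L -> pairing (wt k) (Y l) = 0].
Proof.
have f0 : free [seq wt i | i <- [::]] by exact: nil_free.
have [b [bV fb sb]] := free_extract (enum V) f0.
rewrite cats0 in fb sb.
have [c [_ fc sc]] := free_extract (enum {: sidx N}) fb.
have spanF : <<[seq wt i | i <- c ++ b]>>%VS = fullv.
  apply/eqP; rewrite eqEsubv subvf /=; apply/subvP => v _.
  have [e ->] := wt_span v; apply: memv_suml => k _; apply/memvZ/sc.
  by rewrite mem_enum.
have sz : size (c ++ b) = d.
  have := fc; rewrite /free spanF dimvf size_map /dim /= mul1n => /eqP ->.
  by [].
pose t : d.-tuple (sidx N) := Tuple (introT eqP sz).
have tE l k0 : tnth t l = nth k0 (c ++ b) l by rewrite (tnth_nth k0).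
have [Y hY] : exists Y, wbasis (tnth t) Y.
  apply: wbasis_unit => u u0.
  have /freeP fp : free [tuple of map wt t] by [].
  apply/rowP => l; rewrite [RHS]mxE; move: l; apply: fp => //.
  by rewrite -[RHS]u0; apply: eq_bigr => l _; rewrite -tnth_nth tnth_map.
(* The weights chosen in [V] form the tail [b] of [c ++ b], hence the indices from [size c] on. *)
exists (tnth t), Y, [set l : 'I_d | (size c <= l)%N]%SET; split => // [l|k Vk l].
  rewrite inE => cl; have k0 := tnth t l; rewrite (tE l k0) nth_cat ltnNge cl /=.
  have /bV : nth k0 b (l - size c) \in b.
    by rewrite mem_nth // ltn_subLR // -size_cat sz.
  by rewrite mem_enum.
rewrite inE -ltnNge => lc.
have kb : wt k \in <<in_tuple [seq wt i | i <- b]>>%VS by apply: sb; rewrite mem_enum.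
rewrite (coord_span kb) pairing_suml big1 // => j _; rewrite pairingZl.
have jb : (j < size b)%N by rewrite -(size_map wt).
rewrite (nth_map k) //.
have jd : (size c + j < d)%N by rewrite -[ltnRHS]sz size_cat ltn_add2l.
have -> : nth k b j = tnth t (Ordinal jd).
  by rewrite (tE _ k) /= nth_cat ltnNge leq_addr /= addKn.
rewrite hY.1 -val_eqE /= gtn_eqF ?mulr0 //.
by rewrite ltn_addr.
Qed.

(** Steinitz exchange with its effect on the dual basis: [Y l0] is only rescaled, which keeps the
    direction of a wall visible after the exchange. *)
Lemma exchange_wbasis kap Y l0 k : wbasis kap Y -> pairing (wt k) (Y l0) != 0 ->
  let Y' l := if l == l0 then (pairing (wt k) (Y l0))^-1 *: Y l0
    else Y l - (pairing (wt k) (Y l) / pairing (wt k) (Y l0)) *: Y l0 in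
  wbasis (fun l => if l == l0 then k else kap l) Y'.
Proof.
move=> [h1 h2] k0 Y'; set a := pairing (wt k) (Y l0) in k0 *.
have D l m : pairing (wt (if l == l0 then k else kap l)) (Y' m) = (l == m)%:R.
  rewrite /Y'; have [->|ml0] := eqVneq m l0.
    rewrite pairingZr; case: (eqVneq l l0) => [_|ll0]; first by rewrite mulVf.
    by rewrite h1 (negPf ll0) mulr0.
  rewrite pairingBr pairingZr; case: (eqVneq l l0) => [->|ll0].
    by rewrite mulfVK // subrr eq_sym (negPf ml0).
  by rewrite !h1 (negPf ll0) mulr0 subr0.
split => // v.
apply/eqP; rewrite -subr_eq0; apply/eqP; set w := v - _.
have wY' m : pairing w (Y' m) = 0.
  rewrite pairingBl pairing_suml (bigD1 m) //= pairingZl D eqxx mulr1.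
  by rewrite big1 ?addr0 ?subrr // => l lm; rewrite pairingZl D (negPf lm) mulr0.
have w0 : pairing w (Y l0) = 0.
  apply/eqP; have := wY' l0; rewrite /Y' eqxx pairingZr => /eqP.
  by rewrite mulf_eq0 invr_eq0 (negPf k0).
rewrite (h2 w) big1 // => m _; have := wY' m; rewrite /Y'.
have [-> _|_] := eqVneq m l0; first by rewrite w0 scale0r.
by rewrite pairingBr pairingZr w0 mulr0 subr0 => ->; rewrite scale0r.
Qed.

(** The coordinate of [wt k] along the [l]-th basis weight. The floor serves only to get an [int];
    it is exact once integrality is known. *)
Definition wcoef (Y : 'I_d -> 'rV[R]_d) k l : int := Num.floor (pairing (wt k) (Y l)).

Hypothesis hK : unimodular_subtorus K.

(** Decompose the standard vector [X_i], for [i] the index of [kap l], by unimodularity. Its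
    component in [k_Z] has the same coordinates on [J] as [X_i], so it is [Y l] up to sign. Thus
    [Y l] is integral, and its pairings with the weights are its coordinates up to sign. *)
Lemma wbasis_int kap Y k l : wbasis kap Y -> pairing (wt k) (Y l) \is a Num.int.
Proof.
move=> [h1 h2].
pose J := [set (kap m).1 | m in 'I_d]%SET.
(* The two weights attached to one index are opposite, so they cannot both occur in a basis; [kap]
   therefore selects [d] distinct elements of [J]. *)
have inj m m' : (kap m).1 = (kap m').1 -> m = m'.
  move=> e; apply/eqP; have := h1 m m; rewrite eqxx.
  have [e2|e2] := eqVneq (kap m).2 (kap m').2.
    have -> : kap m = kap m' by rewrite [LHS]surjective_pairing e e2 -surjective_pairing.
    by rewrite h1 eq_sym; case: (m == m') => //= /eqP; rewrite eq_sym oner_eq0.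
  have -> : kap m = ((kap m').1, ~~ (kap m').2).
    rewrite [LHS]surjective_pairing e; congr pair.
    by case: (kap m).2 (kap m').2 e2 => [] [].
  rewrite wt_negb -surjective_pairing pairingNl h1 [m' == m]eq_sym.
  case: (m == m') => //= /eqP; rewrite oppr0 eq_sym oner_eq0 //.
have bJ : basis_of {: 'rV[R]_d} [seq iotau K i | i in J].
  rewrite basisEdim; apply/andP; split; last first.
    by rewrite size_image dimvf /dim /= mul1n -[leqRHS]card_ord leq_imset_card.
  apply/subvP => v _; rewrite (h2 v); apply: memv_suml => m _; apply: memvZ.
  have mJ : iotau K (kap m).1 \in [seq iotau K i | i in J].
    by apply/mapP; exists (kap m).1 => //; rewrite mem_enum; apply: imset_f.
  by rewrite /wt; case: ifP => _; rewrite ?memvN memv_span.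
pose e : 'rV[R]_N := delta_mx 0 (kap l).1.
have eint : integral_vector e by move=> i; rewrite mxE; case: andP.
have [y [c [yint cint cJ eE]]] := (hK bJ e).1 eint.
have yY : y = (if (kap l).2 then -1 else 1) *: Y l.
  apply/eqP; rewrite -subr_eq0; apply/eqP; apply: wt_sep => k'.
  rewrite (h2 (wt k')) pairing_suml big1 // => m _; rewrite pairingZl.
  rewrite pairingBr pairingZr h1 [pairing (wt (kap m)) y]pairing_wt.
  have -> : k_incl K y 0 (kap m).1 = (m == l)%:R.
    have := congr1 (fun M : 'rV_N => M 0 (kap m).1) eE.
    rewrite [in RHS]mxE cJ ?addr0; last by apply: imset_f.
    move=> <-; rewrite mxE eqxx /=.
    have -> : ((kap m).1 == (kap l).1) = (m == l); last by [].
    by apply/idP/idP => [/eqP/inj ->|/eqP ->].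
  have [<-|ml] := eqVneq m l; last by case: ifP; rewrite !mulr0 ?subr0 ?oppr0 mulr0.
  by case: ifP => _; rewrite ?mulN1r ?mulr1 ?subrr ?mulr0.
have -> : Y l = (if (kap l).2 then -1 else 1) *: y.
  by rewrite yY scalerA; case: ifP; rewrite ?mulrNN !mulr1 scale1r.
rewrite pairingZr pairing_wt.
by case: ifP => _; case: ifP => _; rewrite ?mulN1r ?mul1r ?rpredN yint.
Qed.

Lemma wcoefK kap Y k l : wbasis kap Y -> (wcoef Y k l)%:~R = pairing (wt k) (Y l).
Proof. by move=> h; rewrite floorK //; apply: wbasis_int h. Qed.

Lemma wcoef_kap kap Y l m : wbasis kap Y -> wcoef Y (kap l) m = (l == m)%:R.
Proof.
move=> h; apply: (@intr_inj R); rewrite (wcoefK _ _ h) h.1.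
by case: (l == m).
Qed.

Lemma wcoef_negb kap Y i b l : wbasis kap Y ->
  wcoef Y (i, ~~ b) l = - wcoef Y (i, b) l.
Proof.
move=> h; apply: (@intr_inj R).
by rewrite mulrNz !(wcoefK _ _ h) wt_negb pairingNl.
Qed.

End WeightBases.

(** * Characters of unimodular subtori *)

Section Continuity.
Variables (T : topologicalType) (K : numFieldType).

Lemma eq_continuous_at (U : topologicalType) (f g : T -> U) x : f =1 g ->
  {for x, continuous g} -> {for x, continuous f}.
Proof. by move=> /funext ->. Qed.

Lemma continuous_mx m n (f : T -> 'M[K]_(m, n)) x :
  (forall i j, {for x, continuous (fun t => f t i j)}) -> {for x, continuous f}.
Proof.
move=> h A /nbhs_ballP[e e0 eA].
have : \forall t \near x, forall ij : 'I_m * 'I_n, ball (f x ij.1 ij.2) e (f t ij.1 ij.2).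
  by apply: filter_forall => -[i j]; apply: h; exact: nbhsx_ballx.
by apply: filterS => t ht; apply: eA; split => // i j; exact: (ht (i, j)).
Qed.

Lemma near_forall (I : finType) (P : I -> T -> Prop) (x : T) :
  (forall i, \forall y \near x, P i y) -> \forall y \near x, forall i, P i y.
Proof. exact: filter_forall. Qed.

Lemma open_forall (I : finType) (P : I -> set T) :
  (forall i, open (P i)) -> open [set x | forall i, P i x].
Proof.
move=> oP; rewrite openE => x Px.
have h i : \forall y \near x, P i y by apply: open_nbhs_nbhs; split.
exact: filter_forall h.
Qed.

Lemma continuous_mul (f g : T -> K) x : {for x, continuous f} ->
  {for x, continuous g} -> {for x, continuous (fun t => f t * g t)}.
Proof. exact: cvgM. Qed.

Lemma continuous_add (f g : T -> K) x : {for x, continuous f} ->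
  {for x, continuous g} -> {for x, continuous (fun t => f t + g t)}.
Proof. exact: cvgD. Qed.

Lemma continuous_opp (f : T -> K) x : {for x, continuous f} ->
  {for x, continuous (fun t => - f t)}.
Proof. exact: cvgN. Qed.

Lemma continuous_inv (f : T -> K) x : f x != 0 -> {for x, continuous f} ->
  {for x, continuous (fun t => (f t)^-1)}.
Proof. exact: cvgV. Qed.

Lemma continuous_bigsum (I : Type) (r : seq I) (P : pred I) (f : I -> T -> K) x :
  (forall i, P i -> {for x, continuous (f i)}) ->
  {for x, continuous (fun t => \sum_(i <- r | P i) f i t)}.
Proof.
move=> h; elim: r => [|i r IH].
  by apply: eq_continuous_at (fun t => big_nil _ _ _ _) _; exact: cvg_cst.
apply: eq_continuous_at (fun t => big_cons _ _ _ _ _ _) _.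
by case: (P i) (h i) => [hi|//]; apply: cvgD => //; exact: hi.
Qed.

Lemma continuous_bigprod (I : Type) (r : seq I) (P : pred I) (f : I -> T -> K) x :
  (forall i, P i -> {for x, continuous (f i)}) ->
  {for x, continuous (fun t => \prod_(i <- r | P i) f i t)}.
Proof.
move=> h; elim: r => [|i r IH].
  by apply: eq_continuous_at (fun t => big_nil _ _ _ _) _; exact: cvg_cst.
apply: eq_continuous_at (fun t => big_cons _ _ _ _ _ _) _.
by case: (P i) (h i) => [hi|//]; apply: cvgM => //; exact: hi.
Qed.

Lemma continuous_expz (f : T -> K) (n : int) x : {for x, continuous f} -> f x != 0 ->
  {for x, continuous (fun t => f t ^ n)}.
Proof.
move=> cf f0.
have X m : {for x, continuous (fun t => f t ^+ m)}.
  elim: m => [|m IH]; first exact: cvg_cst.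
  by apply: eq_continuous_at (fun t => exprS (f t) m) _; apply: cvgM.
case: n => n; first exact: X.
by apply: cvgV; [rewrite expf_neq0|exact: X].
Qed.

End Continuity.

Section RealRows.
Variable R : realType.

Lemma rV_normP n (X : 'rV[R]_n) (e : R) : 0 < e -> (`|X| < e) <-> (forall i, `|X 0 i| < e).
Proof.
move=> e0; have := @mx_norm_ball R 1 n; rewrite predeq3E => /(_ 0 e X).
rewrite /ball_ /= sub0r normrN => <-; split => [[_ h] i|h].
  by have := h 0 i; rewrite -ball_normE /= mxE sub0r normrN.
by split => // i j; rewrite (ord1 i) -ball_normE /= mxE sub0r normrN.
Qed.

Lemma rV_coord_le n (X : 'rV[R]_n) i : `|X 0 i| <= `|X|.
Proof.
apply/ler_addgt0Pr => e e0; apply: ltW.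
have h : 0 < `|X| + e by rewrite ltr_wpDl.
by apply: (rV_normP X h).1; rewrite ltrDl.
Qed.

End RealRows.

Section UnitCircle.
Variable R : realType.

Definition cexpi (t : R) : Cx R := cof (cos (2 * pi * t)) (sin (2 * pi * t)).

Lemma cexpiD s t : cexpi (s + t) = cexpi s * cexpi t.
Proof. by rewrite /cexpi mulrDr cosD sinD cofM; congr cof; rewrite addrC. Qed.

Lemma cexpi0 : cexpi 0 = 1.
Proof. by rewrite /cexpi mulr0 cos0 sin0. Qed.

Lemma sqn_cexpi t : sqn (cexpi t) = 1.
Proof. exact: cos2Dsin2. Qed.

Lemma cexpi_neq0 t : cexpi t != 0.
Proof. by rewrite -sqn_eq0 sqn_cexpi oner_eq0. Qed.

Lemma cexpiN t : cexpi (- t) = (cexpi t)^-1.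
Proof.
apply: (mulfI (cexpi_neq0 t)).
by rewrite -cexpiD subrr cexpi0 divff ?cexpi_neq0.
Qed.

Lemma cexpiMz t (n : int) : cexpi (t *~ n) = cexpi t ^ n.
Proof.
have X m : cexpi (t *+ m) = cexpi t ^+ m.
  by elim: m => [|m IH]; rewrite ?mulr0n ?cexpi0 // mulrS cexpiD IH exprS.
by case: n => n; rewrite /exprz /intmul ?cexpiN X.
Qed.

Lemma cexpi_sum (I : Type) (r : seq I) (P : pred I) (f : I -> R) :
  cexpi (\sum_(i <- r | P i) f i) = \prod_(i <- r | P i) cexpi (f i).
Proof. by elim/big_rec2: _ => [|i x y _ <-]; rewrite ?cexpi0 ?cexpiD. Qed.

Lemma cexpi_surj c : sqn c = 1 -> exists t, c = cexpi t.
Proof.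
move=> /unit_cos_sin[t [h h']]; exists (t / (2 * pi)).
rewrite /cexpi mulrC divfK; first by rewrite -h -h' cofK.
by rewrite mulf_neq0 // ?pnatr_eq0 // gt_eqF // pi_gt0.
Qed.

Lemma cexpi_continuous : continuous cexpi.
Proof.
move=> x; apply: continuous_cof.
  apply: (@continuous_comp _ _ _ (fun t => 2 * pi * t) cos); last exact: continuous_cos.
  by apply: cvgM; [exact: cvg_cst|exact: cvg_id].
apply: (@continuous_comp _ _ _ (fun t => 2 * pi * t) sin); last exact: continuous_sin.
by apply: cvgM; [exact: cvg_cst|exact: cvg_id].
Qed.

Lemma cexpi_triv t : (forall s, cexpi (s * t) = 1) -> t = 0.
Proof.
move=> h; apply/eqP; apply: contraT => t0.
have := h ((2 * t)^-1); rewrite invfM -mulrA mulVf // mulr1 /cexpi.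
rewrite mulrAC divff ?pnatr_eq0 // mul1r cospi -rC1 => /cof_inj[/eqP].
by rewrite lt_eqF.
Qed.

Definition carg (c : Cx R) : R := asin (cim c) / (2 * pi).

Lemma carg1 : carg 1 = 0.
Proof.
rewrite /carg /=; have -> : asin (0 : R) = 0; last by rewrite mul0r.
apply: sin_inj; rewrite ?in_itv /=.
- by rewrite asin_geNpi2 ?asin_lepi2 // lerN10 ler01.
- by rewrite oppr_le0 divr_ge0 // ?pi_ge0.
by rewrite asinK ?sin0 // in_itv /= lerN10 ler01.
Qed.

Lemma cargK c : sqn c = 1 -> 0 < cre c -> cexpi (carg c) = c.
Proof.
move=> c1 c0; rewrite /cexpi /carg mulrC divfK; last first.
  by rewrite mulf_neq0 // ?pnatr_eq0 // gt_eqF // pi_gt0.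
have h : -1 <= cim c <= 1.
  rewrite -ler_norml -(@ler_pXn2r _ 2) ?nnegrE // real_normK ?num_real //.
  by rewrite expr1n -c1 lerDr sqr_ge0.
rewrite cos_asin // asinK // -c1 addrK sqrtr_sqr gtr0_norm //; exact: cofK.
Qed.

Lemma carg_small (e : R) : 0 < e -> exists2 dl, 0 < dl &
  forall c, cabs (c - 1) < dl -> 0 < cre c /\ `|carg c| < e.
Proof.
move=> e0; have ci : {for 1, continuous carg}.
  apply: (@continuous_comp _ _ _ (@cim R) (fun t => asin t / (2 * pi))).
    exact: cim_continuous.
  apply: cvgM; last exact: cvg_cst.
  by apply: continuous_asin; rewrite /= ltrN10 ltr01.
have n1 : \forall c \near (1 : Cx R), 0 < cre c /\ `|carg c| < e.
  near=> c; split; near: c.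
    apply: (@cre_continuous R 1 [set x | 0 < x]).
    by apply: open_nbhs_nbhs; split; [exact: open_gt|exact: ltr01].
  have /cvgrPdist_lt/(_ _ e0) := ci; apply: filterS => c.
  by rewrite carg1 sub0r normrN.
by have [dl d0 h] := (nbhs_cabsP _ _).1 n1; exists dl.
Unshelve. all: by end_near. Qed.

End UnitCircle.

Section TorusStructure.
Variables (R : realType) (N d : nat) (K : subtorus R N d).

Definition sgc (g : 'rV[Cx R]_N) (k : sidx N) : Cx R :=
  if k.2 then (g 0 k.1)^-1 else g 0 k.1.

Lemma crd_act p g k : crd (act p g) k = crd p k * sgc g k.
Proof. by case: k => i [] /=; rewrite /crd /sgc /= !mxE. Qed.

Lemma torus_neq0 g i : torus K g -> g 0 i != 0.
Proof. by move=> /torus_unit h; rewrite -normr_eq0 h oner_eq0. Qed.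

Lemma texpE (X : 'rV[R]_N) i : texp X 0 i = cexpi (X 0 i).
Proof. by rewrite mxE. Qed.

Lemma texp_continuous : continuous (@texp R N).
Proof.
move=> X; apply: continuous_mx => i j; rewrite (ord1 i).
apply: eq_continuous_at (fun t => texpE _ _) _.
apply: (@continuous_comp _ _ _ (fun M : 'rV[R]_N => M 0 j) (@cexpi R)).
  exact: coord_continuous.
exact: cexpi_continuous.
Qed.

Lemma texpZz (X : 'rV[R]_N) (q : int) : torus K (texp X) -> torus K (texp (X *~ q)).
Proof.
have X0 : texp (0 : 'rV[R]_N) = const_mx 1.
  by apply/rowP => i; rewrite texpE !mxE cexpi0.
have XD (X1 X2 : 'rV[R]_N) : texp (X1 + X2) = tmul (texp X1) (texp X2).
  by apply/rowP => i; rewrite texpE !mxE cexpiD.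
move=> h; have XN m : torus K (texp (X *+ m)).
  elim: m => [|m IH]; first by rewrite mulr0n X0; exact: torus1.
  by rewrite mulrS XD; apply: torusM.
case: q => q; first exact: XN.
have -> : texp (X *~ Negz q) = tinv (texp (X *+ q.+1)).
  apply/rowP => i; rewrite texpE [RHS]mxE texpE -cexpiN; congr cexpi.
  by rewrite /intmul mxE.
exact: torusV (XN _).
Qed.

(* a sequence of one-parameter directions of torus elements tending to 1 has a
   limit direction lying in the Lie algebra *)
Lemma torus_limit_direction (Z : set 'I_N) :
  (forall e : R, 0 < e -> exists X : 'rV[R]_N,
    [/\ X != 0, `|X| < e, torus K (texp X) & forall i, Z i -> X 0 i = 0]) ->
  exists2 y : 'rV[R]_d, y != 0 & forall i, Z i -> k_incl K y 0 i = 0.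
Proof.
move=> h.
have /choice[X XP] : forall n : nat, exists X : 'rV[R]_N,
    [/\ X != 0, `|X| < n.+1%:R^-1, torus K (texp X) & forall i, Z i -> X 0 i = 0].
  by move=> n; apply: h; rewrite invr_gt0.
pose u n : 'rV[R]_N := `|X n|^-1 *: X n.
have u1 n : `|u n| = 1 by have [X0 _ _ _] := XP n; rewrite normfZV.
have cS : compact [set x : 'rV[R]_N | `|x| = 1].
  apply: bounded_closed_compact.
    by exists 1; split; [exact: num_real|move=> M M1 x /= ->; exact: ltW].
  rewrite (_ : [set x | _] = (fun x : 'rV[R]_N => `|x|) @^-1` [set 1]) //.
  apply: closed_comp; last exact: closed_eq.
  by move=> x _; exact: norm_continuous.
have [|p [p1 cp]] := cS (u @ \oo) _; first by exists 0%N => // n _ /=.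
rewrite /= in p1.
have near_p dl : 0 < dl -> exists n, [/\ `|X n| < dl & `|u n - p| < dl].
  move=> dl0.
  have F1 : (u @ \oo) (u @` [set n | n.+1%:R^-1 < dl]).
    have := near_infty_natSinv_lt (PosNum dl0).
    by apply: filterS => n hn; exists n.
  have [_ [[n nd <-] bn]] := cp _ _ F1 (nbhsx_ballx p dl dl0).
  exists n; have [_ Xn _ _] := XP n; split; first exact: lt_trans Xn nd.
  by move: bn; rewrite -ball_normE /= distrC.
(* The integer multiples of [X n] exponentiate into [K], and the multiple by the floor of
   [s / |X n|] is at distance at most [|X n| + |s| |u n - p|] from [s *: p]. Closedness of [K]
   finishes. *)
have pK s : torus K (texp (s *: p)).
  apply: (torus_closed (s:=K)) => B /texp_continuous/nbhs_ballP[e /= e0 eB].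
  have s0 : 0 < 1 + `|s| by rewrite ltr_pwDl.
  have dl0 : 0 < e / (1 + `|s|) by rewrite divr_gt0.
  have [n [tn un]] := near_p _ dl0.
  pose q := Num.floor (s / `|X n|).
  exists (texp (X n *~ q)); split.
    by apply: texpZz; have [] := XP n.
  apply: eB; rewrite -ball_normE /=.
  have [X0 _ _ _] := XP n; have t0 : 0 < `|X n| by rewrite normr_gt0.
  have -> : s *: p - X n *~ q = - ((q%:~R * `|X n| - s) *: u n + s *: (u n - p)).
    have tu : `|X n| *: u n = X n by rewrite /u scalerA divff ?gt_eqF // scale1r.
    by rewrite scalerBl scalerBr addrA subrK opprB -scalerA tu scaler_int.
  rewrite normrN (le_lt_trans (ler_normD _ _)) // [X in X + _]normrZ [X in _ + X]normrZ u1 mulr1.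
  have qs : `|q%:~R * `|X n| - s| <= `|X n|.
    have /andP[q1 q2] := floor_itv (s / `|X n|).
    rewrite -/q in q1 q2; move: q1 q2; rewrite ler_pdivlMr // ltr_pdivrMr // => q1 q2.
    rewrite ler0_norm ?subr_le0 // opprB lerBlDr ltW //.
    by rewrite (lt_le_trans q2) // intrD mulrDl mul1r addrC.
  rewrite (@lt_le_trans _ _ (e / (1 + `|s|) + `|s| * (e / (1 + `|s|)))) //.
    by rewrite ltr_leD ?(le_lt_trans qs) // ler_wpM2l // ltW.
  by rewrite -[X in X + _]mul1r -mulrDl mulrC divfK ?gt_eqF.
have /submxP[y yE] := (tlieP K p).2 pK.
exists y.
  apply/eqP => y0; move: p1; rewrite yE y0 mul0mx normr0 => /eqP.
  by rewrite eq_sym oner_eq0.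
move=> i Zi; rewrite /k_incl -yE.
apply/eqP; rewrite -normr_eq0 eq_le normr_ge0 andbT; apply/ler_addgt0Pr => e e0.
rewrite add0r; have [n [_ un]] := near_p e e0.
have [_ _ _ Xi] := XP n.
rewrite (le_trans _ (ltW un)) // (le_trans _ (rV_coord_le _ i)) //.
by rewrite !mxE Xi // mulr0 sub0r normrN.
Qed.

Hypothesis hK : unimodular_subtorus K.
Variables (kap : 'I_d -> sidx N) (Y : 'I_d -> 'rV[R]_d).
Hypothesis hY : wbasis K kap Y.

Notation A := (wcoef K Y).

(** The value of the character [wt k] at the point where the basis characters [wt (kap l)] take the
    values [h l]. *)
Definition mon (h : 'I_d -> Cx R) (k : sidx N) : Cx R := \prod_l h l ^ A k l.

Lemma mon_kap h l : mon h (kap l) = h l.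
Proof.
rewrite /mon (bigD1 l) //= (wcoef_kap hK _ _ hY) eqxx big1 ?mulr1 ?expr1z // => m ml.
by rewrite (wcoef_kap hK _ _ hY) eq_sym (negPf ml) expr0z.
Qed.

Lemma mon_negb h i b : mon h (i, ~~ b) = (mon h (i, b))^-1.
Proof.
rewrite -prodfV; apply: eq_bigr => l _.
by rewrite (wcoef_negb hK _ _ _ hY) invr_expz.
Qed.

Lemma monM h h' k : mon (fun l => h l * h' l) k = mon h k * mon h' k.
Proof. by rewrite -big_split; apply: eq_bigr => l _; rewrite expfzMl. Qed.

Lemma monV h k : mon (fun l => (h l)^-1) k = (mon h k)^-1.
Proof. by rewrite -prodfV; apply: eq_bigr => l _; rewrite expfV. Qed.

Lemma mon1 k : mon (fun=> 1) k = 1.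
Proof. by rewrite /mon big1 // => l _; rewrite exp1rz. Qed.

Lemma mon_neq0 h k : (forall l, h l != 0) -> mon h k != 0.
Proof. by move=> h0; apply/prodf_neq0 => l _; rewrite expfz_neq0. Qed.

Lemma sgc_row_mon h k : sgc (\row_i mon h (i, false)) k = mon h k.
Proof.
by case: k => i [] /=; rewrite /sgc /= mxE // -(mon_negb h i false).
Qed.

Lemma wt_expand y k : pairing (wt K k) y = \sum_l pairing (wt K (kap l)) y *~ A k l.
Proof.
rewrite {1}(hY.2 (wt K k)) pairing_suml; apply: eq_bigr => l _.
by rewrite pairingZl -(wcoefK hK _ _ hY) mulrzl.
Qed.

Lemma cexpi_mon y k : cexpi (pairing (wt K k) y) = mon (fun l => cexpi (pairing (wt K (kap l)) y)) k.
Proof. by rewrite wt_expand cexpi_sum; apply: eq_bigr => l _; rewrite cexpiMz. Qed.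

Lemma texp_mon y : texp (k_incl K y) = \row_i mon (fun l => cexpi (pairing (wt K (kap l)) y)) (i, false).
Proof. by apply/rowP => i; rewrite texpE [RHS]mxE -cexpi_mon pairing_wt. Qed.

Lemma wbasis_pairing (th : 'I_d -> R) l :
  pairing (wt K (kap l)) (\sum_m th m *: Y m) = th l.
Proof.
rewrite pairing_sumr (bigD1 l) //= pairingZr hY.1 eqxx mulr1 big1 ?addr0 // => m ml.
by rewrite pairingZr hY.1 eq_sym (negPf ml) mulr0.
Qed.

Lemma torus_texp y : torus K (texp (k_incl K y)).
Proof.
have /(tlieP K (k_incl K y))/(_ 1) : (k_incl K y <= tlie K)%MS by exact: submxMl.
by rewrite scale1r.
Qed.

Lemma mon_torus h : (forall l, sqn (h l) = 1) -> torus K (\row_i mon h (i, false)).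
Proof.
move=> h1; have /choice[th thE] l := cexpi_surj (h1 l).
have -> : \row_i mon h (i, false) = texp (k_incl K (\sum_m th m *: Y m)).
  rewrite texp_mon; apply/rowP => i; rewrite [LHS]mxE [RHS]mxE; congr (mon _ _).
  by apply/funext => l; rewrite wbasis_pairing.
exact: torus_texp.
Qed.

Lemma sgc_continuous k g : torus K g -> {for g, continuous (fun g => sgc g k)}.
Proof.
move=> Kg; case: k => i [] /=; rewrite /sgc /=.
  by apply: continuous_inv; [exact: torus_neq0 Kg|exact: (@coord_continuous (Cx R) 1 N 0 i)].
exact: (@coord_continuous (Cx R) 1 N 0 i).
Qed.

Lemma sgc_neq0 k g : torus K g -> sgc g k != 0.
Proof. by move=> /torus_neq0 h; rewrite /sgc; case: ifP => _; rewrite ?invr_eq0 h. Qed.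

Lemma sqn_sgc k g : torus K g -> sqn (sgc g k) = 1.
Proof.
move=> /torus_unit h; apply/norm1_sqn; rewrite /sgc.
by case: ifP => _; rewrite ?normfV h ?invr1.
Qed.

(** The quotient of [g] by the monomial point with the same basis characters: the obstruction to [g]
    being determined by these. *)
Definition mon_rest (g : 'rV[Cx R]_N) : 'rV[Cx R]_N :=
  \row_i (g 0 i * (mon (fun l => sgc g (kap l)) (i, false))^-1).

Lemma mon_rest_torus g : torus K g -> torus K (mon_rest g).
Proof.
move=> Kg; rewrite (_ : mon_rest g =
  tmul g (tinv (\row_i mon (fun l => sgc g (kap l)) (i, false)))).
  by apply: torusM => //; apply: torusV; apply: mon_torus => l; exact: sqn_sgc.
by apply/rowP => i; rewrite !mxE.
Qed.

Lemma sgc_mon_rest g k : sgc (mon_rest g) k = sgc g k * (mon (fun l => sgc g (kap l)) k)^-1.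
Proof.
case: k => i [] /=; rewrite /sgc /= mxE // invfM; congr (_ * _).
by rewrite -mon_negb.
Qed.

Lemma mon_rest_kap g l : torus K g -> sgc (mon_rest g) (kap l) = 1.
Proof. by move=> Kg; rewrite sgc_mon_rest mon_kap divff // sgc_neq0. Qed.

(** The image [M] of [mon_rest] is connected, as [K] is, and all basis characters are 1 on it. If 1
    were not isolated in [M], logarithms of elements of [M] tending to 1 would have a limit
    direction in the Lie algebra killed by all basis weights, which must be 0. So the point 1 is
    open and closed in [M]. *)
Lemma mon_rest_eq1 g : torus K g -> mon_rest g = const_mx 1.
Proof.
pose M := mon_rest @` torus K.
have M1 : M (const_mx 1).
  exists (const_mx 1); first exact: torus1.
  have s1 k : sgc (const_mx 1) k = 1 by rewrite /sgc !mxE; case: ifP; rewrite ?invr1.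
  apply/rowP => i; rewrite !mxE (_ : (fun l => _) = fun=> 1) ?mon1 ?divr1 //.
  by apply/funext => l; exact: s1.
have cM : connected M.
  apply: connected_continuous_connected; first exact: torus_connected.
  apply: continuous_in_subspaceT => h; rewrite inE => Kh.
  apply: continuous_mx => i j; apply: eq_continuous_at (fun t => mxE _ _ _ _) _.
  apply: continuous_mul; first exact: (@coord_continuous (Cx R) 1 N 0 j).
  apply: continuous_inv; first by apply: mon_neq0 => l; exact: sgc_neq0.
  apply: continuous_bigprod => l _; apply: continuous_expz; last exact: sgc_neq0.
  exact: sgc_continuous.
have [dl dl0 iso] : exists2 dl : R, 0 < dl &
    forall m, M m -> (forall i, cabs (m 0 i - 1) < dl) -> m = const_mx 1.
  apply: contrapT => nex.
  have [|y y0 yk] := @torus_limit_direction [set i | exists l, (kap l).1 = i].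
    move=> e e0; have [dl dl0 hdl] := carg_small e0.
    have [m [Mm mdl m1]] : exists m, [/\ M m, forall i, cabs (m 0 i - 1) < dl & m <> const_mx 1].
      apply: contrapT => h; apply: nex; exists dl => // m Mm mdl.
      by apply: contrapT => m1; apply: h; exists m.
    have Km : torus K m by case: Mm => g' Kg' <-; exact: mon_rest_torus.
    have mE : texp (\row_i carg (m 0 i)) = m.
      apply/rowP => i; rewrite texpE mxE; have [c0 _] := hdl _ (mdl i).
      by rewrite cargK // -norm1_sqn; apply: torus_unit Km i.
    exists (\row_i carg (m 0 i)); split => [||//|i [l <-]].
    - apply/eqP => h; apply: m1; rewrite -mE h; apply/rowP => i.
      by rewrite texpE !mxE cexpi0.
    - by apply/rV_normP => // i; rewrite mxE; have [_] := hdl _ (mdl i).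
    - by rewrite mE.
    rewrite mxE; case: Mm => g' Kg' gE.
    have := mon_rest_kap l Kg'; rewrite gE /sgc; case: ifP => _ h.
      by rewrite -[m 0 _]invrK h invr1 carg1.
    by rewrite h carg1.
  move/eqP: y0; apply; apply: (wt_sep (K := K)) => k.
  rewrite wt_expand big1 // => l _; rewrite pairing_wt yk; last by exists l.
  by rewrite oppr0 if_same mul0rz.
have eM : [set const_mx 1] = M.
  apply: cM; first by exists (const_mx 1).
    exists [set m : 'rV[Cx R]_N | forall i, cabs (m 0 i - 1) < dl].
      apply: (open_forall (P := fun i (m' : 'rV[Cx R]_N) => cabs (m' 0 i - 1) < dl)) => i.
      apply: (@open_comp _ _ (fun m' : 'rV[Cx R]_N => cabs (m' 0 i - 1)) [set r | r < dl]); last exact: open_lt.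
      move=> m _; apply: (@continuous_comp _ _ _ (fun m' : 'rV[Cx R]_N => m' 0 i - 1) (@cabs R)).
        apply: continuous_add; first exact: (@coord_continuous (Cx R) 1 N 0 i).
        exact: cst_continuous.
      exact: cabs_continuous.
    apply/seteqP; split => [m ->|m [Mm]]; last exact: iso.
    by split => // i; rewrite mxE subrr -rC0 cabs_rC normr0.
  exists [set const_mx 1].
    apply: accessible_closed_set1; apply: hausdorff_accessible; exact: norm_hausdorff.
  by apply/seteqP; split => [m ->|m []].
move=> Kg; have : M (mon_rest g) by exists g.
by rewrite -eM.
Qed.

Lemma torus_monE g k : torus K g -> sgc g k = mon (fun l => sgc g (kap l)) k.
Proof.
move=> Kg; have : sgc (mon_rest g) k = 1.
  by rewrite mon_rest_eq1 // /sgc !mxE; case: ifP; rewrite ?invr1.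
rewrite sgc_mon_rest => h; apply/eqP; rewrite -subr_eq0; apply/eqP.
have m0 : mon (fun l => sgc g (kap l)) k != 0 by apply: mon_neq0 => l; exact: sgc_neq0.
apply: (mulIf (_ : (mon (fun l => sgc g (kap l)) k)^-1 != 0)); first by rewrite invr_eq0.
by rewrite mul0r mulrBl h divff // subrr.
Qed.

Lemma expR_mon y k : rC (expR (pairing (wt K k) y)) =
  mon (fun l => rC (expR (pairing (wt K (kap l)) y))) k.
Proof.
have X (a : R) (n : int) : expR (a *~ n) = expR a ^ n.
  case: n => n; first by rewrite -[a *~ n]/(a *+ n) -mulr_natl expRM_natl.
  by rewrite /intmul /exprz expRN -mulr_natl expRM_natl.
rewrite wt_expand expR_sum rC_prod; apply: eq_bigr => l _.
by rewrite X rC_expz.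
Qed.

Definition cexp (y : 'rV[R]_d) : 'rV[Cx R]_N := map_mx (fun t => cof (expR t) 0) (k_incl K y).

Lemma sgc_cexp y k : sgc (cexp y) k = rC (expR (pairing (wt K k) y)).
Proof.
by rewrite pairing_wt /sgc mxE; case: ifP => _ //; rewrite expRN rCV.
Qed.

Lemma sgc_tmul g h k : sgc (tmul g h) k = sgc g k * sgc h k.
Proof. by rewrite /sgc !mxE; case: ifP => _ //; rewrite invfM. Qed.

Lemma torusC_monE c : torusC K c <->
  exists h : 'I_d -> Cx R, (forall l, h l != 0) /\ forall k, sgc c k = mon h k.
Proof.
split => [[g [y [Kg ->]]]|[h [h0 hE]]].
  exists (fun l => sgc g (kap l) * rC (expR (pairing (wt K (kap l)) y))); split.
    by move=> l; rewrite mulf_neq0 ?sgc_neq0 // rC_eq0 gt_eqF ?expR_gt0.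
  by move=> k; rewrite sgc_tmul (sgc_cexp y) monM -torus_monE // -expR_mon.
pose g := \row_i mon (fun l => h l * rC (cabs (h l))^-1) (i, false).
pose y := \sum_m ln (cabs (h m)) *: Y m.
exists g, y; split.
  apply: mon_torus => l.
  by rewrite sqnM sqn_rC -cabs_sqr -exprMn divff ?cabs_eq0 // expr1n.
have hc l : rC (expR (pairing (wt K (kap l)) y)) = rC (cabs (h l)).
  by rewrite wbasis_pairing lnK // posrE cabs_gt0.
apply/rowP => i; have := hE (i, false); rewrite {1}/sgc /= => ->.
rewrite mxE -[map_mx _ _]/(cexp y) -[cexp y 0 i]/(sgc (cexp y) (i, false)) sgc_cexp mxE.
rewrite expR_mon -monM; congr (mon _ _); apply/funext => l.
by rewrite hc -mulrA -rCM mulVf ?mulr1 // cabs_eq0.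
Qed.

Lemma corb_monE p q : corb K p q <->
  exists h : 'I_d -> Cx R, (forall l, h l != 0) /\ forall k, crd q k = crd p k * mon h k.
Proof.
split => [[c /torusC_monE[h [h0 hE]] ->]|[h [h0 hE]]].
  by exists h; split => // k; rewrite crd_act hE.
exists (\row_i mon h (i, false)).
  by apply/torusC_monE; exists h; split => // k; rewrite sgc_row_mon.
by apply: crd_inj => k; rewrite hE crd_act sgc_row_mon.
Qed.

End TorusStructure.

(** * The Kempf-Ness theorem *)

Section KempfNess.
Variable R : realType.

(** Bounds [exp x] by [1 / (1 - x)]; it controls the second-order term when a minimum is
    perturbed. *)
Lemma expR_quad (x : R) : `|x| <= 2^-1 -> expR x <= 1 + x + 2 * x ^+ 2.
Proof.
rewrite ler_norml => /andP[x1 x2].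
have h : 0 < 1 - x by lra.
have : expR x <= (1 - x)^-1.
  by rewrite -[leLHS]invrK lef_pV2 ?posrE ?invr_gt0 ?expR_gt0 // -expRN expR_ge1Dx.
move=> /le_trans; apply; rewrite -(@ler_pM2r _ (1 - x)) // mulVf ?gt_eqF //.
rewrite -subr_ge0 (_ : _ - _ = x ^+ 2 * (1 - 2 * x)); last by ring.
by rewrite mulr_ge0 ?sqr_ge0 //; lra.
Qed.

(** Coercivity of one summand of the Kempf-Ness function. For negative [s] the linear term suffices.
    For [s >= 0] the exponential lies above the tangent of [exp] at [ln (2 c / m)], chosen to make
    it grow like [2 c s]. *)
Lemma exp_tangent (m c s : R) : 0 < m -> 0 < c ->
  c * `|s| - `|c * (1 - ln (2 * c / m))| <= m * expR (2 * s) / 2 - c * s.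
Proof.
move=> m0 c0; have [s0|s0] := lerP 0 s; last first.
  rewrite (ltr0_norm s0); have := normr_ge0 (c * (1 - ln (2 * c / m))).
  have := mulr_gt0 m0 (expR_gt0 (2 * s)); nra.
set t := ln (2 * c / m); have et : expR t = 2 * c / m by rewrite lnK // posrE divr_gt0 ?mulr_gt0.
have h : expR t * (1 + (2 * s - t)) <= expR (2 * s).
  have -> : expR (2 * s) = expR t * expR (2 * s - t) by rewrite -expRD addrC subrK.
  by rewrite ler_pM2l ?expR_gt0 // expR_ge1Dx.
have h2 : 2 * c * (1 + (2 * s - t)) <= m * expR (2 * s).
  rewrite -(ler_pM2l m0) in h; apply: le_trans h; rewrite et.
  by rewrite mulrA mulrCA divff ?gt_eqF // mulr1.
rewrite (ger0_norm s0); have := lerNnormlW (lexx `|c * (1 - t)|); nra.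
Qed.

(** The equation says that [y] is critical for the convex function
    [sum_k m k exp (2 s_k) / 2 - c k s_k] with [s_k] the pairing of [v k] and [y]. It is minimised
    in the variables [s], on the linear space of their possible values: the [v k] need not span, so
    sublevel sets are bounded in [s] but not in [y]. *)
Lemma kempf_ness_ord n d (v : 'I_n -> 'rV[R]_d) (m c : 'I_n -> R) :
  (forall k, 0 <= m k) -> (forall k, 0 <= c k) ->
  (forall k, (0 < m k) = (0 < c k)) ->
  exists y, \sum_k (m k * expR (2 * pairing (v k) y)) *: v k = \sum_k c k *: v k.
Proof.
move=> m0 c0 mc.
have mz k : ~~ (0 < c k) -> m k = 0 /\ c k = 0.
  by move=> ck; split; apply/eqP; rewrite eq_le ?m0 ?c0 andbT leNgt ?mc.
pose M : 'M[R]_(d, n) := \matrix_(j, k) (if 0 < c k then v k 0 j else 0).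
have ME (y : 'rV_d) k : (y *m M) 0 k = if 0 < c k then pairing (v k) y else 0.
  rewrite mxE; case: ifP => ck; last by rewrite big1 // => j _; rewrite mxE ck mulr0.
  by apply: eq_bigr => j _; rewrite mxE ck mulrC.
pose Phi (s : 'rV[R]_n) := \sum_k (m k * expR (2 * s 0 k) / 2 - c k * s 0 k).
pose E := \sum_k `|c k * (1 - ln (2 * c k / m k))|.
pose P0 := Phi 0.
(* On the sublevel set of [Phi 0], [exp_tangent] gives [sum_k c k |s_k| <= P0 + E], so all
   coordinates lie in the box of radius [B]. *)
pose B := \sum_k (if 0 < c k then `|P0 + E| / c k else 0).
have B0 : 0 <= B by apply: sumr_ge0 => k _; case: ifP => // ck; rewrite divr_ge0 // ltW.
have coer (s : 'rV[R]_n) : (forall k, ~~ (0 < c k) -> s 0 k = 0) -> Phi s <= P0 -> forall k, `|s 0 k| <= B.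
  move=> sz sP k; have [ck|ck] := boolP (0 < c k); last by rewrite sz // normr0.
  have tot : \sum_k c k * `|s 0 k| <= P0 + E.
    rewrite -lerBlDr -sumrB; apply: le_trans sP; apply: ler_sum => j _.
    have [cj|cj] := boolP (0 < c j); first by apply: exp_tangent; rewrite ?mc.
    by have [-> ->] := mz _ cj; rewrite !mul0r normr0.
  have : c k * `|s 0 k| <= `|P0 + E|.
    apply: le_trans (ler_norm _); apply: le_trans tot.
    by rewrite (bigD1 k) //= lerDl; apply: sumr_ge0 => j _; rewrite mulr_ge0.
  rewrite mulrC -ler_pdivlMr // => /le_trans; apply.
  rewrite /B (bigD1 k) //= ck lerDl; apply: sumr_ge0 => j _.
  by case: ifP => // cj; rewrite divr_ge0 // ltW.
pose box := [set s : 'rV[R]_n | forall k, [set` `[- B, B]] (s 0 k)].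
have cbox : compact box by apply: (@rV_compact R n (fun=> [set` `[- B, B]])) => k; exact: segment_compact.
pose L := [set s : 'rV[R]_n | s *m cokermx M = 0].
have LP s : L s <-> exists y, s = y *m M.
  rewrite /L /=; split => [/eqP|[y ->]]; last by rewrite -mulmxA mulmx_coker mulmx0.
  by rewrite -submxE => /submxP.
have cL : closed L.
  apply: (@closed_comp _ _ (fun s : 'rV[R]_n => s *m cokermx M) [set 0]); last first.
    apply: accessible_closed_set1; apply: hausdorff_accessible; exact: norm_hausdorff.
  move=> s _; apply: continuous_mx => i j; rewrite (ord1 i).
  apply: eq_continuous_at (fun t => mxE _ _ _ _) _; apply: continuous_bigsum => l _.
  apply: continuous_mul; first exact: (@coord_continuous R 1 n 0 l).
  exact: cst_continuous.
have cK : compact (box `&` L) by exact: compact_closedI.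
have PhiC : continuous Phi.
  move=> s; apply: continuous_bigsum => k _; apply: continuous_add.
    apply: continuous_mul; last exact: cst_continuous.
    apply: continuous_mul; first exact: cst_continuous.
    apply: (@continuous_comp _ _ _ (fun s : 'rV[R]_n => 2 * s 0 k) expR); last exact: continuous_expR.
    by apply: continuous_mul; [exact: cst_continuous|exact: (@coord_continuous R 1 n 0 k)].
  apply: continuous_opp; apply: continuous_mul; first exact: cst_continuous.
  exact: (@coord_continuous R 1 n 0 k).
have [|s0 s0K s0min] := EVT_min_rV _ cK (continuous_subspaceT PhiC).
  exists 0; split; last by rewrite /L /= mul0mx.
  by move=> k /=; rewrite mxE in_itv /= oppr_le0 B0.
have {s0K} [s0b s0L] : box s0 /\ L s0 by move: s0K; rewrite inE.
have [y0 y0E] := (LP _).1 s0L.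
have smin y : Phi s0 <= Phi (s0 + y *m M).
  have z0 : 0 \in box `&` L.
    rewrite inE; split; last by rewrite /L /= mul0mx.
    by move=> k /=; rewrite mxE in_itv /= oppr_le0 B0.
  have [h|/ltW h] := lerP (Phi (s0 + y *m M)) P0; last exact: le_trans (s0min _ z0) h.
  apply: s0min; rewrite inE; split; last by apply/LP; exists (y0 + y); rewrite mulmxDl -y0E.
  move=> k /=; rewrite in_itv /= -ler_norml; apply: coer => // j cj.
  by rewrite y0E -mulmxDl ME (negPf cj).
exists y0.
have s0E k : 0 < c k -> s0 0 k = pairing (v k) y0 by move=> ck; rewrite y0E ME ck.
apply/eqP; rewrite -subr_eq0 -pairing_eq0; set w := _ - _.
have wE : w = \sum_k (m k * expR (2 * s0 0 k) - c k) *: v k.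
  rewrite /w -sumrB; apply: eq_bigr => k _; rewrite -scalerBl.
  have [ck|ck] := boolP (0 < c k); first by rewrite s0E.
  by have [-> ->] := mz _ ck; rewrite !mul0r.
(* the derivative of Phi at its minimum s0 in the direction w vanishes *)
pose dd k := if 0 < c k then pairing (v k) w else 0.
have AE : pairing w w = \sum_k (m k * expR (2 * s0 0 k) - c k) * dd k.
  rewrite {1}wE pairing_suml; apply: eq_bigr => k _; rewrite pairingZl /dd.
  have [//|ck] := boolP (0 < c k); by have [-> ->] := mz _ ck; rewrite !mul0r subrr !mul0r.
(* For [t <= 1 / (4 D)] the exponents [2 t dd k] stay within the range of [expR_quad]; [Q] then
   collects the second-order terms, and the added 1 makes it positive. *)
pose D := 1 + \sum_k `|dd k|.
have D1 : 1 <= D by rewrite lerDl; apply: sumr_ge0.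
have dD k : `|dd k| <= D.
  by rewrite /D (bigD1 k) //= addrCA lerDl addr_ge0 //; apply: sumr_ge0.
pose Q := 1 + \sum_k 4 * (m k * expR (2 * s0 0 k)) * dd k ^+ 2.
have Q1 : 1 <= Q.
  rewrite lerDl; apply: sumr_ge0 => k _; apply: mulr_ge0; last exact: sqr_ge0.
  by rewrite mulr_ge0 // mulr_ge0 // expR_ge0.
have key t : 0 <= t -> t <= (4 * D)^-1 -> 0 <= - t * pairing w w + t ^+ 2 * Q.
  move=> t0 tD; have := smin (- t *: w); rewrite -subr_ge0 => h.
  apply: le_trans h _; rewrite /Phi -sumrB AE mulr_sumr mulrDr mulr1.
  rewrite addrCA -[leLHS]add0r lerD ?sqr_ge0 // mulr_sumr -big_split /=.
  apply: ler_sum => k _.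
  have -> : (s0 + - t *: w *m M) 0 k = s0 0 k + - t * dd k.
    by rewrite mxE -scalemxAl [X in _ + X]mxE ME.
  have e1 : expR (2 * (- t * dd k)) <= 1 + 2 * (- t * dd k) + 2 * (2 * (- t * dd k)) ^+ 2.
    apply: expR_quad; rewrite normrM normrM normrN (ger0_norm t0) ger0_norm //.
    have : t * `|dd k| <= (4 * D)^-1 * D by rewrite ler_pM.
    by rewrite invfM mulfVK ?gt_eqF //; [lra|exact: lt_le_trans D1].
  rewrite mulrDr expRD.
  have := ler_wpM2l (mulr_ge0 (m0 k) (expR_ge0 (2 * s0 0 k))) e1.
  set X := m k * expR (2 * s0 0 k); set Z := expR (2 * (- t * dd k)).
  rewrite [m k * (_ * Z)]mulrA -/X; set r := dd k.
  by move=> hh; lra.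
rewrite eq_le pairing_ge0 andbT leNgt; apply/negP => w0.
set W := pairing w w in key w0.
(* For this [t] one has [t Q <= W / 2], so the gain [t W] in the linear term exceeds the loss
   [t^2 Q], against minimality. *)
pose t := Num.min (4 * D)^-1 (W / (2 * Q)).
have Q0 : 0 < Q by exact: lt_le_trans Q1.
have t0 : 0 < t by rewrite lt_min invr_gt0 divr_gt0 ?mulr_gt0 // (lt_le_trans _ D1).
have tW : t * Q <= W / 2.
  have : t <= W / (2 * Q) by rewrite /t ge_min lexx orbT.
  move=> h; have := ler_wpM2r (ltW Q0) h; rewrite invfM mulrA mulfVK ?gt_eqF //.
have := key t (ltW t0); rewrite {1}/t ge_min lexx => /(_ isT).
rewrite (_ : - t * W + _ = t * (t * Q - W)); last by ring.
rewrite pmulr_rge0 // subr_ge0 => h.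
by move: (le_trans h tW) w0; clearbody W; lra.
Qed.

Lemma kempf_ness (I : finType) d (v : I -> 'rV[R]_d) (m c : I -> R) :
  (forall k, 0 <= m k) -> (forall k, 0 <= c k) ->
  (forall k, (0 < m k) = (0 < c k)) ->
  exists y, \sum_k (m k * expR (2 * pairing (v k) y)) *: v k = \sum_k c k *: v k.
Proof.
move=> m0 c0 mc.
have [|||y h] := @kempf_ness_ord #|I| d (fun j => v (enum_val j))
   (fun j => m (enum_val j)) (fun j => c (enum_val j)) => //.
have E (F : I -> 'rV[R]_d) : \sum_k F k = \sum_(j < #|I|) F (enum_val j).
  by rewrite (reindex _ (onW_bij _ (enum_val_bij I))).
by exists y; rewrite !E.
Qed.

(* convexity of the Kempf-Ness function *)
Lemma kempf_ness_inj (I : finType) d (v : I -> 'rV[R]_d) (m : I -> R) y :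
  (forall k, 0 <= m k) ->
  \sum_k (m k * expR (2 * pairing (v k) y)) *: v k = \sum_k m k *: v k ->
  forall k, 0 < m k -> pairing (v k) y = 0.
Proof.
move=> m0 /(congr1 (fun w => pairing w y)) /eqP.
rewrite !pairing_suml -subr_eq0 -sumrB psumr_eq0; last first.
  move=> k _; rewrite !pairingZl -mulrBl -{2}[m k]mulr1 -mulrBr -mulrA mulr_ge0 //.
  set s := pairing _ _; have [s0|s0] := leP 0 s.
    by rewrite mulr_ge0 // subr_ge0 -expR0 ler_expR mulr_ge0.
  by rewrite mulr_le0 ?ltW // subr_lt0 -expR0 ltr_expR pmulr_rlt0.
move=> /allP h k mk; have := h k (mem_index_enum k).
rewrite !pairingZl -mulrBl -{2}[m k]mulr1 -mulrBr mulf_eq0 mulf_eq0 (gt_eqF mk) /=.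
rewrite subr_eq0 => /orP[/eqP h1|/eqP //].
have /expR_inj/eqP : expR (2 * pairing (v k) y) = expR 0 by rewrite expR0.
by rewrite mulf_eq0 pnatr_eq0 /= => /eqP.
Qed.

End KempfNess.

(** * Limits of semistable orbits *)

Section NbhsHN.
Variables (R : realType) (N : nat).

Lemma nbhs_HN (p : HNn R N) (A : set (HNn R N)) :
  nbhs p A <-> exists2 e : R, 0 < e & forall q, (forall k, cabs (crd q k - crd p k) < e) -> A q.
Proof.
split => [/nbhs_ballP[e /= /rC_pos[a a0 ->] h]|[e e0 h]].
  exists a => // q hq; apply: h; split; split; rewrite ?rC_lt // => i j; rewrite (ord1 i) -ball_normE /=.
    by rewrite distrC norm_cabs rC_lt (hq (j, false)).
  by rewrite distrC norm_cabs rC_lt (hq (j, true)).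
have : \forall q \near p, forall k, cabs (crd q k - crd p k) < e.
  apply: near_forall => k; apply: (@crd_continuous R N k p [set c | cabs (c - crd p k) < e]).
  by apply/nbhs_cabsP; exists e.
exact: filterS.
Qed.

Lemma closure_const (T : topologicalType) (p : T) (A : set T) (f : T -> Cx R) c :
  {for p, continuous f} -> (forall q, A q -> f q = c) -> closure A p -> f p = c.
Proof.
move=> cf fc cp; apply: contrapT => fpc.
have : nbhs (f p) [set c' | c' != c].
  apply/nbhs_cabsP; exists (cabs (f p - c)).
    by rewrite cabs_gt0 subr_eq0; apply/eqP.
  move=> c' h; apply: contraTneq h => ->; rewrite -leNgt.
  by rewrite -opprB /cabs /sqn creN cimN !sqrrN.
by move=> /cf /cp[q [Aq /=]]; rewrite fc // eqxx.
Qed.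

End NbhsHN.

Section Limits.
Variables (R : realType) (N d : nat) (K : subtorus R N d).
Hypothesis hK : unimodular_subtorus K.
Notation wt := (wt K).

Definition supp (p : HN R N) : pred (sidx N) := fun k => crd p k != 0.

Definition prodC (p : HN R N) : 'rV[Cx R]_d :=
  \sum_i (crd p (i, false) * crd p (i, true)) *: map_mx (@rC R) (iotau K i).

Lemma muC_prodC p : muC K p = (- 2 * rC pi * 'i) *: prodC p. Proof. by []. Qed.

Lemma muC_eq p q : (forall i, crd q (i, false) * crd q (i, true) = crd p (i, false) * crd p (i, true)) ->
  muC K q = muC K p.
Proof.
by move=> h; rewrite !muC_prodC; congr (_ *: _); apply: eq_bigr => i _; rewrite h.
Qed.

Lemma muC_factor_neq0 : - 2 * rC pi * 'i != 0 :> Cx R.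
Proof.
by rewrite mulf_neq0 ?neq0Ci // mulf_neq0 ?oppr_eq0 ?pnatr_eq0 // rC_eq0 gt_eqF ?pi_gt0.
Qed.

Lemma ssP a be p : ss K a be p <-> muC K p = be /\ in_cone wt (supp p) a.
Proof.
split=> [[pb [x [y [x0 y0 aE]]]]|[pb [c [c0 cP aE]]]]; split => //.
  exists (fun k => (if k.2 then y k.1 else x k.1) * sqn (crd p k)); split.
  - by move=> [i b]; apply: mulr_ge0; [case: b => /=; [exact: y0|exact: x0]|exact: sqn_ge0].
  - by move=> k; rewrite negbK => /eqP ->; rewrite -rC0 sqn_rC expr0n mulr0.
  - by rewrite big_sidx aE big_split.
exists (fun i => c (i, false) / sqn (crd p (i, false))).
exists (fun i => c (i, true) / sqn (crd p (i, true))); split.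
- by move=> i; rewrite divr_ge0 ?sqn_ge0.
- by move=> i; rewrite divr_ge0 ?sqn_ge0.
rewrite aE big_sidx big_split /=.
have E k : c k / sqn (crd p k) * sqn (crd p k) = c k.
  have [k0|k0] := eqVneq (crd p k) 0; first by rewrite cP ?mul0r // /supp k0 eqxx.
  by rewrite divfK // sqn_eq0.
by congr (_ + _); apply: eq_bigr => i _; rewrite (E (i, false), E (i, true)).
Qed.

Lemma corb_real p q : corb K p q -> exists y,
  [/\ exists2 g, torus K g & q = act p (tmul g (cexp K y)),
      forall k, cabs (crd q k) = cabs (crd p k) * expR (pairing (wt k) y),
      muC K q = muC K p & supp q = supp p].
Proof.
move=> [c [g [y [Kg ->]]] qE]; exists y.
have qk k : crd q k = crd p k * (sgc g k * rC (expR (pairing (wt k) y))).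
  by rewrite qE crd_act sgc_tmul (sgc_cexp K).
have s0 k : sgc g k * rC (expR (pairing (wt k) y)) != 0.
  by rewrite mulf_neq0 ?(sgc_neq0 _ Kg) // rC_eq0 gt_eqF ?expR_gt0.
split; first by exists g.
- move=> k; rewrite qk !cabsM cabs_rC ger0_norm ?expR_ge0 //.
  by rewrite {2}/cabs (sqn_sgc _ Kg) sqrtr1 mul1r.
- apply: muC_eq => i; rewrite !qk mulrACA -[RHS]mulr1; congr (_ * _).
  rewrite mulrACA -rCM -expRD (wt_negb K i false) pairingNl subrr expR0 rC1 mulr1.
  by rewrite /sgc /= divff // (torus_neq0 i Kg).
by apply/funext => k; rewrite /supp qk mulf_eq0 negb_or s0 andbT.
Qed.

Lemma sgc1 k : sgc (const_mx 1 : 'rV[Cx R]_N) k = 1.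
Proof. by rewrite /sgc !mxE; case: ifP; rewrite ?invr1. Qed.

Lemma corb_ex_basis : exists kap Y, wbasis K kap Y.
Proof. by have [kap [Y [_ [h _ _]]]] := extend_wbasis K xpredT; exists kap, Y. Qed.

Lemma corb_refl p : corb K p p.
Proof.
have [kap [Y hY]] := corb_ex_basis; apply/(corb_monE hK hY).
by exists (fun=> 1); split => [l|k]; rewrite ?oner_eq0 // mon1 mulr1.
Qed.

Lemma corb_sym p q : corb K p q -> corb K q p.
Proof.
have [kap [Y hY]] := corb_ex_basis => /(corb_monE hK hY)[h [h0 hE]].
apply/(corb_monE hK hY); exists (fun l => (h l)^-1); split => [l|k].
  by rewrite invr_eq0.
by rewrite hE monV -mulrA divff ?mulr1 // mon_neq0.
Qed.

Lemma corb_trans p q r : corb K p q -> corb K q r -> corb K p r.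
Proof.
have [kap [Y hY]] := corb_ex_basis.
move=> /(corb_monE hK hY)[h [h0 hE]] /(corb_monE hK hY)[h' [h0' hE']].
apply/(corb_monE hK hY); exists (fun l => h l * h' l); split => [l|k].
  by rewrite mulf_neq0.
by rewrite hE' hE monM mulrA.
Qed.

Lemma corb_eq p q : corb K p q -> corb K p = corb K q.
Proof.
move=> pq; apply/seteqP; split => r h.
  exact: corb_trans (corb_sym pq) h.
exact: corb_trans pq h.
Qed.

Lemma korb_refl p : korb K p p.
Proof.
exists (const_mx 1); first exact: torus1.
by apply: crd_inj => k; rewrite crd_act sgc1 mulr1.
Qed.

Lemma korb_corb p q : korb K p q -> corb K p q.
Proof.
move=> [g Kg ->]; exists (tmul g (cexp K 0)); first by exists g, 0.
apply: crd_inj => k; rewrite !crd_act sgc_tmul sgc_cexp pairing0r expR0 rC1 mulr1 //.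
Qed.

Definition restr (F : {set sidx N}) (p : HN R N) : HN R N :=
  mkp (fun k => if k \in F then crd p k else 0).

Lemma crd_restr F p k : crd (restr F p) k = if k \in F then crd p k else 0.
Proof. exact: crd_mkp. Qed.

Lemma restr_corb F p q : corb K p q -> corb K (restr F p) (restr F q).
Proof.
have [kap [Y hY]] := corb_ex_basis => /(corb_monE hK hY)[h [h0 hE]].
apply/(corb_monE hK hY); exists h; split => // k.
by rewrite !crd_restr; case: ifP => _; rewrite ?mul0r // hE.
Qed.

Variable a : 'rV[R]_d.

Definition face p := min_face wt (supp p) a.
Definition limpt p := restr (face p) p.

Lemma face_supp p k : k \in face p -> crd p k != 0.
Proof. exact: min_face_sub. Qed.

Lemma supp_limpt p k : supp (limpt p) k = (k \in face p).
Proof.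
by rewrite /supp crd_restr; case: ifP => [/face_supp ->|_]; rewrite ?eqxx.
Qed.

(** Every support between the minimal face and the support of [p] has the same minimal face, because
    both certificates remain valid. *)
Lemma face_restr p (F : {set sidx N}) : in_cone wt (supp p) a ->
  (forall k, k \in face p -> k \in F) -> (forall k, k \in F -> supp p k) ->
  forall q, (forall k, supp q k = (k \in F)) -> face q = face p.
Proof.
move=> Cp fF Fp q qF; have [c [c0 cF aE]] := min_face_coef Cp.
have [y [yF yP _]] := min_face_sep Cp.
apply: (min_face_eq (c := c) (y := y)) => // k; rewrite qF; first exact: fF.
by move=> /Fp; exact: yP.
Qed.

Lemma face_limpt p : in_cone wt (supp p) a -> face (limpt p) = face p.
Proof.
move=> Cp; apply: (face_restr (F := face p)) => // k; last exact: supp_limpt.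
exact: min_face_sub.
Qed.

Lemma limpt_id p : in_cone wt (supp p) a -> limpt (limpt p) = limpt p.
Proof.
move=> Cp; apply: crd_inj => k; rewrite {1}/limpt face_limpt // !crd_restr.
by case: (k \in face p).
Qed.

(** If both coordinates at [i] are non-zero, their weights are opposite and the separating
    functional is nonnegative on both. So it vanishes on both, and the product survives in
    [limpt p]. *)
Lemma muC_limpt p : in_cone wt (supp p) a -> muC K (limpt p) = muC K p.
Proof.
move=> Cp; apply: muC_eq => i; rewrite !crd_restr.
have [y [yF yP _]] := min_face_sep Cp.
have [f0|f0] := eqVneq (crd p (i, false)) 0; first by rewrite f0 if_same !mul0r.
have [t0|t0] := eqVneq (crd p (i, true)) 0; first by rewrite t0 if_same !mulr0.
have X b : ((i, b) \in face p) || (0 < pairing (wt (i, b)) y).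
  by case: (boolP (_ \in _)) => //= h; apply: yP => //; case: b {h}.
have := X true; have := X false.
case: (boolP (_ \in _)) => [h1 _|_ /= h1]; case: (boolP (_ \in _)) => [h2 _|_ /= h2] //.
- by move: h2; rewrite (wt_negb K i false) pairingNl yF // oppr0 ltxx.
- by move: h1; rewrite -[false]negbK -[~~ false]/true (wt_negb K i true) pairingNl yF // oppr0 ltxx.
- by move: h2; rewrite (wt_negb K i false) pairingNl oppr_gt0 ltNge (ltW h1).
Qed.

Lemma limpt_cone p : in_cone wt (supp p) a -> in_cone wt (supp (limpt p)) a.
Proof.
move=> Cp; have [c [c0 cF aE]] := min_face_coef Cp.
exists c; split => // k; rewrite supp_limpt -cF -leNgt => ck.
by apply/eqP; rewrite eq_le ck c0.
Qed.

Lemma limpt_ss be p : ss K a be p -> ss K a be (limpt p).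
Proof.
move=> /ssP[pb Cp]; apply/ssP; rewrite muC_limpt //; split => //.
exact: limpt_cone.
Qed.

Lemma corb_ss be p q : corb K p q -> ss K a be p -> ss K a be q.
Proof.
move=> /corb_real[y [_ _ mE sE]] /ssP[pb Cp]; apply/ssP.
by rewrite mE sE.
Qed.

(** Flow along minus the separating functional: coordinates in the face are fixed, all others decay
    exponentially. *)
Lemma limpt_closure p : in_cone wt (supp p) a -> @closure (HNn R N) (corb K p) (limpt p).
Proof.
move=> Cp B /nbhs_HN[e e0 eB].
have [y [yF yP _]] := min_face_sep Cp.
(* By [1 + x <= exp x], each summand is a time after which the corresponding coordinate has modulus
   below [e]; the sum serves for all of them. *)
pose T := \sum_k (if (crd p k != 0) && (k \notin face p) then
   cabs (crd p k) / (e * pairing (wt k) y) else 0).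
have term_ge0 k : 0 <= (if (crd p k != 0) && (k \notin face p) then
   cabs (crd p k) / (e * pairing (wt k) y) else 0).
  case: ifP => // /andP[pk kF]; rewrite divr_ge0 ?cabs_ge0 // mulr_ge0 ?ltW //.
  exact: yP.
exists (act p (tmul (const_mx 1) (cexp K (- T *: y)))); split.
  exists (tmul (const_mx 1) (cexp K (- T *: y))) => //.
  by exists (const_mx 1), (- T *: y); split => //; exact: torus1.
apply: eB => k; rewrite crd_act sgc_tmul sgc1 mul1r sgc_cexp crd_restr.
rewrite pairingZr; case: ifP => kF.
  by rewrite yF // mulr0 expR0 rC1 mulr1 subrr -rC0 cabs_rC normr0.
have [pk|pk] := eqVneq (crd p k) 0.
  by rewrite pk mul0r subrr -rC0 cabs_rC normr0.
have m0 : 0 < pairing (wt k) y by apply: yP => //; rewrite kF.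
rewrite subr0 cabsM cabs_rC ger0_norm ?expR_ge0 // mulNr expRN ltr_pdivrMr ?expR_gt0 //.
apply: lt_le_trans (_ : e * (1 + T * pairing (wt k) y) <= _); last first.
  by rewrite ler_pM2l // expR_ge1Dx.
have hT : cabs (crd p k) / (e * pairing (wt k) y) <= T.
  rewrite /T (bigD1 k) //= pk kF /= lerDl; apply: sumr_ge0 => j _; exact: term_ge0.
rewrite ler_pdivrMr ?mulr_gt0 // in hT.
by rewrite mulrDr mulr1 mulrCA ltr_pwDl.
Qed.

Lemma closure_corb_supp p (r : HNn R N) k : @closure (HNn R N) (corb K p) r -> crd r k != 0 -> crd p k != 0.
Proof.
move=> cr; apply: contra => /eqP pk; apply/eqP.
apply: (@closure_const _ (HNn R N) r (corb K p) (fun q => crd q k) 0 _ _ cr).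
  exact: crd_continuous.
move=> q /corb_real[y [_ _ _ /(congr1 (fun f => f k))]]; rewrite /supp pk eqxx.
by case: (eqVneq (crd q k) 0).
Qed.

(* On the orbit of p the moduli of the coordinates in the face are bounded
   below near r, because a is a positive combination of their weights and a
   nonnegative combination of the weights of r. *)
Lemma closure_corb_face p (r : HNn R N) k : in_cone wt (supp p) a -> @closure (HNn R N) (corb K p) r ->
  in_cone wt (supp r) a -> k \in face p -> crd r k != 0.
Proof.
move=> Cp cr [c' [c'0 c'P aE']] kF; apply/negP => /eqP rk.
have [c [c0 cF aE]] := min_face_coef Cp.
have sr j : crd r j != 0 -> 0 < cabs (crd p j).
  by rewrite cabs_gt0; exact: closure_corb_supp.
pose lo j := ln (cabs (crd r j) / 2 / cabs (crd p j)).
pose up j := ln ((cabs (crd r j) + 1) / cabs (crd p j)).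
(* Comparing the two representations of [a] at [y], and bounding the exponents by [lo] from below
   and by [up] from above, forces the exponent at [k] to be at least [B]. Points of the orbit near
   [r] would have it below [B], by the choice of [dl]. *)
pose B := (\sum_j c' j * lo j - \sum_(j | j != k) c j * up j) / c k.
have ck : 0 < c k by rewrite cF.
have pk : 0 < cabs (crd p k) by rewrite cabs_gt0 face_supp.
pose dl := cabs (crd p k) * expR B.
have dl0 : 0 < dl by rewrite mulr_gt0 ?expR_gt0.
have n1 : \forall q \near r, [/\ forall j, crd r j != 0 -> cabs (crd r j) / 2 < cabs (crd q j),
    forall j, cabs (crd q j) < cabs (crd r j) + 1 & cabs (crd q k) < dl].
  have cc j : {for r, continuous (fun q : HNn R N => cabs (crd q j))}.
    apply: (@continuous_comp _ _ _ (fun q : HNn R N => crd q j) (@cabs R)).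
      exact: crd_continuous.
    exact: cabs_continuous.
  have A1 : \forall q \near r, forall j, crd r j != 0 -> cabs (crd r j) / 2 < cabs (crd q j).
    apply: (near_forall (x := r)) => j; have [rj|rj] := eqVneq (crd r j) 0; first by near=> q.
    have : nbhs (cabs (crd r j)) [set t | cabs (crd r j) / 2 < t].
      apply: open_nbhs_nbhs; split; first exact: open_gt.
      by rewrite /= ltr_pdivrMr // mulr_natr mulr2n ltrDl cabs_gt0.
    by move=> /(cc j) h; apply: (@filterS _ (nbhs r) _ _ _ _ h) => q hq _; exact: hq.
  have A2 : \forall q \near r, forall j, cabs (crd q j) < cabs (crd r j) + 1.
    apply: (near_forall (x := r)) => j.
    have : nbhs (cabs (crd r j)) [set t | t < cabs (crd r j) + 1].
      by apply: open_nbhs_nbhs; split; [exact: open_lt|rewrite /= ltrDl].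
    by move=> /(cc j) h; apply: (@filterS _ (nbhs r) _ _ _ _ h) => q hq; exact: hq.
  have A3 : \forall q \near r, cabs (crd q k) < dl.
    have : nbhs (cabs (crd r k)) [set t | t < dl].
      apply: open_nbhs_nbhs; split; first exact: open_lt.
      by rewrite /= rk -rC0 cabs_rC normr0.
    by move=> /(cc k) h; apply: (@filterS _ (nbhs r) _ _ _ _ h) => q hq; exact: hq.
  by near=> q; split; near: q.
have [q [/corb_real[y [_ qE _ _]] [q1 q2 q3]]] := cr _ n1.
have lo_le j : crd r j != 0 -> lo j <= pairing (wt j) y.
  move=> rj; rewrite -ler_expR lnK; last by rewrite posrE !divr_gt0 ?sr // cabs_gt0.
  by rewrite ler_pdivrMr ?sr // [leRHS]mulrC -qE ltW // q1.
have le_up j : 0 < c j -> pairing (wt j) y <= up j.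
  move=> cj; have pj : 0 < cabs (crd p j) by rewrite cabs_gt0 face_supp // -cF.
  rewrite -ler_expR lnK; last by rewrite posrE divr_gt0 // ltr_wpDl ?cabs_ge0.
  by rewrite ler_pdivlMr // [leLHS]mulrC -qE ltW.
have aLO : \sum_j c' j * lo j <= pairing a y.
  rewrite aE' pairing_suml; apply: ler_sum => j _; rewrite pairingZl.
  have [rj|rj] := eqVneq (crd r j) 0; first by rewrite c'P ?mul0r // /supp rj eqxx.
  by rewrite ler_wpM2l // lo_le.
have aUP : pairing a y <= c k * pairing (wt k) y + \sum_(j | j != k) c j * up j.
  rewrite aE pairing_suml (bigD1 k) //= pairingZl lerD2l; apply: ler_sum => j _.
  rewrite pairingZl; have [cj|cj] := ltP 0 (c j); first by rewrite ler_pM2l ?le_up.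
  have -> : c j = 0 by apply/eqP; rewrite eq_le cj c0.
  by rewrite !mul0r.
have : B <= pairing (wt k) y.
  by rewrite ler_pdivrMr // mulrC lerBlDr (le_trans aLO).
rewrite -ler_expR -(ler_pM2l pk) -qE => /(lt_le_trans q3); rewrite ltxx //.
Unshelve. all: by end_near. Qed.

(* Laurent monomials in the coordinates of F that are constant on orbits
   separate the orbits with support F. *)
Lemma closure_restr_corb (F : {set sidx N}) p (r : HNn R N) : @closure (HNn R N) (corb K p) r ->
  (forall k, k \in F -> crd r k != 0) -> corb K (restr F p) (restr F r).
Proof.
move=> cr rF.
have [kap [Y [L [hY LF LP]]]] := extend_wbasis K (fun k => k \in F).
have pF k : k \in F -> crd p k != 0 by move=> /rF; exact: closure_corb_supp.
pose h l := if l \in L then crd r (kap l) / crd p (kap l) else 1.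
have AL k l : k \in F -> l \notin L -> wcoef K Y k l = 0.
  move=> kF lL; apply: (@intr_inj R); rewrite (wcoefK hK _ _ hY).
  by apply: LP.
have hE k : k \in F -> crd r k = crd p k * mon K Y h k.
  move=> kF; have monL (g : 'I_d -> Cx R) : mon K Y g k = \prod_(l in L) g l ^ wcoef K Y k l.
    rewrite /mon (bigID (mem L)) /= [X in _ * X]big1 ?mulr1 // => l lL.
    by rewrite AL.
  (* For [k] in [F] the weight is a combination of the basis weights in [L] only, so this monomial
     is invariant; it is continuous at [r] because the coordinates in [F] do not vanish there. *)
  pose phi (q : HNn R N) := crd q k * \prod_(l in L) (crd q (kap l)) ^ (- wcoef K Y k l).
  have phic : {for r, continuous phi}.
    apply: continuous_mul; first exact: crd_continuous.
    apply: continuous_bigprod => l lL; apply: continuous_expz.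
      exact: crd_continuous.
    by apply: rF; apply: LF.
  have phiO q : corb K p q -> phi q = phi p.
    move=> /(corb_monE hK hY)[g [g0 gE]]; rewrite /phi gE -mulrA monL; congr (_ * _).
    rewrite -big_split /=; apply: eq_bigr => l lL.
    by rewrite gE (mon_kap hK hY) expfzMl mulrCA -expfzDr ?g0 // subrr expr0z mulr1.
  have := closure_const phic phiO cr; rewrite /phi {phi phic phiO}.
  have : forall l, l \in L -> crd r (kap l) != 0 by move=> l /LF/rF.
  have : forall l, l \in L -> h l = crd r (kap l) / crd p (kap l) by move=> l lL; rewrite /h lL.
  rewrite monL; move: (crd r) (crd p) => rr pp hl r0 E.
  have P10 : \prod_(l in L) rr (kap l) ^ (- wcoef K Y k l) != 0.
    by apply/prodf_neq0 => l lL; rewrite expfz_neq0 // r0.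
  apply: (mulIf P10); rewrite E -mulrA; congr (_ * _).
  rewrite -big_split; apply: eq_bigr => l lL; rewrite hl // expfzMl /=.
  by rewrite mulrAC -expfzDr ?r0 // subrr expr0z mul1r exprz_inv.
apply/(corb_monE hK hY); exists h; split => [l|k].
  rewrite /h; case: ifP => [lL|_]; last exact: oner_neq0.
  by rewrite mulf_neq0 ?invr_eq0 ?rF ?pF // LF.
by rewrite !crd_restr; case: ifP => kF; [exact: hE|rewrite mul0r].
Qed.

Lemma limpt_closed_corb be p : ss K a be p -> closed_corb K a be (corb K (limpt p)).
Proof.
move=> ssp; have [pb Cp] := (ssP _ _ _).1 ssp.
split.
- by exists (limpt p) => //; exact: limpt_ss.
- by move=> q /corb_ss; apply; exact: limpt_ss.
move=> r [cr ssr]; have [rb Cr] := (ssP _ _ _).1 ssr.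
have rF k : k \in face p -> crd r k != 0.
  rewrite -(face_limpt Cp); apply: closure_corb_face => //; exact: limpt_cone.
have := closure_restr_corb cr rF.
have -> : restr (face p) (limpt p) = limpt p.
  by apply: crd_inj => k; rewrite !crd_restr; case: (k \in face p).
suff -> : restr (face p) r = r by [].
apply: crd_inj => k; rewrite crd_restr; case: ifP => // kF; apply/esym/eqP.
by apply: contraFT kF => rk; rewrite -supp_limpt; exact: closure_corb_supp cr rk.
Qed.

(** A point [r] of such an orbit has the same minimal face as [p]. Being closed, the orbit contains
    [limpt r], the restriction of [r] to this face, and invariant monomials identify it with the
    orbit of the restriction of [p]. *)
Lemma closed_corb_unique be p O : ss K a be p -> closed_corb K a be O ->
  O `<=` closure (corb K p) -> O = corb K (limpt p).
Proof.
move=> ssp [[r ssr OE] Oss Oc] Op; have [pb Cp] := (ssP _ _ _).1 ssp.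
have [rb Cr] := (ssP _ _ _).1 ssr.
have cr : @closure (HNn R N) (corb K p) r by apply: Op; rewrite OE; exact: corb_refl.
have rF k : k \in face p -> crd r k != 0 by exact: closure_corb_face.
have fr : face r = face p.
  apply: (face_restr (F := [set k | supp r k]%SET)) => // k.
  - by move=> kF; rewrite inE; exact: rF.
  - by rewrite inE; exact: closure_corb_supp.
  - by rewrite inE.
have : O (limpt r).
  apply: Oc; split; last exact: limpt_ss.
  by rewrite OE; exact: limpt_closure.
rewrite OE => /corb_eq ->; rewrite /limpt fr; apply/esym/corb_eq.
exact: closure_restr_corb.
Qed.

Lemma limit_corbE be p : ss K a be p -> limit_corb K a be p = corb K (limpt p).
Proof.
move=> ssp; apply: xget_unique => [|O [cO Op]]; last exact: closed_corb_unique ssp cO Op.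
have [pb Cp] := (ssP _ _ _).1 ssp.
split; first exact: limpt_closed_corb.
move=> _ [g [g0 [y [Kg0 gE]]] ->].
have qp : corb K (act p g) p by apply: corb_sym; exists g => //; exists g0, y.
have -> : act (limpt p) g = limpt (act p g).
  have -> : limpt (act p g) = restr (face p) (act p g).
    by rewrite /limpt /face; have [_ [_ _ _ ->]] := corb_real qp.
  by apply: crd_inj => k; rewrite crd_act !crd_restr crd_act; case: ifP; rewrite ?mul0r.
rewrite -(corb_eq qp); apply: limpt_closure.
by have [_ [_ _ _ <-]] := corb_real qp.
Qed.

Lemma mu1E (p : HN R N) : mu1 K p = pi *: \sum_k sqn (crd p k) *: wt k.
Proof.
rewrite /mu1 big_sidx; congr (_ *: _); apply: eq_bigr => i _.
by rewrite scalerBl scalerN.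
Qed.

(** [kempf_ness] requires the squared moduli and the target coefficients to be positive at the same
    indices; passing to [limpt p] is what makes its support equal to the face. *)
Lemma limpt_level p : in_cone wt (supp p) a -> exists2 y, mu1 K (act (limpt p) (cexp K y)) = a &
  corb K (limpt p) (act (limpt p) (cexp K y)).
Proof.
move=> Cp; have [c [c0 cF aE]] := min_face_coef Cp.
have [|||y yE] := @kempf_ness _ _ _ wt (fun k => pi * sqn (crd (limpt p) k)) c => //.
- by move=> k; rewrite mulr_ge0 ?sqn_ge0 ?pi_ge0.
- by move=> k; rewrite pmulr_rgt0 ?pi_gt0 // sqn_gt0 cF -supp_limpt.
have sE : tmul (const_mx 1) (cexp K y) = cexp K y.
  by apply/rowP => i; rewrite !mxE mul1r.
exists y; last first.
  exists (cexp K y) => //; exists (const_mx 1), y; split; first exact: torus1.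
  by rewrite -[LHS]sE.
rewrite mu1E aE -yE scaler_sumr; apply: eq_bigr => k _.
rewrite scalerA crd_act sgc_cexp sqnM sqn_rC -mulrA; congr (_ * (_ * _) *: _).
by rewrite -expRM_natl.
Qed.

Lemma corb_mu1_korb p q : corb K p q -> mu1 K q = mu1 K p -> korb K p q.
Proof.
move=> /corb_real[y [[g Kg qE] qk _ _]]; rewrite !mu1E => /(scalerI (lt0r_neq0 (pi_gt0 R))) h.
exists g => //; rewrite qE; apply: crd_inj => k; rewrite !crd_act sgc_tmul sgc_cexp.
have [->|pk] := eqVneq (crd p k) 0; first by rewrite !mul0r.
rewrite (@kempf_ness_inj R _ d wt (fun k => sqn (crd p k)) y) ?sqn_gt0 //.
- by rewrite expR0 rC1 mulr1.
- by move=> j; exact: sqn_ge0.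
rewrite -h; apply: eq_bigr => j _; congr (_ *: _).
by rewrite -!cabs_sqr qk exprMn -expRM_natl.
Qed.

Lemma clsE be p : ss K a be p -> cls K a be p = corb K (limpt p) `&` [set q | mu1 K q = a].
Proof. by move=> ssp; rewrite /cls limit_corbE. Qed.

Lemma cls_nonempty be p : ss K a be p -> exists q, cls K a be p q.
Proof.
move=> ssp; rewrite clsE //; have [_ Cp] := (ssP _ _ _).1 ssp.
by have [y h1 h2] := limpt_level Cp; exists (act (limpt p) (cexp K y)).
Qed.

Lemma corb_limpt p q : corb K p q -> corb K (limpt p) (limpt q).
Proof.
move=> pq; rewrite {2}/limpt /face; have [_ [_ _ _ ->]] := corb_real pq.
exact: restr_corb.
Qed.

Lemma cls_eqP be p q : ss K a be p -> ss K a be q ->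
  cls K a be p = cls K a be q <-> corb K (limpt p) (limpt q).
Proof.
move=> ssp ssq; split => [E|/corb_eq h]; last by rewrite !clsE // h.
have [r rp] := cls_nonempty ssp; have := rp; rewrite E.
rewrite (clsE ssq) => -[qr _]; move: rp; rewrite clsE // => -[pr _].
exact: corb_trans pr (corb_sym qr).
Qed.

Lemma cls_corb be p q : ss K a be p -> corb K p q -> cls K a be p = cls K a be q.
Proof.
move=> ssp pq; apply/cls_eqP => //; first exact: corb_ss pq ssp.
exact: corb_limpt.
Qed.

Lemma cls_limpt be p : ss K a be p -> cls K a be (limpt p) = cls K a be p.
Proof.
move=> ssp; have [_ Cp] := (ssP _ _ _).1 ssp; apply/cls_eqP => //; first exact: limpt_ss.
by rewrite limpt_id //; exact: corb_refl.
Qed.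

Lemma cls_mem be p q : ss K a be p -> cls K a be p q ->
  [/\ corb K (limpt p) q, mu1 K q = a, ss K a be q & cls K a be q = cls K a be p].
Proof.
move=> ssp; have := ssp => /limpt_ss ssl; rewrite {1}clsE // => -[lq mq]; split => //.
  exact: corb_ss lq ssl.
by rewrite -(cls_corb ssl lq) cls_limpt.
Qed.

(** The equation [mu1 K p = a] is itself a representation of [a] that is positive on the whole
    support, so the minimal face is the whole support. *)
Lemma level_face be p : level K a be p ->
  [/\ ss K a be p, limpt p = p & forall k, supp p k = (k \in face p)].
Proof.
move=> [m1 mC].
have aE : a = \sum_k (pi * sqn (crd p k)) *: wt k.
  by rewrite -m1 mu1E scaler_sumr; apply: eq_bigr => k _; rewrite scalerA.
have c0 k : 0 <= pi * sqn (crd p k) by rewrite mulr_ge0 ?sqn_ge0 ?pi_ge0.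
have cz k : ~~ supp p k -> pi * sqn (crd p k) = 0.
  by rewrite negbK => /eqP ->; rewrite -rC0 sqn_rC expr0n mulr0.
have Cp : in_cone wt (supp p) a by exists (fun k => pi * sqn (crd p k)).
have fE k : supp p k = (k \in face p).
  apply/idP/idP => [pk|]; last exact: min_face_sub.
  apply/min_faceP; exists (fun k => pi * sqn (crd p k)); split => //.
  by rewrite mulr_gt0 ?pi_gt0 // sqn_gt0.
split => //; first by apply/ssP.
apply: crd_inj => k; rewrite crd_restr -fE /supp.
by case: (eqVneq (crd p k) 0) => [->|].
Qed.

Lemma level_cls be p : level K a be p -> cls K a be p = korb K p.
Proof.
move=> lp; have [ssp lE _] := level_face lp; rewrite clsE // lE.
have [m1 mC] := lp; apply/seteqP; split => q.
  by move=> [pq mq]; apply: corb_mu1_korb => //; rewrite m1.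
move=> pq; split; first exact: korb_corb.
have [g Kg ->] := pq; rewrite /= -m1 !mu1E; congr (_ *: _); apply: eq_bigr => k _.
by rewrite crd_act sqnM (sqn_sgc _ Kg) mulr1.
Qed.

Lemma cls_level be p q : ss K a be p -> cls K a be p q -> level K a be q.
Proof.
move=> ssp pq; have [_ mq ssq _] := cls_mem ssp pq; split => //.
by case/ssP: ssq.
Qed.

End Limits.

(** * Chambers *)

Section ComplexPairing.
Variables (R : realType) (d : nat).

Definition pC (be : 'rV[Cx R]_d) (y : 'rV[R]_d) : Cx R := \sum_j be 0 j * rC (y 0 j).

Lemma cre_pC be y : cre (pC be y) = pairing (map_mx (@cre R) be) y.
Proof.
by rewrite cre_sum; apply: eq_bigr => j _; rewrite mulrC creZ mulrC mxE.
Qed.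

Lemma cim_pC be y : cim (pC be y) = pairing (map_mx (@cim R) be) y.
Proof.
by rewrite cim_sum; apply: eq_bigr => j _; rewrite mulrC cimZ mulrC mxE.
Qed.

Lemma pC_eq0 be y : pC be y = 0 <->
  pairing (map_mx (@cre R) be) y = 0 /\ pairing (map_mx (@cim R) be) y = 0.
Proof.
rewrite -cre_pC -cim_pC; split => [->//|[h1 h2]]; exact: Cx_eqP.
Qed.

Lemma pC_scale c be y : pC (c *: be) y = c * pC be y.
Proof. by rewrite mulr_sumr; apply: eq_bigr => j _; rewrite mxE mulrA. Qed.

Lemma pC_sum (I : Type) (r : seq I) (P : pred I) (F : I -> 'rV[Cx R]_d) y :
  pC (\sum_(i <- r | P i) F i) y = \sum_(i <- r | P i) pC (F i) y.
Proof.
rewrite /pC exchange_big /=; apply: eq_bigr => j _.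
by rewrite summxE mulr_suml.
Qed.

Lemma pC_map u y : pC (map_mx (@rC R) u) y = rC (pairing u y).
Proof. by rewrite rC_sum; apply: eq_bigr => j _; rewrite mxE rCM. Qed.

Lemma pC_scaler be c y : pC be (c *: y) = rC c * pC be y.
Proof. by rewrite mulr_sumr; apply: eq_bigr => j _; rewrite mxE rCM mulrCA. Qed.

Lemma pC_delta be j : pC be (delta_mx 0 j) = be 0 j.
Proof.
rewrite /pC (bigD1 j) //= mxE !eqxx rC1 mulr1 big1 ?addr0 // => i ij.
by rewrite mxE eqxx (negPf ij) rC0 mulr0.
Qed.

Lemma pC_sumr be (I : Type) (r : seq I) (P : pred I) (F : I -> 'rV[R]_d) :
  pC be (\sum_(i <- r | P i) F i) = \sum_(i <- r | P i) pC be (F i).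
Proof.
rewrite /pC exchange_big /=; apply: eq_bigr => j _.
by rewrite summxE rC_sum mulr_sumr.
Qed.

Lemma pairing_continuous (y : 'rV[R]_d) : continuous (fun v : 'rV[R]_d => pairing v y).
Proof.
move=> v; apply: continuous_bigsum => j _.
by apply: continuous_mul; [exact: (@coord_continuous R 1 d 0 j)|exact: cst_continuous].
Qed.

End ComplexPairing.

Section Chambers.
Variables (R : realType) (N d : nat) (K : subtorus R N d).
Hypothesis hK : unimodular_subtorus K.
Notation wt := (wt K).
Implicit Types (a v y : 'rV[R]_d) (be : 'rV[Cx R]_d) (p : HN R N).

Lemma pC_muC p y : pC (muC K p) y = (- 2 * rC pi * 'i) *
  \sum_i crd p (i, false) * crd p (i, true) * rC (pairing (wt (i, false)) y).
Proof.
rewrite muC_prodC pC_scale pC_sum; congr (_ * _); apply: eq_bigr => i _.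
by rewrite pC_scale pC_map.
Qed.

Lemma wbasis_dual kap Y y : wbasis K kap Y ->
  y = \sum_l pairing (wt (kap l)) y *: Y l.
Proof.
move=> hY; apply/eqP; rewrite -subr_eq0; apply/eqP; apply: (wt_sep (K := K)) => k.
rewrite (hY.2 (wt k)) pairing_suml big1 // => l _; rewrite pairingZl.
by rewrite pairingBr (wbasis_pairing hY) subrr mulr0.
Qed.

Lemma sgc_texp y k : sgc (texp (k_incl K y)) k = cexpi (pairing (wt k) y).
Proof. by rewrite pairing_wt /sgc texpE; case: ifP => _ //; rewrite cexpiN. Qed.

Lemma torus_texpZ y t : torus K (texp (t *: k_incl K y)).
Proof. by apply: (tlieP K _).1; exact: submxMl. Qed.

Lemma k_inclZ t y : t *: k_incl K y = k_incl K (t *: y).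
Proof. by rewrite /k_incl scalemxAl. Qed.

Lemma lie_isotropy p y : lie_of K (isotropy K p) y <->
  forall k, crd p k != 0 -> pairing (wt k) y = 0.
Proof.
split => [h k pk|h t].
  apply: cexpi_triv => s; have [_ /(congr1 (fun q => crd q k))] := h s.
  rewrite crd_act k_inclZ sgc_texp pairingZr => /(canRL (mulKf pk)).
  by rewrite mulVf.
split; first exact: torus_texpZ.
apply: crd_inj => k; rewrite crd_act k_inclZ sgc_texp pairingZr.
have [->|pk] := eqVneq (crd p k) 0; first by rewrite mul0r.
by rewrite h // mulr0 cexpi0 mulr1.
Qed.

(** A point supported on the weights that annihilate [Y]. For a dual basis vector these include
    [d - 1] basis weights, so the stabiliser is one-dimensional with Lie algebra spanned by [Y]. *)
Definition wallpt (Y : 'rV[R]_d) : HN R N :=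
  mkp (fun k => if pairing (wt k) Y == 0 then 1 else 0).

Lemma wallptP kap Y l : wbasis K kap Y ->
  isotropy1 K (isotropy K (wallpt (Y l))) /\
  lie_of K (isotropy K (wallpt (Y l))) = [set c *: Y l | c in [set: R]].
Proof.
move=> hY; have Yl0 : Y l != 0.
  by apply/eqP => h; have := hY.1 l l; rewrite h pairing0r eqxx => /eqP; rewrite eq_sym oner_eq0.
suff E : lie_of K (isotropy K (wallpt (Y l))) = [set c *: Y l | c in [set: R]].
  by split => //; split; [exists (wallpt (Y l))|exists (Y l)].
apply/seteqP; split => y.
  move=> /lie_isotropy h; exists (pairing (wt (kap l)) y) => //.
  rewrite [RHS](wbasis_dual y hY) (bigD1 l) //= big1 ?addr0 // => m ml.
  by rewrite h ?scale0r // crd_mkp hY.1 (negPf ml) eqxx oner_neq0.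
move=> [c _ <-]; apply/lie_isotropy => k; rewrite crd_mkp pairingZr.
by case: (pairing (wt k) (Y l) =P 0) => [->|_]; rewrite ?mulr0 // eqxx.
Qed.

Lemma wall_span H Y v : lie_of K H = [set c *: Y | c in [set: R]] ->
  wall K H v <-> pairing v Y = 0.
Proof.
move=> hE; split => [h|h y]; first by apply: h; rewrite hE; exists 1 => //; rewrite scale1r.
by rewrite hE => -[c _ <-]; rewrite pairingZr h mulr0.
Qed.

Lemma wallC_span H Y be : lie_of K H = [set c *: Y | c in [set: R]] ->
  wallC K H be <-> pC be Y = 0.
Proof.
move=> hE; rewrite pC_eq0; split => -[h1 h2]; split.
- exact: (wall_span _ hE).1.
- exact: (wall_span _ hE).1.
- exact: (wall_span _ hE).2.
- exact: (wall_span _ hE).2.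
Qed.

Lemma Swalls_lie be H : Swalls K be H -> exists2 Y, Y != 0 &
  lie_of K H = [set c *: Y | c in [set: R]] /\ pC be Y = 0.
Proof.
by move=> [[_ [Y Y0 hE]] hb]; exists Y => //; split => //; exact: (wallC_span _ hE).1.
Qed.

(** [Y l] with [l] outside [L] annihilates [a], a combination of face weights, and also [be], since
    [be] is the value of [muC] at [limpt p], whose support is the face. *)
Lemma face_walls a be p : ss K a be p -> exists kap Y (L : {set 'I_d}),
  [/\ wbasis K kap Y, forall l, l \in L -> kap l \in face K a p,
      forall k, k \in face K a p -> forall l, l \notin L -> pairing (wt k) (Y l) = 0 &
      forall l, l \notin L -> Swalls K be (isotropy K (wallpt (Y l))) /\
        wall K (isotropy K (wallpt (Y l))) a].
Proof.
move=> /ssP[pb Cp]; have [kap [Y [L [hY LF LP]]]] := extend_wbasis K (fun k => k \in face K a p).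
exists kap, Y, L; split => // l lL.
have [i1 lE] := wallptP l hY.
have [c [c0 cF aE]] := min_face_coef Cp; split; last first.
  apply/(wall_span _ lE); rewrite aE pairing_suml big1 // => k _; rewrite pairingZl.
  have [kF|] := boolP (k \in face K a p); first by rewrite LP ?mulr0.
  by rewrite -cF -leNgt => ck; have -> : c k = 0 by [apply/eqP; rewrite eq_le ck c0]; rewrite mul0r.
split => //; apply/(wallC_span _ lE); rewrite -pb -(muC_limpt Cp) pC_muC big1 ?mulr0 // => i _.
rewrite crd_restr; case: ifP => iF; last by rewrite !mul0r.
by rewrite LP // rC0 mulr0.
Qed.

(** Off the walls no [Y l] can be left outside [L], so the face spans; a separating functional
    vanishes on it, hence is 0, and no weight of the support is off the face. *)
Lemma generic_face a be p : generic_locus K be a -> ss K a be p ->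
  (forall k, supp p k = (k \in face K a p)) /\
  (forall y, (forall k, k \in face K a p -> pairing (wt k) y = 0) -> y = 0).
Proof.
move=> ga ssp; have [kap [Y [L [hY LF LP LW]]]] := face_walls ssp.
have LT l : l \in L.
  apply: contrapT => /negP lL; have [h1 h2] := LW l lL; apply: ga; by exists (isotropy K (wallpt (Y l))).
have sep y : (forall k, k \in face K a p -> pairing (wt k) y = 0) -> y = 0.
  by move=> h; rewrite (wbasis_dual y hY) big1 // => l _; rewrite h ?LF ?scale0r.
split => // k; have [_ Cp] := (ssP _ _ _ _).1 ssp.
apply/idP/idP => [pk|]; last exact: min_face_sub.
have [y [yF yP _]] := min_face_sep Cp.
apply: contrapT => /negP kF; have := yP k pk kF.
by rewrite (sep y yF) pairing0r ltxx.
Qed.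

Lemma cone_open a (V : pred (sidx N)) (c : sidx N -> R) :
  (forall k, 0 <= c k) -> (forall k, V k -> 0 < c k) -> (forall k, ~~ V k -> c k = 0) ->
  a = \sum_k c k *: wt k ->
  (forall y, (forall k, V k -> pairing (wt k) y = 0) -> y = 0) ->
  \forall v \near a, in_cone wt V v.
Proof.
move=> c0 cV cz aE sep; have [kap [Y [L [hY LV LP]]]] := extend_wbasis K V.
have kV l : V (kap l).
  apply: contrapT => kl; have : Y l = 0.
    apply: sep => k Vk; apply: LP => //; by apply/negP => /LV.
  by move=> h; have := hY.1 l l; rewrite h pairing0r eqxx => /eqP; rewrite eq_sym oner_eq0.
pose e v l := pairing (v - a) (Y l).
have ec : \forall v \near a, forall k, V k -> \sum_l `|e v l| < c k.
  apply: near_forall => k; have [Vk|Vk] := boolP (V k); last by near=> v.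
  have cc : {for a, continuous (fun v => \sum_l `|e v l|)}.
    apply: continuous_bigsum => l _.
    apply: (@continuous_comp _ _ _ (fun v => e v l) (fun x : R => `|x|)); last exact: norm_continuous.
    rewrite /e; apply: (@eq_continuous_at _ _ _ (fun v => pairing v (Y l) + - pairing a (Y l))).
      by move=> v; rewrite pairingBl.
    by apply: continuous_add; [exact: pairing_continuous|exact: cst_continuous].
  have : nbhs (\sum_l `|e a l|) [set t | t < c k].
    apply: open_nbhs_nbhs; split; first exact: open_lt.
    by rewrite /= big1 ?cV // => l _; rewrite /e subrr pairing0l normr0.
  by move=> /cc h; apply: (@filterS _ (nbhs a) _ _ _ _ h) => v hv _; exact: hv.
apply: filterS ec => v ev.
(* The coordinates of [v - a] in a basis of weights from [V] are added to the coefficients, which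
   stay nonnegative near [a]. *)
exists (fun k => c k + \sum_(l | kap l == k) e v l); split.
- move=> k; have [Vk|Vk] := boolP (V k).
    have : - \sum_l `|e v l| <= \sum_(l | kap l == k) e v l.
      rewrite -[leLHS]opprK lerNl opprK (le_trans (ler_norm _)) // normrN.
      rewrite (le_trans (ler_norm_sum _ _ _)) // [leRHS](bigID (fun l => kap l == k)) /= lerDl.
      exact: sumr_ge0.
    have := ev k Vk; lra.
  rewrite cz // add0r big1 // => l /eqP kl; by move: Vk; rewrite -kl kV.
- move=> k Vk; rewrite cz // add0r big1 // => l /eqP kl; by move: Vk; rewrite -kl kV.
under eq_bigr do rewrite scalerDl.
rewrite big_split /= -aE; apply/eqP; rewrite addrC -subr_eq; apply/eqP.
rewrite {1}(hY.2 (v - a)) (partition_big kap xpredT) //=.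
apply: eq_bigr => k _; rewrite scaler_suml; apply: eq_bigr => l /eqP <- //.
Unshelve. all: by end_near. Qed.

(** By Farkas' lemma a point outside is separated by a strict, hence open, inequality. *)
Lemma cone_closed (V : pred (sidx N)) : closed [set v | in_cone wt V v].
Proof.
rewrite -[X in closed X]setCK; apply: open_closedC; rewrite openE => a /= aV.
have [//|[y yV ya]] := farkas wt V a.
have : nbhs (pairing a y) [set t | t < 0] by apply: open_nbhs_nbhs; split; [exact: open_lt|].
move=> /(@pairing_continuous _ _ y a) h.
apply: (@filterS _ (nbhs a) _ _ _ _ h) => v /= vy /in_cone_ge0/(_ yV).
by rewrite leNgt vy.
Qed.

Lemma chamber_connected be Ch : chamber K be Ch -> connected Ch.
Proof. by move=> [v _ ->]; exact: component_connected. Qed.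

Lemma chamber_generic be Ch : chamber K be Ch -> Ch `<=` generic_locus K be.
Proof. by move=> [v _ ->]; exact: connected_component_sub. Qed.

(** Within the connected chamber, the points for which [p] is semi-stable form a closed set, and an
    open one because minimal faces span off the walls. *)
Lemma chamber_cone be Ch a a' p : chamber K be Ch -> Ch a -> Ch a' ->
  ss K a be p -> ss K a' be p.
Proof.
move=> hC Ca Ca' /ssP[pb Cp]; apply/ssP; split => //.
suff E : Ch `&` [set v | in_cone wt (supp p) v] = Ch by have : Ch a' by []; rewrite -E => -[].
apply: (chamber_connected hC).
- by exists a.
- exists ([set v | in_cone wt (supp p) v]°)%classic; first exact: open_interior.
  apply/seteqP; split => v [Cv hv]; split => //; last exact: nbhs_singleton.
  have [h1 h2] := generic_face (chamber_generic hC Cv) ((ssP _ _ _ _).2 (conj pb hv)).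
  have [c [c0 cF vE]] := min_face_coef hv.
  apply: (cone_open (c := c)) => // [k pk|k pk|y hy].
  + by rewrite cF -[X in is_true X]h1.
  + apply/eqP; rewrite eq_le c0 andbT leNgt cF; apply: contra pk; exact: min_face_sub.
  + by apply: h2 => k kF; apply: hy; exact: min_face_sub kF.
- exists [set v | in_cone wt (supp p) v] => //; exact: cone_closed.
Qed.

Lemma chamber_sign be Ch a a' H y : chamber K be Ch -> Ch a -> Ch a' ->
  Swalls K be H -> lie_of K H y -> 0 < pairing a y -> 0 < pairing a' y.
Proof.
move=> hC Ca Ca' sH Hy ay.
suff E : Ch `&` [set v | 0 < pairing v y] = Ch by have : Ch a' by []; rewrite -E => -[].
apply: (chamber_connected hC).
- by exists a.
- exists [set v | 0 < pairing v y] => //.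
  apply: (@open_comp _ _ (fun v => pairing v y) [set t | 0 < t]); last exact: open_gt.
  by move=> v _; exact: pairing_continuous.
exists [set v | 0 <= pairing v y].
  apply: (@closed_comp _ _ (fun v => pairing v y) [set t | 0 <= t]); last exact: closed_ge.
  by move=> v _; exact: pairing_continuous.
apply/seteqP; split => v [Cv /= hv]; split => //; first exact: ltW.
rewrite /= lt_neqAle hv andbT eq_sym; apply/eqP => v0.
apply: (chamber_generic hC Cv); exists H => // z.
have [Y Y0 [lE _]] := Swalls_lie sH; rewrite lE => -[c _ <-].
move: Hy; rewrite lE => -[e _ yE]; move: v0; rewrite -yE !pairingZr => /eqP.
rewrite mulf_eq0 => /orP[/eqP e0|/eqP ->]; last by rewrite mulr0.
by move: ay; rewrite -yE e0 scale0r pairing0r ltxx.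
Qed.

Lemma generic_neq0 be a H Y : generic_locus K be a -> Swalls K be H ->
  lie_of K H = [set c *: Y | c in [set: R]] -> pairing a Y != 0.
Proof.
move=> ga sH lE; apply/eqP => h; apply: ga; exists H => //.
exact: (wall_span _ lE).2.
Qed.

Definition same_side be a a' := forall H Y, Swalls K be H ->
  lie_of K H = [set c *: Y | c in [set: R]] -> 0 < pairing a Y * pairing a' Y.

Lemma same_side_generic be a a' : same_side be a a' -> generic_locus K be a'.
Proof.
move=> h [H sH wH]; have [Y Y0 [lE _]] := Swalls_lie sH.
by have := h H Y sH lE; rewrite ((wall_span _ lE).1 wH) mulr0 ltxx.
Qed.

Lemma chamber_same_side be Ch a a' : chamber K be Ch -> Ch a -> Ch a' -> same_side be a a'.
Proof.
move=> hC Ca Ca' H Y sH lE.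
have HY c : lie_of K H (c *: Y) by rewrite lE; exists c.
have := generic_neq0 (chamber_generic hC Ca) sH lE.
rewrite neq_lt => /orP[aY|aY].
  have := @chamber_sign _ _ a a' H (-1 *: Y) hC Ca Ca' sH (HY _).
  rewrite !pairingZr !mulN1r !oppr_gt0 => /(_ aY) aY'.
  by rewrite nmulr_rgt0.
have := @chamber_sign _ _ a a' H (1 *: Y) hC Ca Ca' sH (HY _).
by rewrite !pairingZr !mul1r => /(_ aY) aY'; rewrite pmulr_rgt0.
Qed.

(** The segment from [a] to [a'] meets no wall, since a linear form of the same sign at both ends
    does not vanish in between. *)
Lemma same_side_chamber be Ch a a' : chamber K be Ch -> Ch a -> same_side be a a' -> Ch a'.
Proof.
move=> [v gv ->] va aa'; rewrite (same_connected_component va).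
have := @connected_component_max _ (generic_locus K be)
  ((fun t : R => a + t *: (a' - a)) @` [set` `[0, 1]]) a.
apply.
- by exists 0; rewrite ?scale0r ?addr0 //= in_itv /= lexx ler01.
- move=> _ [t /= + <-]; rewrite in_itv /= => /andP[t0 t1].
  apply: (@same_side_generic be a) => H Y sH lE.
  have := aa' H Y sH lE; have := generic_neq0 (connected_component_sub va) sH lE.
  rewrite pairingDl pairingZl pairingBl; set x := pairing a Y; set z := pairing a' Y => x0 xz.
  have : 0 < x ^+ 2 by rewrite exprn_even_gt0.
  have [->|t1'] := eqVneq t 1; first by rewrite mul1r addrC subrK.
  have {}t1' : t < 1 by rewrite lt_neqAle t1' t1.
  by nra.
- apply: connected_continuous_connected; first exact: segment_connected.
  apply: continuous_subspaceT => t; apply: cvgD; first exact: cvg_cst.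
  by apply: cvgZr_tmp || apply: cvgZl; exact: cvg_id.
by exists 1; rewrite ?scale1r ?[a + _]addrC ?subrK //= in_itv /= lexx ler01.
Qed.

Lemma closure_sign be Ch a v H Y : chamber K be Ch -> Ch a -> closure Ch v ->
  Swalls K be H -> lie_of K H = [set c *: Y | c in [set: R]] ->
  0 <= pairing a Y * pairing v Y.
Proof.
move=> hC Ca cv sH lE.
have cl : closed [set w | 0 <= pairing a Y * pairing w Y].
  apply: (@closed_comp _ _ (fun w => pairing a Y * pairing w Y) [set t | 0 <= t]); last exact: closed_ge.
  move=> w _; apply: (@continuous_mul _ _ (fun=> pairing a Y) (fun w => pairing w Y)).
    exact: cst_continuous.
  exact: pairing_continuous.
apply: cl; apply: closure_subset cv => w Cw.
by apply: ltW; exact: (chamber_same_side hC Ca Cw) sH lE.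
Qed.

Lemma ortho_prop (A : 'M[R]_(d.-1, d)) Y0 Y : row_free A -> Y0 != 0 ->
  (forall j, pairing (row j A) Y0 = 0) -> (forall j, pairing (row j A) Y = 0) ->
  exists c, Y = c *: Y0.
Proof.
move=> fA Y00 h0 h; have d0 : (0 < d)%N.
  by case: d A Y0 Y00 {h0 h fA Y} => // A Y0 /eqP; case; apply/rowP; case.
have kerP y : (forall j, pairing (row j A) y = 0) -> (y <= kermx A^T)%MS.
  move=> hy; apply/sub_kermxP/rowP => j; rewrite !mxE -[RHS](hy j).
  by apply: eq_bigr => i _; rewrite !mxE mulrC.
have r1 : \rank (kermx A^T) = 1%N.
  rewrite mxrank_ker mxrank_tr (eqP fA); move: d0; clear.
  by case: d => // n _ /=; rewrite subSnn.
have e : (Y0 == kermx A^T)%MS.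
  by rewrite -(geq_leqif (mxrank_leqif_eq (kerP _ h0))) r1 lt0n mxrank_eq0.
have /submxP[D ->] : (Y <= Y0)%MS by apply: submx_trans (kerP _ h) _; case/andP: e.
by exists (D 0 0); rewrite [D]mx11_scalar mul_scalar_mx !mxE eqxx mulr1n.
Qed.

Section NextChambers.
Variables (be : 'rV[Cx R]_d) (Cp Cm : set 'rV[R]_d).
Hypotheses (hCp : chamber K be Cp) (hCm : chamber K be Cm).
Variables (H0 : set 'rV[Cx R]_N).
Hypotheses (hH0 : Swalls K be H0) (hnext : next_across K H0 Cm Cp).
Variable Y0 : 'rV[R]_d.
Hypotheses (hY0 : lie_of K H0 Y0) (hY0n : Y0 != 0).
Variables (ap am al : 'rV[R]_d).
Hypotheses (hap : Cp ap) (ham : Cm am).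
Hypotheses (hal : closure Cp al) (hal0 : wall K H0 al)
  (hals : forall H, Swalls K be H -> H <> H0 -> ~ wall K H al).

Lemma lie_H0 : lie_of K H0 = [set c *: Y0 | c in [set: R]].
Proof.
have [Y Yn [lE _]] := Swalls_lie hH0; move: (hY0); rewrite lE => -[c _ cY].
have c0 : c != 0 by apply: contraNneq hY0n => c0; rewrite -cY c0 scale0r.
apply/seteqP; split => _ [e _ <-].
  by exists (e / c) => //; rewrite -cY scalerA divfK.
by exists (e * c) => //; rewrite -cY scalerA.
Qed.

Lemma pairing_al0 : pairing al Y0 = 0.
Proof. exact: (wall_span _ lie_H0).1. Qed.

Lemma pC_be0 : pC be Y0 = 0.
Proof. by have [_ h] := hH0; exact: (wallC_span _ lie_H0).1. Qed.

(** The common facet contains [d - 1] independent vectors in the closures of both chambers. If [Y]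
    does not annihilate all of them, one of them carries the same strict sign as both chambers;
    otherwise [Y] is proportional to [Y0]. *)
Lemma next_sides H Y : Swalls K be H ->
  lie_of K H = [set c *: Y | c in [set: R]] ->
  (exists c, Y = c *: Y0) \/ 0 < pairing ap Y * pairing am Y.
Proof.
move=> sH lE; have [_ [F [FH Fm [[l [_ _ FE]] [A [fA AF]]]]]] := hnext.
have [[l' [_ _ FE']] _] := Fm.
have cp j : closure Cp (row j A) by have := AF j; rewrite FE => -[].
have cm j : closure Cm (row j A) by have := AF j; rewrite FE' => -[].
have [h|] := pselect (forall j, pairing (row j A) Y = 0).
  left; apply: ortho_prop fA hY0n _ h => j.
  by apply: (wall_span _ lie_H0).1; apply: FH; exact: AF.
move=> /existsNP[j /eqP Aj]; right.
have sp := closure_sign hCp hap (cp j) sH lE.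
have sm := closure_sign hCm ham (cm j) sH lE.
have ap0 := generic_neq0 (chamber_generic hCp hap) sH lE.
have am0 := generic_neq0 (chamber_generic hCm ham) sH lE.
have {}sp : 0 < pairing ap Y * pairing (row j A) Y by rewrite lt_neqAle sp eq_sym mulf_neq0.
have {}sm : 0 < pairing am Y * pairing (row j A) Y by rewrite lt_neqAle sm eq_sym mulf_neq0.
have := mulr_gt0 sp sm; rewrite mulrACA pmulr_lgt0 //.
by rewrite -expr2 exprn_even_gt0.
Qed.

(** [al] is assumed to be in the closure of [Cp] only. For [am] the weak sign conditions at [al] are
    transported through [next_sides], and for the wall itself the pairing with [al] is 0. *)
Lemma segment_chamber a t : a = ap \/ a = am -> 0 < t -> t <= 1 ->
  same_side be a (al + t *: (a - al)).
Proof.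
move=> ha t0 t1 H Y sH lE.
have ga : generic_locus K be a.
  by case: ha => ->; [exact: chamber_generic hCp _ hap|exact: chamber_generic hCm _ ham].
have a0 := generic_neq0 ga sH lE.
have as0 : 0 <= pairing a Y * pairing al Y.
  have hp := closure_sign hCp hap hal sH lE.
  have [[c cE]|pm] := next_sides sH lE.
    by rewrite cE !pairingZr pairing_al0 !mulr0.
  case: ha => -> //.
  have ap0 := generic_neq0 (chamber_generic hCp hap) sH lE.
  have : 0 <= (pairing ap Y * pairing am Y) * (pairing ap Y * pairing al Y) by rewrite mulr_ge0 // ltW.
  by rewrite mulrACA -expr2 pmulr_rge0 // exprn_even_gt0.
have : 0 < pairing a Y ^+ 2 by rewrite exprn_even_gt0.
rewrite pairingDl pairingZl pairingBl; nra.
Qed.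

Lemma segment_ss a t p : a = ap \/ a = am -> 0 < t -> t <= 1 ->
  ss K (al + t *: (a - al)) be p <-> ss K a be p.
Proof.
move=> ha t0 t1; have ss1 := segment_chamber ha t0 t1.
have [Ch [hC Ca]] : exists Ch, chamber K be Ch /\ Ch a.
  by case: ha => ->; [exists Cp|exists Cm].
have Ct := same_side_chamber hC Ca ss1.
by split; apply: (chamber_cone hC).
Qed.

Lemma next_ss_sub a p : a = ap \/ a = am -> ss K a be p -> ss K al be p.
Proof.
move=> ha ssp; have [pb _] := (ssP _ _ _ _).1 ssp.
apply/ssP; split => //; have [//|[y yV yb]] := farkas wt (supp p) al.
have seg t : 0 < t -> t <= 1 -> 0 <= pairing al y + t * (pairing a y - pairing al y).
  move=> t0 t1; have /ssP[_ h] := (segment_ss p ha t0 t1).2 ssp.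
  by have := in_cone_ge0 h yV; rewrite pairingDl pairingZl pairingBl.
exfalso; set x := pairing al y in yb seg; set z := pairing a y in seg.
have zx : 0 < z - x by have := seg 1 ltr01 (lexx _); lra.
(* At this parameter the linear function from [x] at 0 to [z] at 1 takes the value [x / 2], still
   negative. *)
have t0 : 0 < (- x) / (2 * (z - x)) by rewrite divr_gt0 ?oppr_gt0 ?mulr_gt0.
have t1 : (- x) / (2 * (z - x)) <= 1.
  by rewrite ler_pdivrMr ?mulr_gt0 // mul1r; have := seg 1 ltr01 (lexx _); lra.
have := seg _ t0 t1; rewrite invfM mulrA mulfVK ?gt_eqF //.
by move: yb; lra.
Qed.

(** Every [Y l] left outside the face gives a wall of [be] through [al], which can only be that of
    [H0]. So it is a multiple of [Y0], and linear independence leaves room for one such [l]. *)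
Lemma wall_dichotomy p : ss K al be p ->
  (forall y, (forall k, k \in face K al p -> pairing (wt k) y = 0) -> y = 0) \/
  (forall k, k \in face K al p -> pairing (wt k) Y0 = 0) /\
  (forall y, (forall k, k \in face K al p -> pairing (wt k) y = 0) -> exists c, y = c *: Y0).
Proof.
move=> ssp; have [kap [Y [L [hY LF LP LW]]]] := face_walls ssp.
have [LT|] := pselect (forall l, l \in L).
  left => y h; rewrite (wbasis_dual y hY) big1 // => l _.
  by rewrite h ?scale0r // LF.
move=> /existsNP[l0 /negP l0L]; right.
have lprop l : l \notin L -> exists c, Y l = c *: Y0.
  move=> lL; have [sH wH] := LW l lL.
  have HE : isotropy K (wallpt (Y l)) = H0.
    by apply: contrapT => hne; exact: hals sH hne wH.
  have [_ lE] := wallptP l hY; rewrite HE lie_H0 in lE.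
  have : [set c *: Y l | c in [set: R]] (Y l) by exists 1; rewrite ?scale1r.
  by rewrite -lE => -[c _ <-]; exists c.
have Yn l : Y l != 0.
  by apply/eqP => h; have := hY.1 l l; rewrite h pairing0r eqxx => /eqP; rewrite eq_sym oner_eq0.
have [c0 c0E] := lprop l0 l0L.
have c0n : c0 != 0 by apply: contraNneq (Yn l0) => c0z; rewrite c0E c0z scale0r.
have Y0E : Y0 = c0^-1 *: Y l0 by rewrite c0E scalerA mulVf // scale1r.
split; first by move=> k kF; rewrite Y0E pairingZr LP ?mulr0.
move=> y h; exists (pairing (wt (kap l0)) y * c0).
rewrite [LHS](wbasis_dual y hY) (bigD1 l0) //= big1 ?addr0 => [|l ll0].
  by rewrite c0E scalerA.
have [lL|lL] := boolP (l \in L); first by rewrite h ?scale0r // LF.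
have [c cE] := lprop l lL.
have : c / c0 = 0.
  have := hY.1 l0 l; rewrite eq_sym (negPf ll0) => hz.
  transitivity (pairing (wt (kap l0)) (Y l)); last exact: hz.
  by rewrite cE [in RHS]Y0E scalerA [RHS]pairingZr (hY.1 l0 l0) eqxx mulr1.
move=> /eqP; rewrite mulf_eq0 invr_eq0 (negPf c0n) orbF => /eqP cz.
by have := Yn l; rewrite cE cz scale0r eqxx.
Qed.

Lemma cone_perturb (V : pred (sidx N)) (c e : sidx N -> R) v w :
  (forall k, 0 <= c k) -> (forall k, ~~ V k -> c k = 0 /\ e k = 0) ->
  (forall k, c k = 0 -> 0 <= e k) ->
  v = \sum_k c k *: wt k -> w = \sum_k e k *: wt k ->
  exists t, [/\ 0 < t, t <= 1 & in_cone wt V (v + t *: w)].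
Proof.
move=> c0 cz ce vE wE.
have [t [t0 t1 tk]] : exists t : R, [/\ 0 < t, t <= 1 & forall k, 0 <= c k + t * e k].
  have X k : \forall t \near 0^'+, 0 <= c k + t * e k.
    have [ck|ck] := eqVneq (c k) 0.
      by near=> t; rewrite ck add0r mulr_ge0 ?ce.
    have ck0 : 0 < c k by rewrite lt_neqAle eq_sym ck c0.
    near=> t.
    have t0 : 0 < t by [].
    have : t <= c k / (1 + `|e k|).
      near: t; apply: nbhs_right_le; by rewrite divr_gt0 // ltr_pwDl.
    rewrite ler_pdivlMr ?ltr_pwDl // => h.
    have := ler_norm (- e k); rewrite normrN; nra.
  have : \forall t \near 0^'+, forall k, 0 <= c k + t * e k by exact: filter_forall X.
  move=> Xk; have [t [[t0 t1] tk]] : exists t : R, (0 < t /\ t <= 1) /\ forall k, 0 <= c k + t * e k.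
    apply: (@filter_ex _ (0^'+ : set_system R)); near=> t; split; last by near: t.
    by split => //; near: t; exact: nbhs_right_le.
  by exists t.
exists t; split => //; exists (fun k => c k + t * e k); split => //.
  by move=> k /cz[-> ->]; rewrite mulr0 addr0.
rewrite vE wE scaler_sumr -big_split; apply: eq_bigr => k _.
by rewrite scalerDl scalerA.
Unshelve. all: by end_near. Qed.

Lemma wbasis_coef kap Y w : wbasis K kap Y -> exists e : sidx N -> R,
  w = \sum_k e k *: wt k /\
  (forall k, e k = \sum_(l | kap l == k) pairing w (Y l)).
Proof.
move=> hY; exists (fun k => \sum_(l | kap l == k) pairing w (Y l)); split => //.
rewrite {1}(hY.2 w) (partition_big kap xpredT) //=.
apply: eq_bigr => k _; rewrite scaler_suml; apply: eq_bigr => l /eqP <- //.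
Qed.

(** A spanning face contains a basis of weights with positive coefficients, so [al] can be moved a
    little towards [a] inside the cone; [segment_ss] carries this to [a]. *)
Lemma interior_ss a p : a = ap \/ a = am -> ss K al be p ->
  (forall y, (forall k, k \in face K al p -> pairing (wt k) y = 0) -> y = 0) ->
  ss K a be p.
Proof.
move=> ha ssp sep; have [pb Cal] := (ssP _ _ _ _).1 ssp.
have [c [c0 cF aE]] := min_face_coef Cal.
have [kap [Y [L [hY LF LP]]]] := extend_wbasis K (fun k => k \in face K al p).
have LT l : kap l \in face K al p.
  apply: contrapT => kl; have : Y l = 0.
    by apply: sep => k kF; apply: LP => //; apply/negP => /LF.
  by move=> h; have := hY.1 l l; rewrite h pairing0r eqxx => /eqP; rewrite eq_sym oner_eq0.
have [e [wE eE]] := wbasis_coef (a - al) hY.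
have ez k : k \notin face K al p -> e k = 0.
  by move=> kF; rewrite eE big1 // => l /eqP lk; move: kF; rewrite -lk LT.
have cz k : k \notin face K al p -> c k = 0.
  by rewrite -cF -leNgt => ck; apply/eqP; rewrite eq_le ck c0.
have [||t [t0 t1 tC]] := @cone_perturb (supp p) c e al (a - al) c0 _ _ aE wE.
- move=> k pk; have kF : k \notin face K al p by apply: contra pk; exact: min_face_sub.
  by rewrite cz ?ez.
- move=> k ck; rewrite ez // -cF ck ltxx //.
by apply/(segment_ss p ha t0 t1)/ssP.
Qed.

(** If no weight of the support lies on the side of [a], a multiple of [Y0] separates [a] from the
    cone. Conversely such a weight [k0] completes the face to a spanning set, and pairing with [Y0]
    shows that moving towards [a] increases its coefficient, which may therefore start from 0. *)
Lemma wall_ss a p : a = ap \/ a = am -> ss K al be p ->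
  (forall k, k \in face K al p -> pairing (wt k) Y0 = 0) ->
  (forall y, (forall k, k \in face K al p -> pairing (wt k) y = 0) -> exists c, y = c *: Y0) ->
  ss K a be p <-> exists2 k, supp p k & 0 < pairing (wt k) Y0 * pairing a Y0.
Proof.
move=> ha ssp F0 sep; have [pb Cal] := (ssP _ _ _ _).1 ssp.
have ga : generic_locus K be a.
  by case: ha => ->; [exact: chamber_generic hCp _ hap|exact: chamber_generic hCm _ ham].
have a0 := generic_neq0 ga hH0 lie_H0.
split=> [/ssP[_ Ca]|[k0 pk0 k0a]].
  apply: contrapT => nex; have : 0 <= pairing a (- pairing a Y0 *: Y0).
    apply: in_cone_ge0 Ca _ => k pk; rewrite pairingZr mulNr oppr_ge0 leNgt mulrC.
    by apply/negP => h; apply: nex; exists k.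
  by rewrite pairingZr mulNr oppr_ge0 leNgt -expr2 exprn_even_gt0 // a0.
have [c [c0 cF aE]] := min_face_coef Cal.
pose V := [predU1 k0 & face K al p].
have [kap [Y [L [hY LF LP]]]] := extend_wbasis K V.
have k0n : pairing (wt k0) Y0 != 0 by apply: contraTneq k0a => ->; rewrite mul0r ltxx.
have LT l : V (kap l).
  apply: contrapT => kl; have : Y l = 0.
    have lL : l \notin L by apply/negP => /LF.
    have [|e eE] := sep (Y l).
      by move=> k kF; apply: LP => //=; rewrite kF orbT.
    have := LP k0 _ l lL; rewrite /= eqxx => /(_ isT); rewrite eE pairingZr => /eqP.
    by rewrite mulf_eq0 (negPf k0n) orbF => /eqP ->; rewrite scale0r.
  by move=> h; have := hY.1 l l; rewrite h pairing0r eqxx => /eqP; rewrite eq_sym oner_eq0.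
have [e [wE eE]] := wbasis_coef (a - al) hY.
have ez k : ~~ V k -> e k = 0.
  by move=> kF; rewrite eE big1 // => l /eqP lk; move: kF; rewrite -lk LT.
have cz k : k \notin face K al p -> c k = 0.
  by rewrite -cF -leNgt => ck; apply/eqP; rewrite eq_le ck c0.
have ek0 : 0 < e k0.
  have : pairing (a - al) Y0 = e k0 * pairing (wt k0) Y0.
    rewrite wE pairing_suml (bigD1 k0) //= pairingZl big1 ?addr0 // => k kk0.
    rewrite pairingZl; have [kF|kF] := boolP (k \in face K al p); first by rewrite F0 ?mulr0.
    by rewrite ez ?mul0r // /V /= negb_or kk0.
  rewrite pairingBl pairing_al0 subr0 => aE'; move: k0a; rewrite aE'.
  by rewrite mulrCA -expr2 pmulr_lgt0 // exprn_even_gt0.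
have [||t [t0 t1 tC]] := @cone_perturb (supp p) c e al (a - al) c0 _ _ aE wE.
- move=> k pk; have kF : k \notin face K al p by apply: contra pk; exact: min_face_sub.
  rewrite cz // ez // /V /= negb_or kF andbT.
  by apply: contraNneq pk => ->.
- move=> k ck; have [kk0|kk0] := eqVneq k k0; first by rewrite kk0 ltW.
  by rewrite ez // /V /= negb_or kk0 -cF ck ltxx.
by apply/(segment_ss p ha t0 t1)/ssP.
Qed.

End NextChambers.

End Chambers.

(** * Complex quotient spaces *)

Section Sheafy.
Variable R : realType.

Lemma holomorphic_onS (E : normedModType (Cx R)) (O O' : set E) (F : E -> Cx R) :
  holomorphic_on O F -> open O' -> O' `<=` O -> holomorphic_on O' F.
Proof. by move=> [oO dF] oO' O'O; split => // p /O'O/dF. Qed.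

Lemma open_preimage_at (T U : topologicalType) (O : set T) (f : T -> U) (B : set U) :
  open O -> (forall x, O x -> {for x, continuous f}) -> open B -> open (O `&` f @^-1` B).
Proof.
move=> oO cf oB; rewrite openE => x [Ox Bx]; apply: filterI.
  exact: open_nbhs_nbhs.
by apply: (cf x Ox); exact: open_nbhs_nbhs.
Qed.

Lemma differentiable_mx (K : numFieldType) (V : normedModType K) m n
    (f : V -> 'M[K]_(m, n)) x :
  (forall i j, differentiable (fun t => f t i j : K^o) x) -> differentiable f x.
Proof.
move=> h.
have -> : f = (fun t => \sum_(i < m) \sum_(j < n) (f t i j : K^o) *: (delta_mx i j : 'M[K]_(m, n))).
  by apply/funext => t; exact: matrix_sum_delta.
have sumd N (g : 'I_N -> V -> 'M[K]_(m, n)) : (forall i, differentiable (g i) x) ->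
    differentiable (fun t => \sum_(i < N) g i t) x.
  move=> hg; have -> : (fun t => \sum_(i < N) g i t) = \sum_(i < N) g i.
    by apply/funext => t; rewrite fct_sumE.
  exact: differentiable_sum.
by apply: (sumd) => i; apply: (sumd) => j; apply: differentiableZl.
Qed.

(** The properties of a ringed space that charts require: intersections and local unions of open
    sets, locality of functions, and stability under a holomorphic function of finitely many of
    them. All spaces used come from [quot_space] by passing to subspaces, which preserves these
    properties. *)
Record sheafy T (X : cspace R T) : Prop := Sheafy {
  sh_sub : forall U, opn X U -> U `<=` pts X;
  sh_full : opn X (pts X);
  sh_I : forall U V, opn X U -> opn X V -> opn X (U `&` V);
  sh_loc : forall U, (forall x, U x -> exists V, [/\ opn X V, V x & V `<=` U]) -> opn X U;
  sh_res : forall U V f, opn X V -> V `<=` U -> hol X U f -> hol X V f;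
  sh_glue : forall U f, opn X U -> (forall x, U x -> exists V g,
    [/\ opn X V, V x, hol X V g & forall y, V y -> U y -> g y = f y]) -> hol X U f;
  sh_pre : forall U n (h : 'I_n -> T -> Cx R) (Om : set 'rV[Cx R]_n), opn X U ->
    (forall i, hol X U (h i)) -> open Om ->
    opn X (U `&` [set x | Om (\row_i h i x)]);
  sh_comp : forall U n (h : 'I_n -> T -> Cx R) (Om : set 'rV[Cx R]_n)
      (G : 'rV[Cx R]_n -> Cx R), opn X U ->
    (forall i, hol X U (h i)) -> holomorphic_on Om G ->
    (forall x, U x -> Om (\row_i h i x)) -> hol X U (fun x => G (\row_i h i x)) }.

Section Quot.
Variables (E : normedModType (Cx R)) (S : set E) (T : Type) (c : E -> T).
Let X := quot_space S c.

Lemma quot_opnP U : opn X U <-> U `<=` c @` S /\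
  forall p, S p -> U (c p) -> \forall q \near p, S q -> U (c q).
Proof.
split=> [[UX [ O oO OE]]|[UX h]]; split => //.
  move=> p Sp Up; have Op : O p by have : (S `&` c @^-1` U) p by []; rewrite OE => -[].
  have : nbhs p O by exact: open_nbhs_nbhs.
  by apply: filterS => q Oq Sq; have : (S `&` O) q by []; rewrite -OE => -[].
pose O := [set q | exists2 p, S p /\ U (c p) & exists2 A : set E, open A &
  A q /\ (A p /\ forall r, A r -> S r -> U (c r))].
exists O.
  rewrite openE => q [p [Sp Up] [A oA [Aq [Ap AU]]]].
  have : nbhs q A by exact: open_nbhs_nbhs.
  by apply: filterS => r Ar; exists p => //; exists A.
apply/seteqP; split => [p [Sp Up]|p [Sp [p' _ [A oA [Ap [_ AU]]]]]]; split => //; last exact: AU.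
have : nbhs p [set q | S q -> U (c q)] by exact: h.
by rewrite nbhsE => -[A [oA Ap] AU]; exists p => //; exists A.
Qed.

Lemma quot_hol_open U p : opn X U -> S p -> U (c p) ->
  exists O : set E, [/\ open O, O p & forall q, O q -> S q -> U (c q)].
Proof.
move=> /quot_opnP[_ h] Sp Up; have : nbhs p [set q | S q -> U (c q)] by exact: h.
by rewrite nbhsE => -[A [oA Ap] AU]; exists A.
Qed.

Lemma quot_hol_family U n (h : 'I_n -> T -> Cx R) p :
  (forall i, hol X U (h i)) -> S p -> U (c p) ->
  exists (O : set E) (F : E -> 'rV[Cx R]_n), [/\ open O, O p,
    forall q, O q -> differentiable F q &
    forall q, O q -> S q -> U (c q) -> F q = \row_i h i (c q)].
Proof.
move=> hh Sp Up.
have /choice[OF OFP] : forall i, exists OF : set E * (E -> Cx R),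
    [/\ holomorphic_on OF.1 OF.2, OF.1 p &
      forall q, OF.1 q -> S q -> U (c q) -> OF.2 q = h i (c q)].
  by move=> i; have [ O [F h']] := hh i p Sp Up; exists (O, F).
exists [set q | forall i, (OF i).1 q], (fun q => \row_i (OF i).2 q); split.
- rewrite openE => q hq.
  have : \forall r \near q, forall i, (OF i).1 r.
    have X' i : \forall r \near q, (OF i).1 r.
      by apply: open_nbhs_nbhs; split => //; have [[]] := OFP i.
    exact: filter_forall X'.
  by [].
- by move=> i; have [] := OFP i.
- move=> q hq; apply: differentiable_mx => i j.
  have [[_ d] _ _] := OFP j.
  rewrite (_ : (fun t => _) = ((OF j).2 : E -> (Cx R)^o)); first exact: d (hq j).
  by apply/funext => t; rewrite mxE.
- move=> q hq Sq Uq; apply/rowP => i; rewrite !mxE.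
  by have [_ _ ->] := OFP i.
Qed.

Lemma quot_sheafy : sheafy X.
Proof.
split.
- by move=> U /quot_opnP[].
- by apply/quot_opnP; split => // p Sp _; near=> q => Sq; exists q.
- move=> U V /quot_opnP[UX hU] /quot_opnP[VX hV]; apply/quot_opnP; split.
    by move=> x [/UX].
  move=> p Sp [Up Vp]; have := hU p Sp Up; have := hV p Sp Vp.
  by apply: filterS2 => q h1 h2 Sq; split; [exact: h2|exact: h1].
- move=> U h; apply/quot_opnP; split => [x /h[V [/quot_opnP[VX _] Vx _]]|p Sp Up]; first exact: VX.
  have [V [/quot_opnP[_ hV] Vp VU]] := h _ Up; have := hV p Sp Vp.
  by apply: filterS => q h1 Sq; apply/VU/h1.
- move=> U V f oV VU hf p Sp Vp; have [ O [F [h1 h2 h3]]] := hf p Sp (VU _ Vp).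
  by exists O, F; split => // q Oq Sq Vq; apply: h3 => //; exact: VU.
- move=> U f oU h p Sp Up; have [V [g [oV Vp hg gf]]] := h _ Up.
  have [ O [F [h1 h2 h3]]] := hg p Sp Vp.
  have [ O' [oO' O'p O'V]] := quot_hol_open oV Sp Vp.
  exists (O `&` O'), F; split => //.
    by apply: (holomorphic_onS h1); [apply: openI => //; case: h1|move=> q []].
  by move=> q [Oq O'q] Sq Uq; rewrite -gf ?h3 //; exact: O'V.
- move=> U n h Om oU hh oOm; apply/quot_opnP; split=> [x [/(proj1 ((quot_opnP U).1 oU))]//|p Sp [Up hp]].
  have [ O [F [oO Op dF FE]]] := quot_hol_family hh Sp Up.
  have [ O' [oO' O'p O'U]] := quot_hol_open oU Sp Up.
  have : nbhs p ((O `&` F @^-1` Om) `&` O').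
    apply: open_nbhs_nbhs; split; last by split => //; split => //=; rewrite FE.
    apply: openI => //; apply: open_preimage_at => // q Oq.
    by apply: differentiable_continuous; exact: dF.
  apply: filterS => q [[Oq Fq] O'q] Sq; have Uq := O'U q O'q Sq.
  by split => //=; rewrite -FE.
- move=> U n h Om G oU hh [oOm dG] hOm p Sp Up.
  have [ O [F [oO Op dF FE]]] := quot_hol_family hh Sp Up.
  exists (O `&` F @^-1` Om), (G \o F); split.
  + split.
      apply: open_preimage_at => // q Oq; apply: differentiable_continuous; exact: dF.
    move=> q [Oq Fq]; apply: (@differentiable_comp _ _ _ (Cx R)^o F G); first exact: dF.
    exact: dG.
  + by split => //=; rewrite FE //; exact: hOm.
  + by move=> q [Oq Fq] Sq Uq /=; rewrite FE.
Unshelve. all: by end_near. Qed.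

End Quot.

Section Sub.
Variables (T : Type) (X : cspace R T).
Hypothesis sX : sheafy X.

Lemma sub_hol_family V U n (h : 'I_n -> T -> Cx R) x : V `<=` setT ->
  (forall i, hol (sub_space X V) U (h i)) -> U x -> pts X x ->
  exists W (g : 'I_n -> T -> Cx R), [/\ opn X W, W x, forall i, hol X W (g i) &
    forall i y, W y -> U y -> g i y = h i y].
Proof.
move=> _ hh Ux Xx.
elim: n h hh => [|n IH] h hh.
  by exists (pts X), (fun _ _ => 0); split => [|//|[]//|[]//]; exact: sh_full sX.
have [W [g [oW Wx hg gE]]] := IH (fun i => h (lift ord0 i)) (fun i => hh _).
have [W' [g' [oW' W'x hg' gE']]] := hh ord0 x Ux.
exists (W `&` W'), (fun i => if unlift ord0 i is Some j then g j else g'); split => //.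
- exact: sh_I sX _ _ oW oW'.
- move=> i; case: unliftP => [j _|_].
    apply: (sh_res sX _ _ (hg j)); [exact: sh_I sX _ _ oW oW'|by move=> y []].
  apply: (sh_res sX _ _ hg'); [exact: sh_I sX _ _ oW oW'|by move=> y []].
- move=> i y [Wy W'y] Uy; case: unliftP => [j ->|->]; [exact: gE|exact: gE'].
Qed.

Lemma sub_opn_sub V U : opn (sub_space X V) U -> U `<=` V.
Proof. by move=> [U' _ ->] x []. Qed.

Lemma sub_sheafy V : sheafy (sub_space X V).
Proof.
split.
- by move=> U [U' oU' ->] x [/(sh_sub sX oU')].
- by exists (pts X) => //; exact: sh_full sX.
- move=> _ _ [U oU ->] [W oW ->]; exists (U `&` W); first exact: sh_I sX _ _ oU oW.
  by rewrite setIACA setIid.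
(* The largest open set of [X] whose trace on [V] lies in [U]. *)
- move=> U h; exists [set x | exists W, [/\ opn X W, W x & W `&` V `<=` U]].
    apply: (sh_loc sX) => x [W [oW Wx WU]]; exists W; split => // y Wy.
    by exists W.
  apply/seteqP; split => [x Ux|x [[W [oW Wx WU]] Vx]]; last exact: WU.
  have [_ [[W oW ->] [Wx Vx] WU]] := h x Ux; split => //; by exists W.
- move=> U V' f oV' V'U hf x V'x; have [W [g [oW Wx hg gf]]] := hf x (V'U _ V'x).
  by exists W, g; split => // y Wy V'y; apply: gf => //; exact: V'U.
- move=> U f oU h x Ux; have [_ [g [[V' oV' ->] [V'x Vx] hg gf]]] := h x Ux.
  have [W [g' [oW Wx hg' gE]]] := hg x (conj V'x Vx).
  exists (W `&` V'), g'; split => //.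
  + exact: sh_I sX _ _ oW oV'.
  + apply: (sh_res sX _ _ hg'); [exact: sh_I sX _ _ oW oV'|by move=> y []].
  + move=> y [Wy V'y] Uy; have Vy := sub_opn_sub oU Uy.
    by rewrite gE // gf.
- move=> U n h Om oU hh oOm.
  have [U' oU' UE] := oU.
  exists [set x | exists W, [/\ opn X W, W x & W `&` V `<=` U `&` [set x | Om (\row_i h i x)]]].
    apply: (sh_loc sX) => x [W [oW Wx WU]]; exists W; split => // y Wy.
    by exists W.
  apply/seteqP; split => [x [Ux Ox]|x [[W [oW Wx WU]] Vx]]; last exact: WU.
  have Vx := sub_opn_sub oU Ux.
  have Xx : pts X x by apply: (sh_sub sX oU'); move: Ux; rewrite UE => -[].
  have [W [g [oW Wx hg gE]]] := @sub_hol_family V U n h x (fun _ _ => I) hh Ux Xx.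
  split => //; exists ((W `&` [set x | Om (\row_i g i x)]) `&` U'); split.
  + apply: sh_I sX _ _ _ oU'; exact: sh_pre sX _ _ _ _ oW hg oOm.
  + split; last by move: Ux; rewrite UE => -[].
    split => //=; rewrite (_ : \row_i g i x = \row_i h i x) //.
    by apply/rowP => i; rewrite !mxE gE.
  + move=> y [[[Wy Oy] U'y] Vy]; have Uy : U y by rewrite UE.
    split => //=; rewrite (_ : \row_i h i y = \row_i g i y) //.
    by apply/rowP => i; rewrite !mxE gE.
- move=> U n h Om G oU hh hG hOm x Ux.
  have [U' oU' UE] := oU.
  have Xx : pts X x by apply: (sh_sub sX oU'); move: Ux; rewrite UE => -[].
  have [W [g [oW Wx hg gE]]] := @sub_hol_family V U n h x (fun _ _ => I) hh Ux Xx.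
  have rE y : W y -> U y -> \row_i g i y = \row_i h i y.
    by move=> Wy Uy; apply/rowP => i; rewrite !mxE gE.
  pose W' := W `&` [set x | Om (\row_i g i x)].
  have oW' : opn X W' by apply: sh_pre sX _ _ _ _ oW hg _; have [] := hG.
  exists W', (fun x => G (\row_i g i x)); split => //.
  + by split => //=; rewrite rE //; exact: hOm.
  + apply: (sh_comp sX) hG _ => // [i|y []//].
    by apply: (sh_res sX (U := W)) => // y [].
  + by move=> y [Wy _] Uy; rewrite rE.
Qed.

End Sub.

(** * Holomorphic maps between subspaces and quotients *)

Section HolMaps.

Lemma hol_map_comp T1 T2 T3 (X : cspace R T1) (Y : cspace R T2) (Z : cspace R T3) f g :
  hol_map X Y f -> hol_map Y Z g -> hol_map X Z (g \o f).
Proof.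
move=> [f1 f2 f3] [g1 g2 g3]; split.
- by move=> x /f1/g1.
- move=> U /g2/f2; rewrite (_ : _ `&` _ = pts X `&` (g \o f) @^-1` U) //.
  by apply/seteqP; split => x /= [Xx]; [case|split => //; split => //; exact: f1].
- move=> U h oU /(g3 _ _ oU)/(f3 _ _ (g2 _ oU)).
  rewrite (_ : _ `&` _ = pts X `&` (g \o f) @^-1` U) //.
  by apply/seteqP; split => x /= [Xx]; [case|split => //; split => //; exact: f1].
Qed.

Lemma hol_map_sub T1 T2 (X : cspace R T1) (Y : cspace R T2) f V W :
  hol_map X Y f -> (forall x, pts X x -> V x -> W (f x)) ->
  hol_map (sub_space X V) (sub_space Y W) f.
Proof.
move=> [f1 f2 f3] VW; split.
- by move=> x [Xx Vx]; split; [exact: f1|exact: VW].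
- move=> _ [U oU ->]; exists (pts X `&` f @^-1` U); first exact: f2.
  apply/seteqP; split => x /= [[Xx]]; first by move=> Vx [].
  by move=> Ux Vx; split => //; split => //; exact: VW.
- move=> U g _ hg x [[Xx Vx] Ux]; have [U' [h [oU' U'x hh hE]]] := hg _ Ux.
  exists (pts X `&` f @^-1` U'), (h \o f); split => //; [exact: f2|exact: f3|].
  by move=> y [Xy U'y] [_ Uy]; exact: hE.
Qed.

Lemma hol_map_subl T1 T2 (X : cspace R T1) (Y : cspace R T2) f V :
  hol_map X Y f -> hol_map (sub_space X V) Y f.
Proof.
move=> [f1 f2 f3]; split.
- by move=> x [Xx Vx]; exact: f1.
- move=> U oU; exists (pts X `&` f @^-1` U); first exact: f2.
  by rewrite setIAC.
- move=> U g oU hg x [[Xx Vx] Ux].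
  exists (pts X `&` f @^-1` U), (g \o f); split => //; [exact: f2|exact: f3].
Qed.

Lemma hol_map_subr T1 T2 (X : cspace R T1) (Y : cspace R T2) f W : sheafy X ->
  hol_map X Y f -> (forall x, pts X x -> W (f x)) -> hol_map X (sub_space Y W) f.
Proof.
move=> sX [f1 f2 f3] hW.
have E U : pts X `&` f @^-1` (U `&` W) = pts X `&` f @^-1` U.
  by apply/seteqP; split => x [Xx /=]; [case|move=> Ux; split => //; split => //; exact: hW].
split.
- by move=> x Xx; split; [exact: f1|exact: hW].
- by move=> _ [U oU ->]; rewrite E; exact: f2.
- move=> _ g [U oU ->] hg; rewrite E; apply: (sh_glue sX); first exact: f2.
  move=> x [Xx Ux]; have [U' [h [oU' U'x hh hE]]] := hg (f x) (conj Ux (hW _ Xx)).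
  exists (pts X `&` f @^-1` U'), (h \o f); split => //; [exact: f2|exact: f3|].
  by move=> y [Xy U'y] [_ Uy] /=; apply: hE => //; split => //; exact: hW.
Qed.

Lemma hol_map_id T (X : cspace R T) : sheafy X -> hol_map X X id.
Proof.
move=> sX; split => // [U oU|U g oU hg]; rewrite preimage_id.
  exact: sh_I sX _ _ (sh_full sX) oU.
by apply: (sh_res sX) hg; [exact: sh_I sX _ _ (sh_full sX) oU|move=> x []].
Qed.

Lemma hol_map_subsub T (X : cspace R T) V W : sheafy X ->
  hol_map (sub_space (sub_space X V) W) (sub_space X (V `&` W)) id /\
  hol_map (sub_space X (V `&` W)) (sub_space (sub_space X V) W) id.
Proof.
move=> sX; have s1 := sub_sheafy sX V; have s2 := sub_sheafy sX (V `&` W); split.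
  apply: hol_map_subr; first exact: sub_sheafy.
    by do 2 apply: hol_map_subl; exact: hol_map_id.
  by move=> x [[_ Vx] Wx].
apply: hol_map_subr => //.
  apply: hol_map_subr => //; first by apply: hol_map_subl; exact: hol_map_id.
  by move=> x [_ []].
by move=> x [_ []].
Qed.

(** An open subspace of a quotient is the quotient of a saturated open part of [S], so maps out of
    it may be studied upstairs. *)
Lemma quot_sub_hol_map (E : normedModType (Cx R)) (S : set E) T (c : E -> T) V T2
    (Y : cspace R T2) f : opn (quot_space S c) V ->
  hol_map (quot_space (S `&` c @^-1` V) c) Y f ->
  hol_map (sub_space (quot_space S c) V) Y f.
Proof.
move=> oV [f1 f2 f3].
have VS : V `<=` c @` S by exact: (sh_sub (quot_sheafy S c) oV).
have PE : pts (sub_space (quot_space S c) V) = pts (quot_space (S `&` c @^-1` V) c).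
  apply/seteqP; split => [_ /= [[p Sp <-] Vp]|_ [p [Sp Vp] <-]]; first by exists p.
  by split => //; exists p.
have OE U : opn (quot_space (S `&` c @^-1` V) c) U -> opn (quot_space S c) U.
  move=> /quot_opnP[UX h]; apply/quot_opnP; split.
    by move=> x /UX[p [Sp _] <-]; exists p.
  move=> p Sp Up; have Vp : V (c p) by have [p' [_ Vp'] <-] := UX _ Up.
  have := h p (conj Sp Vp) Up; have := ((quot_opnP S c V).1 oV).2 p Sp Vp.
  by apply: filterS2 => q h1 h2 Sq; apply: h2; split => //; exact: h1.
split.
- by rewrite PE.
- move=> U /f2; rewrite -PE => /OE h; exists (pts (sub_space (quot_space S c) V) `&` f @^-1` U) => //.
  by apply/seteqP; split => [x [[Xx Vx] Ux]|x [h' _]] //.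
- move=> U g oU hg x [[Xx Vx] Ux].
  have oW := f2 _ oU; have := f3 _ _ oU hg; rewrite -PE in oW * => hW.
  exists (pts (sub_space (quot_space S c) V) `&` f @^-1` U), (g \o f); split => //.
    exact: OE.
  move=> p Sp [[cp Vp] Up]; have [ O [F [h1 h2 h3]]] := hW p (conj Sp Vp) (conj (conj cp Vp) Up).
  by exists O, F; split => // q Oq Sq [[cq Vq] Uq]; apply: h3.
Qed.

(** It is enough to lift a map locally to the ambient vector spaces; functions and open sets are
    then pulled back along the lift. *)
Lemma hol_lift (E1 E2 : normedModType (Cx R)) (S1 : set E1) (S2 : set E2) T1 T2
    (c1 : E1 -> T1) (c2 : E2 -> T2) (G : T1 -> T2) :
  (forall p, S1 p -> exists (O : set E1) (m : E1 -> E2), [/\ open O, O p,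
     forall q, O q -> differentiable m q &
     forall q, O q -> S1 q -> S2 (m q) /\ G (c1 q) = c2 (m q)]) ->
  hol_map (quot_space S1 c1) (quot_space S2 c2) G.
Proof.
move=> H; split.
- move=> _ [p Sp <-]; have [ O [m [oO Op _ h]]] := H p Sp.
  by have [S2m ->] := h p Op Sp; exists (m p).
- move=> U /quot_opnP[UX h]; apply/quot_opnP; split => [x []//|p Sp [_ Up]].
  have [ O [m [oO Op dm hm]]] := H p Sp; have [S2p Gp] := hm p Op Sp.
  have n1 : nbhs p O by exact: open_nbhs_nbhs.
  have n2 : \forall q \near p, S2 (m q) -> U (c2 (m q)).
    have n3 : nbhs (m p) [set q | S2 q -> U (c2 q)] by apply: h => //; rewrite -Gp.
    exact: (differentiable_continuous (dm p Op) n3).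
  move: n1 n2; apply: filterS2 => q Oq hq Sq; have [S2q Gq] := hm q Oq Sq.
  by split => /=; [exists q|rewrite Gq; exact: hq].
- move=> U g oU hg p Sp [_ Up].
  have [ O [m [oO Op dm hm]]] := H p Sp; have [S2p Gp] := hm p Op Sp.
  have {}Up : U (c2 (m p)) by rewrite -Gp.
  have [ O2 [F [[oO2 dF] h2 h3]]] := hg (m p) S2p Up.
  exists (O `&` m @^-1` O2), (F \o m); split.
  + split.
      apply: open_preimage_at => // q Oq; apply: differentiable_continuous; exact: dm.
    move=> q [Oq O2q]; apply: (@differentiable_comp _ _ _ (Cx R)^o m F); first exact: dm.
    exact: dF.
  + by split => //=; apply: h2.
  + move=> q [Oq O2q] Sq [_ Uq] /=; have [S2q Gq] := hm q Oq Sq.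
    by rewrite Gq; apply: h3 => //; move: Uq; rewrite /= Gq.
Qed.

End HolMaps.

End Sheafy.

(** * Holomorphic charts, slices and products *)

Section Charts.
Variable R : realType.

Lemma cdomain_pts n (Om : set 'rV[Cx R]_n) : pts (cdomain Om) = Om.
Proof. exact: image_id. Qed.

Lemma cdomain_opnP n (Om U : set 'rV[Cx R]_n) : open Om ->
  opn (cdomain Om) U <-> U `<=` Om /\ open U.
Proof.
move=> oOm; split=> [[UO [ O oO OE]]|[UO oU]].
  rewrite image_id in UO; split => //.
  rewrite (_ : U = Om `&` O); first exact: openI.
  by rewrite -OE preimage_id; apply/seteqP; split => [x Ux|x []//]; split => //; exact: UO.
by split; [rewrite image_id|exists U => //; rewrite preimage_id].
Qed.

Lemma hol_map_cdomain T (X : cspace R T) n (Om Om' : set 'rV[Cx R]_n) f :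
  open Om -> open Om' -> Om' `<=` Om -> hol_map X (cdomain Om) f ->
  (forall x, pts X x -> Om' (f x)) -> hol_map X (cdomain Om') f.
Proof.
move=> oOm oOm' sO [f1 f2 f3] fO; split.
- by move=> x Xx; rewrite cdomain_pts; exact: fO.
- move=> U /(cdomain_opnP _ oOm')[UO oU]; apply: f2; apply/(cdomain_opnP _ oOm).
  by split => // x /UO/sO.
- move=> U g /(cdomain_opnP _ oOm')[UO oU] hg; apply: f3.
    by apply/(cdomain_opnP _ oOm); split => // x /UO/sO.
  move=> p Op Up; have [ O [F [h1 h2 h3]]] := hg p (UO _ Up) Up.
  by exists O, F; split => // q Oq _ Uq; apply: h3 => //; exact: UO.
Qed.

Lemma cdomain_sheafy n (Om : set 'rV[Cx R]_n) : sheafy (cdomain Om).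
Proof. exact: quot_sheafy. Qed.

Lemma biholomorphic_id T T2 (X X' : cspace R T) (Y : cspace R T2) f :
  hol_map X X' id -> hol_map X' X id -> biholomorphic X' Y f -> biholomorphic X Y f.
Proof.
move=> h1 h2 [hf [g [hg gf fg]]]; split; first exact: hol_map_comp h1 hf.
exists g; split => //; first exact: hol_map_comp hg h2.
by move=> x Xx; apply: gf; case: h1 => h1 _ _; exact: h1.
Qed.

Section Chart.
Variables (T : Type) (X : cspace R T).
Hypothesis sX : sheafy X.

Lemma sub_opn U W : opn X U -> opn (sub_space X U) W -> opn X W.
Proof. by move=> oU [W' oW' ->]; exact: sh_I sX _ _ oW' oU. Qed.

Lemma sub_hol U W f : opn X U -> opn (sub_space X U) W -> hol (sub_space X U) W f -> hol X W f.
Proof.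
move=> oU oW h; apply: (sh_glue sX); first exact: sub_opn oW.
by move=> x Wx; have [V [g [oV Vx hg gf]]] := h x Wx; exists V, g.
Qed.

Lemma chart_preimage U n (Om B : set 'rV[Cx R]_n) phi : chart X U Om phi -> open B ->
  opn X (U `&` phi @^-1` B).
Proof.
move=> [oU oOm [[f1 f2 f3] _]] oB.
have XU := sh_sub sX oU.
have h := f2 (Om `&` B) ((cdomain_opnP _ oOm).2 (conj (@subIsetl _ _ _) (openI oOm oB))).
have := sub_opn oU h; congr (opn X _); apply/seteqP; split => [x [[_ Ux] [_ Bx]]|x [Ux Bx]] //.
have Px : pts (sub_space X U) x by split => //; exact: XU.
by split => //; split => //; have := f1 x Px; rewrite cdomain_pts.
Qed.

Lemma chart_dom U n (Om : set 'rV[Cx R]_n) phi x : chart X U Om phi -> U x -> Om (phi x).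
Proof.
move=> [oU _ [[f1 _ _] _]] Ux; have := f1 x (conj (sh_sub sX oU Ux) Ux).
by rewrite cdomain_pts.
Qed.

Lemma chart_coord U n (Om : set 'rV[Cx R]_n) phi j : chart X U Om phi ->
  hol X U (fun x => phi x 0 j).
Proof.
move=> [oU oOm [[f1 f2 f3] _]].
have oO : opn (cdomain Om) Om by apply/(cdomain_opnP _ oOm); split.
have h : hol (cdomain Om) Om (fun w => w 0 j).
  move=> p Op _; exists setT, (fun w : 'rV[Cx R]_n => w 0 j); split => //; split; first exact: openT.
  by move=> q _; exact: differentiable_coord.
have := sub_hol oU (f2 _ oO) (f3 _ _ oO h).
suff -> : pts (sub_space X U) `&` phi @^-1` Om = U by [].
apply/seteqP; split => [x [[_ Ux] _]//|x Ux].
have Px : pts (sub_space X U) x by split => //; exact: (sh_sub sX oU).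
by split => //; have := f1 x Px; rewrite cdomain_pts.
Qed.

Lemma chart_restr U n (Om : set 'rV[Cx R]_n) phi U' : chart X U Om phi -> opn X U' ->
  exists Om', Om' `<=` Om /\ chart X (U `&` U') Om' phi.
Proof.
move=> [oU oOm [hf [g [hg gf fg]]]] oU'.
pose Om' := Om `&` g @^-1` (U' `&` U).
have XU := sh_sub sX oU.
have fO x : U x -> Om (phi x).
  move=> Ux; have [f1 _ _] := hf; have := f1 x (conj (XU _ Ux) Ux).
  by rewrite cdomain_pts.
have oOm' : open Om'.
  have [_ g2 _] := hg; have := g2 (U' `&` U) (ex_intro2 _ _ U' oU' erefl).
  by rewrite cdomain_pts => /(cdomain_opnP _ oOm)[].
exists Om'; split; first by move=> x [].
have o2 := sh_I sX oU oU'.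
split => //.
have s2 := sub_sheafy sX (U `&` U').
split.
- apply: (hol_map_cdomain oOm oOm'); first by move=> x [].
    apply: (hol_map_comp (g := phi) (f := id)) hf.
    apply: (hol_map_subr s2); first by apply: hol_map_subl; exact: hol_map_id.
    by move=> x [_ []].
  move=> x [Xx [Ux U'x]]; split; first exact: fO.
  by rewrite /= gf.
- exists g; split.
  + apply: hol_map_subr; first exact: cdomain_sheafy.
      apply: (hol_map_comp (g := id) (f := g) (Y := sub_space X U)); last first.
        by apply: hol_map_subl; exact: hol_map_id.
      apply: (hol_map_comp (f := id) (Y := cdomain Om)) hg.
      apply: hol_lift => p [Op _]; exists setT, id; split => //; first exact: openT.
      by move=> q _ [].
    by move=> x; rewrite cdomain_pts => -[_ [? ?]].
  + by move=> x [Xx [Ux U'x]]; rewrite gf.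
  + move=> y; rewrite cdomain_pts => -[Oy _]; apply: fg.
    by rewrite cdomain_pts.
Qed.

End Chart.

(** [N] gives invariant coordinates, [s] a section of them. [W] is open and is where [N] is defined;
    [V] need not be open, so that the wall locus can be charted by the same statement as the whole
    quotient. *)
Lemma slice_chart (E : normedModType (Cx R)) (S : set E) T (c : E -> T) (V W : set T) n
    (N : E -> 'rV[Cx R]_n) (s : 'rV[Cx R]_n -> E) (Om : set 'rV[Cx R]_n) :
  opn (quot_space S c) W -> open Om ->
  (forall p, S p -> W (c p) -> exists O, [/\ open O, O p & forall q, O q -> differentiable N q]) ->
  (forall p q, S p -> S q -> W (c p) -> c p = c q -> N p = N q) ->
  (forall w, Om w -> differentiable s w) ->
  (forall w, Om w -> [/\ S (s w), W (c (s w)), V (c (s w)) & N (s w) = w]) ->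
  (forall p, S p -> W (c p) -> V (c p) -> Om (N p) /\ c (s (N p)) = c p) ->
  exists phi, biholomorphic (sub_space (quot_space S c) (V `&` W)) (cdomain Om) phi /\
    forall p, S p -> W (c p) -> phi (c p) = N p.
Proof.
move=> oW oOm dN cN ds sP NP; have sX := quot_sheafy S c.
(* [N] evaluated at an arbitrary representative; by invariance the choice does not matter over
   [W]. *)
pose phi t := N (xget 0 [set p | S p /\ c p = t]).
have phiE p : S p -> W (c p) -> phi (c p) = N p.
  move=> Sp Wp; rewrite /phi; case: xgetP => [q -> [Sq cq]|/(_ p)[]//].
  by apply: cN => //; rewrite cq.
exists phi; split => //; split.
- apply: (hol_map_cdomain (Om := setT)) => //; first exact: openT.
    apply: (hol_map_comp (f := id) (g := phi) (Y := sub_space (quot_space S c) W)).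
      apply: hol_map_subr; first exact: sub_sheafy.
        by apply: hol_map_subl; exact: hol_map_id.
      by move=> x [_ []].
    apply: quot_sub_hol_map => //; apply: hol_lift => p [Sp Wp].
    have [ O [oO Op dO]] := dN p Sp Wp; exists O, N; split => // q Oq [Sq Wq].
    by split => //; rewrite phiE.
  by move=> _ [[p Sp <-] [Vp Wp]]; rewrite phiE //; have [] := NP p Sp Wp Vp.
- exists (fun w => c (s w)); split.
  + apply: hol_map_subr; first exact: cdomain_sheafy.
      apply: hol_lift => w Ow; exists Om, s; split => // q Oq _.
      by have [] := sP q Oq.
    by move=> w; rewrite cdomain_pts => Ow; have [? ? ? ?] := sP w Ow.
  + move=> _ [[p Sp <-] [Vp Wp]]; rewrite phiE //.
    by have [] := NP p Sp Wp Vp.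
  + move=> w; rewrite cdomain_pts => Ow; have [? ? ? E'] := sP w Ow.
    by rewrite phiE.
Qed.

Section Products.
Variables (T1 T2 : Type) (A : cspace R T1) (B : cspace R T2).
Hypotheses (sA : sheafy A) (sB : sheafy B).

Lemma hol_map_pair T (X : cspace R T) f : sheafy X ->
  hol_map X A (fun x => (f x).1) -> hol_map X B (fun x => (f x).2) ->
  hol_map X (prod_space A B) f.
Proof.
move=> sX [f1 f2 f3] [g1 g2 g3].
have hb W : opn (prod_space A B) W -> opn X (pts X `&` f @^-1` W).
  move=> oW; apply: (sh_loc sX) => x [Xx Wx].
  move: (oW (f x).1 (f x).2); rewrite -surjective_pairing => /(_ Wx)[U [V [oU oV Ux Vx UV]]].
  exists ((pts X `&` (fun x => (f x).1) @^-1` U) `&` (pts X `&` (fun x => (f x).2) @^-1` V)).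
  split; [by apply: (sh_I sX); [exact: f2|exact: g2]|by []|].
  move=> y [[Xy Uy] [_ Vy]]; split => //=.
  by rewrite (surjective_pairing (f y)); exact: UV.
split => //.
- by move=> x Xx; split; [exact: f1|exact: g1].
- move=> W h oW hh; apply: (sh_glue sX); first exact: hb.
  move=> x [Xx Wx].
  move: (hh (f x).1 (f x).2); rewrite -surjective_pairing => /(_ Wx).
  move=> [m [n [U [V [Om [Om' [phi [psi [g [cU cV [Ux Vx] [oOO dg] hg]]]]]]]]]].
  have [oU oOm bU] := cU; have [oV oOm' bV] := cV.
  pose P := (pts X `&` (fun x => (f x).1) @^-1` U) `&` (pts X `&` (fun x => (f x).2) @^-1` V).
  have oP : opn X P by apply: (sh_I sX); [exact: f2|exact: g2].
  have o2 : opn X (P `&` (pts X `&` f @^-1` W)) by apply: (sh_I sX) => //; exact: hb.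
  have hc (j : 'I_(m + n)) : hol X (P `&` (pts X `&` f @^-1` W))
      (fun y => row_mx (phi (f y).1) (psi (f y).2) 0 j).
    case: (split_ordP j) => k ->.
      have -> : (fun y => row_mx (phi (f y).1) (psi (f y).2) 0 (lshift n k)) =
          (fun t => phi t 0 k) \o (fun y => (f y).1).
        by apply/funext => y; rewrite row_mxEl.
      apply: (sh_res sX _ _ (f3 _ _ oU (chart_coord sA k cU))) => //.
      by move=> y [[[]]].
    have -> : (fun y => row_mx (phi (f y).1) (psi (f y).2) 0 (rshift m k)) =
        (fun t => psi t 0 k) \o (fun y => (f y).2).
      by apply/funext => y; rewrite row_mxEr.
    apply: (sh_res sX _ _ (g3 _ _ oV (chart_coord sB k cV))) => //.
    by move=> y [[_ []]].
  (* The coordinates of both charts are concatenated, so that a function on the product becomes a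
     holomorphic function of one row of functions on [X] and [sh_comp] applies. *)
  pose OO : set 'rV[Cx R]_(m + n) := [set w | (Om `*` Om') (lsubmx w, rsubmx w)].
  pose G (w : 'rV[Cx R]_(m + n)) := g (lsubmx w, rsubmx w).
  have dLR w : differentiable (fun w : 'rV[Cx R]_(m + n) => (lsubmx w, rsubmx w)) w.
    by apply: differentiable_pair; [exact: differentiable_lsubmx|exact: differentiable_rsubmx].
  have hG : holomorphic_on OO G.
    split.
      rewrite (_ : OO = setT `&` (fun w => (lsubmx w, rsubmx w)) @^-1` (Om `*` Om')).
        apply: open_preimage_at; [exact: openT| |exact: oOO].
        by move=> w _; apply: differentiable_continuous; exact: dLR.
      by rewrite setTI.
    move=> w Ow; exact: (differentiable_comp (dLR w) (dg _ Ow)).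
  exists (P `&` (pts X `&` f @^-1` W)), (fun y => G (\row_j row_mx (phi (f y).1) (psi (f y).2) 0 j)).
  have rE y : \row_j row_mx (phi (f y).1) (psi (f y).2) 0 j = row_mx (phi (f y).1) (psi (f y).2).
    by apply/rowP => j; rewrite mxE.
  split => //.
  + apply: (sh_comp sX o2 hc hG) => y [[[_ Uy] [_ Vy]] _].
    rewrite rE /OO /= row_mxKl row_mxKr; split => /=; [exact: chart_dom cU Uy|exact: chart_dom cV Vy].
  + move=> y [[[_ Uy] [_ Vy]] [Xy Wy]] _ /=; rewrite rE /G row_mxKl row_mxKr.
    by rewrite (surjective_pairing (f y)) hg // -surjective_pairing.
Qed.

Lemma hol_map_of_prod (E : normedModType (Cx R)) (S : set E) T (c : E -> T) V
    (F : T1 * T2 -> T) :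
  (forall x y, pts A x -> pts B y -> exists m n U1 U2 (Om1 : set 'rV[Cx R]_m)
      (Om2 : set 'rV[Cx R]_n) phi psi (M : 'rV[Cx R]_m * 'rV[Cx R]_n -> E),
    [/\ chart A U1 Om1 phi, chart B U2 Om2 psi, U1 x /\ U2 y,
      forall w, (Om1 `*` Om2) w -> differentiable M w &
      forall x' y', U1 x' -> U2 y' -> let z := M (phi x', psi y') in
        [/\ S z, V (c z) & F (x', y') = c z]]) ->
  hol_map (prod_space A B) (sub_space (quot_space S c) V) F.
Proof.
move=> H.
(* Continuity of the lift [M] in the chart variables allows both charts to be shrunk until [M] maps
   their product into a given open set. *)
have box x y (O : set E) : pts A x -> pts B y -> open O ->
    (forall m n U1 U2 (Om1 : set 'rV[Cx R]_m)
      (Om2 : set 'rV[Cx R]_n) phi psi (M : 'rV[Cx R]_m * 'rV[Cx R]_n -> E),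
    chart A U1 Om1 phi -> chart B U2 Om2 psi -> U1 x -> U2 y ->
    (forall w, (Om1 `*` Om2) w -> differentiable M w) ->
    O (M (phi x, psi y)) ->
    exists U1' U2' Om1' Om2', [/\ U1' `<=` U1 /\ U2' `<=` U2, chart A U1' Om1' phi,
      chart B U2' Om2' psi, U1' x /\ U2' y &
      (Om1' `*` Om2') `<=` (Om1 `*` Om2) `&` M @^-1` O]).
  move=> Ax By oO m n U1 U2 Om1 Om2 phi psi M c1 c2 U1x U2y dM OM.
  have O1 := chart_dom sA c1 U1x; have O2 := chart_dom sB c2 U2y.
  have n1 : nbhs (phi x, psi y) (M @^-1` O).
    by apply: (differentiable_continuous (dM (phi x, psi y) (conj O1 O2))); exact: open_nbhs_nbhs.
  have [[B1 B2] [/= nB1 nB2] BO] := n1.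
  have nbE k (x' : 'rV[Cx R]_k) B' : nbhs x' B' -> exists2 D, open D /\ D x' & D `<=` B'.
    by rewrite nbhsE => -[D [oD Dx] DB]; exists D.
  have [D1 [oD1 D1x] DB1] := nbE _ _ _ nB1; have [D2 [oD2 D2y] DB2] := nbE _ _ _ nB2.
  have p1 := chart_preimage sA c1 oD1; have p2 := chart_preimage sB c2 oD2.
  have [Om1' [s1 c1']] := chart_restr sA c1 p1; have [Om2' [s2 c2']] := chart_restr sB c2 p2.
  exists (U1 `&` (U1 `&` phi @^-1` D1)), (U2 `&` (U2 `&` psi @^-1` D2)), Om1', Om2'.
  split; [by split => z []|exact: c1'|exact: c2'|by []|].
  move=> [w1 w2] [/= w1O w2O]; split; first by split; [exact: s1|exact: s2].
  have bij k (O' : set 'rV[Cx R]_k) T' (Z : cspace R T') U' ph w : chart Z U' O' ph -> O' w ->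
      exists2 z, U' z & ph z = w.
    move=> [_ _ [_ [g [[h1 _ _] _ h3]]]] O'w; exists (g w).
      by have [] : pts (sub_space Z U') (g w) by apply: h1; rewrite cdomain_pts.
    by apply: h3; rewrite cdomain_pts.
  have [z1 [_ [_ D1z]] <-] := bij _ _ _ _ _ _ _ c1' w1O.
  have [z2 [_ [_ D2z]] <-] := bij _ _ _ _ _ _ _ c2' w2O.
  by apply: BO; split; [exact: DB1|exact: DB2].
split.
- move=> [x y] [/= Ax By]; have [m [n [U1 [U2 [Om1 [Om2 [phi [psi [M [c1 c2 [U1x U2y] dM h]]]]]]]]]] := H x y Ax By.
  by have [Sz Vz ->] := h x y U1x U2y; split => //; exists (M (phi x, psi y)).
- move=> _ [U oU ->] x y [[/= Ax By] [Ux Vx]].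
  have [m [n [U1 [U2 [Om1 [Om2 [phi [psi [M [c1 c2 [U1x U2y] dM h]]]]]]]]]] := H x y Ax By.
  have [Sz Vz FE] := h x y U1x U2y.
  have Uz : U (c (M (phi x, psi y))) by rewrite -FE.
  have [ O [oO Oz OU]] := quot_hol_open oU Sz Uz.
  have [U1' [U2' [Om1' [Om2' [[s1 s2] c1' c2' [U1x' U2y'] sO]]]]] :=
    box x y O Ax By oO m n U1 U2 Om1 Om2 phi psi M c1 c2 U1x U2y dM Oz.
  exists U1', U2'; split; [by case: c1'|by case: c2'|by []|by []|].
  move=> [x' y'] [/= U1x'' U2y'']; have [Sz' Vz' FE'] := h x' y' (s1 _ U1x'') (s2 _ U2y'').
  split.
    have [oU1' _ _] := c1'; have [oU2' _ _] := c2'.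
    by split; [exact: (sh_sub sA oU1')|exact: (sh_sub sB oU2')].
  rewrite /= FE'; split => //; apply: OU => //.
  have [|_ //] := sO (phi x', psi y').
  by split; [exact: chart_dom c1' _|exact: chart_dom c2' _].
- move=> U g oU hg x y [[/= Ax By] Ux].
  have [m [n [U1 [U2 [Om1 [Om2 [phi [psi [M [c1 c2 [U1x U2y] dM h]]]]]]]]]] := H x y Ax By.
  have [Sz Vz FE] := h x y U1x U2y.
  have Uz : U (c (M (phi x, psi y))) by rewrite -FE.
  have [U' [k [oU' U'z hk kg]]] := hg _ Uz.
  have [ O [G [[oO dG] Oz OG]]] := hk _ Sz U'z.
  have [ O' [oO' O'z O'U]] := quot_hol_open oU' Sz U'z.
  have [U1' [U2' [Om1' [Om2' [[s1 s2] c1' c2' [U1x' U2y'] sO]]]]] :=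
    box x y (O `&` O') Ax By (openI oO oO') m n U1 U2 Om1 Om2 phi psi M c1 c2 U1x U2y dM (conj Oz O'z).
  exists m, n, U1', U2', Om1', Om2', phi, psi, (G \o M); split => //.
  + split.
      have [_ o1 _] := c1'; have [_ o2 _] := c2'.
      rewrite openE => -[w1 w2] [/= h1 h2]; exists (Om1', Om2') => //.
      by split; exact: open_nbhs_nbhs.
    move=> w Ow; have [Oww [OMw _]] := sO w Ow.
    by apply: (@differentiable_comp _ _ _ (Cx R)^o M G); [exact: dM|exact: dG].
  + move=> x' y' U1x'' U2y'' [_ Uxy] /=.
    have [Sz' Vz' FE'] := h x' y' (s1 _ U1x'') (s2 _ U2y'').
    have [|_ [Oz' O'z']] := sO (phi x', psi y').
      by split; [exact: chart_dom c1' _|exact: chart_dom c2' _].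
    rewrite FE' OG //; last exact: O'U.
    by apply/esym/kg; [exact: O'U|rewrite -FE'].
Qed.

End Products.
End Charts.

(** * Points over the wall *)

Section WallPoints.
Variables (R : realType) (N d : nat) (K : subtorus R N d).
Hypothesis hK : unimodular_subtorus K.
Notation wt := (wt K).
Variables (be : 'rV[Cx R]_d) (H0 : set 'rV[Cx R]_N).
Hypothesis hH0 : Swalls K be H0.
Variable Y0 : 'rV[R]_d.
Hypotheses (hY0 : lie_of K H0 Y0) (hY0n : Y0 != 0).
Variable al : 'rV[R]_d.
Hypothesis hals : forall H, Swalls K be H -> H <> H0 -> ~ wall K H al.

Let Z0 := level K al be `&` fixed_by H0.
Notation face := (face K al).

Definition on_wall (p : HN R N) := forall k, k \in face p -> pairing (wt k) Y0 = 0.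

Lemma wbasis_neq0 kap Y l : wbasis K kap Y -> Y l != 0.
Proof.
by move=> hY; apply/eqP => h; have := hY.1 l l; rewrite h pairing0r eqxx => /eqP; rewrite eq_sym oner_eq0.
Qed.

(** The Lie algebra alone only controls the identity component of [H0]. But an element of [H0] fixes
    [p0], so the basis characters in the support of [p0] are trivial on it, and a weight on the wall
    is a monomial in these alone: the remaining [Y l] are multiples of [Y0], which makes its other
    exponents 0. *)
Lemma fixed_H0 p : fixed_by H0 p <-> forall k, pairing (wt k) Y0 != 0 -> crd p k = 0.
Proof.
split=> [h k kY|h g].
  apply: contraNeq kY => pk; apply/eqP; apply: cexpi_triv => s.
  have /(congr1 (fun q => crd q k)) := h _ (hY0 s).
  by rewrite crd_act k_inclZ sgc_texp pairingZr => /(canRL (mulKf pk)); rewrite mulVf.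
have [[[p0 HE] _] _] := hH0; rewrite HE => -[Kg gp].
have [kap [Y [L [hY LF LP]]]] := extend_wbasis K (supp p0).
apply: crd_inj => k; rewrite crd_act.
have [kY|kY] := eqVneq (pairing (wt k) Y0) 0; last by rewrite h ?mul0r.
rewrite (torus_monE hK hY) // [mon _ _ _ _]big1 ?mulr1 // => l _.
have [lL|lL] := boolP (l \in L).
  have pl := LF l lL; have /(congr1 (fun q => crd q (kap l))) := gp.
  by rewrite crd_act => /(canRL (mulKf pl)); rewrite mulVf // => ->; rewrite exp1rz.
have : lie_of K H0 (Y l) by rewrite HE; apply/lie_isotropy => m pm; exact: LP.
rewrite (lie_H0 hH0 hY0 hY0n) => -[c _ cE].
suff -> : wcoef K Y k l = 0 by rewrite expr0z.
by apply: (@intr_inj R); rewrite (wcoefK hK _ _ hY) -cE pairingZr kY mulr0.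
Qed.

Lemma cls_wall p : ss K al be p ->
  (korb K @` Z0) (cls K al be p) <-> on_wall p.
Proof.
move=> ssp; split.
  move=> [z [lz fz] zE] k kF; have [ssz zl zf] := level_face lz.
  have : cls K al be p = cls K al be z by rewrite (level_cls hK lz) zE.
  move=> /(cls_eqP hK ssp ssz); rewrite zl => pz.
  have [_ [_ _ _ sE]] := corb_real pz.
  apply/eqP; apply/negPn/negP => kY.
  by have := kF; rewrite -supp_limpt -sE /supp ((fixed_H0 z).1 fz k kY) eqxx.
move=> wp; have [q pq] := cls_nonempty hK ssp; exists q; last first.
  by have [_ _ _ <-] := cls_mem hK ssp pq; rewrite (level_cls hK (cls_level hK ssp pq)).
split; first exact: cls_level pq.
apply/fixed_H0 => k kY; have [cq _ _ _] := cls_mem hK ssp pq.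
have [_ [_ _ _ sE]] := corb_real cq.
apply/eqP/negPn/negP => qk; have : supp q k by [].
by rewrite sE supp_limpt => /wp /eqP; rewrite (negPf kY).
Qed.

Lemma on_wall_sep p : ss K al be p -> on_wall p ->
  forall y, (forall k, k \in face p -> pairing (wt k) y = 0) -> exists c, y = c *: Y0.
Proof.
move=> ssp wp; have [h|[]//] := wall_dichotomy hH0 hY0 hY0n hals ssp.
by have := h Y0 wp => Y00; move: hY0n; rewrite Y00 eqxx.
Qed.

(** Exactly one basis weight lies off the face, because its dual vector must be a multiple of [Y0];
    it is exchanged for the prescribed [k0]. *)
Lemma wall_basis p k0 : ss K al be p -> on_wall p -> pairing (wt k0) Y0 != 0 ->
  exists kap Y l0, [/\ wbasis K kap Y, kap l0 = k0, forall l, l != l0 -> kap l \in face p &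
    Y l0 = (pairing (wt k0) Y0)^-1 *: Y0].
Proof.
move=> ssp wp k00.
have [kap [Y [L [hY LF LP]]]] := extend_wbasis K (fun k => k \in face p).
have [l0 l0L] : exists l0, l0 \notin L.
  apply: contrapT => /forallNP h; move: hY0n; rewrite (wbasis_dual Y0 hY) big1 ?eqxx // => l _.
  by rewrite wp ?scale0r //; apply: LF; apply/negPn/negP/h.
have prop l : l \notin L -> exists2 c, c != 0 & Y l = c *: Y0.
  move=> lL; have [|c cE] := on_wall_sep ssp wp (y := Y l); first by move=> k kF; exact: LP.
  by exists c => //; apply: contraNneq (wbasis_neq0 l hY) => c0; rewrite cE c0 scale0r.
have [c0 c0n c0E] := prop l0 l0L.
have uniq l : l != l0 -> l \in L.
  move=> ll0; apply/negPn/negP => lL; have [c cn cE] := prop l lL.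
  have := hY.1 l0 l; rewrite eq_sym (negPf ll0) cE => /eqP; rewrite pairingZr mulf_eq0 (negPf cn) /=.
  have := hY.1 l0 l0; rewrite c0E pairingZr eqxx => h1 /eqP h2.
  by move: h1; rewrite h2 mulr0 => /eqP; rewrite eq_sym oner_eq0.
have kl0 : pairing (wt k0) (Y l0) != 0 by rewrite c0E pairingZr mulf_neq0.
have hY' := exchange_wbasis hY kl0.
do 2 eexists; exists l0; split; first exact: hY'; rewrite /= ?eqxx //.
  by move=> l ll0; rewrite (negPf ll0); apply: LF; exact: uniq.
by rewrite c0E pairingZr scalerA invfM mulrAC mulVf // mul1r.
Qed.

Lemma wall_pairing_int p k k0 : ss K al be p -> on_wall p -> pairing (wt k0) Y0 != 0 ->
  pairing (wt k) Y0 / pairing (wt k0) Y0 \is a Num.int.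
Proof.
move=> ssp wp k00; have [kap [Y [l0 [hY _ _ YE]]]] := wall_basis ssp wp k00.
by have := wbasis_int hK k l0 hY; rewrite YE pairingZr mulrC.
Qed.

(** The ratio and its inverse are positive integers, hence 1. This is why the fibres are ordinary
    and not weighted projective spaces. *)
Lemma wall_pairing p k k0 : ss K al be p -> on_wall p ->
  0 < pairing (wt k) Y0 * pairing (wt k0) Y0 -> pairing (wt k) Y0 = pairing (wt k0) Y0.
Proof.
move=> ssp wp; set x := pairing (wt k) Y0; set y := pairing (wt k0) Y0 => xy.
have x0 : x != 0 by apply: contraTneq xy => ->; rewrite mul0r ltxx.
have y0 : y != 0 by apply: contraTneq xy => ->; rewrite mulr0 ltxx.
have h1 := wall_pairing_int k ssp wp y0; have h2 := wall_pairing_int k0 ssp wp x0.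
have pos u v : 0 < u * v -> v != 0 -> 0 < u / v :> R.
  move=> uv v0; have -> : u / v = u * v * (v ^+ 2)^-1 by rewrite expr2 invfM mulrA mulfK.
  by rewrite divr_gt0 // exprn_even_gt0.
have g1 := pos x y xy y0; have g2 := pos y x; rewrite mulrC in g2; have {}g2 := g2 xy x0.
have ge1 u : u \is a Num.int -> 0 < u -> 1 <= u :> R.
  by move=> /intrP[z ->]; rewrite ltr0z ler1z.
have e1 := ge1 _ h1 g1; have e2 := ge1 _ h2 g2.
have : x / y = 1.
  apply/eqP; rewrite eq_le e1 andbT -(ler_pM2r g2) mul1r.
  by rewrite mulrA divfK // divff.
by move=> /(canRL (mulfVK y0)); rewrite mul1r.
Qed.

Section NearWallPoint.
Variable q0 : HN R N.
Hypotheses (ssq0 : ss K al be q0) (wq0 : on_wall q0).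

(* the points at which the monomials of a slice through q0 are defined *)
Definition near_wall (p : HN R N) := forall k, k \in face q0 -> crd p k != 0.

Lemma near_wall_ss p : muC K p = be -> near_wall p -> ss K al be p.
Proof.
move=> pb np; apply/ssP; split => //; have /ssP[_ Cq] := ssq0.
have [c [c0 cF aE]] := min_face_coef Cq; exists c; split => // k pk.
apply/eqP; rewrite eq_le c0 andbT leNgt cF; apply: contra pk; exact: np.
Qed.

Lemma near_wall_face p : muC K p = be -> near_wall p ->
  forall k, k \in face q0 -> k \in face p.
Proof.
move=> pb np k kF; have /ssP[_ Cq] := ssq0.
have [c [c0 cF aE]] := min_face_coef Cq.
apply/min_faceP; exists c; split => // [j pj|]; last by rewrite cF.
apply/eqP; rewrite eq_le c0 andbT leNgt cF; apply: contra pj; exact: np.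
Qed.

(** A functional separating the face of [p] vanishes on the face of [q0], so it is a multiple of
    [Y0] and vanishes at [k] as well. *)
Lemma near_wall_off p k : muC K p = be -> near_wall p -> crd p k != 0 ->
  pairing (wt k) Y0 = 0 -> k \in face p.
Proof.
move=> pb np pk kY; have ssp := near_wall_ss pb np.
have /ssP[_ Cp] := ssp; have [y [yF yP _]] := min_face_sep Cp.
have [|c yE] := on_wall_sep ssq0 wq0 (y := y).
  by move=> j jF; apply: yF; exact: near_wall_face.
apply: contrapT => /negP kF; have := yP k pk kF.
by rewrite yE pairingZr kY mulr0 ltxx.
Qed.

Lemma near_wall_limpt p k : muC K p = be -> near_wall p -> pairing (wt k) Y0 = 0 ->
  crd (limpt K al p) k = crd p k.
Proof.
move=> pb np kY; rewrite crd_restr; case: ifPn => // kF.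
by apply/esym/eqP; apply: contraNT kF => pk; exact: near_wall_off.
Qed.

Lemma cls_near_wall p p' : ss K al be p -> ss K al be p' -> cls K al be p = cls K al be p' ->
  near_wall p -> near_wall p'.
Proof.
move=> ssp ssp' /(cls_eqP hK ssp ssp') pp' np k kF.
have [_ [_ _ _ sE]] := corb_real pp'.
have pb : muC K p = be by case/ssP: ssp.
have h : supp (limpt K al p') k by rewrite sE supp_limpt; exact: near_wall_face.
by move: h; rewrite supp_limpt => /face_supp.
Qed.

Lemma near_wall_open : open ([set p | near_wall p] : set (HNn R N)).
Proof.
rewrite (_ : [set p | _] = [set p : HNn R N | forall k, (if k \in face q0 then crd p k != 0 else true)]).
  apply: (@open_forall _ _ (fun k => [set p : HNn R N | if k \in face q0 then crd p k != 0 else true])) => k.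
  case: (k \in face q0); last by rewrite (_ : [set p | _] = setT); [exact: openT|apply/seteqP].
  have h (p : HNn R N) : crd p k != 0 -> \forall q \near p, crd q k != 0.
    by move=> pk; apply: open_neq0 => //; exact: crd_continuous.
  by rewrite openE => p pk; exact: h.
apply/seteqP; split => p h k; last by move=> kF; have := h k; rewrite kF.
by case: ifP => // /h.
Qed.

Lemma near_wall_opn : opn (Xspace K al be) [set cls K al be p | p in [set p | ss K al be p /\ near_wall p]].
Proof.
apply/quot_opnP; split; first by move=> _ [p [ssp _] <-]; exists p.
move=> p ssp [p' [ssp' np'] E]; have np := cls_near_wall ssp' ssp E np'.
have h : nbhs (p : HNn R N) [set p | near_wall p].
  by apply: open_nbhs_nbhs; split => //; exact: near_wall_open.
by apply: filterS h => q nq ssq; exists q.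
Qed.

End NearWallPoint.

Section Side.
Variable a : 'rV[R]_d.
Hypotheses (a0 : pairing a Y0 != 0) (al0 : pairing al Y0 = 0).
Hypothesis hsub : forall p, ss K a be p -> ss K al be p.
Hypothesis hgen : forall p, ss K a be p -> limpt K a p = p.
Hypothesis hwall : forall p, ss K al be p -> on_wall p ->
  ss K a be p <-> exists2 k, supp p k & 0 < pairing (wt k) Y0 * pairing a Y0.

(** The weights on the same side of the wall as [a]; the sign of [Y0] does not matter. *)
Definition up k := 0 < pairing (wt k) Y0 * pairing a Y0.

(** The functional separating the face at [al] is a multiple of [Y0] and is positive at every weight
    of the support off the wall, so all these weights lie on one side. Semi-stability for [a]
    provides one that is on the side of [a]. *)
Lemma on_wall_up p k : ss K a be p -> on_wall p -> crd p k != 0 ->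
  pairing (wt k) Y0 != 0 -> up k.
Proof.
move=> ssa wp pk kY; have ssp := hsub ssa.
have /ssP[_ Cp] := ssp; have [y [yF yP _]] := min_face_sep Cp.
have [c yE] := on_wall_sep ssp wp yF.
have [k1 pk1 k1a] := (hwall ssp wp).1 ssa.
have offF k' : pairing (wt k') Y0 != 0 -> k' \notin face p.
  by apply: contra => /wp ->.
have k1Y : pairing (wt k1) Y0 != 0 by apply: contraTneq k1a => ->; rewrite mul0r ltxx.
have := yP k1 pk1 (offF _ k1Y); have := yP k pk (offF _ kY).
rewrite yE !pairingZr /up => h1 h2.
have ca : 0 < c * pairing a Y0.
  have := mulr_gt0 h2 k1a; set u := pairing (wt k1) Y0 in k1Y *.
  rewrite (_ : c * u * _ = (c * pairing a Y0) * (u ^+ 2)); last by ring.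
  by rewrite pmulr_lgt0 // exprn_even_gt0.
have c2 : 0 < c ^+ 2 by rewrite exprn_even_gt0 //=; apply: contraTneq ca => ->; rewrite mul0r ltxx.
have := mulr_gt0 h1 ca.
set u := pairing (wt k) Y0; rewrite (_ : c * u * _ = u * pairing a Y0 * c ^+ 2); last by ring.
by rewrite pmulr_lgt0.
Qed.

(** Pairing a positive representation of [al] with [Y0] gives 0 as a sum of terms of one sign, so
    all face weights lie on the wall. *)
Lemma up_on_wall p : ss K al be p ->
  (forall k, crd p k != 0 -> pairing (wt k) Y0 != 0 -> up k) -> on_wall p.
Proof.
move=> ssp h k kF; have /ssP[_ Cp] := ssp; have [c [c0 cF aE]] := min_face_coef Cp.
have : \sum_j c j * (pairing (wt j) Y0 * pairing a Y0) = 0.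
  transitivity (\sum_j pairing (c j *: wt j) Y0 * pairing a Y0).
    by apply: eq_bigr => j _; rewrite pairingZl mulrA.
  by rewrite -mulr_suml -pairing_suml -aE al0 mul0r.
move/eqP; rewrite psumr_eq0 => [/allP /(_ k (mem_index_enum _)) |j _]; last first.
  have [jF|] := boolP (j \in face p); last first.
    by rewrite -cF -leNgt => cj; have -> : c j = 0 by [apply/eqP; rewrite eq_le cj c0]; rewrite mul0r.
  rewrite mulr_ge0 //; have [->|jY] := eqVneq (pairing (wt j) Y0) 0; first by rewrite mul0r.
  by apply/ltW/h => //; exact: face_supp jF.
rewrite /= mulf_eq0 mulf_eq0 (negPf a0) orbF => /orP[|/eqP//].
by move=> /eqP ck; move: kF; rewrite -cF ck ltxx.
Qed.

Lemma up_negb k : pairing (wt k) Y0 != 0 -> up (k.1, ~~ k.2) = ~~ up k.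
Proof.
move=> kY; rewrite /up -leNgt; case: k kY => i b /= kY; rewrite wt_negb pairingNl mulNr oppr_gt0.
by rewrite lt_neqAle mulf_neq0.
Qed.

Lemma wall_basis_coef p k0 kap Y l0 : ss K al be p -> on_wall p -> up k0 ->
  wbasis K kap Y -> Y l0 = (pairing (wt k0) Y0)^-1 *: Y0 ->
  (forall k, up k -> wcoef K Y k l0 = 1) /\
  (forall k, pairing (wt k) Y0 = 0 -> wcoef K Y k l0 = 0).
Proof.
move=> ssp wp uk0 hY YE.
have k0Y : pairing (wt k0) Y0 != 0 by apply: contraTneq uk0; rewrite /up => ->; rewrite mul0r ltxx.
split=> k kY; apply: (@intr_inj R); rewrite (wcoefK hK _ _ hY) YE pairingZr; last by rewrite kY mulr0.
rewrite (wall_pairing ssp wp (k := k) (k0 := k0)) ?mulVf //.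
by have := mulr_gt0 kY uk0; rewrite mulrACA pmulr_lgt0 // -expr2 exprn_even_gt0.
Qed.

Lemma wall_fibre q0 kap Y p p' : ss K al be q0 -> on_wall q0 -> wbasis K kap Y ->
  ss K al be p -> ss K al be p' -> near_wall q0 p ->
  cls K al be p = cls K al be p' ->
  exists2 h, forall l, h l != 0 & forall k, pairing (wt k) Y0 = 0 ->
     crd p' k = crd p k * mon K Y h k.
Proof.
move=> ssq wq hY ssp ssp' np E.
have pb : muC K p = be by case/ssP: ssp.
have pb' : muC K p' = be by case/ssP: ssp'.
have np' := cls_near_wall ssq ssp ssp' E np.
move: E => /(cls_eqP hK ssp ssp') /(corb_monE hK hY)[h [h0 hE]].
by exists h => // k kY; have := hE k; rewrite !(near_wall_limpt ssq wq).
Qed.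

(** Two points over the same point of the wall differ by some [h] in the coordinates on the wall.
    The parameter at [l0] is still free: it has exponent 0 there and exponent 1 in all coordinates
    of [up], so only a common scalar [c] has to be matched. *)
Lemma wall_fibre_corb q0 kap Y l0 p p' : ss K al be q0 -> on_wall q0 -> wbasis K kap Y ->
  (forall k, up k -> wcoef K Y k l0 = 1) ->
  (forall k, pairing (wt k) Y0 = 0 -> wcoef K Y k l0 = 0) ->
  ss K a be p -> ss K a be p' -> near_wall q0 p -> on_wall p ->
  cls K al be p = cls K al be p' ->
  (forall h, (forall l, h l != 0) ->
     (forall k, pairing (wt k) Y0 = 0 -> crd p' k = crd p k * mon K Y h k) ->
     exists2 c, c != 0 & forall k, up k -> crd p' k = crd p k * mon K Y h k * c) ->
  corb K p p'.
Proof.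
move=> ssq wq hY u1 u0 ssa ssa' np wp E H.
have [h h0 hE] := wall_fibre ssq wq hY (hsub ssa) (hsub ssa') np E.
have [c c0 cE] := H h h0 hE.
have wp' : on_wall p' by apply/cls_wall; [exact: hsub|rewrite -E; apply/cls_wall => //; exact: hsub].
apply/(corb_monE hK hY); exists (fun l => h l * (if l == l0 then c else 1)); split.
  by move=> l; rewrite mulf_neq0 //; case: ifP => _ //; exact: oner_neq0.
move=> k; rewrite monM.
have mE : mon K Y (fun l => if l == l0 then c else 1) k = c ^ wcoef K Y k l0.
  rewrite /mon (bigD1 l0) //= eqxx big1 ?mulr1 // => l /negPf ->; exact: exp1rz.
rewrite mE; have [kY|kY] := eqVneq (pairing (wt k) Y0) 0.
  by rewrite u0 // expr0z mulr1 hE.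
have [uk|uk] := boolP (up k); first by rewrite u1 // expr1z mulrA cE.
have z q : ss K a be q -> on_wall q -> crd q k = 0.
  move=> sq wq'; apply/eqP/negPn/negP => qk; move: uk; rewrite (on_wall_up sq) //.
by rewrite !z // mul0r.
Qed.

End Side.
End WallPoints.

(** * Slices *)

Section ComplexDifferentiable.
Variables (R : realType) (E : normedModType (Cx R)).
Implicit Types f g : E -> Cx R.

Definition cdiff f x := differentiable (f : E -> (Cx R)^o) x.

Lemma cdiff_eq f g x : f =1 g -> cdiff f x -> cdiff g x.
Proof. by move=> /funext ->. Qed.

Lemma cdiff_cst (c : Cx R) x : cdiff (fun=> c) x.
Proof. exact: differentiable_cst. Qed.

Lemma cdiff_add f g x : cdiff f x -> cdiff g x -> cdiff (fun t => f t + g t) x.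
Proof. exact: differentiableD. Qed.

Lemma cdiff_mul f g x : cdiff f x -> cdiff g x -> cdiff (fun t => f t * g t) x.
Proof. exact: differentiableM. Qed.

Lemma cdiff_opp f x : cdiff f x -> cdiff (fun t => - f t) x.
Proof. exact: differentiableN. Qed.

Lemma cdiff_inv f x : cdiff f x -> f x != 0 -> cdiff (fun t => (f t)^-1) x.
Proof. by move=> df f0; apply: (differentiable_comp df); exact: differentiable_Rinv. Qed.

Lemma cdiff_sum (I : Type) (r : seq I) (P : pred I) (f : I -> E -> Cx R) x :
  (forall i, P i -> cdiff (f i) x) -> cdiff (fun t => \sum_(i <- r | P i) f i t) x.
Proof.
move=> df; elim: r => [|i r IH].
  by apply: (cdiff_eq (f := fun=> 0)) => [t|]; [rewrite big_nil|exact: cdiff_cst].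
have [Pi|Pi] := boolP (P i).
  apply: (cdiff_eq (f := fun t => f i t + \sum_(j <- r | P j) f j t)) => [t|].
    by rewrite big_cons Pi.
  by apply: cdiff_add => //; exact: df.
by apply: cdiff_eq IH => t; rewrite big_cons (negPf Pi).
Qed.

Lemma cdiff_prod (I : Type) (r : seq I) (f : I -> E -> Cx R) x :
  (forall i, cdiff (f i) x) -> cdiff (fun t => \prod_(i <- r) f i t) x.
Proof.
move=> df; elim: r => [|i r IH].
  by apply: (cdiff_eq (f := fun=> 1)) => [t|]; [rewrite big_nil|exact: cdiff_cst].
apply: (cdiff_eq (f := fun t => f i t * \prod_(j <- r) f j t)) => [t|].
  by rewrite big_cons.
exact: cdiff_mul.
Qed.

Lemma cdiff_expz f (z : int) x : cdiff f x -> f x != 0 -> cdiff (fun t => f t ^ z) x.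
Proof.
move=> df f0.
have dn n : cdiff (fun t => f t ^+ n) x.
  elim: n => [|n IH]; first by apply: (cdiff_eq (f := fun=> 1)) => //; exact: cdiff_cst.
  by apply: (cdiff_eq (f := fun t => f t * f t ^+ n)) => [t|]; [rewrite exprS|exact: cdiff_mul].
case: z => n; first exact: dn.
by apply: cdiff_inv => //; rewrite expf_neq0.
Qed.

Lemma cdiff_continuous f x : cdiff f x -> {for x, continuous f}.
Proof. by move=> df; exact: (differentiable_continuous df). Qed.

Lemma cdiff_neq0 f x : cdiff f x -> f x != 0 -> nbhs x [set t | f t != 0].
Proof. by move=> /cdiff_continuous cf fx; exact: (open_neq0 cf fx). Qed.

Lemma cdiff_row n (f : E -> 'rV[Cx R]_n) x : (forall i, cdiff (fun t => f t 0 i) x) ->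
  differentiable f x.
Proof. by move=> df; apply: differentiable_mx => i j; rewrite (ord1 i); exact: df. Qed.

Lemma cdiff_mkp N (c : E -> sidx N -> Cx R) x : (forall k, cdiff (fun t => c t k) x) ->
  differentiable (fun t => mkp (c t) : HNn R N) x.
Proof.
move=> dc; apply: (@differentiable_pair _ _ _ _ (fun t => (mkp (c t)).1) (fun t => (mkp (c t)).2)).
  by apply: cdiff_row => i; apply: (cdiff_eq (f := fun t => c t (i, false))) => [t|//]; rewrite /mkp mxE.
by apply: cdiff_row => i; apply: (cdiff_eq (f := fun t => c t (i, true))) => [t|//]; rewrite /mkp mxE.
Qed.

End ComplexDifferentiable.

Lemma cdiff_crd (R : realType) N (p : HNn R N) k : cdiff (fun q : HNn R N => crd q k) p.
Proof.
pose f (q : HNn R N) : (Cx R)^o := crd q k.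
have lf : linear f.
  by move=> c u v; case: k @f => i [] f; rewrite /f /crd /= !mxE.
pose M := GRing.isLinear.Build _ _ _ _ f lf.
pose fL : {linear HNn R N -> (Cx R)^o} := HB.pack f M.
by apply: (@linear_differentiable _ _ _ fL); exact: crd_continuous.
Qed.

Lemma differentiable_fst (K : numFieldType) (U V : normedModType K) (x : U * V) :
  differentiable (fst : U * V -> U) x.
Proof.
have lf : linear (fst : U * V -> U) by [].
pose M := GRing.isLinear.Build _ _ _ _ _ lf.
pose fL : {linear (U * V)%type -> U} := HB.pack (fst : U * V -> U) M.
by apply: (@linear_differentiable _ _ _ fL) => y; exact: cvg_fst.
Qed.

Lemma differentiable_snd (K : numFieldType) (U V : normedModType K) (x : U * V) :
  differentiable (snd : U * V -> V) x.
Proof.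
have lf : linear (snd : U * V -> V) by [].
pose M := GRing.isLinear.Build _ _ _ _ _ lf.
pose fL : {linear (U * V)%type -> V} := HB.pack (snd : U * V -> V) M.
by apply: (@linear_differentiable _ _ _ fL) => y; exact: cvg_snd.
Qed.

Section Slices.
Variables (R : realType) (N d : nat) (K : subtorus R N d).
Hypothesis hK : unimodular_subtorus K.
Notation wt := (wt K).
Variables (kap : 'I_d -> sidx N) (Y : 'I_d -> 'rV[R]_d).
Hypothesis hY : wbasis K kap Y.
Notation mon := (mon K Y).
Variable L : {set 'I_d}.

(** Coordinates of the point in the [K_C]-orbit of [p] obtained by scaling the chosen basis
    coordinates to 1. *)
Definition nrm (p : HN R N) k := crd p k * mon (fun l => if l \in L then (crd p (kap l))^-1 else 1) k.

Definition chosen_neq0 (p : HN R N) := forall l, l \in L -> crd p (kap l) != 0.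

Lemma nrm_corb p : chosen_neq0 p -> corb K p (mkp (nrm p)).
Proof.
move=> p0; apply/(corb_monE hK hY).
exists (fun l => if l \in L then (crd p (kap l))^-1 else 1); split.
  by move=> l; case: ifP => [/p0|_]; rewrite ?invr_eq0 ?oner_neq0.
by move=> k; rewrite crd_mkp.
Qed.

Lemma nrm_kap p l : chosen_neq0 p -> l \in L -> nrm p (kap l) = 1.
Proof. by move=> p0 lL; rewrite /nrm (mon_kap hK hY) lL mulfV // p0. Qed.

Lemma nrm_mon p q h k : (forall l, h l != 0) -> (forall l, l \in L -> crd q (kap l) = crd p (kap l) * h l) ->
  crd q k = crd p k * mon h k ->
  nrm q k = nrm p k * mon (fun l => if l \in L then 1 else h l) k.
Proof.
move=> h0 hL hk; rewrite /nrm hk -[RHS]mulrA -[LHS]mulrA; apply: congr1.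
rewrite -[LHS]monM -[RHS]monM; apply: (congr1 (mon^~ k)); apply/funext => l; case: ifP => lL; last by rewrite mulr1 mul1r.
by rewrite hL // mulr1 invfM mulrCA mulfV ?mulr1.
Qed.

Lemma nrm_normalized p k : (forall l, l \in L -> crd p (kap l) = 1) -> nrm p k = crd p k.
Proof.
move=> p1; rewrite /nrm (_ : mon _ k = 1) ?mulr1 // -[RHS](mon1 K Y k).
by congr (mon _ k); apply/funext => l; case: ifP => // /p1 ->; rewrite invr1.
Qed.

Lemma cdiff_nrm (p : HNn R N) k : chosen_neq0 p -> cdiff (fun q : HNn R N => nrm q k) p.
Proof.
move=> p0; apply: cdiff_mul; first exact: cdiff_crd.
apply: cdiff_prod => l; have [lL|lL] := boolP (l \in L); last first.
  by apply: (cdiff_eq (f := fun=> 1)) => [t|]; [rewrite exp1rz|exact: cdiff_cst].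
apply: cdiff_expz; last by rewrite invr_eq0 p0.
by apply: cdiff_inv; [exact: cdiff_crd|exact: p0].
Qed.

Definition bidx i := [pick l in L | (kap l).1 == i].

Lemma kap1_inj l m : (kap l).1 = (kap m).1 -> l = m.
Proof.
move=> e; apply/eqP/negPn/negP => lm; have := hY.1 l m; rewrite (negPf lm).
have := hY.1 m m; rewrite eqxx; move: e; case: (kap l) (kap m) => i b [j b'] /= <-.
case: b b' => [] [] => [->|h|h|->] /eqP; rewrite ?oner_eq0 //.
  by rewrite -[true]/(~~ false) wt_negb pairingNl h oppr_eq0 oner_eq0.
by rewrite -[false]/(~~ true) wt_negb pairingNl h oppr_eq0 oner_eq0.
Qed.

Lemma bidx_kap l : l \in L -> bidx (kap l).1 = Some l.
Proof.
move=> lL; rewrite /bidx; case: pickP => [m /andP[_ /eqP/kap1_inj ->]//|/(_ l)].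
by rewrite lL eqxx.
Qed.

Lemma bidxP i l : bidx i = Some l -> l \in L /\ (kap l).1 = i.
Proof. by rewrite /bidx; case: pickP => // m /andP[mL /eqP mi] [<-]. Qed.

Definition kap_sgn l : R := if (kap l).2 then -1 else 1.

Lemma pairing_kap_sgn l m : pairing (wt ((kap l).1, false)) (Y m) = kap_sgn l * (l == m)%:R.
Proof.
rewrite -(hY.1 l m) /kap_sgn; case: (kap l) => i [] /=; last by rewrite mul1r.
by rewrite -[true]/(~~ false) wt_negb pairingNl mulrN mulNr opprK mul1r.
Qed.

Lemma pC_eqP (u v : 'rV[Cx R]_d) : (forall l, pC u (Y l) = pC v (Y l)) -> u = v.
Proof.
move=> h; apply/rowP => j; rewrite -!pC_delta (wbasis_dual (delta_mx 0 j) hY).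
by rewrite !pC_sumr; apply: eq_bigr => l _; rewrite !pC_scaler h.
Qed.

Variable be : 'rV[Cx R]_d.
Definition bval l : Cx R := pC be (Y l) / (- 2 * rC pi * 'i).

Lemma muC_basis p : muC K p = be <-> forall l,
  \sum_i crd p (i, false) * crd p (i, true) * rC (pairing (wt (i, false)) (Y l)) = bval l.
Proof.
have f0 := muC_factor_neq0 R; split => [h l|h].
  by rewrite /bval -h pC_muC mulrC mulKf.
by apply: pC_eqP => l; rewrite pC_muC h /bval mulrC divfK.
Qed.

Definition free_sum (c : sidx N -> Cx R) l :=
  \sum_(i | bidx i == None) c (i, false) * c (i, true) * rC (pairing (wt (i, false)) (Y l)).

(* extends given coordinates c to a normalized solution of the moment map equations *)
Definition fill (c : sidx N -> Cx R) k : Cx R :=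
  if bidx k.1 is Some l then
    if k == kap l then 1 else rC (kap_sgn l) * (bval l - free_sum c l)
  else c k.

Lemma fill_free c k : bidx k.1 = None -> fill c k = c k.
Proof. by rewrite /fill => ->. Qed.

Lemma fill_kap c l : l \in L -> fill c (kap l) = 1.
Proof. by move=> lL; rewrite /fill bidx_kap // eqxx. Qed.

Lemma eq_fill c c' k : (forall k, bidx k.1 = None -> c k = c' k) -> fill c k = fill c' k.
Proof.
move=> h; rewrite /fill; case E: (bidx k.1) => [l|]; last exact: h.
case: ifP => // _; congr (_ * (_ - _)); apply: eq_bigr => i /eqP bi.
by rewrite !h.
Qed.

Lemma fill_prod c i l : bidx i = Some l ->
  fill c (i, false) * fill c (i, true) = rC (kap_sgn l) * (bval l - free_sum c l).
Proof.
move=> bi; have [lL ki] := bidxP bi; rewrite /fill /= bi -ki.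
case: (kap l) => j [] /=; rewrite !xpair_eqE eqxx /=; first by rewrite mulr1.
by rewrite mul1r.
Qed.

Lemma sum_bidx (F : 'I_N -> Cx R) : \sum_i F i =
  \sum_(l in L) F (kap l).1 + \sum_(i | bidx i == None) F i.
Proof.
rewrite (bigID (fun i => bidx i == None)) /= addrC; congr (_ + _).
transitivity (\sum_(i | bidx i != None) \sum_(l in L | bidx i == Some l) F i).
  apply: eq_bigr => i; case E: (bidx i) => [l|] // _; have [lL _] := bidxP E.
  rewrite (big_pred1 l) // => m; rewrite /= (inj_eq Some_inj) eq_sym.
  by case: eqVneq => [->|]; rewrite ?lL ?andbF.
rewrite (exchange_big_dep (mem L)) //=; last by move=> i l _ /andP[].
apply: eq_bigr => l lL; rewrite (big_pred1 (kap l).1) // => i /=; rewrite lL /=.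
apply/andP/eqP => [[_ /eqP/bidxP[_ <-]//]|->]; by rewrite bidx_kap.
Qed.

(** Paired with [Y l] for [l] in [L], the equation contains a single product at a chosen index,
    namely the partner of [kap l] times 1, and is solved for that partner. For the other [l] no
    chosen index occurs and the equation constrains the free coordinates alone. *)
Lemma muC_fill c : (forall l, l \notin L -> free_sum c l = bval l) -> muC K (mkp (fill c)) = be.
Proof.
move=> h; apply/muC_basis => l; rewrite sum_bidx.
have -> : \sum_(i | bidx i == None) crd (mkp (fill c)) (i, false) *
   crd (mkp (fill c)) (i, true) * rC (pairing (wt (i, false)) (Y l)) = free_sum c l.
  by apply: eq_bigr => i /eqP bi; rewrite !crd_mkp !fill_free.
have E m : m \in L -> crd (mkp (fill c)) ((kap m).1, false) *
   crd (mkp (fill c)) ((kap m).1, true) * rC (pairing (wt ((kap m).1, false)) (Y l)) =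
   if m == l then bval l - free_sum c l else 0.
  move=> mL; rewrite !crd_mkp (fill_prod _ (bidx_kap mL)) pairing_kap_sgn.
  case: eqVneq => [->|_]; last by rewrite mulr0 rC0 mulr0.
  rewrite mulr1 mulrAC -rCM (_ : kap_sgn l * _ = 1) ?rC1 ?mul1r //.
  by rewrite /kap_sgn; case: ifP => _; rewrite ?mulrNN mulr1.
rewrite (eq_bigr _ E) -big_mkcondr /=.
have [lL|lL] := boolP (l \in L).
  rewrite (big_pred1 l) ?subrK // => m /=; case: eqVneq => [->|]; rewrite ?lL ?andbF //.
by rewrite big1 ?add0r ?h // => m /andP[mL /eqP ml]; move: lL; rewrite -ml mL.
Qed.

Lemma fill_crd p k : muC K p = be -> (forall l, l \in L -> crd p (kap l) = 1) ->
  fill (crd p) k = crd p k.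
Proof.
move=> /muC_basis pb p1; rewrite /fill; case E: (bidx k.1) => [l|//].
have [lL kl] := bidxP E; case: eqP => [->|kk]; first by rewrite p1.
have := pb l; rewrite sum_bidx (bigD1 l) //= big1 ?addr0 => [h|m /andP[mL ml]]; last first.
  by rewrite pairing_kap_sgn (negPf ml) mulr0 rC0 mulr0.
have -> : bval l - free_sum (crd p) l =
    crd p ((kap l).1, false) * crd p ((kap l).1, true) * rC (kap_sgn l).
  by rewrite -h pairing_kap_sgn eqxx mulr1 addrK.
rewrite mulrCA -rCM (_ : kap_sgn l * _ = 1) ?rC1 ?mulr1; last first.
  by rewrite /kap_sgn; case: ifP => _; rewrite ?mulrNN mulr1.
have := p1 l lL; case: k kl kk {E} => i b /=; case: (kap l) => j b' /= <-.
by case: b b' => [] [] kk; rewrite ?(mulr1, mul1r) // => -> ; rewrite ?(mulr1, mul1r).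
Qed.

Lemma cdiff_fill (E : normedModType (Cx R)) (c : E -> sidx N -> Cx R) x k :
  (forall k, cdiff (fun t => c t k) x) -> cdiff (fun t => fill (c t) k) x.
Proof.
move=> dc; rewrite /fill; case: (bidx k.1) => [l|]; last exact: dc.
case: (k == kap l); first exact: cdiff_cst.
apply: cdiff_mul; first exact: cdiff_cst.
apply: cdiff_add; first exact: cdiff_cst.
apply: cdiff_opp; apply: cdiff_sum => i _; apply: cdiff_mul; last exact: cdiff_cst.
by apply: cdiff_mul; exact: dc.
Qed.

Section FreeCoordinates.
Variables (n : nat) (fl : 'I_n -> sidx N).
Hypotheses (fl_inj : injective fl) (fl_free : forall i, bidx (fl i).1 = None).

Definition spread (w : 'rV[Cx R]_n) k : Cx R := \sum_(i | fl i == k) w 0 i.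

Lemma spread_fl w i : spread w (fl i) = w 0 i.
Proof. by rewrite /spread (big_pred1 i) // => j /=; rewrite (inj_eq fl_inj). Qed.

Lemma spread_out w k : (forall i, fl i != k) -> spread w k = 0.
Proof. by move=> h; rewrite /spread big1 // => i /eqP ik; have := h i; rewrite ik eqxx. Qed.

Lemma cdiff_spread (w : 'rV[Cx R]_n) k : cdiff (fun w => spread w k) w.
Proof. by apply: cdiff_sum => i _; exact: differentiable_coord. Qed.

Definition slice (p : HN R N) : 'rV[Cx R]_n := \row_i nrm p (fl i).
Definition section (w : 'rV[Cx R]_n) : HN R N := mkp (fill (spread w)).

Lemma slice_diff (p : HNn R N) : chosen_neq0 p ->
  differentiable (slice : HNn R N -> 'rV[Cx R]_n) p.
Proof.
move=> p0; apply: cdiff_row => i; apply: (cdiff_eq (f := fun q => nrm q (fl i))) => [t|].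
  by rewrite mxE.
exact: cdiff_nrm.
Qed.

Lemma section_diff (w : 'rV[Cx R]_n) : differentiable (section : 'rV[Cx R]_n -> HNn R N) w.
Proof. by apply: cdiff_mkp => k; apply: cdiff_fill => k'; exact: cdiff_spread. Qed.

Lemma section_kap w l : l \in L -> crd (section w) (kap l) = 1.
Proof. by move=> lL; rewrite crd_mkp fill_kap. Qed.

Lemma section_fl w i : crd (section w) (fl i) = w 0 i.
Proof. by rewrite crd_mkp fill_free // spread_fl. Qed.

Lemma slice_section w : slice (section w) = w.
Proof.
apply/rowP => i; rewrite mxE nrm_normalized ?section_fl // => l lL.
exact: section_kap.
Qed.

Lemma section_slice p : muC K p = be -> chosen_neq0 p ->
  (forall k, bidx k.1 = None -> (forall i, fl i != k) -> crd p k = 0) ->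
  section (slice p) = mkp (nrm p) /\ corb K p (section (slice p)).
Proof.
move=> pb p0 pz; have pn := nrm_corb p0.
suff E : section (slice p) = mkp (nrm p) by rewrite E.
apply: crd_inj => k; rewrite crd_mkp crd_mkp.
rewrite (eq_fill (c' := crd (mkp (nrm p)))) => [|k' bk].
  rewrite fill_crd ?crd_mkp // => [|l lL]; last by rewrite crd_mkp nrm_kap.
  by have [_ [_ _ -> _]] := corb_real pn.
rewrite crd_mkp; have [[i <-]|h] := pselect (exists i, fl i = k').
  by rewrite spread_fl mxE.
have h' i : fl i != k' by apply/eqP => e; apply: h; exists i.
by rewrite spread_out // /nrm pz // mul0r.
Qed.

End FreeCoordinates.
End Slices.

(** * Charts of projective space *)

Section ProjectiveCharts.
Variables (R : realType) (n : nat).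

Lemma lineZ (c : Cx R) (v : 'rV[Cx R]_n.+1) : c != 0 -> line (c *: v) = line v.
Proof.
move=> c0; apply/seteqP; split => _ [e e0 <-].
  by exists (e * c); rewrite ?scalerA //= mulf_neq0.
exists (e / c); last by rewrite scalerA divfK.
by rewrite /= mulf_neq0 // invr_eq0.
Qed.

Lemma line_eqP (v w : 'rV[Cx R]_n.+1) : line v = line w <-> exists2 c, c != 0 & w = c *: v.
Proof.
split=> [E|[c c0 ->]]; last by rewrite lineZ.
have : line w w by exists 1; rewrite /= ?oner_neq0 ?scale1r.
by rewrite -E => -[c c0 <-]; exists c.
Qed.

Definition affine_slice (j : 'I_n.+1) (v : 'rV[Cx R]_n.+1) : 'rV[Cx R]_n :=
  \row_i (v 0 (lift j i) / v 0 j).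
Definition affine_section (j : 'I_n.+1) (w : 'rV[Cx R]_n) : 'rV[Cx R]_n.+1 :=
  \row_i if unlift j i is Some t then w 0 t else 1.

Lemma affine_section1 j w : affine_section j w 0 j = 1.
Proof. by rewrite mxE unlift_none. Qed.

Lemma affine_section_neq0 j w : affine_section j w != 0.
Proof.
apply: contraNneq (oner_neq0 (Cx R)) => h.
by rewrite -(affine_section1 j w) h mxE.
Qed.

Lemma affine_slice_section j w : affine_slice j (affine_section j w) = w.
Proof. by apply/rowP => i; rewrite mxE affine_section1 divr1 mxE liftK. Qed.

Lemma affine_section_slice j (v : 'rV[Cx R]_n.+1) : v 0 j != 0 ->
  affine_section j (affine_slice j v) = (v 0 j)^-1 *: v.
Proof.
move=> vj; apply/rowP => i; rewrite mxE [RHS]mxE; case: unliftP => [t ->|->].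
  by rewrite mxE mulrC.
by rewrite mulVf.
Qed.

Lemma affine_section_diff j w : differentiable (affine_section j : 'rV[Cx R]_n -> 'rV[Cx R]_n.+1) w.
Proof.
apply: cdiff_row => i; case E: (unlift j i) => [t|].
  apply: (cdiff_eq (f := fun w : 'rV[Cx R]_n => w 0 t)) => [u|]; first by rewrite mxE E.
  exact: differentiable_coord.
apply: (cdiff_eq (f := fun=> 1)) => [u|]; first by rewrite mxE E.
exact: cdiff_cst.
Qed.

Lemma projective_chart y : pts (CP R n) y -> exists U phi j,
  [/\ chart (CP R n) U (setT : set 'rV[Cx R]_n) phi, U y &
    forall z, U z -> z = line (affine_section j (phi z))].
Proof.
move=> [v v0 <-]; have [j vj] : exists j, v 0 j != 0.
  apply: contrapT => /forallNP h; move/eqP: v0; apply; apply/rowP => j.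
  by rewrite mxE; apply/eqP/negPn/negP/h.
pose U := @line R n @` [set w : 'rV[Cx R]_n.+1 | w 0 j != 0].
have UP (w : 'rV[Cx R]_n.+1) : w != 0 -> U (line w) -> w 0 j != 0.
  by move=> w0 [u uj /line_eqP[c c0 ->]]; rewrite mxE mulf_neq0.
have jn (w : 'rV[Cx R]_n.+1) : w 0 j != 0 -> w != 0.
  by apply: contraNneq => ->; rewrite mxE.
have oj : open [set w : 'rV[Cx R]_n.+1 | w 0 j != 0].
  have h (w : 'rV[Cx R]_n.+1) : w 0 j != 0 -> nbhs w [set u : 'rV[Cx R]_n.+1 | u 0 j != 0].
    by move=> wj; apply: (open_neq0 (f := fun u : 'rV[Cx R]_n.+1 => u 0 j)) => //; exact: coord_continuous.
  by rewrite openE => w wj; exact: h.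
have oU : opn (CP R n) U.
  apply/quot_opnP; split; first by move=> _ [w wj <-]; exists w => //; exact: jn.
  move=> w w0 /(UP w w0) wj.
  have h : nbhs w [set w : 'rV[Cx R]_n.+1 | w 0 j != 0] by apply: open_nbhs_nbhs.
  by apply: filterS h => u uj _; exists u.
have [|||||phi [phiB phiE]] := @slice_chart R _ [set v : 'rV[Cx R]_n.+1 | v != 0] _ (@line R n)
   setT U n (affine_slice j) (affine_section j) setT oU openT.
- move=> w w0 /(UP w w0) wj; exists [set w : 'rV[Cx R]_n.+1 | w 0 j != 0]; split => // u uj.
  apply: cdiff_row => i; apply: (cdiff_eq (f := fun w : 'rV[Cx R]_n.+1 => w 0 (lift j i) * (w 0 j)^-1)) => [t|].
    by rewrite mxE.
  apply: cdiff_mul; first exact: differentiable_coord.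
  by apply: cdiff_inv => //; exact: differentiable_coord.
- move=> w u w0 u0 /(UP w w0) wj /line_eqP[c c0 ->]; apply/rowP => i.
  by rewrite !mxE invfM mulrACA mulfV // mul1r.
- by move=> w _; exact: affine_section_diff.
- move=> w _; split => //; first exact: affine_section_neq0.
    by exists (affine_section j w) => //=; rewrite affine_section1 oner_neq0.
  exact: affine_slice_section.
- move=> w w0 /(UP w w0) wj _; split => //.
  by rewrite affine_section_slice // lineZ // invr_eq0.
exists U, phi, j; split.
- by split => //; [exact: openT|rewrite -[U]setTI].
- by exists v.
- move=> _ [w wj <-]; rewrite phiE //; last by exists w.
    by rewrite affine_section_slice // lineZ // invr_eq0.
  exact: jn.
Qed.

End ProjectiveCharts.

(** * Crossing the wall *)

Section WallCrossing.
Variables (R : realType) (N d : nat) (K : subtorus R N d).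
Hypothesis hK : unimodular_subtorus K.
Notation wt := (wt K).
Variables (be : 'rV[Cx R]_d) (H0 : set 'rV[Cx R]_N).
Hypothesis hH0 : Swalls K be H0.
Variable Y0 : 'rV[R]_d.
Hypotheses (hY0 : lie_of K H0 Y0) (hY0n : Y0 != 0).
Variable al : 'rV[R]_d.
Hypothesis hals : forall H, Swalls K be H -> H <> H0 -> ~ wall K H al.
Variable a : 'rV[R]_d.
Hypotheses (a0 : pairing a Y0 != 0) (al0 : pairing al Y0 = 0).
Hypothesis hsub : forall p, ss K a be p -> ss K al be p.
Hypothesis hgen : forall p, ss K a be p -> limpt K a p = p.
Hypothesis hwall : forall p, ss K al be p -> on_wall K Y0 al p ->
  ss K a be p <-> exists2 k, supp p k & 0 < pairing (wt k) Y0 * pairing a Y0.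
Hypothesis hint : forall p, ss K al be p ->
  (forall y, (forall k, k \in face K al p -> pairing (wt k) y = 0) -> y = 0) -> ss K a be p.

Let Z0 := level K al be `&` fixed_by H0.
Let V0 := korb K @` Z0.
Let X := Xspace K al be.
Let Xa := Xspace K a be.
Let f := natural_map K al be.
Let Va := pts Xa `&` f @^-1` V0.
Notation on_wall := (on_wall K Y0 al).
Notation near_wall := (near_wall K al).
Notation up := (up K Y0 a).
Notation cls := (cls K).

Lemma ss_muC b p : ss K b be p -> muC K p = be.
Proof. by case/ssP. Qed.

Lemma natural_map_cls b c p : ss K b be p -> ss K c be p -> limpt K b p = p ->
  natural_map K c be (cls b be p) = cls c be p.
Proof.
move=> sb sc lb; have h q : cls b be p q -> cls c be q = cls c be p.
  move=> /(cls_mem hK sb); rewrite lb => -[pq _ _ _].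
  by rewrite (cls_corb hK sc pq).
apply/seteqP; split => [x [q /h ->]//|x xp].
by have [q pq] := cls_nonempty hK sb; exists q => //; rewrite h.
Qed.

Lemma cls_side p q : ss K a be p -> ss K a be q ->
  cls a be p = cls a be q <-> corb K p q.
Proof. by move=> sp sq; rewrite -{2}(hgen sp) -{2}(hgen sq); exact: cls_eqP. Qed.

Lemma f_cls p : ss K a be p -> f (cls a be p) = cls al be p.
Proof. by move=> sp; apply: natural_map_cls => //; [exact: hsub|exact: hgen]. Qed.

Lemma V0_cls p : ss K al be p -> V0 (cls al be p) <-> on_wall p.
Proof. exact: cls_wall. Qed.

Lemma V0P x : V0 x -> exists p, [/\ ss K al be p, on_wall p & x = cls al be p].
Proof.
move=> [z [lz fz] <-]; have [ssz _ _] := level_face lz; exists z.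
rewrite (level_cls hK lz); split => //; apply/V0_cls => //.
by rewrite (level_cls hK lz); exists z.
Qed.

Lemma VaP x : Va x <-> exists p, [/\ ss K a be p, on_wall p & x = cls a be p].
Proof.
split=> [[[p sp <-] h]|[p [sp wp ->]]].
  by exists p; split => //; apply/V0_cls; [exact: hsub|rewrite -f_cls].
by split; [exists p|rewrite /= f_cls //; apply/V0_cls => //; exact: hsub].
Qed.

Lemma natural_hol_map : hol_map Xa X f.
Proof.
apply: (hol_lift (E1 := HNn R N) (E2 := HNn R N)) => p sp; exists setT, id.
split => //; first exact: openT.
by move=> q _ sq; split; [exact: hsub|exact: f_cls].
Qed.

(** Off the wall the face at [al] spans. Then the separating functional is 0, so [p] already
    represents a closed orbit. *)
Lemma off_wall_ss p : ss K al be p -> ~ on_wall p -> ss K a be p /\ limpt K al p = p.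
Proof.
move=> sp wp; have [h|[]//] := wall_dichotomy hH0 hY0 hY0n hals sp.
split; first exact: hint.
apply: crd_inj => k; rewrite crd_restr; case: ifPn => // kF.
have /ssP[_ Cp] := sp; have [y [yF yP _]] := min_face_sep Cp.
apply/esym/eqP/negPn/negP => pk; have := yP k pk kF.
by rewrite (h y yF) pairing0r ltxx.
Qed.

Lemma off_wall_opn : opn X (pts X `\` V0).
Proof.
apply/quot_opnP; split; first by move=> x [].
move=> p sp [_ Vp]; have wp : ~ on_wall p by move=> /(V0_cls sp).
have h : nbhs (p : HNn R N) [set q | near_wall p q].
  apply: open_nbhs_nbhs; split; first exact: near_wall_open.
  by move=> k; exact: face_supp.
apply: filterS h => q nq sq; split; first by exists q.
move=> /(V0_cls sq) wq; apply: wp => k kF; apply: wq.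
exact: (near_wall_face sp (ss_muC sq) nq).
Qed.

(** Away from the wall both semi-stability conditions and both orbit relations agree, so the
    identity of [H^N] lifts both the map and its inverse. *)
Lemma natural_biholomorphic : biholomorphic (sub_space Xa (pts Xa `\` Va))
  (sub_space X (pts X `\` V0)) f.
Proof.
have sX : sheafy X by exact: quot_sheafy.
split.
  apply: hol_map_sub natural_hol_map _ => _ [p sp <-] [_ nV].
  rewrite f_cls //; split; first by exists p => //; exact: hsub.
  move=> h; apply: nV; apply/VaP; exists p; split => //.
  by apply/V0_cls => //; exact: hsub.
have gE p : ss K al be p -> ~ on_wall p -> natural_map K a be (cls al be p) = cls a be p.
  by move=> sp wp; have [sa lp] := off_wall_ss sp wp; exact: natural_map_cls.
exists (natural_map K a be); split.
- apply: hol_map_subr; first exact: sub_sheafy.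
    apply: quot_sub_hol_map; first exact: off_wall_opn.
    apply: (hol_lift (E1 := HNn R N) (E2 := HNn R N)) => p _; exists setT, id.
    split => //; first exact: openT.
    move=> q _ [sq [_ Vq]]; have wq : ~ on_wall q by move=> /(V0_cls sq).
    by rewrite gE //; have [] := off_wall_ss sq wq.
  move=> _ [[p sp <-] [_ Vp]]; have wp : ~ on_wall p by move=> /(V0_cls sp).
  have [sa _] := off_wall_ss sp wp; rewrite gE //; split; first by exists p.
  by move=> [_]; rewrite /= f_cls.
- move=> _ [[p sp <-] [_ nV]]; rewrite f_cls // gE //; first exact: hsub.
  by move=> wp; apply: nV; apply/VaP; exists p.
- move=> _ [[p sp <-] [_ Vp]]; have wp : ~ on_wall p by move=> /(V0_cls sp).
  have [sa _] := off_wall_ss sp wp; by rewrite gE // f_cls.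
Qed.

Variable J0 : {set 'I_N}.
Hypothesis hJ0 : J0 = [set i | k_incl K Y0 0 i != 0]%SET.

Lemma in_J0 i b : (pairing (wt (i, b)) Y0 != 0) = (i \in J0).
Proof. by rewrite hJ0 inE pairing_wt /=; case: b => //; rewrite oppr_eq0. Qed.

(** For [i] in [J0], [upper i] and [lower i] name the weight among the two opposite ones that lies
    on the side of [a], and the other one. *)
Definition upper i : sidx N := (i, ~~ up (i, false)).
Definition lower i : sidx N := (i, up (i, false)).

Lemma up_negJ i b : i \in J0 -> up (i, ~~ b) = ~~ up (i, b).
Proof. by move=> iJ; apply: (up_negb a0 (k := (i, b))); rewrite in_J0. Qed.

Lemma up_upper i : i \in J0 -> up (upper i).
Proof.
move=> iJ; rewrite /upper; case E: (up (i, false)) => //=.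
by rewrite -[true]/(~~ false) up_negJ // E.
Qed.

Lemma up_in k : up k -> k.1 \in J0 /\ k = upper k.1.
Proof.
case: k => i b uk; have iJ : i \in J0.
  by rewrite -(in_J0 i b); apply: contraTneq uk => h; rewrite /up h mul0r ltxx.
split => //=; rewrite /upper; case: b uk => uk; last by rewrite uk.
by have := up_negJ true iJ; rewrite uk => ->.
Qed.

Lemma not_up_in k : k.1 \in J0 -> ~~ up k -> k = lower k.1.
Proof.
case: k => i b /= iJ uk; rewrite /lower; case: b uk => uk; last by rewrite (negPf uk).
by have := up_negJ true iJ; rewrite uk => ->.
Qed.

Lemma up_lower i : i \in J0 -> ~~ up (lower i).
Proof.
move=> iJ; rewrite /lower; case E: (up (i, false)); last by rewrite E.
by rewrite -[true]/(~~ false) up_negJ // E.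
Qed.

Lemma J0_neq0 : exists i, i \in J0.
Proof.
apply: contrapT => /forallNP h; move: hY0n; rewrite (wt_sep (K := K) (y := Y0)) ?eqxx // => -[i b].
by apply/eqP/negPn/negP; rewrite in_J0 => /h.
Qed.

Lemma open_near_wall q : open ([set p | near_wall q p] : set (HNn R N)).
Proof. exact: near_wall_open. Qed.

(** Since [be] annihilates [Y0], pairing [muC] with [Y0] gives one linear relation between the
    products at the indices of [J0]. Hence all [#J0] lower coordinates vanish as soon as [#J0 - 1]
    of them do: this is the codimension. *)
Lemma lower_eq0 p i0 : muC K p = be -> i0 \in J0 ->
  (forall i, i \in J0 -> i != i0 -> crd p (lower i) = 0) -> crd p (upper i0) != 0 ->
  crd p (lower i0) = 0.
Proof.
move=> pb iJ h pu; have := pC_be0 hH0 hY0 hY0n; rewrite -pb pC_muC => /eqP.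
rewrite mulf_eq0 (negPf (muC_factor_neq0 R)) /= (bigD1 i0) //= big1 ?addr0 => [|i ii0].
  rewrite mulf_eq0 rC_eq0 (negPf (_ : pairing (wt (i0, false)) Y0 != 0)) ?in_J0 // orbF.
  rewrite mulf_eq0; move: pu; rewrite /upper /lower; case: (up (i0, false)) => /= pu;
    by rewrite (negPf pu) ?orbF /= => /eqP.
have [iJ'|iJ'] := boolP (i \in J0); last first.
  by have := in_J0 i false; rewrite (negPf iJ') => /negbFE/eqP ->; rewrite rC0 mulr0.
have := h i iJ' ii0; rewrite /lower; case: (up (i, false)) => ->; by rewrite ?mulr0 ?mul0r.
Qed.

(** * The codimension of the locus over the wall *)

Section Codim.
Notation LT := [set: 'I_d]%SET.
Variables (p0 : HN R N) (kap : 'I_d -> sidx N) (Y : 'I_d -> 'rV[R]_d) (l0 : 'I_d) (i0 : 'I_N).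
Hypotheses (sp0 : ss K a be p0) (wp0 : on_wall p0).
Hypotheses (hY : wbasis K kap Y) (iJ0 : i0 \in J0) (kE : kap l0 = upper i0).
Hypotheses (p0u : crd p0 (upper i0) != 0).
Hypothesis kF : forall l, l != l0 -> kap l \in face K al p0.

(** The lower coordinates cutting out [Va]. The one at [i0] is absent: it is the partner of the
    normalised coordinate [upper i0] and is determined by [muC]. *)
Let ys := [set k : sidx N | k.1 \in J0 & (k.1 != i0) && ~~ up k]%SET.
Let zs := [set k : sidx N | (bidx kap LT k.1 == None) && (k \notin ys)]%SET.

Let cE : #|J0|.-1 = #|J0 :\ i0|%SET.
Proof. by rewrite (cardsD1 i0 J0) iJ0. Qed.

Let yl (j : 'I_(#|J0|.-1)) : sidx N := lower (enum_val (cast_ord cE j)).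
Let fl (i : 'I_(#|J0|.-1 + #|zs|)) : sidx N :=
  match fintype.split i with inl j => yl j | inr j => enum_val j end.

Let yl_in j : yl j \in ys.
Proof.
have := enum_valP (cast_ord cE j); rewrite !inE => /andP[ij iJ].
by rewrite /yl /= iJ ij up_lower.
Qed.

Let ysE k : k \in ys -> exists j, k = yl j.
Proof.
rewrite inE => /and3P[kJ k0 uk].
have h : k.1 \in (J0 :\ i0)%SET by rewrite !inE k0.
exists (cast_ord (esym cE) (enum_rank_in h k.1)).
by rewrite /yl cast_ordKV enum_rankK_in // -not_up_in.
Qed.

Let fl_inj : injective fl.
Proof.
move=> i j; rewrite /fl -{2}(splitK i) -{2}(splitK j).
case: (fintype.split i) (fintype.split j) => u [] v h /=.
- congr (lshift _ _); apply: (@cast_ord_inj _ _ cE); apply: enum_val_inj.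
  by move: h => /(congr1 fst).
- by have := enum_valP v; rewrite -h !inE => /andP[_]; rewrite -(in_setE) ; have := yl_in u; rewrite !inE => ->.
- by have := enum_valP u; rewrite h !inE => /andP[_]; have := yl_in v; rewrite !inE => ->.
- by rewrite (enum_val_inj h).
Qed.

Let ys_free k : k \in ys -> bidx kap LT k.1 = None.
Proof.
rewrite inE => /and3P[kJ k0 uk]; case E: (bidx _ _ _) => [l|//].
have [_ kl] := bidxP E; have [ll|ll] := eqVneq l l0.
  by move: k0; rewrite -kl ll kE eqxx.
have /wp0 h := kF ll; move: kJ; rewrite -kl -(in_J0 _ (kap l).2) -surjective_pairing.
by rewrite h eqxx.
Qed.

Let fl_free i : bidx kap LT (fl i).1 = None.
Proof.
rewrite /fl; case: (fintype.split i) => j; first exact/ys_free/yl_in.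
by have := enum_valP j; rewrite inE => /andP[/eqP].
Qed.

Let fl_onto (k : sidx N) : bidx kap LT k.1 = None -> exists i, fl i = k.
Proof.
move=> bk; have [/ysE[j ->]|kys] := boolP (k \in ys).
  by exists (lshift _ j); rewrite /fl -[lshift _ _]/(unsplit (inl _)) unsplitK.
have h : k \in zs by rewrite inE bk eqxx.
exists (rshift _ (enum_rank_in h k)).
by rewrite /fl -[rshift _ _]/(unsplit (inr _)) unsplitK enum_rankK_in.
Qed.

Let W := cls a be @` [set q | [/\ ss K a be q, near_wall p0 q & crd q (upper i0) != 0]].
Let ok q := near_wall p0 q /\ crd q (upper i0) != 0.

Let ok_open : open ([set q | ok q] : set (HNn R N)).
Proof.
apply: openI; first exact: open_near_wall.
have h (p : HNn R N) : crd p (upper i0) != 0 -> \forall q \near p, crd q (upper i0) != 0.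
  by move=> pk; apply: open_neq0 => //; exact: crd_continuous.
by rewrite openE => p pk; exact: h.
Qed.

Let ok_corb q q' : corb K q q' -> ok q -> ok q'.
Proof.
move=> /corb_real[_ [_ _ _ sE]] [nq uq].
by split => [k kF'|]; rewrite -/(supp q' _) sE //; exact: nq.
Qed.

Let WP q : ss K a be q -> W (cls a be q) -> ok q.
Proof.
move=> sq [q' [sq' nq' uq'] /(cls_side sq' sq) qq'].
exact: ok_corb qq' (conj nq' uq').
Qed.

Let W_opn : opn Xa W.
Proof.
apply/quot_opnP; split; first by move=> _ [q [sq _ _] <-]; exists q.
move=> q sq /(WP sq) oq.
have h : nbhs (q : HNn R N) [set q | ok q] by apply: open_nbhs_nbhs; split.
by apply: filterS h => q' [nq' uq'] sq'; exists q'.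
Qed.

Let ok_chosen q : ok q -> chosen_neq0 kap LT q.
Proof.
move=> [nq uq] l _; have [->|ll] := eqVneq l l0; first by rewrite kE.
exact/nq/kF.
Qed.

Let sl := slice K kap Y LT fl.
Let se := section K kap Y LT be fl.

Let se_muC w : muC K (se w) = be.
Proof. by apply: muC_fill => // l; rewrite inE. Qed.

Let se_ss w : near_wall p0 (se w) -> ss K a be (se w) /\ ok (se w).
Proof.
move=> nw; have uw : crd (se w) (upper i0) != 0 by rewrite -kE section_kap ?oner_neq0 ?inE.
split => //; have sw : ss K al be (se w) by apply: (near_wall_ss (hsub sp0)) nw; exact: se_muC.
have [ww|ww] := pselect (on_wall (se w)); last by have [] := off_wall_ss sw ww.
by apply/(hwall sw ww); exists (upper i0) => //; exact: up_upper.
Qed.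

(** All [d] basis coordinates are scaled to 1, [upper i0] among them, so no moment map equation is
    left over and every free coordinate is independent. A point lies over the wall iff its lower
    coordinates vanish, and the first block of the chart consists of these. *)
Lemma codim_chart : exists (Om : set 'rV[Cx R]_(#|J0|.-1 + #|zs|)) phi,
  [/\ chart Xa W Om phi, W (cls a be p0) &
    forall y, W y -> (Va y <-> lsubmx (phi y) = 0)].
Proof.
have okp0 : ok p0 by split => // k; exact: face_supp.
pose Om := [set w | near_wall p0 (se w)].
have oOm : open Om.
  rewrite (_ : Om = setT `&` (fun w => se w : HNn R N) @^-1` [set q | near_wall p0 q]); last by rewrite setTI.
  apply: open_preimage_at; [exact: openT| |exact: open_near_wall].
  by move=> w _; apply: differentiable_continuous; exact: section_diff.
have slE q : ss K a be q -> ok q -> corb K q (se (sl q)).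
  move=> sq oq; have [] // := section_slice hK hY (be := be) fl_inj (ss_muC sq) (ok_chosen oq).
  by move=> k bk h; have [i ik] := fl_onto bk; have := h i; rewrite ik eqxx.
have [|||||phi [phiB phiE]] := @slice_chart R (HNn R N) (ss K a be) _ (cls a be) setT W _
    (sl : HNn R N -> _) (se : _ -> HNn R N) Om W_opn oOm.
- move=> q sq /(WP sq) oq; exists [set q | ok q]; split => // q' oq'.
  exact/slice_diff/ok_chosen.
- move=> q q' sq sq' /(WP sq) oq /(cls_side sq sq') /(corb_monE hK hY)[h [h0 hE]].
  have hL l : l \in LT -> crd q' (kap l) = crd q (kap l) * h l.
    by move=> _; rewrite hE (mon_kap hK hY).
  have m1 k : mon K Y (fun l => if l \in LT then 1 else h l) k = 1.
    rewrite (_ : (fun l => _) = fun=> 1); first exact: mon1.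
    by apply/funext => l; rewrite inE.
  apply/rowP => i; rewrite [LHS]mxE [RHS]mxE.
  by have := nrm_mon h0 hL (hE (fl i)); rewrite m1 mulr1 => ->.
- by move=> w _; exact: section_diff.
- move=> w nw; have [sw [n' uw]] := se_ss nw; split => //; first by exists (se w).
  exact: slice_section.
- move=> q sq /(WP sq) oq _; have qs := slE q sq oq; split.
    by have [] := ok_corb qs oq.
  by apply/esym/cls_corb.
exists Om, phi; split.
- by split => //; rewrite -[W]setTI.
- by exists p0; first by case: okp0.
- move=> _ [q [sq nq uq] <-]; rewrite phiE //; last by exists q.
  have oq : ok q by [].
  have -> : Va (cls a be q) <-> on_wall q.
    split=> [|wq]; last by apply/VaP; exists q.
    by move=> [_]; rewrite /= f_cls // => /(V0_cls (hsub sq)).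
  have ylE j : (lsubmx (sl q) 0 j == 0) = (crd q (yl j) == 0).
    rewrite !mxE /nrm mulf_eq0 [X in _ || X]negbTE ?orbF.
      by rewrite /fl -[lshift _ _]/(unsplit (inl _)) unsplitK.
    apply: mon_neq0 => l; rewrite inE invr_eq0; exact: ok_chosen.
  split=> [wq|h].
    apply/rowP => j; rewrite [RHS]mxE; apply/eqP; rewrite ylE; apply/negPn/negP => qy.
    have := yl_in j; rewrite inE => /and3P[yJ _ /negP]; apply.
    apply: (on_wall_up hH0 hY0 hY0n hals hsub hwall sq wq qy).
    by rewrite [yl j]surjective_pairing in_J0.
  have hy k : k \in ys -> crd q k = 0.
    by move=> /ysE[j ->]; apply/eqP; rewrite -ylE h mxE.
  apply: (up_on_wall a0 al0 (hsub sq)) => k qk kY; apply: contraT => uk.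
  have kJ : k.1 \in J0 by rewrite -(in_J0 _ k.2) -surjective_pairing.
  have [ki|ki] := eqVneq k.1 i0; last first.
    by move: qk; rewrite hy ?eqxx // inE kJ ki.
  move: qk; rewrite (not_up_in kJ uk) ki lower_eq0 ?eqxx //; first exact: ss_muC sq.
  by move=> i iJ ii0; apply: hy; rewrite inE /= iJ ii0 up_lower.
Qed.

End Codim.

Lemma wall_codim : has_codim Xa Va #|J0|.-1.
Proof.
split; first by move=> x [].
move=> _ /VaP[p [sp wp ->]]; have sl := hsub sp.
have [k pk uk] := (hwall sl wp).1 sp; have [kJ kE] := up_in uk.
have kY : pairing (wt k) Y0 != 0 by rewrite [k]surjective_pairing in_J0.
have [kap [Y [l0 [hY lE kF _]]]] := wall_basis hH0 hY0 hY0n hals sl wp kY.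
rewrite kE in lE; move: pk; rewrite /supp kE => pk.
have [Om [phi [h1 h2 h3]]] := codim_chart sp wp hY kJ lE pk kF.
by eexists; eexists; exists Om, phi; split; [exact: h1|exact: h2|exact: h3].
Qed.

(** * Local triviality over the wall *)

Section Bundle.
Variables (q0 : HN R N) (kap : 'I_d -> sidx N) (Y : 'I_d -> 'rV[R]_d) (l0 : 'I_d) (k0 : sidx N).
Hypotheses (sq0 : ss K al be q0) (wq0 : on_wall q0) (hY : wbasis K kap Y).
Hypothesis kF : forall l, l != l0 -> kap l \in face K al q0.
Hypotheses (uk0 : up k0) (YE : Y l0 = (pairing (wt k0) Y0)^-1 *: Y0).

Notation n := (#|J0|.-1).
Notation L := [set~ l0]%SET.
Notation nw := (near_wall q0).

Let coefs : (forall k, up k -> wcoef K Y k l0 = 1) /\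
  (forall k, pairing (wt k) Y0 = 0 -> wcoef K Y k l0 = 0).
Proof. exact: (wall_basis_coef hK hH0 hY0 hY0n hals a0 sq0 wq0 uk0 hY YE). Qed.

Let nE : n.+1 = #|J0|.
Proof. by have [i iJ] := J0_neq0; rewrite (cardsD1 i J0) iJ. Qed.

Let xk (i : 'I_n.+1) : sidx N := upper (enum_val (cast_ord nE i)).

Let xk_up i : up (xk i). Proof. by apply: up_upper; exact: enum_valP. Qed.

Let xk_inj : injective xk.
Proof. by move=> i j /(congr1 fst) /= /enum_val_inj /cast_ord_inj. Qed.

Let xk_onto k : up k -> exists i, k = xk i.
Proof.
move=> /up_in[kJ ->]; exists (cast_ord (esym nE) (enum_rank_in kJ k.1)).
by rewrite /xk cast_ordKV enum_rankK_in.
Qed.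

Let kJP (k : sidx N) : (k.1 \in J0) = (pairing (wt k) Y0 != 0).
Proof. by rewrite [k in RHS]surjective_pairing in_J0. Qed.

Let Fs := [set k : sidx N | (bidx kap L k.1 == None) && (k.1 \notin J0)]%SET.
Let fl : 'I_#|Fs| -> sidx N := @enum_val _ (mem Fs).

Let fl_inj : injective fl. Proof. exact: enum_val_inj. Qed.

Let fl_free i : bidx kap L (fl i).1 = None.
Proof. by have := enum_valP i; rewrite inE => /andP[/eqP]. Qed.

Let fl_off i : (fl i).1 \notin J0.
Proof. by have := enum_valP i; rewrite inE => /andP[]. Qed.

Let fl_onto (k : sidx N) : bidx kap L k.1 = None -> k.1 \notin J0 -> exists i, fl i = k.
Proof.
move=> bk kJ; have h : k \in Fs by rewrite inE bk eqxx.
by exists (enum_rank_in h k); rewrite /fl enum_rankK_in.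
Qed.

Let kap_off l : l != l0 -> (kap l).1 \notin J0.
Proof. by move=> /kF /wq0 h; rewrite kJP h eqxx. Qed.

Let J_free i : i \in J0 -> bidx kap L i = None.
Proof.
move=> iJ; case E: (bidx _ _ _) => [l|//]; have [lL kl] := bidxP E.
by move: iJ; rewrite -kl (negPf (kap_off _)) //; move: lL; rewrite !inE.
Qed.

Let sl := slice K kap Y L fl.
Let se := section K kap Y L be fl.
(** Base coordinates [w] on the wall and fibre coordinates [x] at the upper weights, with 0 at the
    lower ones. The products at [J0] then vanish, so [muC] does not see [x] and the construction is
    a product. *)
Let cc (w : 'rV[Cx R]_#|Fs|) (x : 'rV[Cx R]_n.+1) k := spread xk x k + spread fl w k.
Let pt w x : HN R N := mkp (fill K kap Y L be (cc w x)).

Let xk_out (w : 'rV[Cx R]_#|Fs|) (k : sidx N) : k.1 \in J0 -> spread fl w k = 0.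
Proof. by move=> kJ; apply: spread_out => i; apply: contraTneq kJ => <-; exact: fl_off. Qed.

Let x_out (x : 'rV[Cx R]_n.+1) k : ~~ up k -> spread xk x k = 0.
Proof. by move=> uk; apply: spread_out => i; apply: contraNneq uk => <-. Qed.

Let cc_low w x i : i \in J0 -> cc w x (lower i) = 0.
Proof. by move=> iJ; rewrite /cc xk_out // x_out ?addr0 // up_lower. Qed.

Let cc_off w x (k : sidx N) : k.1 \notin J0 -> cc w x k = spread fl w k.
Proof. by move=> kJ; rewrite /cc x_out ?add0r //; apply: contra kJ => /up_in[]. Qed.

Let prodJ (c : sidx N -> Cx R) i : c (lower i) = 0 -> c (i, false) * c (i, true) = 0.
Proof. by rewrite /lower; case: (up (i, false)) => ->; rewrite ?mulr0 ?mul0r. Qed.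

Let pt_muC w x : muC K (pt w x) = be.
Proof.
apply: muC_fill => // l; rewrite !inE negbK => /eqP ->.
rewrite /bval YE pC_scaler (pC_be0 hH0 hY0 hY0n) mulr0 mul0r.
rewrite /free_sum big1 // => i _; rewrite YE pairingZr; have [iJ|iJ] := boolP (i \in J0).
  by rewrite (prodJ (cc_low w x iJ)) mul0r.
by move: iJ; rewrite -(in_J0 i false) negbK => /eqP ->; rewrite mulr0 rC0 mulr0.
Qed.

Let pt0 w : pt w 0 = se w.
Proof.
congr (mkp (fill K kap Y L be _)); apply/funext => k; rewrite /cc [X in X + _]big1 ?add0r //.
by move=> i _; rewrite mxE.
Qed.

Let se_muC w : muC K (se w) = be. Proof. by rewrite -pt0 pt_muC. Qed.

Let pt_off w x (k : sidx N) : k.1 \notin J0 -> crd (pt w x) k = crd (se w) k.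
Proof.
move=> kJ; rewrite -pt0 !crd_mkp /fill; case: (bidx kap L k.1) => [l|]; last by rewrite !cc_off.
case: (k == kap l) => //; congr (_ * (_ - _)); apply: eq_bigr => i _.
have [iJ|iJ] := boolP (i \in J0); last by rewrite !cc_off.
by rewrite !(prodJ (cc_low _ _ iJ)).
Qed.

Let pt_up w x i : crd (pt w x) (xk i) = x 0 i.
Proof.
have [xJ _] := up_in (xk_up i).
by rewrite crd_mkp fill_free ?J_free // /cc xk_out // addr0 spread_fl.
Qed.

Let pt_low w x (k : sidx N) : k.1 \in J0 -> ~~ up k -> crd (pt w x) k = 0.
Proof. by move=> kJ uk; rewrite crd_mkp fill_free ?J_free // (not_up_in kJ uk) cc_low. Qed.

Let pt_near w x : nw (se w) -> nw (pt w x).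
Proof. by move=> h k kF'; rewrite pt_off ?h // kJP wq0 ?eqxx. Qed.

Let pt_on_wall w x : nw (se w) -> ss K al be (pt w x) /\ on_wall (pt w x).
Proof.
move=> h; have sp : ss K al be (pt w x) by apply: (near_wall_ss sq0 (pt_muC w x)); exact: pt_near.
split => //; apply: (up_on_wall a0 al0 sp) => k pk; rewrite -kJP => kJ.
by apply: contraNT pk => uk; rewrite pt_low.
Qed.

Let pt_ss w x : nw (se w) -> x != 0 -> ss K a be (pt w x).
Proof.
move=> h x0; have [sp wp] := pt_on_wall x h; apply/(hwall sp wp).
have [i xi] : exists i, x 0 i != 0.
  apply: contrapT => /forallNP h'; move/eqP: x0; apply; apply/rowP => i.
  by rewrite mxE; apply/eqP/negPn/negP/h'.
by exists (xk i); [rewrite /supp pt_up|exact: xk_up].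
Qed.

Let pt_cls w x : nw (se w) -> cls al be (pt w x) = cls al be (se w).
Proof.
move=> h; have [sp wp] := pt_on_wall x h; have [sp' wp'] := pt_on_wall 0 h.
rewrite -pt0; apply/(cls_eqP hK sp sp').
suff -> : limpt K al (pt w x) = limpt K al (pt w 0) by exact: corb_refl.
apply: crd_inj => k; have [kJ|kJ] := boolP (k.1 \in J0).
  rewrite !crd_restr !ifN //; first by apply/negP => /wp' h'; move: kJ; rewrite kJP h' eqxx.
  by apply/negP => /wp h'; move: kJ; rewrite kJP h' eqxx.
have kY : pairing (wt k) Y0 = 0 by move: kJ; rewrite kJP negbK => /eqP.
rewrite (near_wall_limpt hH0 hY0 hY0n hals sq0 wq0 (pt_muC w x) (pt_near x _) kY) ?pt0 //.
rewrite -[in RHS]pt0 (near_wall_limpt hH0 hY0 hY0n hals sq0 wq0 (pt_muC w 0) (pt_near 0 _) kY) //.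
by rewrite pt0 pt_off.
Qed.

(** Homogeneous coordinates on the fibre: normalising the wall coordinates leaves one scalar of
    [K_C], which acts on all upper coordinates with exponent 1. *)
Let Xco (q : HN R N) : 'rV[Cx R]_n.+1 := \row_i nrm K kap Y L q (xk i).

Let pt_Xco w x : Xco (pt w x) = x.
Proof.
apply/rowP => i; rewrite mxE nrm_normalized ?pt_up // => l; rewrite !inE => ll.
by rewrite crd_mkp (fill_kap hY) // !inE.
Qed.

Let nw_chosen q : nw q -> chosen_neq0 kap L q.
Proof. by move=> h l; rewrite !inE => ll; apply: h; exact: kF. Qed.

Let nw_corb q q' : corb K q q' -> nw q -> nw q'.
Proof.
move=> /corb_real[_ [_ _ _ sE]] nq k kF'; rewrite -/(supp q' _) sE; exact: nq.
Qed.

Let nrm_l0 q q' h (k : sidx N) : (forall l, h l != 0) ->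
  (forall k : sidx N, k.1 \notin J0 -> crd q' k = crd q k * mon K Y h k) ->
  crd q' k = crd q k * mon K Y h k ->
  nrm K kap Y L q' k = nrm K kap Y L q k * h l0 ^ wcoef K Y k l0.
Proof.
move=> h0 hE hk; rewrite (nrm_mon (L := L) h0 _ hk) => [|l]; last first.
  by rewrite !inE => ll; rewrite hE ?(mon_kap hK hY) //; exact: kap_off.
congr (_ * _); rewrite /mon (bigD1 l0) //= !inE eqxx /= big1 ?mulr1 // => l ll.
by rewrite !inE ll exp1rz.
Qed.

Let Xco_corb q q' : corb K q q' -> line (Xco q) = line (Xco q').
Proof.
move=> /(corb_monE hK hY)[h [h0 hE]]; apply/line_eqP; exists (h l0); first exact: h0.
apply/rowP => i; rewrite [RHS]mxE [LHS]mxE [X in _ = _ * X]mxE (nrm_l0 h0 _ (hE _)) //.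
by rewrite coefs.1 // expr1z mulrC.
Qed.

Let NW := cls al be @` [set q | ss K al be q /\ nw q].
Let U := V0 `&` NW.

Let NW_opn : opn X NW. Proof. exact: near_wall_opn. Qed.

Let NWP q : ss K al be q -> NW (cls al be q) -> nw q.
Proof. by move=> sq [q' [sq' nq'] E]; exact: (cls_near_wall hK sq0 sq' sq E nq'). Qed.

Let base_section q : ss K al be q -> nw q -> on_wall q ->
  nw (se (sl q)) /\ cls al be (se (sl q)) = cls al be q.
Proof.
(* The section has zero coordinates at [J0], so it is compared with the limit point, which has the
   same slice coordinates as [q]. *)
move=> sq nq wq; set q' := limpt K al q.
have lE (k : sidx N) : k.1 \notin J0 -> crd q' k = crd q k.
  rewrite kJP negbK => /eqP kY; apply: (near_wall_limpt hH0 hY0 hY0n hals sq0 wq0 _ nq kY).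
  exact: ss_muC sq.
have sq' : ss K al be q' by exact: limpt_ss.
have slE : sl q' = sl q.
  apply/rowP => i; rewrite [LHS]mxE [RHS]mxE /nrm (lE _ (fl_off i)).
  apply: congr1; apply: (congr1 (fun h => mon K Y h (fl i))).
  by apply/funext => l; rewrite !inE; case: eqVneq => //= ll; rewrite lE ?kap_off.
have nq' : nw q'.
  move=> k kF'; have kJ : k.1 \notin J0 by rewrite kJP wq0 ?eqxx.
  by rewrite (lE _ kJ); exact: nq.
have [|_] := section_slice hK hY (be := be) fl_inj (ss_muC sq') (nw_chosen nq').
  move=> k bk kfl; rewrite /q' crd_restr; case: ifPn => // kF'.
  have kJ : k.1 \notin J0 by rewrite kJP wq ?eqxx.
  by have [i ik] := fl_onto bk kJ; have := kfl i; rewrite ik eqxx.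
rewrite -/sl -/se slE => qc; split; first exact: nw_corb qc nq'.
by rewrite -(cls_corb hK sq' qc) cls_limpt.
Qed.

Let base_chart : exists Om phi, [/\ chart (sub_space (sub_space X V0) U) U Om phi,
  forall q, ss K al be q -> nw q -> phi (cls al be q) = sl q &
  forall w, Om w -> nw (se w)].
Proof.
pose Om := [set w | nw (se w)].
have oOm : open Om.
  rewrite (_ : Om = setT `&` (fun w => se w : HNn R N) @^-1` [set q | nw q]); last by rewrite setTI.
  apply: open_preimage_at; [exact: openT| |exact: near_wall_open].
  by move=> w _; apply: differentiable_continuous; exact: section_diff.
have [|||||phi [phiB phiE]] := @slice_chart R (HNn R N) (ss K al be) _ (cls al be) V0 NW _
    (sl : HNn R N -> _) (se : _ -> HNn R N) Om NW_opn oOm.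
- move=> q sq /(NWP sq) nq; exists [set q | nw q]; split => //; first exact: near_wall_open.
  by move=> q' nq'; exact/slice_diff/nw_chosen.
- move=> q q' sq sq' /(NWP sq) nq E.
  have [h h0 hE] := wall_fibre hK hH0 hY0 hY0n hals sq0 wq0 hY sq sq' nq E.
  have hE' (k : sidx N) : k.1 \notin J0 -> crd q' k = crd q k * mon K Y h k.
    by rewrite kJP negbK => /eqP; exact: hE.
  apply/rowP => i; rewrite [LHS]mxE [RHS]mxE (nrm_l0 h0 hE') ?hE' ?fl_off //.
  by rewrite coefs.2 ?expr0z ?mulr1 //; apply/eqP; move: (fl_off i); rewrite kJP negbK.
- by move=> w _; exact: section_diff.
- move=> w nse; have := pt_on_wall 0 nse; rewrite pt0 => -[sw ww]; split => //.
  + by exists (se w).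
  + exact/V0_cls.
  + exact: slice_section.
- move=> q sq /(NWP sq) nq /(V0_cls sq) wq; exact: base_section.
exists Om, phi; split => //; last by move=> q sq nq; apply: phiE => //; exists q.
have sX : sheafy X by exact: quot_sheafy.
have s1 := sub_sheafy sX V0; have s2 := sub_sheafy s1 U; have s3 := sub_sheafy s2 U.
have o1 : opn (sub_space X V0) U by exists NW => //; rewrite setIC.
split => //.
  exists U => //; by rewrite setIid.
apply: biholomorphic_id phiB.
  apply: hol_map_subr => //; last by move=> x [].
  by do 3! apply: hol_map_subl; exact: hol_map_id.
have s4 := sub_sheafy sX (V0 `&` NW).
do 2 (apply: hol_map_subr => //; last by move=> x []).
apply: hol_map_subr => //; last by move=> x [_ []].
by apply: hol_map_subl; exact: hol_map_id.
Qed.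

(** An open neighbourhood in [Xa] of the part of [Va] over the base chart; on it the projection to
    projective space extends, which allows its holomorphy to be checked in [Xa]. *)
Let Ua := cls a be @` [set q | [/\ ss K a be q, nw q & Xco q != 0]].
Let UaP q : ss K a be q -> Ua (cls a be q) -> nw q /\ Xco q != 0.
Proof.
move=> sq [q' [sq' nq' xq'] /(cls_side sq' sq) qq']; split; first exact: nw_corb qq' nq'.
have /line_eqP[c c0 ->] := Xco_corb qq'; by rewrite scaler_eq0 negb_or c0.
Qed.

Let Xco_diff (q : HNn R N) : nw q -> differentiable (Xco : HNn R N -> _) q.
Proof.
move=> nq; apply: cdiff_row => i.
apply: (cdiff_eq (f := fun q : HNn R N => nrm K kap Y L q (xk i))) => [t|]; first by rewrite mxE.
exact/cdiff_nrm/nw_chosen.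
Qed.

Let Ua_opn : opn Xa Ua.
Proof.
have nrm_near (q : HNn R N) i : nw q -> nrm K kap Y L q (xk i) != 0 ->
    nbhs q [set r : HNn R N | nrm K kap Y L r (xk i) != 0].
  move=> nq xi; pose g (r : HNn R N) : Cx R := nrm K kap Y L r (xk i).
  have dg : cdiff g q by apply: cdiff_nrm; exact: nw_chosen.
  exact: (cdiff_neq0 dg xi).
apply/quot_opnP; split; first by move=> _ [q [sq _ _] <-]; exists q.
move=> q sq /(UaP sq)[nq xq].
have h1 : nbhs (q : HNn R N) [set q | nw q].
  by apply: open_nbhs_nbhs; split => //; exact: near_wall_open.
have [i xi] : exists i, Xco q 0 i != 0.
  apply: contrapT => /forallNP h'; move/eqP: xq; apply; apply/rowP => i.
  by rewrite [RHS]mxE; apply/eqP/negPn/negP/h'.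
have h2 : nbhs (q : HNn R N) [set q | nrm K kap Y L q (xk i) != 0].
  have xi' : nrm K kap Y L q (xk i) != 0 by move: xi; rewrite mxE.
  exact: nrm_near.
move: h1 h2; apply: filterS2 => r nr xr sr.
have xr' : Xco r != 0.
  have xr2 : nrm K kap Y L r (xk i) != 0 := xr; apply: contraNneq xr2 => h.
  by have := congr1 (fun v : 'rV_n.+1 => v 0 i) h; rewrite /Xco [LHS]mxE [RHS]mxE => ->.
by exists r; [split; [exact: sr|exact: nr|exact: xr']|].
Qed.

Let G (O : set (HN R N)) := line (Xco (xget 0 [set q | ss K a be q /\ cls a be q = O])).

Let G_cls q : ss K a be q -> G (cls a be q) = line (Xco q).
Proof.
move=> sq; rewrite /G; case: xgetP => [r -> [sr /(cls_side sr sq)]|/(_ q)[]//].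
exact: Xco_corb.
Qed.

Let G_hol : hol_map (sub_space Xa Ua) (CP R n) G.
Proof.
apply: quot_sub_hol_map; first exact: Ua_opn.
apply: (hol_lift (E1 := HNn R N)) => q [sq /(UaP sq)[nq xq]].
exists [set q | nw q], Xco; split; [exact: near_wall_open|exact: nq|exact: Xco_diff|].
move=> r nr [sr /(UaP sr)[_ xr]]; split; [exact: xr|exact: G_cls].
Qed.

Let Phi O := (f O, G O).
(** The inverse trivialisation is defined by choice from its graph: [p] witnesses that [O] lies over
    [x] with homogeneous coordinates [l]. *)
Let good O x l p := [/\ ss K a be p, nw p, on_wall p, cls al be p = x &
  line (Xco p) = l /\ cls a be p = O].
Let Psi (xl : set (HN R N) * set 'rV[Cx R]_n.+1) :=
  xget set0 [set O | exists p, good O xl.1 xl.2 p].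

Let good_unique O O' x l p p' : good O x l p -> good O' x l p' -> O = O'.
Proof.
move=> [sp np wp px [pl <-]] [sp' np' wp' px' [pl' <-]].
apply: (cls_corb hK sp).
apply: (wall_fibre_corb hK hH0 hY0 hY0n hals hsub hwall sq0 wq0 hY coefs.1 coefs.2 sp sp' np wp).
  by rewrite px px'.
move=> h h0 hE; move: (pl); rewrite -pl' => /line_eqP[c c0 xE].
(* Moving [p] by [h] already multiplies [Xco] by [h l0], so this is the factor left to reach [c]. *)
exists (c / h l0); first by rewrite mulf_neq0 ?invr_eq0.
move=> k uk; have [i ik] := xk_onto uk; rewrite ik.
have := congr1 (fun v : 'rV_n.+1 => v 0 i) xE; rewrite /Xco [LHS]mxE [RHS]mxE [X in _ = _ * X]mxE.
(* [p] moved by [h] in all coordinates. It shares with [p'] the basis coordinates on the wall, hence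
   the normalising factor [m]. *)
pose q : HN R N := mkp (fun k => crd p k * mon K Y h k).
have qE k' : crd q k' = crd p k' * mon K Y h k' by rewrite crd_mkp.
have := nrm_l0 (q := p) (q' := q) h0 (fun k _ => qE k) (qE (xk i)); rewrite coefs.1 // expr1z => nq.
have pk j : j \in L -> crd p' (kap j) = crd q (kap j).
  rewrite !inE => ll; rewrite qE hE //; apply/eqP; rewrite -[_ == _]negbK -kJP; exact: kap_off.
pose m := mon K Y (fun l => if l \in L then (crd q (kap l))^-1 else 1) (xk i).
have nE' r : (forall l, l \in L -> crd r (kap l) = crd q (kap l)) ->
    nrm K kap Y L r (xk i) = crd r (xk i) * m.
  move=> rq; rewrite /nrm; apply: congr1; apply: (congr1 (fun h => mon K Y h (xk i))); apply/funext => j.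
  by case: ifP => // /rq ->.
have m0 : m != 0.
  apply: mon_neq0 => j; case: ifP => [lL|_]; last exact: oner_neq0.
  by rewrite invr_eq0 -pk // nw_chosen.
rewrite (nE' p' pk) => e; apply: (mulIf m0); rewrite e.
rewrite -(qE (xk i)) mulrAC -(nE' q) // nq -mulrA [h l0 * _]mulrC divfK //.
by rewrite mulrC.
Qed.

Let PsiE O x l p : good O x l p -> Psi (x, l) = O.
Proof.
move=> gp; rewrite /Psi; case: xgetP => [ O' -> [p' gp']|/(_ O)[]]; last by exists p.
exact: good_unique gp' gp.
Qed.

Let pt_good w x : nw (se w) -> x != 0 ->
  good (cls a be (pt w x)) (cls al be (se w)) (line x) (pt w x).
Proof.
move=> h x0; have [_ wp] := pt_on_wall x h; split => //.
- exact: pt_ss.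
- exact: pt_near.
- exact: pt_cls.
- by rewrite pt_Xco.
Qed.

Let pts_good x l : pts (sub_space (sub_space X V0) U) x -> pts (CP R n) l ->
  exists O p, good O x l p.
Proof.
move=> [_ [Vx [q [sq nq] qx]]] [v v0 <-]; rewrite -qx in Vx *.
have [nse E] := base_section sq nq ((V0_cls sq).1 Vx).
have := pt_good nse v0; rewrite E => gp.
by eexists; eexists; exact: gp.
Qed.

Let Xco_neq0 p : ss K a be p -> nw p -> on_wall p -> Xco p != 0.
Proof.
move=> sp np wp; have [k pk uk] := (hwall (hsub sp) wp).1 sp; have [i ik] := xk_onto uk.
apply: contraNneq pk => h; have := congr1 (fun v : 'rV_n.+1 => v 0 i) h.
rewrite /Xco [LHS]mxE [RHS]mxE -ik => /eqP; rewrite mulf_eq0 => /orP[//|].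
rewrite (negPf (_ : mon _ _ _ _ != 0)) //; apply: mon_neq0 => l; case: ifP => [lL|_].
  by rewrite invr_eq0 nw_chosen.
exact: oner_neq0.
Qed.

Let goodP O x l p : good O x l p ->
  pts (sub_space (sub_space Xa Va) (f @^-1` U)) O /\ Phi O = (x, l).
Proof.
move=> [sp np wp px [pl pO]]; rewrite -pO.
have fE := f_cls sp; have VE : V0 (cls al be p) by apply/V0_cls => //; exact: hsub.
split; last by rewrite /Phi fE px G_cls // pl.
split; first by split; [exists p|apply/VaP; exists p].
by rewrite /= fE; split => //; exists p => //; split => //; exact: hsub.
Qed.

Let pts_goodP O : pts (sub_space (sub_space Xa Va) (f @^-1` U)) O ->
  exists p, good O (Phi O).1 (Phi O).2 p.
Proof.
move=> [[_ /VaP[p [sp wp OE]]] UO]; exists p; have h : U (f O) by exact: UO.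
move: h; rewrite OE => -[_]; rewrite (f_cls sp) => NO.
have np := NWP (hsub sp) NO.
split; [exact: sp|exact: np|exact: wp|by rewrite /Phi /= f_cls|].
by split; first by rewrite /Phi /= G_cls.
Qed.

Lemma local_bundle : opn (sub_space X V0) U /\
  biholomorphic (sub_space (sub_space Xa Va) (f @^-1` U))
    (prod_space (sub_space (sub_space X V0) U) (CP R n)) Phi.
Proof.
have sX : sheafy X by exact: quot_sheafy.
have sXa : sheafy Xa by exact: quot_sheafy.
have sA := sub_sheafy (sub_sheafy sX V0) U.
have sC : sheafy (CP R n) by exact: quot_sheafy.
have sYa := sub_sheafy (sub_sheafy sXa Va) (f @^-1` U).
have s1 := sub_sheafy (sub_sheafy sX V0) U.
split; first by exists NW => //; rewrite setIC.
split.
  apply: hol_map_pair => //=.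
    by apply: hol_map_sub => //; apply: hol_map_sub => [|x _ []//]; exact: natural_hol_map.
  apply: (hol_map_comp (f := id) (g := G)) G_hol; apply: hol_map_subr => //.
    by do 2! apply: hol_map_subl; exact: hol_map_id.
  move=> x /pts_goodP[p [sp np wp _ [_ <-]]]; exists p => //; split => //.
  exact: Xco_neq0.
exists Psi; split.
- apply: (hol_map_comp (g := id) (Y := sub_space Xa (Va `&` f @^-1` U))); last first.
    by case: (hol_map_subsub Va (f @^-1` U) sXa).
  apply: (hol_map_of_prod sA sC) => x y Ax Cy.
  have [Om [phi [cU phiE OmE]]] := base_chart.
  have [U2 [psi [j [cU2 U2y yE]]]] := projective_chart Cy.
  have Ux : U x by case: Ax.
  exists _, _, U, U2, Om, setT, phi, psi,
    (fun ww => pt ww.1 (affine_section j ww.2) : HNn R N).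
  split => //.
  + move=> [w w'] _; apply: cdiff_mkp => k; apply: cdiff_fill => k'.
    apply: cdiff_add; apply: cdiff_sum => i _.
      apply: (@differentiable_comp _ _ _ (Cx R)^o (fun ww : 'rV[Cx R]_#|Fs| * 'rV[Cx R]_n => ww.2) (fun w => affine_section j w 0 i)).
        exact: differentiable_snd.
      apply: (@differentiable_comp _ _ _ (Cx R)^o (affine_section j) (fun w => w 0 i)).
        exact: affine_section_diff.
      exact: differentiable_coord.
    apply: (@differentiable_comp _ _ _ (Cx R)^o (fun ww : 'rV[Cx R]_#|Fs| * 'rV[Cx R]_n => ww.1) (fun w => w 0 i)).
      exact: differentiable_fst.
    exact: differentiable_coord.
  + move=> x' y' [Vx' [q [sq nq] qx]] U2y' /=; rewrite -qx in Vx' *.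
    have [nse E] := base_section sq nq ((V0_cls sq).1 Vx').
    rewrite (phiE _ sq nq).
    have gp := pt_good nse (affine_section_neq0 j (psi y')); rewrite E in gp.
    have [[[_ h1] h2] _] := goodP gp; have [sp _ _ _ _] := gp.
    split; [exact: sp|by split|].
    by rewrite {1}(yE y' U2y'); exact: (PsiE gp).
- move=> O /pts_goodP[p gp]; exact: PsiE gp.
- move=> [x l] [Ax Cl]; have [ O [p gp]] := pts_good Ax Cl.
  by rewrite (PsiE gp); case: (goodP gp).
Qed.

End Bundle.

Lemma wall_bundle : fiber_bundle (sub_space Xa Va) (sub_space X V0) (CP R #|J0|.-1) f.
Proof.
split; first by apply: hol_map_sub => [|x _ []//]; exact: natural_hol_map.
move=> _ [_ /V0P[p [sp wp ->]]]; have [i iJ] := J0_neq0.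
have uk := up_upper iJ.
have kY : pairing (wt (upper i)) Y0 != 0 by rewrite in_J0.
have [kap [Y [l0 [hY lE kF YE]]]] := wall_basis hH0 hY0 hY0n hals sp wp kY.
have [h1 h2] := local_bundle sp wp hY kF uk YE.
eexists; eexists; split; [exact: h1| |exact: h2|by []].
by split; [exact/V0_cls|exists p => //; split => // k; exact: face_supp].
Qed.

End WallCrossing.

(** * Smooth functions *)

Section Differentiability.
Variables (R : realType) (V W : normedModType R).

Lemma diff_eps (f : V -> W) x e : differentiable f x -> 0 < e ->
  \forall h \near 0, `|f (h + x) - f x - 'd f x h| <= e * `|h|.
Proof.
move=> /diff_locally /eqaddoP h e0; have := h e e0; apply: filterS => t.
by rewrite /= opprD addrA.
Qed.

Lemma eps_diff (f : V -> W) x (L : {linear V -> W}) : continuous L ->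
  (forall e, 0 < e -> \forall h \near 0, `|f (h + x) - f x - L h| <= e * `|h|) ->
  differentiable f x /\ 'd f x = L :> (V -> W).
Proof.
move=> cL h; have E : f \o shift x = cst (f x) + L +o_ 0 id.
  apply/eqaddoP => e e0; have := h e e0; apply: filterS => t.
  by rewrite /= opprD addrA.
have dE := diff_unique cL E; split => //.
by apply/diff_locallyP; rewrite dE.
Qed.

Lemma near_eq_diff (f g : V -> W) x : {near x, f =1 g} -> differentiable f x -> differentiable g x.
Proof.
move=> fg df; have [] // := @eps_diff g x ('d f x) (diff_continuous df).
move=> e e0; have := diff_eps df e0.
have fgx : f x = g x by exact: nbhs_singleton fg.
have : \forall h \near 0, f (h + x) = g (h + x).
  have c : (fun h : V => h + x) @ nbhs (0 : V) --> nbhs (0 + x).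
    by apply: cvgD; [exact: cvg_id|exact: cvg_cst].
  by rewrite add0r in c; exact: (c _ fg).
by apply: filterS2 => h E; rewrite E fgx.
Qed.

End Differentiability.

Section Elementary.
Variables (R : realType) (V : normedModType R) (O : set V) (B : (V -> R) -> Prop).
Hypothesis oO : open O.

(** Rational expressions in the generators [B]. If the derivatives of the generators are again of
    this form on [O], so are all iterated derivatives, and smoothness follows by one structural
    induction. Cramer's rule keeps inverse matrices in the class. *)
Inductive elem : (V -> R) -> Prop :=
| elem_base b : B b -> elem b
| elem_cst c : elem (fun=> c)
| elem_add f g : elem f -> elem g -> elem (fun x => f x + g x)
| elem_mul f g : elem f -> elem g -> elem (fun x => f x * g x)
| elem_inv f : elem f -> (forall x, O x -> f x != 0) -> elem (fun x => (f x)^-1).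

Lemma elem_eq f g : f =1 g -> elem f -> elem g.
Proof. by move=> /funext ->. Qed.

Lemma elem_opp f : elem f -> elem (fun x => - f x).
Proof.
move=> ef; apply: (elem_eq (f := fun x => (-1) * f x)) => [x|]; first by rewrite mulN1r.
by apply: elem_mul => //; exact: elem_cst.
Qed.

Lemma elem_sum (I : Type) (r : seq I) (P : pred I) (f : I -> V -> R) :
  (forall i, elem (f i)) -> elem (fun x => \sum_(i <- r | P i) f i x).
Proof.
move=> ef; elim: r => [|i r IH].
  by apply: (elem_eq (f := fun=> 0)) => [t|]; [rewrite big_nil|exact: elem_cst].
case E : (P i).
  apply: (elem_eq (f := fun t => f i t + \sum_(j <- r | P j) f j t)) => [t|].
    by rewrite big_cons E.
  exact: elem_add.
by apply: elem_eq IH => t; rewrite big_cons E.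
Qed.

Lemma elem_prod (I : Type) (r : seq I) (P : pred I) (f : I -> V -> R) :
  (forall i, elem (f i)) -> elem (fun x => \prod_(i <- r | P i) f i x).
Proof.
move=> ef; elim: r => [|i r IH].
  by apply: (elem_eq (f := fun=> 1)) => [t|]; [rewrite big_nil|exact: elem_cst].
case E : (P i).
  apply: (elem_eq (f := fun t => f i t * \prod_(j <- r | P j) f j t)) => [t|].
    by rewrite big_cons E.
  exact: elem_mul.
by apply: elem_eq IH => t; rewrite big_cons E.
Qed.

Lemma elem_det n (M : V -> 'M[R]_n) : (forall i j, elem (fun x => M x i j)) ->
  elem (fun x => \det (M x)).
Proof.
move=> eM; apply: elem_sum => s; apply: elem_mul; first exact: elem_cst.
by apply: elem_prod => i; exact: eM.
Qed.

Lemma elem_invmx n (M : V -> 'M[R]_n) : (forall i j, elem (fun x => M x i j)) ->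
  (forall x, O x -> M x \in unitmx) ->
  forall i j, exists2 g, elem g & forall x, O x -> invmx (M x) i j = g x.
Proof.
move=> eM uM i j; exists (fun x => (\det (M x))^-1 * \adj (M x) i j).
  apply: elem_mul.
    apply: elem_inv; first exact: elem_det.
    by move=> x Ox; have := uM x Ox; rewrite unitmxE unitfE.
  apply: (elem_eq (f := fun x => (-1) ^+ (j + i) * \det (row' j (col' i (M x))))) => [x|].
    by rewrite mxE.
  apply: elem_mul; first exact: elem_cst.
  apply: elem_det => k l; apply: elem_eq (eM (lift j k) (lift i l)) => x.
  by rewrite !mxE.
by move=> x Ox; rewrite /invmx uM // mxE.
Qed.

Hypothesis hB : forall b, B b -> (forall x, O x -> differentiable b x) /\
  forall v, exists2 g, elem g & forall x, O x -> 'D_v b x = g x.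

Lemma elem_diff f : elem f -> (forall x, O x -> differentiable f x) /\
  forall v, exists2 g, elem g & forall x, O x -> 'D_v f x = g x.
Proof.
elim=> {f} [b /hB//|c|f g ef [df Df] eg [dg Dg]|f g ef [df Df] eg [dg Dg]|f ef [df Df] f0].
- split=> [x _|v]; first exact: differentiable_cst.
  by exists (fun=> 0) => [|x _]; [exact: elem_cst|rewrite derive_cst].
- split=> [x Ox|v]; first by apply: differentiableD; [exact: df|exact: dg].
  have [f' ef' fE] := Df v; have [g' eg' gE] := Dg v.
  exists (fun x => f' x + g' x) => [|x Ox]; first exact: elem_add.
  by rewrite deriveD ?fE ?gE //; apply: diff_derivable; [exact: df|exact: dg].
- split=> [x Ox|v]; first by apply: differentiableM; [exact: df|exact: dg].
  have [f' ef' fE] := Df v; have [g' eg' gE] := Dg v.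
  exists (fun x => f x * g' x + g x * f' x) => [|x Ox].
    by apply: elem_add; apply: elem_mul.
  by rewrite deriveM ?fE ?gE //; apply: diff_derivable; [exact: df|exact: dg].
- split=> [x Ox|v]; first by apply: differentiableV; [exact: df|exact: f0].
  have [f' ef' fE] := Df v.
  exists (fun x => - ((f x)^-1 * (f x)^-1) * f' x) => [|x Ox].
    by apply: elem_mul => //; apply: elem_opp; apply: elem_mul; exact: elem_inv.
  rewrite deriveV ?fE //; [|exact: f0|by apply: diff_derivable; exact: df].
  by rewrite expr2 invfM.
Qed.

Lemma elem_derivable f x v : elem f -> O x -> derivable f x v.
Proof. by move=> /elem_diff[df _] Ox; apply: diff_derivable; exact: df. Qed.

Lemma elem_continuous f x : elem f -> O x -> {for x, continuous f}.
Proof. by move=> /elem_diff[df _] Ox; apply: differentiable_continuous; exact: df. Qed.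

Lemma elem_derive_mx m n (f : V -> 'M[R]_(m, n)) v : (forall i j, elem (fun x => f x i j)) ->
  exists2 g : V -> 'M[R]_(m, n), (forall i j, elem (fun x => g x i j)) &
    forall x, O x -> 'D_v f x = g x.
Proof.
move=> ef.
have /choice[g gP] (ij : 'I_m * 'I_n) : exists g, elem g /\ forall x, O x ->
    'D_v (fun x => f x ij.1 ij.2) x = g x.
  by have [_ /(_ v)[g eg gE]] := elem_diff (ef ij.1 ij.2); exists g.
exists (fun x => \matrix_(i, j) g (i, j) x) => [i j|x Ox].
  by apply: (elem_eq (f := g (i, j))) => [x|]; [rewrite mxE|exact: (gP (i, j)).1].
rewrite derive_mx; last by apply/derivable_mxP => i j; exact: elem_derivable.
by apply/matrixP => i j; rewrite !mxE; exact: (gP (i, j)).2.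
Qed.

Lemma elem_smooth m n (f : V -> 'M[R]_(m, n)) :
  (forall i j, elem (fun x => f x i j)) -> smooth_on O f.
Proof.
move=> ef; split => // vs x Ox.
suff [g eg gE] : exists2 g : V -> 'M[R]_(m, n), (forall i j, elem (fun x => g x i j)) &
    forall x, O x -> foldr (fun v (g : V -> 'M[R]_(m, n)) y => 'D_v g y) f vs x = g x.
  apply: (@near_eq_diff _ _ _ g).
    have : nbhs x O by exact: open_nbhs_nbhs.
    by apply: filterS => y Oy; rewrite gE.
  by apply: differentiable_mx => i j; exact: (elem_diff (eg i j)).1.
elim: vs {x Ox} => [|v vs [g eg gE]] /=; first by exists f.
have [g' eg' gE'] := elem_derive_mx v eg; exists g' => // x Ox.
rewrite -gE' //; apply: near_eq_derive.
have : nbhs x O by exact: open_nbhs_nbhs.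
by apply: filterS => y Oy; rewrite gE.
Qed.

End Elementary.

Lemma line_is_derive (R : realType) (V W : normedModType R) (f : V -> W) x u (t : R) l :
  is_derive (t *: u + x) u f l -> is_derive t (1 : R) (fun s => f (s *: u + x)) l.
Proof.
move=> [d dl].
have E : (fun h : R => h^-1 *: (((fun s => f (s *: u + x)) \o shift t) (h *: (1 : R)) -
    f (t *: u + x))) = fun h => h^-1 *: ((f \o shift (t *: u + x)) (h *: u) - f (t *: u + x)).
  by apply/funext => h /=; rewrite [h *: 1]mulr1 scalerDl addrA.
by split; rewrite /derivable /derive E.
Qed.

Lemma segment_mvt (R : realType) (g g' : R -> R) (s : R) : 0 < s ->
  (forall t, 0 <= t <= s -> is_derive t (1 : R) g (g' t)) ->
  exists2 t, 0 <= t <= s & g s - g 0 = g' t * s.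
Proof.
move=> s0 hg; have [||c cs] := @MVT_segment R g g' 0 s (ltW s0).
- by move=> t; rewrite in_itv /= => /andP[t0 ts]; apply: hg; rewrite !ltW.
- apply: derivable_within_continuous => t; rewrite in_itv /= => ts.
  by have [] := hg t ts.
by rewrite subr0 => E; exists c => //; rewrite in_itv in cs.
Qed.

(** The second difference [D] over a small parallelogram is evaluated by the mean value theorem in
    both orders; this equates the mixed derivatives at two points near [x]. *)
Lemma schwarz (R : realType) (V : normedModType R) (O : set V) (x u v : V)
  (f fu fv fuv fvu : V -> R) : open O -> O x ->
  (forall y, O y -> is_derive y u f (fu y)) -> (forall y, O y -> is_derive y v f (fv y)) ->
  (forall y, O y -> is_derive y u fv (fuv y)) -> (forall y, O y -> is_derive y v fu (fvu y)) ->
  {for x, continuous fuv} -> {for x, continuous fvu} -> fuv x = fvu x.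
Proof.
move=> oO Ox hu hv huv hvu cuv cvu.
apply/eqP; rewrite -subr_eq0 -normr_le0; apply/ler_addgt0Pl => e e0; rewrite addr0.
have e2 : 0 < e / 2 by rewrite divr_gt0.
have : \forall y \near x, [/\ O y, `|fuv x - fuv y| <= e / 2 & `|fvu x - fvu y| <= e / 2].
  have n1 : nbhs x O by exact: open_nbhs_nbhs.
  have /cvgrPdist_le /(_ _ e2) n2 := cuv; have /cvgrPdist_le /(_ _ e2) n3 := cvu.
  near=> y; split; near: y => //.
move=> /nbhs_ballP[r /= r0 hr].
(* The side length keeping the parallelogram in the ball of radius [r]; the 1 guards against
   vanishing [u] and [v]. *)
pose s := r / (`|u| + `|v| + 1) / 2.
have nuv : 0 < `|u| + `|v| + 1 by rewrite ltr_wpDl ?addr_ge0.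
have s0 : 0 < s by rewrite !divr_gt0.
have inb a b : 0 <= a <= s -> 0 <= b <= s -> ball x r (a *: u + (b *: v + x)).
  move=> /andP[a0 as'] /andP[b0 bs]; rewrite -ball_normE /= addrA opprD addrCA subrr addr0 normrN.
  apply: (@le_lt_trans _ _ (s * (`|u| + `|v|))).
    rewrite mulrDr (le_trans (ler_normD _ _)) // !normrZ !ger0_norm //.
    by rewrite lerD // ler_wpM2r.
  apply: (@le_lt_trans _ _ (s * (`|u| + `|v| + 1))); first by rewrite ler_pM2l // lerDl.
  by rewrite /s mulrAC divfK ?gt_eqF // ltr_pdivrMr // ltr_pMr // ltr1n.
have I0 : 0 <= (0 : R) <= s by rewrite lexx ltW.
have Is : 0 <= s <= s by rewrite lexx ltW.
have bO y : ball x r y -> O y by move=> /hr[].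
have comm a b : a *: u + (b *: v + x) = b *: v + (a *: u + x) by rewrite addrCA.
pose D := f (s *: u + (s *: v + x)) - f (s *: v + x) - (f (s *: u + x) - f x).
have dline (g g' : V -> R) w y : (forall z, O z -> is_derive z w g (g' z)) ->
    forall t, O (t *: w + y) -> is_derive t (1 : R) (fun t => g (t *: w + y)) (g' (t *: w + y)).
  by move=> hg t Ot; apply: line_is_derive; exact: hg.
have mem a b : 0 <= a <= s -> 0 <= b <= s -> O (a *: u + (b *: v + x)).
  by move=> h1 h2; apply/bO/inb.
have mem0 a : 0 <= a <= s -> O (a *: u + x).
  by move=> h1; have := mem a 0 h1 I0; rewrite scale0r add0r.
have mem0' b : 0 <= b <= s -> O (b *: v + x).
  by move=> h1; have := mem 0 b I0 h1; rewrite scale0r add0r.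
have [P [bP DP]] : exists P, ball x r P /\ D = fvu P * s * s.
  have [|t1 t1s E1] := @segment_mvt R (fun t => f (t *: u + (s *: v + x)) - f (t *: u + x))
    (fun t => fu (t *: u + (s *: v + x)) - fu (t *: u + x)) s s0.
    by move=> t ts; apply: is_deriveB; apply: (dline f fu _ _ hu); [exact: mem|exact: mem0].
  have [|t2 t2s E2] := @segment_mvt R (fun t => fu (t *: v + (t1 *: u + x)))
    (fun t => fvu (t *: v + (t1 *: u + x))) s s0.
    by move=> t ts; apply: (dline fu fvu _ _ hvu); rewrite -comm; exact: mem.
  exists (t2 *: v + (t1 *: u + x)); split; first by rewrite -comm; exact: inb.
  rewrite -E2 scale0r add0r -comm -E1 /D scale0r !add0r; ring.
have [Q [bQ DQ]] : exists Q, ball x r Q /\ D = fuv Q * s * s.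
  have [|t1 t1s E1] := @segment_mvt R (fun t => f (t *: v + (s *: u + x)) - f (t *: v + x))
    (fun t => fv (t *: v + (s *: u + x)) - fv (t *: v + x)) s s0.
    move=> t ts; apply: is_deriveB; apply: (dline f fv _ _ hv); last exact: mem0'.
    by rewrite -comm; exact: mem.
  have [|t2 t2s E2] := @segment_mvt R (fun t => fv (t *: u + (t1 *: v + x)))
    (fun t => fuv (t *: u + (t1 *: v + x))) s s0.
    by move=> t ts; apply: (dline fv fuv _ _ huv); exact: mem.
  exists (t2 *: u + (t1 *: v + x)); split; first exact: inb.
  rewrite -E2 scale0r add0r comm -E1 /D scale0r !add0r comm; ring.
have PQ : fvu P = fuv Q.
  by apply: (mulIf (lt0r_neq0 s0)); apply: (mulIf (lt0r_neq0 s0)); rewrite -DP.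
have [_ _ hP] := hr P bP; have [_ hQ _] := hr Q bQ.
rewrite -(subrKA (fuv Q)) -{2}PQ (splitr e) (le_trans (ler_normD _ _)) // lerD //.
by rewrite distrC.
Unshelve. all: by end_near. Qed.

(** * The implicit solution of the moment map equation *)

Section VanishingProduct.
Variables (R : realType) (V : normedModType R).

(** Where one factor vanishes, the product rule needs only continuity of the other: the error
    [b t (P t - P x)] is of smaller order. *)
Lemma vanishing_mul (b P : V -> R) x : differentiable b x -> b x = 0 -> {for x, continuous P} ->
  differentiable (fun t => b t * P t) x /\
  forall v, 'D_v (fun t => b t * P t) x = 'D_v b x * P x.
Proof.
move=> db b0 cP.
pose r t := b t * (P t - P x).
have [dr dr0] : differentiable r x /\ 'd r x = \0 :> (V -> R).
  apply: (@eps_diff R V R r x \0) => [|e e0]; first by move=> ?; exact: cst_continuous.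
  have [k k0 hk] := linear_lipschitz (diff_continuous db).
  have k1 : 0 < k + 1 by rewrite addr_gt0.
  have ek : 0 < e / (k + 1) by rewrite divr_gt0.
  have n1 := diff_eps db (@ltr01 R).
  have n2 : \forall h \near 0, `|P (h + x) - P x| <= e / (k + 1).
    have c : (fun h : V => h + x) @ nbhs (0 : V) --> nbhs (0 + x).
      by apply: cvgD; [exact: cvg_id|exact: cvg_cst].
    rewrite add0r in c; have /cvgrPdist_le /(_ _ ek) n := cP.
    have n' : \forall h \near (0 : V), `|P x - P (h + x)| <= e / (k + 1) by exact: c _ n.
    by apply: filterS n' => h; rewrite distrC.
  move: n1 n2; apply: filterS2 => h; rewrite b0 subr0 mul1r => h1 h2.
  rewrite /r b0 mul0r !subr0 normrM.
  have bh : `|b (h + x)| <= (k + 1) * `|h|.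
    rewrite -[b (h + x)](subrK ('d b x h)) (le_trans (ler_normD _ _)) // mulrDl mul1r addrC.
    by rewrite lerD // hk.
  rewrite (le_trans (ler_pM _ _ bh h2)) //.
  by rewrite mulrAC mulrCA divff ?gt_eqF // mulr1.
have E : (fun t => b t * P t) = (fun t => b t * P x) + r.
  by apply/funext => t; rewrite fctE /r mulrBr subrKC.
have db' : differentiable (fun t => b t * P x) x.
  by apply: differentiableM => //; exact: differentiable_cst.
rewrite E; split; first exact: differentiableD.
move=> v; rewrite deriveD; [|exact: diff_derivable|exact: diff_derivable].
rewrite [X in _ + X]deriveE // dr0 addr0.
rewrite deriveM; [|exact: diff_derivable|exact: derivable_cst].
by rewrite derive_cst scaler0 add0r [LHS]mulrC.
Qed.

End VanishingProduct.

Section DividedDifference.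
Variable R : realType.

(* the divided difference of exp (2 s) at 0 *)
Definition expdd (s : R) : R := if s == 0 then 2 else (expR (2 * s) - 1) / s.

Lemma expddE (s : R) : expR (2 * s) - 1 = expdd s * s.
Proof.
rewrite /expdd; case: eqVneq => [->|s0]; first by rewrite !mulr0 expR0 subrr.
by rewrite divfK.
Qed.

(** A quantitative form of the monotonicity of [exp (2 s)]. For positive [s] the factor [1 + 2 |s|]
    is slack; for [s = - r] it comes from [exp (- 2 r) <= 1 / (1 + 2 r)]. *)
Lemma exp_lower (s : R) : 2 * s ^+ 2 <= (1 + 2 * `|s|) * ((expR (2 * s) - 1) * s).
Proof.
have [s0|s0] := lerP 0 s.
  have h := expR_ge1Dx (2 * s).
  have : 2 * s <= expR (2 * s) - 1 by lra.
  move=> /(ler_wpM2r s0) h2; apply: (le_trans (y := (expR (2 * s) - 1) * s)); first by nra.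
  rewrite ler_peMl //; last by have := ler_norm s; lra.
  by apply: le_trans h2; rewrite -mulrA mulr_ge0 // -expr2 sqr_ge0.
have [r r0 ->] : exists2 r, 0 < r & s = - r by exists (- s); rewrite ?opprK ?oppr_gt0.
rewrite normrN (gtr0_norm r0) sqrrN mulrN -mulNr opprB (mulrN 2 r).
have h : expR (- (2 * r)) <= (1 + 2 * r)^-1.
  rewrite expRN lef_pV2 ?posrE ?expR_gt0 //; [exact: expR_ge1Dx|by rewrite addr_gt0 // mulr_gt0].
have pos : 0 < 1 + 2 * r by rewrite addr_gt0 // mulr_gt0.
have : 2 * r <= (1 + 2 * r) * (1 - expR (- (2 * r))).
  rewrite -ler_pdivrMl //.
  have -> : (1 + 2 * r)^-1 * (2 * r) = 1 - (1 + 2 * r)^-1 by field; rewrite gt_eqF.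
  lra.
by move=> /(ler_wpM2r (ltW r0)); rewrite expr2 !mulrA.
Qed.

Lemma expdd_gt0 (s : R) : 0 < expdd s.
Proof.
rewrite /expdd; case: eqVneq => [_|s0]; first by [].
have [sp|sn] := ltP 0 s; first by rewrite divr_gt0 // subr_gt0 expR_gt1 mulr_gt0.
have sn' : s < 0 by rewrite lt_neqAle s0.
by rewrite -mulrNN -invrN divr_gt0 ?oppr_gt0 // subr_lt0 expR_lt1 pmulr_rlt0.
Qed.

Lemma expdd_continuous0 : {for 0, continuous expdd}.
Proof.
have [d1 d2] : is_derive (0 : R) (1 : R) (fun s => expR (2 * s)) 2.
  have h : is_derive (0 : R) (1 : R) (fun s : R => 2 * s) 2.
    have := is_deriveZ 2 (is_derive_id (0 : R) (1 : R)).
    by rewrite [2 *: 1]mulr1.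
  have := @is_derive1_comp R expR (fun s : R => 2 * s) 0 _ _ (is_derive_expR _) h.
  by rewrite mulr0 expR0 mul1r.
have h : (fun h : R => h^-1 *: (expR (2 * h) - 1)) @ 0^' --> (2 : R).
  pose q (h : R) : R := h^-1 *: (expR (2 * h) - 1); rewrite -[X in X @ _]/q.
  have E : (fun h : R => h^-1 *: (((fun s => expR (2 * s)) \o shift 0) (h *: (1 : R)) - expR (2 * 0))) = q.
    by apply/funext => h; rewrite /q /= addr0 mulr0 expR0 [h *: 1]mulr1.
  have c : q @ 0^' --> lim (q @ 0^') by rewrite -E; exact: d1.
  have l2 : lim (q @ 0^') = 2 by rewrite -E; exact: d2.
  by rewrite l2 in c.
rewrite /prop_for /continuous_at; apply/cvgrPdist_lt => e e0.
have e00 : expdd 0 = 2 by rewrite /expdd eqxx.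
have /cvgrPdist_lt /(_ _ e0) [dl dl0 hd] := h.
exists dl => //= s sd; rewrite e00 /expdd; case: eqVneq => [_|s0]; first by rewrite subrr normr0.
by have := hd s sd s0; rewrite [_ *: _]mulrC.
Unshelve. all: by end_near. Qed.

End DividedDifference.

Section Gram.
Variables (R : realType) (N d : nat) (K : subtorus R N d).
Notation wt := (wt K).

(** The matrix of the quadratic form [sum_k g k (wt k, z)^2]; the Hessian of the Kempf-Ness function
    has this shape. *)
Definition gram (g : sidx N -> R) : 'M[R]_d := \sum_k g k *: ((wt k)^T *m wt k).

Lemma gramE g (z : 'rV[R]_d) : z *m gram g = \sum_k (g k * pairing (wt k) z) *: wt k.
Proof.
rewrite mulmx_sumr; apply: eq_bigr => k _; rewrite -scalemxAr mulmxA -scalerA; congr (_ *: _).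
rewrite [z *m _]mx11_scalar mul_scalar_mx; congr (_ *: _).
by rewrite mxE pairingC; apply: eq_bigr => j _; rewrite mxE.
Qed.

Lemma gram_unit g : (forall k, 0 <= g k) ->
  (forall z, (forall k, 0 < g k -> pairing (wt k) z = 0) -> z = 0) -> gram g \in unitmx.
Proof.
move=> g0 gsep; rewrite -row_free_unit; apply: inj_row_free => z zg; apply: gsep => k gk.
have : pairing (z *m gram g) z = 0 by rewrite zg pairing0l.
rewrite gramE pairing_suml => /eqP; rewrite psumr_eq0 => [/allP /(_ k (mem_index_enum _))|j _].
  by rewrite /= pairingZl -mulrA !mulf_eq0 orbb (gt_eqF gk) /= => /eqP.
by rewrite pairingZl -mulrA mulr_ge0 // -expr2 sqr_ge0.
Qed.

End Gram.

Section ImplicitSolution.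
Variables (R : realType) (N d : nat) (K : subtorus R N d) (V : normedModType R) (O : set V).
Notation wt := (wt K).
Variables (c : V -> sidx N -> R) (y : V -> 'rV[R]_d) (al : 'rV[R]_d).
Hypothesis oO : open O.
Hypothesis c_ge0 : forall x k, 0 <= c x k.
Hypothesis hy : forall x, O x -> \sum_k (c x k * expR (2 * pairing (wt k) (y x))) *: wt k = al.
Hypothesis hsep : forall x z, O x -> (forall k, 0 < c x k -> pairing (wt k) z = 0) -> z = 0.
Hypothesis hc : forall x k, O x -> differentiable (c^~ k) x.

Section At.
Variable x0 : V.
Hypothesis Ox0 : O x0.

Let e k := expR (2 * pairing (wt k) (y x0)).
Let s x k := pairing (wt k) (y x - y x0).
Let b x := \sum_k ((c x k - c x0 k) * e k) *: wt k.

Let e_gt0 k : 0 < e k. Proof. exact: expR_gt0. Qed.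

(** The difference of the equations at [x] and [x0], arranged so that the right side depends on the
    coefficients [c] only. *)
Let increment x : O x -> \sum_k (c x k * e k * (expR (2 * s x k) - 1)) *: wt k = - b x.
Proof.
move=> Ox; apply/eqP; rewrite -subr_eq0 opprK; apply/eqP; rewrite /b -big_split /=.
transitivity (\sum_k (c x k * expR (2 * pairing (wt k) (y x))) *: wt k -
    \sum_k (c x0 k * expR (2 * pairing (wt k) (y x0))) *: wt k); last by rewrite !hy // subrr.
rewrite -sumrB; apply: eq_bigr => k _; rewrite -scalerDl -scalerBl; congr (_ *: _).
have -> : expR (2 * pairing (wt k) (y x)) = e k * expR (2 * s x k).
  by rewrite /e /s -expRD; congr expR; rewrite pairingBr; ring.
rewrite -/(e k); ring.
Qed.

Let basis : exists kap Y, wbasis K kap Y /\ forall l, 0 < c x0 (kap l).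
Proof.
have [kap [Y [L [hY LF LP]]]] := extend_wbasis K (fun k => 0 < c x0 k).
exists kap, Y; split => // l; apply: LF; apply/negPn/negP => lL.
have : Y l = 0 by apply: (hsep Ox0) => k ck; exact: LP.
by move/eqP; rewrite (negPf (wbasis_neq0 l hY)).
Qed.

Let b_continuous l : {for x0, continuous (fun x => pairing (b x) l)}.
Proof.
have -> : (fun x => pairing (b x) l) = (fun x => \sum_k ((c x k - c x0 k) * e k) * pairing (wt k) l).
  by apply/funext => x; rewrite /b pairing_suml; apply: eq_bigr => k _; rewrite pairingZl.
apply: continuous_bigsum => k _; do 2 (apply: continuous_mul; last exact: cst_continuous).
by apply: continuous_add; [apply: differentiable_continuous; exact: hc|exact: cst_continuous].
Qed.

(** Continuity of the solution. Paired with [y x - y x0], the left side of [increment] is a sum of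
    nonnegative terms. Its term at the largest basis coordinate is bounded below by [exp_lower], and
    the right side by [b] times that coordinate, where [b] is small. *)
Let s_small kap Y : wbasis K kap Y -> (forall l, 0 < c x0 (kap l)) ->
  forall eps, 0 < eps -> \forall x \near x0, forall l, `|s x (kap l)| <= eps.
Proof.
move=> hY c0 eps eps0.
have [d0|d0] := posnP d.
  near=> x => l; by have := ltn_ord l; rewrite {2}d0.
pose m := \big[Num.min/1]_l (c x0 (kap l) * e (kap l)).
have m0 : 0 < m.
  rewrite /m; elim/big_ind: _ => //; first by move=> u v u0 v0; rewrite lt_min u0.
  by move=> l _; rewrite mulr_gt0.
have mle l : m <= c x0 (kap l) * e (kap l) by rewrite /m; exact: bigmin_le_cond.
(* The estimate will be [m t <= be d (1 + 2 t)] for the largest coordinate [t]. If [t] exceeded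
   [eps], then [1 + 2 t <= t (1 / eps + 2)], and this choice of [be] makes the two incompatible. *)
pose be := m / (d%:R * (eps^-1 + 2) + 1).
have den : 0 < d%:R * (eps^-1 + 2) + 1 by rewrite ltr_wpDl // mulr_ge0 // addr_ge0 // invr_ge0 ltW.
have be0 : 0 < be by rewrite divr_gt0.
have m20 : 0 < m / 2 by rewrite divr_gt0.
have n1 : \forall x \near x0, forall l, `|pairing (b x) (Y l)| <= be.
  apply: near_forall => l; have /cvgrPdist_le /(_ _ be0) := @b_continuous (Y l).
  have -> : pairing (b x0) (Y l) = 0.
    by rewrite /b big1 ?pairing0l // => k _; rewrite subrr mul0r scale0r.
  by apply: filterS => x; rewrite sub0r normrN.
have n2 : \forall x \near x0, forall l, m / 2 <= c x (kap l) * e (kap l).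
  apply: near_forall => l.
  have cc : {for x0, continuous (fun x => c x (kap l) * e (kap l))}.
    by apply: continuous_mul; [apply: differentiable_continuous; exact: hc|exact: cst_continuous].
  have /cvgrPdist_le /(_ _ m20) := cc; apply: filterS => x.
  rewrite ler_norml => /andP[_ h]; have := mle l; lra.
have n3 : \forall x \near x0, O x by apply: open_nbhs_nbhs.
near=> x.
have Ox : O x by near: x.
have h1 : forall l, `|pairing (b x) (Y l)| <= be by near: x.
have h2 : forall l, m / 2 <= c x (kap l) * e (kap l) by near: x.
pose t l := `|s x (kap l)|.
have [lm _ lmax] := @arg_maxP _ R _ (Ordinal d0) xpredT t isT.
have {}lmax l : t l <= t lm by exact: lmax.
suff tm : t lm <= eps by move=> l; exact: le_trans (lmax l) tm.
rewrite leNgt; apply/negP => te.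
have t0 : 0 < t lm by exact: lt_trans te.
have E : \sum_k c x k * e k * ((expR (2 * s x k) - 1) * s x k) =
    - \sum_l s x (kap l) * pairing (b x) (Y l).
  transitivity (pairing (\sum_k (c x k * e k * (expR (2 * s x k) - 1)) *: wt k) (y x - y x0)).
    by rewrite pairing_suml; apply: eq_bigr => k _; rewrite pairingZl mulrA.
  rewrite increment // pairingNl; congr (- _).
  rewrite {1}(wbasis_dual (y x - y x0) hY) pairing_sumr.
  by apply: eq_bigr => l _; rewrite pairingZr.
have pos k : 0 <= c x k * e k * ((expR (2 * s x k) - 1) * s x k).
  apply: mulr_ge0; first by rewrite mulr_ge0 // ltW.
  have := exp_lower (s x k); have : 0 < 1 + 2 * `|s x k| by rewrite ltr_wpDr // mulr_ge0.
  by move=> p q; rewrite -(pmulr_rge0 _ p); apply: le_trans q; rewrite mulr_ge0 // sqr_ge0.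
have U1 : c x (kap lm) * e (kap lm) * ((expR (2 * s x (kap lm)) - 1) * s x (kap lm)) <= be * d%:R * t lm.
  apply: (le_trans (y := \sum_k c x k * e k * ((expR (2 * s x k) - 1) * s x k))).
    by rewrite (bigD1 (kap lm)) //= lerDl; apply: sumr_ge0 => k _; exact: pos.
  rewrite E -sumrN (le_trans (y := \sum_(l < d) be * t lm)) //.
    apply: ler_sum => l _; rewrite (le_trans (ler_norm _)) // normrN normrM mulrC.
    by rewrite ler_pM //; exact: lmax.
  have -> : \sum_(l < d) be * t lm = be * d%:R * t lm; last exact: lexx.
  by rewrite sumr_const card_ord -[LHS]mulr_natr mulrAC.
have U2 : m * t lm <= be * d%:R * (1 + 2 * t lm).
  have := exp_lower (s x (kap lm)); rewrite -/(t lm) -[s x (kap lm) ^+ 2](real_normK (num_real _)) -/(t lm) => U3.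
  have U4 := h2 lm.
  set A := (expR _ - 1) * _ in U1 U3; set C := c x _ * _ in U1 U4.
  have A0 : 0 <= A.
    have p : 0 < 1 + 2 * t lm by rewrite ltr_wpDr // mulr_ge0 // ltW.
    by rewrite -(pmulr_rge0 _ p); apply: le_trans U3; rewrite mulr_ge0 // sqr_ge0.
  have V1 : m / 2 * A <= be * d%:R * t lm by apply: le_trans U1; rewrite ler_wpM2r.
  rewrite -(ler_pM2r t0).
  have V2 : m / 2 * (2 * t lm ^+ 2) <= m / 2 * ((1 + 2 * t lm) * A) by rewrite ler_pM2l.
  have V3 : (1 + 2 * t lm) * (m / 2 * A) <= (1 + 2 * t lm) * (be * d%:R * t lm).
    by rewrite ler_wpM2l // addr_ge0 // mulr_ge0 // ltW.
  have -> : m * t lm * t lm = m / 2 * (2 * t lm ^+ 2) by field.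
  apply: le_trans V2 _; rewrite mulrCA; apply: le_trans V3 _.
  by rewrite le_eqVlt; apply/orP; left; apply/eqP; ring.
have : m * t lm <= be * d%:R * (t lm * (eps^-1 + 2)).
  apply: le_trans U2 _; apply: ler_wpM2l; first by rewrite mulr_ge0 // ltW.
  rewrite [t lm * _]mulrDr [t lm * 2]mulrC lerD2r.
  by rewrite ler_pdivlMr // mul1r ltW.
rewrite [t lm * _]mulrC mulrA ler_pM2r // /be -[_ * d%:R * _]mulrA.
rewrite mulrAC ler_pdivlMr // mulrDr mulr1 gerDl => h.
by have := lt_le_trans m0 h; rewrite ltxx.
Unshelve. all: by end_near. Qed.

Let s_continuous k : {for x0, continuous (s^~ k)}.
Proof.
have [kap [Y [hY c0]]] := basis.
have s0 k' : s x0 k' = 0 by rewrite /s subrr pairing0r.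
have ck l : {for x0, continuous (s^~ (kap l))}.
  rewrite /prop_for /continuous_at; apply/cvgrPdist_le => eps eps0.
  have := s_small hY c0 eps0; apply: filterS => x /(_ l).
  by rewrite s0 sub0r normrN.
have -> : s^~ k = fun x => \sum_l s x (kap l) * pairing (wt k) (Y l).
  apply/funext => x; rewrite {1}/s {1}(wbasis_dual (y x - y x0) hY) pairing_sumr.
  by apply: eq_bigr => l _; rewrite pairingZr.
apply: continuous_bigsum => l _; apply: continuous_mul; first exact: ck.
exact: cst_continuous.
Qed.

Let wgt x k := c x k * e k * expdd (s x k).

Let wgt_unit x : O x -> gram K (wgt x) \in unitmx.
Proof.
move=> Ox; apply: gram_unit => [k|z h].
  by rewrite mulr_ge0 ?(ltW (expdd_gt0 _)) // mulr_ge0 // ltW.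
by apply: (hsep Ox) => k ck; apply: h; rewrite mulr_gt0 ?expdd_gt0 // mulr_gt0.
Qed.

(** By [expddE] the increment equation is linear in [y x - y x0], with a Gram matrix that depends on
    [x] through the divided differences. *)
Let solution x : O x -> y x = y x0 - b x *m invmx (gram K (wgt x)).
Proof.
move=> Ox; apply/eqP; rewrite addrC -subr_eq -mulNmx; apply/eqP.
apply: (canRL (mulmxK (wgt_unit Ox))); rewrite gramE -increment //.
by apply: eq_bigr => k _; rewrite /wgt expddE mulrA.
Qed.

Let inv_continuous i j : {for x0, continuous (fun x => invmx (gram K (wgt x)) i j)}.
Proof.
have cM i' j' : {for x0, continuous (fun x => gram K (wgt x) i' j')}.
  have -> : (fun x => gram K (wgt x) i' j') =
      fun x => \sum_k wgt x k * ((wt k)^T *m wt k) i' j'.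
    by apply/funext => x; rewrite summxE; apply: eq_bigr => k _; rewrite mxE.
  apply: continuous_bigsum => k _; apply: continuous_mul; last exact: cst_continuous.
  apply: continuous_mul.
    by apply: continuous_mul; [apply: differentiable_continuous; exact: hc|exact: cst_continuous].
  have s0 : s x0 k = 0 by rewrite /s subrr pairing0r.
  have h : (s^~ k) @ x0 --> (0 : R) by rewrite -s0; exact: s_continuous.
  have h' : (@expdd R \o s^~ k) @ x0 --> expdd 0.
    by apply: (cvg_comp _ _ h); exact: expdd_continuous0.
  by rewrite /prop_for /continuous_at s0; exact: h'.
have cdet n (M : V -> 'M[R]_n) : (forall i j, {for x0, continuous (fun x => M x i j)}) ->
    {for x0, continuous (fun x => \det (M x))}.
  move=> h; apply: continuous_bigsum => p _; apply: continuous_mul; first exact: cst_continuous.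
  by apply: continuous_bigprod => k _; exact: h.
have d0 : \det (gram K (wgt x0)) != 0 by have := wgt_unit Ox0; rewrite unitmxE unitfE.
have ci : {for x0, continuous (fun x => (\det (gram K (wgt x)))^-1 * \adj (gram K (wgt x)) i j)}.
  apply: continuous_mul; first by apply: continuous_inv => //; exact: cdet.
  have -> : (fun x => \adj (gram K (wgt x)) i j) =
      fun x => (-1) ^+ (j + i) * \det (row' j (col' i (gram K (wgt x)))).
    by apply/funext => x; rewrite mxE.
  apply: continuous_mul; first exact: cst_continuous.
  apply: cdet => k l; apply: eq_continuous_at (cM (lift j k) (lift i l)) => x.
  by rewrite !mxE.
rewrite /prop_for /continuous_at; apply: cvg_trans; last first.
  rewrite (_ : invmx (gram K (wgt x0)) i j = (\det (gram K (wgt x0)))^-1 * \adj (gram K (wgt x0)) i j); first exact: ci.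
  by rewrite /invmx wgt_unit // mxE.
apply: near_eq_cvg; have : nbhs x0 O by exact: open_nbhs_nbhs.
by apply: filterS => x Ox; rewrite /invmx wgt_unit // [RHS]mxE.
Qed.

(** In [solution] the factor [b] is differentiable and vanishes at [x0], while the inverse matrix is
    merely continuous; [vanishing_mul] suffices, and evaluates the matrix at [x0], where the divided
    differences are 2. *)
Lemma implicit_diff_at j : differentiable (fun x => y x 0 j) x0 /\
  forall v, 'D_v (fun x => y x 0 j) x0 =
    - \sum_i (\sum_k 'D_v (c^~ k) x0 * e k * wt k 0 i) *
      invmx (gram K (fun k => 2 * c x0 k * e k)) i j.
Proof.
have bE i : (fun x => b x 0 i) = fun x => \sum_k (c x k - c x0 k) * (e k * wt k 0 i).
  by apply/funext => x; rewrite summxE; apply: eq_bigr => k _; rewrite mxE mulrA.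
have db k i : differentiable (fun x => (c x k - c x0 k) * (e k * wt k 0 i)) x0 /\
    forall v, 'D_v (fun x => (c x k - c x0 k) * (e k * wt k 0 i)) x0 = 'D_v (c^~ k) x0 * e k * wt k 0 i.
  have d1 : differentiable (fun x => c x k - c x0 k) x0.
    by apply: differentiableB; [exact: hc|exact: differentiable_cst].
  split; first by apply: differentiableM => //; exact: differentiable_cst.
  move=> v; rewrite deriveM; [|exact: diff_derivable|exact: derivable_cst].
  rewrite derive_cst scaler0 add0r deriveB; [|exact: diff_derivable (hc _ Ox0)|exact: derivable_cst].
  by rewrite derive_cst subr0 -mulrA; exact: mulrC.
have sumdiff (I : Type) (r : seq I) (f : I -> V -> R) (g : I -> V -> R) :
    (forall i, differentiable (f i) x0 /\ forall v, 'D_v (f i) x0 = g i v) ->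
    differentiable (fun x => \sum_(i <- r) f i x) x0 /\
    forall v, 'D_v (fun x => \sum_(i <- r) f i x) x0 = \sum_(i <- r) g i v.
  move=> h; elim: r => [|i r [IH1 IH2]].
    rewrite (_ : (fun x => _) = cst 0); last by apply/funext => x; rewrite big_nil.
    by split=> [|v]; [exact: differentiable_cst|rewrite derive_cst big_nil].
  have [h1 h2] := h i.
  rewrite (_ : (fun x => _) = f i + (fun x => \sum_(i <- r) f i x)); last first.
    by apply/funext => x; rewrite big_cons.
  split; first exact: differentiableD.
  by move=> v; rewrite deriveD ?h2 ?IH2 ?big_cons //; exact: diff_derivable.
have b0 i : b x0 0 i = 0.
  by rewrite summxE big1 // => k _; rewrite subrr mul0r scale0r mxE.
have dbi i := sumdiff _ (index_enum _) _ _ (fun k => db k i).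
have dp i : differentiable (fun x => b x 0 i * invmx (gram K (wgt x)) i j) x0 /\
   forall v, 'D_v (fun x => b x 0 i * invmx (gram K (wgt x)) i j) x0 =
     (\sum_k 'D_v (c^~ k) x0 * e k * wt k 0 i) * invmx (gram K (wgt x0)) i j.
  have [h1 h2] := dbi i; rewrite -bE in h1 h2.
  have [h3 h4] := vanishing_mul h1 (b0 i) (@inv_continuous i j).
  by split => // v; rewrite h4 h2.
have [s1 s2] := sumdiff _ (index_enum _) _ _ dp.
set q := (fun x => \sum_i b x 0 i * invmx (gram K (wgt x)) i j) in s1 s2.
have near_y : \forall x \near x0, (cst (y x0 0 j) - q) x = y x 0 j.
  have : nbhs x0 O by exact: open_nbhs_nbhs.
  by apply: filterS => x Ox; rewrite [in RHS]solution // [RHS]mxE [X in _ = _ + X]mxE [X in _ = _ - X]mxE.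
have wE : wgt x0 = fun k => 2 * c x0 k * e k.
  apply/funext => k; rewrite /wgt /s subrr pairing0r /expdd eqxx; ring.
split.
  by apply: near_eq_diff near_y _; apply: differentiableB => //; exact: differentiable_cst.
move=> v; rewrite -(near_eq_derive v near_y) deriveB; [|exact: derivable_cst|exact: diff_derivable].
by rewrite derive_cst sub0r s2 wE.
Qed.

End At.
End ImplicitSolution.

(** * Quaternionic tangent vectors *)

Lemma cinvE (R : realType) (c : Cx R) : c^-1 = rC (sqn c)^-1 * cof (cre c) (- cim c).
Proof.
have [->|c0] := eqVneq c 0; first by rewrite invr0 /= oppr0 [cof 0 0]rC0 mulr0.
apply: (mulfI c0); rewrite divff // mulrCA.
have -> : c * cof (cre c) (- cim c) = rC (sqn c).
  by apply: Cx_eqP; rewrite ?creM ?cimM /= /sqn; ring.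
by rewrite -rCM mulVf ?sqn_eq0.
Qed.

Section ComplexDerivatives.
Variables (R : realType) (V : normedModType R).
Implicit Types (f g : V -> Cx R) (x v : V) (l c : Cx R).

Lemma is_derive_mulr (f g : V -> R) x v a b : is_derive x v f a -> is_derive x v g b ->
  is_derive x v (fun t => f t * g t) (f x * b + a * g x).
Proof.
move=> hf hg; have h := is_deriveM hf hg.
by apply: (is_derive_eq h); rewrite [X in _ + X]mulrC.
Qed.

Lemma is_derive_invr (f : V -> R) x v a : f x != 0 -> is_derive x v f a ->
  is_derive x v (fun t => (f t)^-1) (- (f x)^-1 ^+ 2 * a).
Proof.
move=> f0 [df <-]; split; first exact: derivableV.
by rewrite deriveV // exprVn.
Qed.

Lemma is_derive_near (W : normedModType R) (f g : V -> W) x v (l : W) :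
  {near x, f =1 g} -> is_derive x v f l -> is_derive x v g l.
Proof.
by move=> fg [df <-]; split; [exact: near_eq_derivable fg df|rewrite (near_eq_derive v fg)].
Qed.

Lemma is_derive_uniq (W : normedModType R) (f : V -> W) x v (l l' : W) :
  is_derive x v f l -> is_derive x v f l' -> l = l'.
Proof. by move=> [_ <-] [_ <-]. Qed.

Lemma is_derive_mx m n (f : V -> 'M[R]_(m, n)) x v (l : 'M[R]_(m, n)) :
  is_derive x v f l <-> forall i j, is_derive x v (fun t => f t i j) (l i j).
Proof.
split=> [[df <-] i j|h].
  have d i' j' : derivable (fun t => f t i' j') x v by move: df => /derivable_mxP.
  by split => //; rewrite derive_mx // mxE.
have df : derivable f x v by apply/derivable_mxP => i j; have [] := h i j.
by split => //; rewrite derive_mx //; apply/matrixP => i j; rewrite mxE; have [] := h i j.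
Qed.

Definition is_cderive x v f l :=
  is_derive x v (fun t => cre (f t)) (cre l) /\ is_derive x v (fun t => cim (f t)) (cim l).

Lemma is_cderive_cst x v c : is_cderive x v (fun=> c) 0.
Proof. by split; exact: is_derive_cst. Qed.

Lemma is_cderive_eq f g x v l : f =1 g -> is_cderive x v f l -> is_cderive x v g l.
Proof. by move=> /funext ->. Qed.

Lemma is_cderive_near f g x v l : {near x, f =1 g} -> is_cderive x v f l -> is_cderive x v g l.
Proof.
move=> fg [h1 h2]; split; [apply: is_derive_near h1|apply: is_derive_near h2];
  by apply: filterS fg => t ->.
Qed.

Lemma is_cderive_uniq f x v l l' : is_cderive x v f l -> is_cderive x v f l' -> l = l'.
Proof.
by move=> [h1 h2] [h3 h4]; apply: Cx_eqP; [exact: is_derive_uniq h1 h3|exact: is_derive_uniq h2 h4].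
Qed.

Lemma is_cderive_cof (a b : V -> R) x v a' b' : is_derive x v a a' -> is_derive x v b b' ->
  is_cderive x v (fun t => cof (a t) (b t)) (cof a' b').
Proof. by []. Qed.

Lemma is_cderive_rC (a : V -> R) x v a' : is_derive x v a a' ->
  is_cderive x v (fun t => rC (a t)) (rC a').
Proof. by move=> h; apply: is_cderive_cof => //; exact: is_derive_cst. Qed.

Lemma is_cderiveD f g x v l m : is_cderive x v f l -> is_cderive x v g m ->
  is_cderive x v (fun t => f t + g t) (l + m).
Proof.
move=> [h1 h2] [h3 h4]; split.
  rewrite creD (_ : (fun t => _) = (fun t => cre (f t)) + (fun t => cre (g t))).
    exact: is_deriveD.
  by apply/funext => t; rewrite creD.
rewrite cimD (_ : (fun t => _) = (fun t => cim (f t)) + (fun t => cim (g t))).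
  exact: is_deriveD.
by apply/funext => t; rewrite cimD.
Qed.

Lemma is_cderiveM f g x v l m : is_cderive x v f l -> is_cderive x v g m ->
  is_cderive x v (fun t => f t * g t) (f x * m + l * g x).
Proof.
move=> [h1 h2] [h3 h4]; split.
  rewrite (_ : (fun t => _) = (fun t => cre (f t) * cre (g t)) - (fun t => cim (f t) * cim (g t))).
    have h := is_deriveB (is_derive_mulr h1 h3) (is_derive_mulr h2 h4).
    by apply: (is_derive_eq h); rewrite creD !creM; ring.
  by apply/funext => t; rewrite creM.
rewrite (_ : (fun t => _) = (fun t => cre (f t) * cim (g t)) + (fun t => cim (f t) * cre (g t))).
  have h := is_deriveD (is_derive_mulr h1 h4) (is_derive_mulr h2 h3).
  by apply: (is_derive_eq h); rewrite cimD !cimM; ring.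
by apply/funext => t; rewrite cimM.
Qed.

Lemma is_cderiveZ c f x v l : is_cderive x v f l -> is_cderive x v (fun t => c * f t) (c * l).
Proof.
by move=> h; have := is_cderiveM (is_cderive_cst x v c) h; rewrite mul0r addr0.
Qed.

Lemma is_cderiveN f x v l : is_cderive x v f l -> is_cderive x v (fun t => - f t) (- l).
Proof.
move=> h; have := is_cderiveZ (-1) h; rewrite mulN1r; apply: is_cderive_eq => t.
by rewrite mulN1r.
Qed.

Lemma is_cderive_sum (I : Type) (r : seq I) (P : pred I) (f : I -> V -> Cx R) x v (l : I -> Cx R) :
  (forall i, P i -> is_cderive x v (f i) (l i)) ->
  is_cderive x v (fun t => \sum_(i <- r | P i) f i t) (\sum_(i <- r | P i) l i).
Proof.
move=> h; elim: r => [|i r IH].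
  by rewrite big_nil; apply: is_cderive_eq (is_cderive_cst x v 0) => t; rewrite big_nil.
rewrite big_cons; case E : (P i).
  by apply: is_cderive_eq (is_cderiveD (h i E) IH) => t; rewrite big_cons E.
by apply: is_cderive_eq IH => t; rewrite big_cons E.
Qed.

Lemma is_cderiveV f x v l : f x != 0 -> is_cderive x v f l ->
  is_cderive x v (fun t => (f t)^-1) (- ((f x)^-1 * l * (f x)^-1)).
Proof.
move=> f0 h.
have n0 : sqn (f x) != 0 by rewrite sqn_eq0.
have [h1 h2] := h.
have hn : is_derive x v (fun t => sqn (f t)) (2 * (cre (f x) * cre l + cim (f x) * cim l)).
  have hd := is_deriveD (is_derive_mulr h1 h1) (is_derive_mulr h2 h2).
  rewrite (_ : (fun t => _) = (fun t => cre (f t) * cre (f t)) + (fun t => cim (f t) * cim (f t))) //.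
  by apply: (is_derive_eq hd); ring.
have hi : is_derive x v (fun t => (sqn (f t))^-1) (- (sqn (f x))^-1 ^+ 2 * (2 * (cre (f x) * cre l + cim (f x) * cim l))).
  exact: (is_derive_invr (f := fun t => sqn (f t)) n0 hn).
have E c : c^-1 = rC (sqn c)^-1 * cof (cre c) (- cim c) by exact: cinvE.
have hc : is_cderive x v (fun t => cof (cre (f t)) (- cim (f t))) (cof (cre l) (- cim l)).
  by apply: is_cderive_cof => //; exact: is_deriveN.
have hp := is_cderiveM (is_cderive_rC hi) hc.
have {}hp := is_cderive_eq (g := fun t => (f t)^-1) (fun t => esym (E (f t))) hp.
suff <- : rC (sqn (f x))^-1 * cof (cre l) (- cim l) +
    rC (- (sqn (f x))^-1 ^+ 2 * (2 * (cre (f x) * cre l + cim (f x) * cim l))) * cof (cre (f x)) (- cim (f x))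
  = - ((f x)^-1 * l * (f x)^-1) by [].
rewrite E; apply: Cx_eqP; rewrite ?creD ?creN ?cimD ?cimN !(creM, cimM) /=;
  by move: n0; rewrite /sqn => n0; field.
Qed.

(** [c] acts as a logarithmic derivative, additive on products, but the formulation allows [f] to
    vanish. *)
Definition is_clog x v f c := is_cderive x v f (f x * c).

Lemma is_clogM f g x v c c' : is_clog x v f c -> is_clog x v g c' ->
  is_clog x v (fun t => f t * g t) (c + c').
Proof. by move=> h h'; have := is_cderiveM h h'; rewrite /is_clog; congr is_cderive; ring. Qed.

Lemma is_clog1 x v : is_clog x v (fun=> 1) 0.
Proof. by rewrite /is_clog mulr0; exact: is_cderive_cst. Qed.

Lemma is_clogV f x v c : f x != 0 -> is_clog x v f c -> is_clog x v (fun t => (f t)^-1) (- c).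
Proof.
move=> f0 h; have := is_cderiveV f0 h; rewrite /is_clog; congr is_cderive.
by rewrite mulKf // mulrN [in RHS]mulrC.
Qed.

Lemma is_clog_prod (I : Type) (r : seq I) (f : I -> V -> Cx R) x v (c : I -> Cx R) :
  (forall i, is_clog x v (f i) (c i)) ->
  is_clog x v (fun t => \prod_(i <- r) f i t) (\sum_(i <- r) c i).
Proof.
move=> h; elim: r => [|i r IH].
  by rewrite big_nil /is_clog big_nil mulr0; apply: is_cderive_eq (is_cderive_cst x v 1) => t; rewrite big_nil.
rewrite big_cons; have := is_clogM (h i) IH; rewrite /is_clog.
by rewrite big_cons; apply: is_cderive_eq => t; rewrite big_cons.
Qed.

Lemma is_clogX f (z : int) x v c : f x != 0 -> is_clog x v f c ->
  is_clog x v (fun t => f t ^ z) (c *~ z).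
Proof.
move=> f0 h.
have hn n : is_clog x v (fun t => f t ^+ n) (c *+ n).
  elim: n => [|n IH]; first by rewrite mulr0n; apply: is_clog1.
  have := is_clogM h IH; rewrite -mulrS /is_clog -exprS; apply: is_cderive_eq => t.
  by rewrite exprS.
case: z => n; first exact: hn.
by rewrite NegzE mulrNz; apply: is_clogV; [exact: expf_neq0|exact: hn].
Qed.

End ComplexDerivatives.

Lemma is_clog_cexpi (R : realType) (a : R) :
  is_clog (0 : R) (1 : R) (fun t => cexpi (t * a)) ('i * rC (2 * pi * a)).
Proof.
have ha : is_derive (0 : R) (1 : R) (fun t => 2 * pi * (t * a)) (2 * pi * a).
  have h := is_derive_mulr (is_derive_cst (2 * pi) (0 : R) (1 : R))
    (is_derive_mulr (is_derive_id (0 : R) (1 : R)) (is_derive_cst a (0 : R) (1 : R))).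
  by apply: (is_derive_eq h); rewrite /cst /=; ring.
rewrite /is_clog mul0r cexpi0 mul1r.
have hc := @is_derive1_comp R (@cos R) _ 0 _ _ (is_derive_cos _) ha.
have hs := @is_derive1_comp R (@sin R) _ 0 _ _ (is_derive_sin _) ha.
rewrite mul0r mulr0 sin0 cos0 oppr0 mul0r mul1r in hc hs.
by split; rewrite ?creM ?cimM /= ?mul0r ?mul1r ?mulr0 ?subr0 ?addr0 ?add0r.
Qed.

Section QuaternionicVectors.
Variables (R : realType) (N : nat).
Implicit Types (v w : 'M[R]_(4, N)) (k : sidx N).

Definition qc v k : Cx R := crd (quat v) k.
Definition cq (c : sidx N -> Cx R) : 'M[R]_(4, N) := unquat (mkp c).

Lemma qcE v i b : qc v (i, b) = if b then cof (v 2%:R i) (v 3%:R i) else cof (v 0 i) (v 1 i).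
Proof. by case: b; rewrite /qc /crd /quat /= mxE. Qed.

Lemma quatK (p : HN R N) : quat (unquat p) = p.
Proof.
by case: p => z w; rewrite /quat /unquat /=; congr pair; apply/rowP => i; rewrite !mxE /= cofK.
Qed.

Lemma qcK c k : qc (cq c) k = c k.
Proof. by rewrite /qc quatK crd_mkp. Qed.

Lemma ord4P (P : 'I_4 -> Prop) : P 0 -> P 1 -> P 2%:R -> P 3%:R -> forall r, P r.
Proof.
by move=> h0 h1 h2 h3 [[|[|[|[|r]]]] hr] //;
  [have -> : Ordinal hr = 0|have -> : Ordinal hr = 1|
   have -> : Ordinal hr = 2%:R|have -> : Ordinal hr = 3%:R] => //; apply/val_inj.
Qed.

Lemma qc_inj v w : (forall k, qc v k = qc w k) -> v = w.
Proof.
move=> h; apply/matrixP => r i.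
have := h (i, false); have := h (i, true); rewrite !qcE => /cof_inj[h2 h3] /cof_inj[h0 h1].
by move: r; apply: ord4P.
Qed.

Lemma qcD v w k : qc (v + w) k = qc v k + qc w k.
Proof. by case: k => i []; rewrite !qcE !mxE. Qed.

Lemma qcN v k : qc (- v) k = - qc v k.
Proof. by case: k => i []; rewrite !qcE !mxE. Qed.

Lemma qcB v w k : qc (v - w) k = qc v k - qc w k.
Proof. by rewrite qcD qcN. Qed.

Lemma qc0 k : qc 0 k = 0.
Proof. by case: k => i []; rewrite !qcE !mxE. Qed.

Lemma qcZ a v k : qc (a *: v) k = rC a * qc v k.
Proof. by case: k => i []; rewrite !qcE !mxE /rC cofM !mul0r subr0 addr0. Qed.

Lemma is_derive_qc (V : normedModType R) (g : V -> 'M[R]_(4, N)) x u l :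
  is_derive x u g l <-> forall k, is_cderive x u (fun t => qc (g t) k) (qc l k).
Proof.
rewrite is_derive_mx; split=> [h [i b]|h].
  rewrite qcE; apply: (is_cderive_eq (f := fun t => if b then cof (g t 2%:R i) (g t 3%:R i) else cof (g t 0 i) (g t 1 i))).
    by move=> t; rewrite qcE.
  by case: b; apply: is_cderive_cof.
move=> r i; have [h0 h1] := h (i, false); have [h2 h3] := h (i, true).
rewrite !qcE /= in h0 h1 h2 h3.
have e b : (fun t => qc (g t) (i, b)) = fun t => if b then cof (g t 2%:R i) (g t 3%:R i) else cof (g t 0 i) (g t 1 i).
  by apply/funext => t; rewrite qcE.
by move: r; apply: ord4P;
  [apply: is_derive_near h0|apply: is_derive_near h1|apply: is_derive_near h2|apply: is_derive_near h3];
  apply: nearW => t; rewrite qcE.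
Qed.

Lemma dotqE v w : dotq v w = \sum_k (cre (qc v k) * cre (qc w k) + cim (qc v k) * cim (qc w k)).
Proof.
rewrite /dotq exchange_big /= big_sidx; apply: eq_bigr => i _.
rewrite !big_ord_recl big_ord0 !qcE /= addr0.
have -> : fintype.lift ord0 (ord0 : 'I_3) = 1 by apply/val_inj.
have -> : fintype.lift ord0 (fintype.lift ord0 (ord0 : 'I_2)) = 2%:R by apply/val_inj.
have -> : fintype.lift ord0 (fintype.lift ord0 (fintype.lift ord0 (ord0 : 'I_1))) = 3%:R by apply/val_inj.
by rewrite !addrA.
Qed.

Lemma dotqC v w : dotq v w = dotq w v.
Proof. by rewrite !dotqE; apply: eq_bigr => k _; ring. Qed.

Lemma dotqDl u v w : dotq (u + v) w = dotq u w + dotq v w.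
Proof. by rewrite !dotqE -big_split; apply: eq_bigr => k _ /=; rewrite !qcD creD cimD; ring. Qed.

Lemma dotqZl a v w : dotq (a *: v) w = a * dotq v w.
Proof. by rewrite !dotqE mulr_sumr; apply: eq_bigr => k _; rewrite !qcZ creZ cimZ; ring. Qed.

Lemma dotqNl v w : dotq (- v) w = - dotq v w.
Proof. by rewrite -scaleN1r dotqZl mulN1r. Qed.

Lemma dotqBl u v w : dotq (u - v) w = dotq u w - dotq v w.
Proof. by rewrite dotqDl dotqNl. Qed.

Lemma dotq0l w : dotq 0 w = 0.
Proof. by rewrite dotqE big1 // => k _; rewrite qc0 !mul0r addr0. Qed.

Lemma dotqDr u v w : dotq u (v + w) = dotq u v + dotq u w.
Proof. by rewrite dotqC dotqDl !(dotqC u). Qed.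

Lemma dotq_sumr (I : Type) (r : seq I) (P : pred I) v (F : I -> 'M[R]_(4, N)) :
  dotq v (\sum_(i <- r | P i) F i) = \sum_(i <- r | P i) dotq v (F i).
Proof.
by elim/big_rec2: _ => [|i x y _ <-]; [rewrite dotqC dotq0l|rewrite dotqDr].
Qed.

Lemma dotq_eq0 v : dotq v v = 0 -> v = 0.
Proof.
rewrite dotqE => /eqP; rewrite psumr_eq0 => [/allP h|k _]; last by rewrite addr_ge0 // -expr2 sqr_ge0.
apply: qc_inj => k; have := h k (mem_index_enum _); rewrite /= -!expr2 -/(sqn _) sqn_eq0 qc0.
by move=> /eqP.
Qed.

Definition J1 v := cq (fun k => 'i * qc v k).
Definition J2 v := cq (fun k => if k.2 then Num.conj (qc v (k.1, false)) else - Num.conj (qc v (k.1, true))).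

Lemma creconj (c : Cx R) : cre (Num.conj c) = cre c. Proof. by case: c. Qed.
Lemma cimconj (c : Cx R) : cim (Num.conj c) = - cim c. Proof. by case: c. Qed.

Lemma rcstrE (a : 'I_3) v :
  rcstr a v = match val a with 0%N => J1 v | 1%N => J2 v | _ => J1 (J2 v) end.
Proof.
have E1 (p : HN R N) : unquat ('i *: p.1, 'i *: p.2) = J1 (unquat p).
  rewrite /J1 /cq; congr unquat; rewrite /mkp /=; congr pair; apply/rowP => i;
  by rewrite !mxE /qc /crd quatK.
have E2 (p : HN R N) : unquat (- map_mx Num.conj p.2, map_mx Num.conj p.1) = J2 (unquat p).
  rewrite /J2 /cq; congr unquat; rewrite /mkp /=; congr pair; apply/rowP => i;
  by rewrite !mxE /qc /crd quatK.
have E : unquat (quat v) = v by apply: qc_inj => k; rewrite /qc quatK.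
by rewrite /rcstr /cstr; case: (val a) => [|[|n]]; rewrite ?E1 ?E2 ?E.
Qed.

Lemma rcstrP (P : 'M[R]_(4, N) -> Prop) :
  (forall v, P v -> P (J1 v)) -> (forall v, P v -> P (J2 v)) ->
  forall a v, P v -> P (rcstr a v).
Proof.
move=> h1 h2 a v Pv; rewrite rcstrE; case: (val a) => [|[|n]];
  [exact: h1|exact: h2|by apply/h1/h2].
Qed.

Lemma qc_J1 v k : qc (J1 v) k = 'i * qc v k. Proof. exact: qcK. Qed.

Lemma qc_J2 v k : qc (J2 v) k =
  if k.2 then Num.conj (qc v (k.1, false)) else - Num.conj (qc v (k.1, true)).
Proof. exact: qcK. Qed.

Lemma J2J1 v : J2 (J1 v) = - J1 (J2 v).
Proof.
apply: qc_inj => k; rewrite qcN qc_J1 !qc_J2 !qc_J1; case: k.2;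
  by apply: Cx_eqP; rewrite ?(creN, cimN, creconj, cimconj, creM, cimM) /=; ring.
Qed.

Lemma J1_skew v w : dotq (J1 v) w = - dotq v (J1 w).
Proof.
rewrite !dotqE -sumrN; apply: eq_bigr => k _.
by rewrite !qc_J1 !creM !cimM /=; ring.
Qed.

Lemma J2_skew v w : dotq (J2 v) w = - dotq v (J2 w).
Proof.
rewrite !dotqE -sumrN !big_sidx; apply: eq_bigr => i _.
by rewrite !qc_J2 /= !(creN, cimN, creconj, cimconj); ring.
Qed.

Lemma rcstr_skew (a : 'I_3) v w : dotq (rcstr a v) w = - dotq v (rcstr a w).
Proof.
rewrite !rcstrE; case: (val a) => [|[|n]]; [exact: J1_skew|exact: J2_skew|].
by rewrite J1_skew J2_skew J2J1 opprK dotqC dotqNl dotqC.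
Qed.

Lemma is_derive_rcstr (V : normedModType R) (g : V -> 'M[R]_(4, N)) (a : 'I_3) x u l :
  is_derive x u g l -> is_derive x u (fun t => rcstr a (g t)) (rcstr a l).
Proof.
have h1 (f : V -> 'M[R]_(4, N)) l' : is_derive x u f l' -> is_derive x u (fun t => J1 (f t)) (J1 l').
  rewrite !is_derive_qc => h k; rewrite qc_J1.
  by apply: is_cderive_eq (is_cderiveZ 'i (h k)) => t; rewrite qc_J1.
have hc (f : V -> Cx R) l' : is_cderive x u f l' -> is_cderive x u (fun t => Num.conj (f t)) (Num.conj l').
  move=> [h2 h3]; split; rewrite ?creconj ?cimconj.
    by apply: is_derive_near h2; apply: nearW => t; rewrite creconj.
  by apply: is_derive_near (is_deriveN h3); apply: nearW => t; rewrite cimconj.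
have h2 (f : V -> 'M[R]_(4, N)) l' : is_derive x u f l' -> is_derive x u (fun t => J2 (f t)) (J2 l').
  rewrite !is_derive_qc => h k; rewrite qc_J2; case E : k.2.
    by apply: is_cderive_eq (hc _ _ (h _)) => t; rewrite qc_J2 E.
  by apply: is_cderive_eq (is_cderiveN (hc _ _ (h _))) => t; rewrite qc_J2 E.
move=> h; rewrite rcstrE; apply: (is_derive_near (f := fun t =>
    match val a with 0%N => J1 (g t) | 1%N => J2 (g t) | _ => J1 (J2 (g t)) end)).
  by apply: nearW => t; rewrite rcstrE.
by case: (val a) => [|[|n]]; [exact: h1|exact: h2|apply: h1; exact: h2].
Qed.

Lemma is_derive_dotq (V : normedModType R) (f g : V -> 'M[R]_(4, N)) x u l m :
  is_derive x u f l -> is_derive x u g m ->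
  is_derive x u (fun t => dotq (f t) (g t)) (dotq l (g x) + dotq (f x) m).
Proof.
move=> /is_derive_mx hf /is_derive_mx hg.
have h := @is_derive_sum _ _ _ 4 (fun r => \sum_i (fun t => f t r i * g t r i)) x u _ (fun r =>
  @is_derive_sum _ _ _ N (fun i t => f t r i * g t r i) x u _ (fun i => is_derive_mulr (hf r i) (hg r i))).
rewrite (_ : (fun t => _) = \sum_(r < 4) \sum_(i < N) (fun t => f t r i * g t r i)); last first.
  by apply/funext => t; rewrite fct_sumE; apply: eq_bigr => r _; rewrite fct_sumE.
apply: (is_derive_eq h); rewrite /dotq -big_split; apply: eq_bigr => r _ /=.
by rewrite -big_split; apply: eq_bigr => i _ /=; rewrite addrC.
Qed.

End QuaternionicVectors.

Section Rotations.
Variables (R : realType) (N d : nat) (K : subtorus R N d).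
Notation wt := (wt K).
Implicit Types (y z : 'rV[R]_d) (v w : 'M[R]_(4, N)).

(* the infinitesimal action of k, normalised to have no factor 2 pi *)
Definition rotq y v := cq (fun k => 'i * rC (pairing (wt k) y) * qc v k).

Lemma qc_rotq y v k : qc (rotq y v) k = 'i * rC (pairing (wt k) y) * qc v k.
Proof. exact: qcK. Qed.

Lemma rotqDl y z v : rotq (y + z) v = rotq y v + rotq z v.
Proof. by apply: qc_inj => k; rewrite qcD !qc_rotq pairingDr rCD; ring. Qed.

Lemma rotqZl c y v : rotq (c *: y) v = c *: rotq y v.
Proof. by apply: qc_inj => k; rewrite qcZ !qc_rotq pairingZr rCM; ring. Qed.

Lemma rotqDr y v w : rotq y (v + w) = rotq y v + rotq y w.
Proof. by apply: qc_inj => k; rewrite qcD !qc_rotq qcD; ring. Qed.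

Lemma rotqNr y v : rotq y (- v) = - rotq y v.
Proof. by apply: qc_inj => k; rewrite qcN !qc_rotq qcN; ring. Qed.

Lemma rotqNl y v : rotq (- y) v = - rotq y v.
Proof. by rewrite -scaleN1r rotqZl scaleN1r. Qed.

Lemma rotqBr y v w : rotq y (v - w) = rotq y v - rotq y w.
Proof. by rewrite rotqDr rotqNr. Qed.

Lemma rotqBl y z v : rotq (y - z) v = rotq y v - rotq z v.
Proof. by rewrite rotqDl rotqNl. Qed.

Lemma rotqC y z v : rotq y (rotq z v) = rotq z (rotq y v).
Proof. by apply: qc_inj => k; rewrite !qc_rotq; ring. Qed.

Lemma rotq_skew y v w : dotq (rotq y v) w = - dotq v (rotq y w).
Proof.
rewrite !dotqE -sumrN; apply: eq_bigr => k _.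
by rewrite !qc_rotq !creM !cimM /=; ring.
Qed.

(** For [J2], the sign from conjugating ['i] is compensated by the opposite weight of the partner
    coordinate. *)
Lemma rotq_rcstr y a v : rotq y (rcstr a v) = rcstr a (rotq y v).
Proof.
have h1 u : rotq y (J1 u) = J1 (rotq y u).
  by apply: qc_inj => k; rewrite !(qc_rotq, qc_J1); ring.
have h2 u : rotq y (J2 u) = J2 (rotq y u).
  apply: qc_inj => -[i b]; rewrite qc_rotq !qc_J2 !qc_rotq.
  have := wt_negb K i false => /= ->; rewrite pairingNl rCN.
  by case: b => /=; rewrite ?pairingNl; apply: Cx_eqP;
    rewrite !(creN, cimN, creconj, cimconj, creM, cimM) /=; rewrite ?mulN1r; try ring.
by rewrite !rcstrE; case: (val a) => [|[|n]]; rewrite ?h1 ?h2.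
Qed.

Lemma is_derive_rotq (V : normedModType R) (a : V -> 'rV[R]_d) (g : V -> 'M[R]_(4, N)) x u a' l :
  is_derive x u a a' -> is_derive x u g l ->
  is_derive x u (fun t => rotq (a t) (g t)) (rotq (a x) l + rotq a' (g x)).
Proof.
move=> /is_derive_mx ha; rewrite !is_derive_qc => hg k.
rewrite qcD !qc_rotq.
have hp : is_derive x u (fun t => pairing (wt k) (a t)) (pairing (wt k) a').
  have h := @is_derive_sum _ _ _ d (fun j t => wt k 0 j * a t 0 j) x u _ (fun j =>
    is_derive_mulr (is_derive_cst (wt k 0 j) x u) (ha 0 j)).
  rewrite (_ : (fun t => _) = \sum_(j < d) (fun t => wt k 0 j * a t 0 j)); last first.
    by apply/funext => t; rewrite fct_sumE.
  by apply: (is_derive_eq h); apply: eq_bigr => j _; rewrite mul0r addr0.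
have h := is_cderiveM (is_cderiveZ 'i (is_cderive_rC hp)) (hg k).
by apply: is_cderive_eq h => t; rewrite qc_rotq.
Qed.

Lemma rotq_entries y v i : [/\ rotq y v 0 i = - (pairing (wt (i, false)) y * v 1 i),
  rotq y v 1 i = pairing (wt (i, false)) y * v 0 i,
  rotq y v 2%:R i = - (pairing (wt (i, true)) y * v 3%:R i) &
  rotq y v 3%:R i = pairing (wt (i, true)) y * v 2%:R i].
Proof.
have := qc_rotq y v (i, false); have := qc_rotq y v (i, true); rewrite !qcE => h1 h2.
have [-> ->] := cof_inj (etrans h2 (esym (cofK _))).
have [-> ->] := cof_inj (etrans h1 (esym (cofK _))).
by rewrite !(creM, cimM) /=; split; ring.
Qed.

End Rotations.

(** * The Levi-Civita connection of the quotient *)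

Lemma smooth_on_eq (R : realType) (E F : normedModType R) (O : set E) (f g : E -> F) :
  (forall x, O x -> f x = g x) -> smooth_on O g -> smooth_on O f.
Proof.
move=> fg [oO sg]; split => // vs x Ox.
have nO y : O y -> nbhs y O by move=> Oy; exact: open_nbhs_nbhs.
suff h : forall y, O y -> foldr (fun v (g : E -> F) y => 'D_v g y) g vs y =
    foldr (fun v (g : E -> F) y => 'D_v g y) f vs y.
  by apply: near_eq_diff (sg vs x Ox); apply: filterS (nO x Ox).
elim: vs {x Ox sg} => [|v vs IH] y Oy /=; first by rewrite fg.
by apply: near_eq_derive; apply: filterS (nO y Oy).
Qed.

Section Parallel.
Variables (R : realType) (N d : nat) (K : subtorus R N d).
Implicit Types (Lv Lw Dv Dw Gv Gw : 'M[R]_(4, N)).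

(** The correction by the infinitesimal action is skew-symmetric, so its two contributions to the
    derivative of the metric cancel. *)
Lemma parallel_dotq y Lv Lw Dv Dw Gv Gw :
  dotq Gv Lw = dotq (Dv - rotq K y Lv) Lw -> dotq Gw Lv = dotq (Dw - rotq K y Lw) Lv ->
  dotq Dv Lw + dotq Lv Dw = dotq Gv Lw + dotq Lv Gw.
Proof.
move=> hv hw; rewrite (dotqC Lv Gw) hv hw !dotqBl rotq_skew.
by rewrite (dotqC (rotq K y Lw)) (dotqC Dw); ring.
Qed.

(** Moving [I_a] to the other argument leaves it a horizontal lift, where the connection is
    characterised; the corrections cancel because the infinitesimal action is skew and commutes with
    [I_a]. *)
Lemma parallel_rcstr a y Lv Lw Lv' Lw' Dv Dw Gv Gw : rcstr a Lv = Lv' -> rcstr a Lw = Lw' ->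
  dotq Gv Lw' = dotq (Dv - rotq K y Lv) Lw' -> dotq Gw Lv' = dotq (Dw - rotq K y Lw) Lv' ->
  dotq (rcstr a Dv) Lw + dotq (rcstr a Lv) Dw =
  dotq (rcstr a Gv) Lw + dotq (rcstr a Lv) Gw.
Proof.
move=> hv' hw' hv hw; rewrite (rcstr_skew a Dv Lw) (rcstr_skew a Gv Lw) hv' hw'.
rewrite (dotqC Lv' Gw) (dotqC Lv' Dw) hv hw !dotqBl.
have -> : dotq (rotq K y Lv) Lw' = dotq (rotq K y Lw) Lv'.
  have := rcstr_skew a (rotq K y Lv) Lw.
  by rewrite -rotq_rcstr rotq_skew hv' hw' (dotqC Lv') => /eqP; rewrite eqr_opp => /eqP ->.
by ring.
Qed.

End Parallel.

Lemma commutator_cancel (R : realType) m n (a b c e f g : 'M[R]_(m, n)) :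
  a - (b + c) - (e - f) - (a - (e + g) - (b - f)) = g - c.
Proof. by apply/matrixP => i j; rewrite !mxE; ring. Qed.

Section Connection.
Variables (R : realType) (N d m : nat) (K : subtorus R N d).
Variables (Om : set 'rV[R]_m) (B : ('rV[R]_m -> R) -> Prop).
Hypothesis oOm : open Om.
Hypothesis hB : forall b, B b -> (forall x, Om x -> differentiable b x) /\
  forall v, exists2 g, elem Om B g & forall x, Om x -> 'D_v b x = g x.
Notation elem := (elem Om B).
Variables (phi : 'rV[R]_m -> 'M[R]_(4, N)) (xi : 'rV[R]_m -> 'rV[R]_m -> 'rV[R]_d).
Hypothesis phi_elem : forall r i, elem (fun x => phi x r i).
Hypothesis xi_elem : forall u j, exists2 g, elem g & forall x, Om x -> xi x u 0 j = g x.
Hypothesis xi_lin : forall x c u v, Om x -> xi x (c *: u + v) = c *: xi x u + xi x v.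

Definition hlift x u := 'D_u phi x - rotq K (xi x u) (phi x).

Hypothesis hlift_ortho : forall x u y, Om x -> dotq (hlift x u) (rotq K y (phi x)) = 0.
Hypothesis hlift_inj : forall x u, Om x -> hlift x u = 0 -> u = 0.
Hypothesis hlift_rcstr : forall x a w, Om x -> exists w', rcstr a (hlift x w) = hlift x w'.

Let elem_rotq (y : 'rV[R]_m -> 'rV[R]_d) (q : 'rV[R]_m -> 'M[R]_(4, N)) :
  (forall j, elem (fun x => y x 0 j)) -> (forall r i, elem (fun x => q x r i)) ->
  forall r i, elem (fun x => rotq K (y x) (q x) r i).
Proof.
move=> ey eq r i.
have ep k : elem (fun x => pairing (wt K k) (y x)).
  by apply: elem_sum => j; apply: elem_mul => //; exact: elem_cst.
have ep' k r' : elem (fun x => pairing (wt K k) (y x) * q x r' i) by exact: elem_mul.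
by move: r; apply: ord4P;
  [apply: (elem_eq _ (elem_opp (ep' (i, false) 1)))|apply: (elem_eq _ (ep' (i, false) 0))|
   apply: (elem_eq _ (elem_opp (ep' (i, true) 3%:R)))|apply: (elem_eq _ (ep' (i, true) 2%:R))] => x;
  have [e0 e1 e2 e3] := rotq_entries K (y x) (q x) i; rewrite ?e0 ?e1 ?e2 ?e3.
Qed.

Let xi_mx u : exists2 g : 'rV[R]_m -> 'rV[R]_d, (forall i j, elem (fun x => g x i j)) &
  forall x, Om x -> xi x u = g x.
Proof.
have /choice[g gP] j : exists g, elem g /\ forall x, Om x -> xi x u 0 j = g x.
  by have [g eg gE] := xi_elem u j; exists g.
exists (fun x => \row_j g j x) => [i j|x Ox].
  by apply: (elem_eq (f := g j)) => [x|]; [rewrite mxE|exact: (gP j).1].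
by apply/rowP => j; rewrite mxE (gP j).2.
Qed.

Lemma hlift_elem u : exists2 g : 'rV[R]_m -> 'M[R]_(4, N), (forall r i, elem (fun x => g x r i)) &
  forall x, Om x -> hlift x u = g x.
Proof.
have [f ef fE] := elem_derive_mx hB u phi_elem; have [g eg gE] := xi_mx u.
exists (fun x => f x - rotq K (g x) (phi x)) => [r i|x Ox]; last by rewrite /hlift fE // gE.
apply: (elem_eq (f := fun x => f x r i + - rotq K (g x) (phi x) r i)) => [x|].
  by rewrite [in RHS]mxE [X in _ = _ + X]mxE.
by apply: elem_add => //; apply: elem_opp; apply: elem_rotq => // j; exact: eg.
Qed.

Lemma hlift_smooth u : smooth_on Om (hlift ^~ u).
Proof.
have [g eg gE] := hlift_elem u; apply: (smooth_on_eq (g := g)) => //.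
exact: (elem_smooth oOm hB eg).
Qed.

Let elem_is_derive (f g : 'rV[R]_m -> 'M[R]_(4, N)) u x :
  (forall r i, elem (fun x => g x r i)) -> (forall x, Om x -> f x = g x) -> Om x ->
  is_derive x u f ('D_u f x).
Proof.
move=> eg fg Ox; have dg : derivable g x u.
  by apply/derivable_mxP => i j; exact: (elem_derivable hB).
have e : {near x, g =1 f} by apply: filterS (open_nbhs_nbhs (conj oOm Ox)) => t Ot; rewrite fg.
by apply: (is_derive_near e); split => //; exact: near_eq_derive.
Qed.

Let phi_diff x : Om x -> differentiable phi x.
Proof. by move=> Ox; apply: differentiable_mx => r i; exact: (elem_diff hB (phi_elem r i)).1. Qed.

Lemma hlift_lin x c u v : Om x -> hlift x (c *: u + v) = c *: hlift x u + hlift x v.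
Proof.
move=> Ox; have dp := phi_diff Ox; rewrite /hlift !deriveE // linearP xi_lin // rotqDl rotqZl.
by rewrite scalerBr opprD addrACA.
Qed.

Section At.
Variable x : 'rV[R]_m.
Hypothesis Ox : Om x.

Let Lj j := hlift x (delta_mx 0 j).

Let hlift_sum u : hlift x u = \sum_j u 0 j *: Lj j.
Proof.
have l0 : hlift x 0 = 0 by have := hlift_lin (-1) 0 0 Ox; rewrite scaler0 addr0 scaleN1r addNr.
have lZ c w : hlift x (c *: w) = c *: hlift x w by have := hlift_lin c w 0 Ox; rewrite l0 !addr0.
have lD w w' : hlift x (w + w') = hlift x w + hlift x w'.
  by have := hlift_lin 1 w w' Ox; rewrite !scale1r.
rewrite {1}[u]row_sum_delta; elim/big_rec2: _ => // j y y' _ <-.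
by rewrite lD lZ.
Qed.

Let gm : 'M[R]_m := \matrix_(i, j) dotq (Lj i) (Lj j).

Let gm_row z j : (z *m gm) 0 j = dotq (hlift x z) (Lj j).
Proof.
rewrite mxE hlift_sum dotqC dotq_sumr; apply: eq_bigr => i _.
by rewrite mxE [in RHS]dotqC dotqZl.
Qed.

Let gm_unit : gm \in unitmx.
Proof.
rewrite -row_free_unit; apply: inj_row_free => z zg; apply: (hlift_inj Ox); apply: dotq_eq0.
rewrite {2}hlift_sum dotq_sumr big1 // => j _.
by rewrite dotqC dotqZl dotqC -gm_row zg mxE mulr0.
Qed.

Let W u v := 'D_u (hlift^~ v) x - rotq K (xi x u) (hlift x v).

Let Gam u v : 'rV[R]_m := (\row_j dotq (W u v) (Lj j)) *m invmx gm.

Let GamP u v w : dotq (hlift x (Gam u v)) (hlift x w) = dotq (W u v) (hlift x w).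
Proof.
rewrite (hlift_sum w) !dotq_sumr; apply: eq_bigr => j _.
rewrite dotqC dotqZl dotqC -gm_row /Gam mulmxKV ?gm_unit // mxE.
by rewrite [in RHS]dotqC dotqZl [in RHS]dotqC.
Qed.

Lemma dhlift u v : is_derive x u (hlift^~ v) ('D_u (hlift^~ v) x).
Proof. by have [g eg gE] := hlift_elem v; exact: (elem_is_derive u eg gE Ox). Qed.

Let schwarz_phi u v : 'D_u (fun t => 'D_v phi t) x = 'D_v (fun t => 'D_u phi t) x.
Proof.
have [fu efu fuE] := elem_derive_mx hB u phi_elem.
have [fv efv fvE] := elem_derive_mx hB v phi_elem.
have [fuv efuv fuvE] := elem_derive_mx hB u efv.
have [fvu efvu fvuE] := elem_derive_mx hB v efu.
have nO : nbhs x Om by exact: open_nbhs_nbhs.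
have dE (g : 'rV[R]_m -> 'M[R]_(4, N)) w g' : (forall r i, elem (fun x => g x r i)) ->
    (forall y, Om y -> 'D_w g y = g' y) ->
    forall r i y, Om y -> is_derive y w (fun t => g t r i) (g' y r i).
  move=> eg gE r i y Oy; have [] := is_derive_mx g y w (g' y).
  move=> h _; apply: h; rewrite -gE //.
  by apply: (elem_is_derive w eg _ Oy).
have -> : 'D_u (fun t => 'D_v phi t) x = fuv x.
  by rewrite -fuvE //; apply: near_eq_derive; apply: filterS nO => t Ot; rewrite fvE.
have -> : 'D_v (fun t => 'D_u phi t) x = fvu x.
  by rewrite -fvuE //; apply: near_eq_derive; apply: filterS nO => t Ot; rewrite fuE.
apply/matrixP => r i.
apply: (@schwarz R _ Om x u v (fun t => phi t r i) (fun t => fu t r i) (fun t => fv t r i)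
  (fun t => fuv t r i) (fun t => fvu t r i)) => //.
- exact: dE.
- exact: dE.
- exact: dE.
- exact: dE.
- exact: (elem_continuous hB (efuv r i) Ox).
- exact: (elem_continuous hB (efvu r i) Ox).
Qed.

(** Second derivatives of [phi] are symmetric and the infinitesimal rotations commute. What remains
    is vertical, hence invisible to horizontal lifts: the torsion vanishes. *)
Let W_sym u v : exists z, W u v - W v u = rotq K z (phi x).
Proof.
have Wh a b : W a b = 'D_a (fun t => 'D_b phi t) x -
    (rotq K (xi x b) ('D_a phi x) + rotq K ('D_a (xi^~ b) x) (phi x)) -
    (rotq K (xi x a) ('D_b phi x) - rotq K (xi x a) (rotq K (xi x b) (phi x))).
  have -> : W a b = 'D_a (hlift^~ b) x -
      (rotq K (xi x a) ('D_b phi x) - rotq K (xi x a) (rotq K (xi x b) (phi x))).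
    by rewrite /W [hlift x b]/hlift rotqBr.
  apply: (congr1 (fun z => z - _)).
  have [f ef fE] := elem_derive_mx hB b phi_elem; have [g eg gE] := xi_mx b.
  have h1 := elem_is_derive a ef fE Ox.
  have h2 : is_derive x a phi ('D_a phi x) by exact: (elem_is_derive a phi_elem).
  have h3 : is_derive x a (xi^~ b) ('D_a (xi^~ b) x).
    have dg : derivable g x a by apply/derivable_mxP => i j; exact: (elem_derivable hB).
    have e : {near x, g =1 xi^~ b}.
      by apply: filterS (open_nbhs_nbhs (conj oOm Ox)) => t Ot; rewrite gE.
    by apply: (is_derive_near e); split => //; exact: near_eq_derive.
  have [_ <-] := is_deriveB h1 (is_derive_rotq K h3 h2).
  by [].
exists ('D_v (xi^~ u) x - 'D_u (xi^~ v) x).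
rewrite !Wh schwarz_phi [rotq K (xi x v) (rotq K (xi x u) _)]rotqC rotqBl.
set a := 'D_v _ x; set b := rotq K (xi x v) _; set c := rotq K ('D_u _ x) _.
set e := rotq K (xi x u) ('D_v _ _); set f := rotq K (xi x u) _; set g := rotq K ('D_v _ _) _.
exact: commutator_cancel.
Qed.

Lemma hlift_connection : exists G : 'rV[R]_m -> 'rV[R]_m -> 'rV[R]_m, (forall u v, G u v = G v u) /\
  forall u v w, dotq (hlift x (G u v)) (hlift x w) =
    dotq ('D_u (hlift^~ v) x - rotq K (xi x u) (hlift x v)) (hlift x w).
Proof.
exists Gam; split=> [u v|]; last exact: GamP.
apply: (congr1 (fun z => z *m _)); apply/rowP => j; rewrite [LHS]mxE [RHS]mxE.
apply/eqP; rewrite -subr_eq0 -dotqBl.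
by have [z ->] := W_sym u v; rewrite dotqC hlift_ortho.
Qed.

End At.

Lemma connection x : Om x -> exists G : 'rV[R]_m -> 'rV[R]_m -> 'rV[R]_m,
  [/\ forall u v, G u v = G v u,
      forall u v w, 'D_u (fun y => dotq (hlift y v) (hlift y w) : R^o) x =
        dotq (hlift x (G u v)) (hlift x w) + dotq (hlift x v) (hlift x (G u w)) &
      forall a u v w, 'D_u (fun y => dotq (rcstr a (hlift y v)) (hlift y w) : R^o) x =
        dotq (rcstr a (hlift x (G u v))) (hlift x w) +
        dotq (rcstr a (hlift x v)) (hlift x (G u w))].
Proof.
move=> Ox; have [G [Gsym GP]] := hlift_connection Ox; exists G; split=> [//|u v w|a u v w].
  have [_ ->] := is_derive_dotq (dhlift Ox u v) (dhlift Ox u w).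
  exact: (parallel_dotq (GP u v w) (GP u w v)).
have [_ ->] := is_derive_dotq (is_derive_rcstr a (dhlift Ox u v)) (dhlift Ox u w).
have [w' w'E] := hlift_rcstr a w Ox; have [v' v'E] := hlift_rcstr a v Ox.
exact: (parallel_rcstr v'E w'E (GP u v w') (GP u w v')).
Qed.

End Connection.

Lemma elem_mono (R : realType) (V : normedModType R) (O : set V) (B B' : (V -> R) -> Prop) f :
  (forall b, B b -> B' b) -> elem O B f -> elem O B' f.
Proof.
move=> BB'; elim=> {f} [b /BB'|c|f g _ ef _ eg|f g _ ef _ eg|f _ ef f0].
- exact: elem_base.
- exact: elem_cst.
- exact: elem_add.
- exact: elem_mul.
- exact: elem_inv.
Qed.

Section ImplicitElementary.
Variables (R : realType) (N d : nat) (K : subtorus R N d) (V : normedModType R) (O : set V).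
Notation wt := (wt K).
Variables (c : V -> sidx N -> R) (y : V -> 'rV[R]_d) (al : 'rV[R]_d).
Hypothesis oO : open O.
Hypothesis c_ge0 : forall x k, 0 <= c x k.
Hypothesis hy : forall x, O x -> \sum_k (c x k * expR (2 * pairing (wt k) (y x))) *: wt k = al.
Hypothesis hsep : forall x z, O x -> (forall k, 0 < c x k -> pairing (wt k) z = 0) -> z = 0.
Variable B0 : (V -> R) -> Prop.
Hypothesis hB0 : forall b, B0 b -> (forall x, O x -> differentiable b x) /\
  forall v, exists2 g, elem O B0 g & forall x, O x -> 'D_v b x = g x.
Hypothesis c_elem : forall k, elem O B0 (fun x => c x k).

Definition implicit_base (b : V -> R) :=
  B0 b \/ exists k, b = fun x => expR (pairing (wt k) (y x)).
Notation B := implicit_base.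

(** The derivative of [y] is a rational expression in the coefficients, their derivatives and the
    exponentials of the weights at [y]. Adjoining these exponentials to the generators therefore
    closes the class under differentiation. *)
Lemma implicit_baseP b : B b -> (forall x, O x -> differentiable b x) /\
  forall v, exists2 g, elem O B g & forall x, O x -> 'D_v b x = g x.
Proof.
have mono f : elem O B0 f -> elem O B f by apply: elem_mono => b' hb; left.
case=> [/hB0[db Db]|[k ->]].
  by split => // v; have [g eg gE] := Db v; exists g => //; exact: mono.
have hc x k' : O x -> differentiable (c^~ k') x by exact: (elem_diff hB0 (c_elem k')).1.
have dy := implicit_diff_at oO c_ge0 hy hsep hc.
pose f x := pairing (wt k) (y x).
have fE : f = \sum_j (fun x => wt k 0 j * y x 0 j).
  by apply/funext => x; rewrite fct_sumE.
have dj x j : O x -> differentiable (fun x => wt k 0 j * y x 0 j) x.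
  by move=> Ox; apply: differentiableM; [exact: differentiable_cst|exact: (dy x Ox j).1].
have df x : O x -> differentiable f x.
  by move=> Ox; rewrite fE; apply: differentiable_sum => j; exact: dj.
have dexp (s : R) : differentiable (@expR R) s by apply/derivable1_diffP; have [] := is_derive_expR s.
have Df x v : O x -> 'D_v (fun x => expR (f x)) x =
    expR (f x) * \sum_j wt k 0 j * 'D_v (fun x => y x 0 j) x.
  move=> Ox; have dfx := df x Ox; have dc := differentiable_comp dfx (dexp (f x)).
  rewrite (deriveE _ dc) (diff_comp dfx (dexp _)) /= (diff1E (dexp _)) derive1E.
  have [_ ->] := is_derive_expR (f x); rewrite [LHS]mulrC -(deriveE _ dfx) fE.
  rewrite derive_sum => [|j]; last by apply: diff_derivable; exact: dj.
  congr (_ * _); apply: eq_bigr => j _; rewrite deriveM; [|exact: derivable_cst|].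
    by rewrite derive_cst scaler0 addr0.
  by apply: diff_derivable; exact: (dy x Ox j).1.
split=> [x Ox|v]; first by apply: (differentiable_comp (df x Ox)); exact: dexp.
have eE k' : elem O B (fun x => expR (2 * pairing (wt k') (y x))).
  apply: (elem_eq (f := fun x => expR (pairing (wt k') (y x)) * expR (pairing (wt k') (y x)))) => [x|].
    by rewrite -expRD mulr_natl mulr2n.
  by apply: elem_mul; apply: elem_base; right; exists k'.
pose G x := gram K (fun k => 2 * c x k * expR (2 * pairing (wt k) (y x))).
have eG i j : elem O B (fun x => G x i j).
  apply: (elem_eq (f := fun x => \sum_k' 2 * c x k' * expR (2 * pairing (wt k') (y x)) *
      ((wt k')^T *m wt k') i j)) => [x|].
    by rewrite summxE; apply: eq_bigr => k' _; rewrite [RHS]mxE.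
  apply: elem_sum => k'; apply: elem_mul; last exact: elem_cst.
  by apply: elem_mul => //; apply: elem_mul; [exact: elem_cst|exact: mono].
have uG x : O x -> G x \in unitmx.
  move=> Ox; apply: gram_unit => [k'|z h]; first by rewrite mulr_ge0 ?expR_ge0 // mulr_ge0.
  by apply: (hsep Ox) => k' ck; apply: h; rewrite mulr_gt0 ?expR_gt0 // mulr_gt0.
have /choice[D DP] k' : exists g, elem O B g /\ forall x, O x -> 'D_v (c^~ k') x = g x.
  by have [_ /(_ v)[g eg gE]] := elem_diff hB0 (c_elem k'); exists g; split => //; exact: mono.
have /choice[I IP] (ij : 'I_d * 'I_d) : exists g, elem O B g /\
    forall x, O x -> invmx (G x) ij.1 ij.2 = g x.
  by have [g eg gE] := elem_invmx eG uG ij.1 ij.2; exists g.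
exists (fun x => expR (f x) * \sum_j wt k 0 j *
   - \sum_i (\sum_k' D k' x * expR (2 * pairing (wt k') (y x)) * wt k' 0 i) * I (i, j) x).
  apply: elem_mul; first by apply: elem_base; right; exists k.
  apply: elem_sum => j; apply: elem_mul; first exact: elem_cst.
  apply: elem_opp; apply: elem_sum => i; apply: elem_mul; last exact: (IP (i, j)).1.
  apply: elem_sum => k'; apply: elem_mul; last exact: elem_cst.
  by apply: elem_mul => //; exact: (DP k').1.
move=> x Ox; rewrite Df //; congr (_ * _); apply: eq_bigr => j _; congr (_ * _).
rewrite (dy x Ox j).2; congr (- _); apply: eq_bigr => i _.
rewrite -[I _ _](IP (i, j)).2 //; congr (_ * _); apply: eq_bigr => k' _.
by rewrite (DP k').2.
Qed.

End ImplicitElementary.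

Section ComplexElementary.
Variables (R : realType) (V : normedModType R) (O : set V) (B : (V -> R) -> Prop).

Definition celem (f : V -> Cx R) :=
  elem O B (fun x => cre (f x)) /\ elem O B (fun x => cim (f x)).

Lemma celem_eq f g : f =1 g -> celem f -> celem g.
Proof. by move=> /funext ->. Qed.

Lemma celem_cst a : celem (fun=> a).
Proof. by split; exact: elem_cst. Qed.

Lemma celem_add f g : celem f -> celem g -> celem (fun x => f x + g x).
Proof.
move=> [f1 f2] [g1 g2]; split.
  by apply: elem_eq (elem_add f1 g1) => x; rewrite creD.
by apply: elem_eq (elem_add f2 g2) => x; rewrite cimD.
Qed.

Lemma celem_mul f g : celem f -> celem g -> celem (fun x => f x * g x).
Proof.
move=> [f1 f2] [g1 g2]; split.
  by apply: elem_eq (elem_add (elem_mul f1 g1) (elem_opp (elem_mul f2 g2))) => x; rewrite creM.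
by apply: elem_eq (elem_add (elem_mul f1 g2) (elem_mul f2 g1)) => x; rewrite cimM.
Qed.

Lemma celem_opp f : celem f -> celem (fun x => - f x).
Proof.
by move=> h; apply: celem_eq (celem_mul (celem_cst (-1)) h) => x; rewrite mulN1r.
Qed.

Lemma celem_rC f : elem O B f -> celem (fun x => rC (f x)).
Proof. by split => //; exact: elem_cst. Qed.

Lemma celem_sum (I : Type) (r : seq I) (P : pred I) (f : I -> V -> Cx R) :
  (forall i, celem (f i)) -> celem (fun x => \sum_(i <- r | P i) f i x).
Proof.
move=> h; split.
  apply: (elem_eq (f := fun x => \sum_(i <- r | P i) cre (f i x))) => [x|]; first by rewrite cre_sum.
  by apply: elem_sum => i; exact: (h i).1.
apply: (elem_eq (f := fun x => \sum_(i <- r | P i) cim (f i x))) => [x|]; first by rewrite cim_sum.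
by apply: elem_sum => i; exact: (h i).2.
Qed.

Lemma elem_sqn f : celem f -> elem O B (fun x => sqn (f x)).
Proof.
by move=> [h1 h2]; apply: elem_add; rewrite /=; apply: elem_mul.
Qed.

Lemma celem_prod (I : Type) (r : seq I) (P : pred I) (f : I -> V -> Cx R) :
  (forall i, celem (f i)) -> celem (fun x => \prod_(i <- r | P i) f i x).
Proof.
move=> h; elim: r => [|i r IH].
  by apply: celem_eq (celem_cst 1) => x; rewrite big_nil.
case E : (P i).
  by apply: celem_eq (celem_mul (h i) IH) => x; rewrite big_cons E.
by apply: celem_eq IH => x; rewrite big_cons E.
Qed.

Lemma celem_inv f : celem f -> (forall x, O x -> f x != 0) -> celem (fun x => (f x)^-1).
Proof.
move=> h f0; have hn : elem O B (fun x => (sqn (f x))^-1).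
  by apply: elem_inv; [exact: elem_sqn|move=> x Ox; rewrite sqn_eq0 f0].
have [h1 h2] := h; split.
  by apply: elem_eq (elem_mul h1 hn) => x; rewrite cinvE creZ mulrC.
by apply: elem_eq (elem_mul (elem_opp h2) hn) => x; rewrite cinvE cimZ mulrC.
Qed.

Lemma celem_expz f (z : int) : celem f -> (forall x, O x -> f x != 0) -> celem (fun x => f x ^ z).
Proof.
move=> h f0; have hn n : celem (fun x => f x ^+ n).
  elim: n => [|n IH]; first exact: celem_cst.
  by apply: celem_eq (celem_mul h IH) => x; rewrite exprS.
case: z => n; first exact: hn.
by apply: celem_inv; [exact: hn|move=> x Ox; apply: expf_neq0; exact: f0].
Qed.

End ComplexElementary.

(** * Linearised moment maps *)

Lemma coord_base (R : realType) m n (O : set 'M[R]_(m, n)) (b : 'M[R]_(m, n) -> R) :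
  let B b := exists i j, b = fun x : 'M[R]_(m, n) => x i j in
  B b -> (forall x, O x -> differentiable b x) /\
  forall v, exists2 g, elem O B g & forall x, O x -> 'D_v b x = g x.
Proof.
move=> B [i [j ->]]; split=> [x _|v]; first exact: differentiable_coord.
exists (fun=> v i j) => [|x _]; first exact: elem_cst.
have [] // : is_derive x v (fun x : 'M[R]_(m, n) => x i j) (v i j).
by have [h _] := is_derive_mx id x v v; apply: h; exact: is_derive_id.
Qed.

Lemma is_derive_bigsum (R : realType) (V : normedModType R) (I : Type) (r : seq I)
    (f : I -> V -> R) x v (l : I -> R) : (forall i, is_derive x v (f i) (l i)) ->
  is_derive x v (fun t => \sum_(i <- r) f i t) (\sum_(i <- r) l i).
Proof.
move=> h; elim: r => [|i r IH].
  rewrite big_nil; apply: is_derive_near (is_derive_cst 0 x v).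
  by apply: nearW => t; rewrite big_nil.
rewrite big_cons; apply: is_derive_near (is_deriveD (h i) IH).
by apply: nearW => t; rewrite big_cons.
Qed.

Section TangentConditions.
Variables (R : realType) (N d : nat) (K : subtorus R N d).
Notation wt := (wt K).
Implicit Types (p v w : 'M[R]_(4, N)) (y : 'rV[R]_d).

(* the linearised moment map equations of mu_1 and mu_C at p *)
Definition dmu1 p v := forall y, \sum_k pairing (wt k) y *
  (cre (qc p k) * cre (qc v k) + cim (qc p k) * cim (qc v k)) = 0.
Definition dmuC p v := forall y, \sum_i rC (pairing (wt (i, false)) y) *
  (qc p (i, false) * qc v (i, true) + qc v (i, false) * qc p (i, true)) = 0.
(* [dmu1] together with orthogonality to the orbit directions *)
Definition dmu1C p v := forall y, \sum_k rC (pairing (wt k) y) * (Num.conj (qc p k) * qc v k) = 0.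

Lemma dotq_rotq v y p : dotq v (rotq K y p) =
  \sum_k pairing (wt k) y * (cre (qc p k) * cim (qc v k) - cim (qc p k) * cre (qc v k)).
Proof.
rewrite dotqE; apply: eq_bigr => k _; rewrite qc_rotq !(creM, cimM) /=; ring.
Qed.

(** The real and imaginary parts of one complex equation; being complex linear in [v], it is
    invariant under [J1]. *)
Lemma dmu1CP p v : dmu1C p v <-> dmu1 p v /\ forall y, dotq v (rotq K y p) = 0.
Proof.
have E y : \sum_k rC (pairing (wt k) y) * (Num.conj (qc p k) * qc v k) =
    cof (\sum_k pairing (wt k) y * (cre (qc p k) * cre (qc v k) + cim (qc p k) * cim (qc v k)))
        (dotq v (rotq K y p)).
  rewrite dotq_rotq; apply: Cx_eqP; rewrite ?cre_sum ?cim_sum /=; apply: eq_bigr => k _.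
    by rewrite creZ creM creconj cimconj; ring.
  by rewrite cimZ cimM creconj cimconj; ring.
split=> [h|[h1 h2] y]; last by rewrite E h1 h2.
have h' y : _ := etrans (esym (E y)) (h y).
by split=> y; have [] := cof_inj (h' y).
Qed.

Lemma dmu1C_J1 p v : dmu1C p v -> dmu1C p (J1 v).
Proof.
move=> h y; have := congr1 ( *%R 'i) (h y); rewrite mulr0 mulr_sumr => E.
apply: etrans E; apply: eq_bigr => k _.
by rewrite qc_J1; ring.
Qed.

Lemma dmuC_J1 p v : dmuC p v -> dmuC p (J1 v).
Proof.
move=> h y; have := congr1 ( *%R 'i) (h y); rewrite mulr0 mulr_sumr => E.
apply: etrans E; apply: eq_bigr => k _.
by rewrite !qc_J1; ring.
Qed.

Let conj_sum (I : finType) (F : I -> Cx R) : Num.conj (\sum_i F i) = \sum_i Num.conj (F i).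
Proof. exact: rmorph_sum. Qed.

Let conj_rC (a : R) : Num.conj (rC a) = rC a.
Proof. by apply: Cx_eqP; rewrite ?creconj ?cimconj /= ?oppr0. Qed.

Lemma wt_true i y : pairing (wt (i, true)) y = - pairing (wt (i, false)) y.
Proof. by rewrite -[true]/(~~ false) wt_negb pairingNl. Qed.

(** Conjugation exchanges the two complex equations under [J2], so together they define a
    quaternionic subspace. *)
Lemma dmu1C_J2 p v : dmuC p v -> dmu1C p (J2 v).
Proof.
move=> h y; have := congr1 Num.conj (h y); rewrite conj_sum rmorph0 => /(congr1 -%R).
rewrite oppr0 -sumrN => E; apply: etrans E; rewrite big_sidx; apply: eq_bigr => i _.
rewrite !qc_J2 /= wt_true rCN !(rmorphM, rmorphD) /= conj_rC; ring.
Qed.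

Lemma dmuC_J2 p v : dmu1C p v -> dmuC p (J2 v).
Proof.
move=> h y; have := congr1 Num.conj (h y); rewrite conj_sum rmorph0 => E.
apply: etrans E; rewrite big_sidx; apply: eq_bigr => i _.
rewrite !qc_J2 /= wt_true rCN !(rmorphM, rmorphN) /= !conj_rC !conjCK; ring.
Qed.

Lemma dmu1C_sub p v w : dmu1C p v -> dmu1C p w -> dmu1C p (v - w).
Proof.
move=> hv hw y; have := congr2 (fun a b => a - b) (hv y) (hw y); rewrite subrr -sumrB => E.
apply: etrans E; apply: eq_bigr => k _; rewrite qcB; ring.
Qed.

Lemma dmu1_sub p v w : dmu1 p v -> dmu1 p w -> dmu1 p (v - w).
Proof.
move=> hv hw y; have := congr2 (fun a b => a - b) (hv y) (hw y); rewrite subrr -sumrB => E.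
apply: etrans E; apply: eq_bigr => k _; rewrite qcB creB cimB; ring.
Qed.

Lemma dmuC_sub p v w : dmuC p v -> dmuC p w -> dmuC p (v - w).
Proof.
move=> hv hw y; have := congr2 (fun a b => a - b) (hv y) (hw y); rewrite subrr -sumrB => E.
apply: etrans E; apply: eq_bigr => k _; rewrite !qcB; ring.
Qed.

Lemma dmu1_rotq p y : dmu1 p (rotq K y p).
Proof.
by move=> z; rewrite big1 // => k _; rewrite qc_rotq !(creM, cimM) /=; ring.
Qed.

Lemma dmuC_rotq p y : dmuC p (rotq K y p).
Proof.
by move=> z; rewrite big1 // => i _; rewrite !qc_rotq wt_true rCN; ring.
Qed.

Section Level.
Variables (al : 'rV[R]_d) (be : 'rV[Cx R]_d) (V : normedModType R) (g : V -> 'M[R]_(4, N)) (x u : V).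
Variable l : 'M[R]_(4, N).
Hypothesis hg : \forall t \near x, level K al be (quat (g t)).
Hypothesis dg : is_derive x u g l.

Let dgk k := (is_derive_qc g x u l).1 dg k.

Lemma level_dmu1 : dmu1 (g x) l.
Proof.
move=> y; pose f t := \sum_k pairing (wt k) y * sqn (qc (g t) k).
have fE : \forall t \near x, pi^-1 * pairing al y = f t.
  apply: filterS hg => t [<- _]; rewrite mu1E pairingZl mulKf ?gt_eqF ?pi_gt0 //.
  by rewrite pairing_suml; apply: eq_bigr => k _; rewrite pairingZl mulrC.
have df : is_derive x u f (\sum_k pairing (wt k) y *
    (2 * (cre (qc (g x) k) * cre (qc l k) + cim (qc (g x) k) * cim (qc l k)))).
  have h k : is_derive x u (fun t => pairing (wt k) y * sqn (qc (g t) k)) (pairing (wt k) y *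
      (2 * (cre (qc (g x) k) * cre (qc l k) + cim (qc (g x) k) * cim (qc l k)))).
    have [h1 h2] := dgk k.
    have hd := is_deriveD (is_derive_mulr h1 h1) (is_derive_mulr h2 h2).
    have := is_derive_mulr (is_derive_cst (pairing (wt k) y) x u) hd.
    rewrite (_ : (fun t => _ * _) = (fun t => pairing (wt k) y * sqn (qc (g t) k))) //.
    by move=> h3; apply: (is_derive_eq h3); rewrite /cst /=; ring.
  exact: is_derive_bigsum.
have h0 := is_derive_near fE (is_derive_cst _ x u).
have := is_derive_uniq df h0; rewrite -[X in _ = X -> _](mulr0 2) => h.
apply: (mulfI (_ : 2 != 0 :> R)) => //; rewrite -h mulr_sumr; apply: eq_bigr => k _; ring.
Qed.

Lemma level_dmuC : dmuC (g x) l.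
Proof.
move=> y; pose f t := \sum_i rC (pairing (wt (i, false)) y) * (qc (g t) (i, false) * qc (g t) (i, true)).
have fE : \forall t \near x, pC be y / (- 2 * rC pi * 'i) = f t.
  apply: filterS hg => t [_ <-]; rewrite pC_muC mulrC mulKf ?muC_factor_neq0 //.
  by apply: eq_bigr => k _; rewrite mulrC.
have df : is_cderive x u f (\sum_i rC (pairing (wt (i, false)) y) *
    (qc (g x) (i, false) * qc l (i, true) + qc l (i, false) * qc (g x) (i, true))).
  by apply: is_cderive_sum => i _; apply: is_cderiveZ; apply: is_cderiveM; exact: dgk.
exact: is_cderive_uniq df (is_cderive_near fE (is_cderive_cst x u _)).
Qed.

End Level.

End TangentConditions.

Section NormalizedDerivative.
Variables (R : realType) (N d : nat) (K : subtorus R N d).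
Variables (kap : 'I_d -> sidx N) (Y : 'I_d -> 'rV[R]_d) (L : {set 'I_d}).
Notation wt := (wt K).

Definition nrm_scale (p : 'M[R]_(4, N)) k : Cx R :=
  mon K Y (fun l => if l \in L then (qc p (kap l))^-1 else 1) k.

(* up to the factor [nrm_scale], the derivative of [nrm] at p in the direction v *)
Definition dnrm (p v : 'M[R]_(4, N)) k : Cx R :=
  qc v k - qc p k * \sum_(l in L) (qc v (kap l) / qc p (kap l)) *~ wcoef K Y k l.

Lemma nrm_scale_neq0 p k : chosen_neq0 kap L (quat p) -> nrm_scale p k != 0.
Proof.
move=> p0; apply: mon_neq0 => l; case: ifP => lL; last exact: oner_neq0.
by rewrite invr_eq0; exact: p0.
Qed.

Lemma is_cderive_nrm (V : normedModType R) (g : V -> 'M[R]_(4, N)) x u l k :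
  is_derive x u g l -> chosen_neq0 kap L (quat (g x)) ->
  is_cderive x u (fun t => nrm K kap Y L (quat (g t)) k) (nrm_scale (g x) k * dnrm (g x) l k).
Proof.
move=> /is_derive_qc dg p0.
pose f m t := (if m \in L then (qc (g t) (kap m))^-1 else 1) ^ wcoef K Y k m.
pose c m := (if m \in L then - (qc l (kap m) / qc (g x) (kap m)) else 0) *~ wcoef K Y k m.
have df m : is_clog x u (f m) (c m).
  rewrite /f /c; case: ifP => mL; last first.
    by rewrite mul0rz exp1rz; exact: is_clog1.
  have q0 : qc (g x) (kap m) != 0 by exact: p0.
  apply: is_clogX; first by rewrite invr_eq0.
  apply: is_clogV => //; rewrite /is_clog mulrC divfK //; exact: dg.
have h := is_cderiveM (dg k) (is_clog_prod (index_enum _) df).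
have := h; rewrite /is_cderive /nrm_scale /dnrm /mon /=.
rewrite (_ : _ + _ = nrm_scale (g x) k * dnrm (g x) l k) //.
rewrite -/(nrm_scale (g x) k) /dnrm mulrBr addrC [nrm_scale _ _ * qc l k]mulrC; congr (_ + _).
rewrite mulrCA -mulrN; congr (_ * _); rewrite -mulrN; congr (_ * _).
rewrite -sumrN [RHS]big_mkcond; apply: eq_bigr => m _; rewrite /c; case: ifP => _.
  by rewrite mulNrz.
by rewrite mul0rz.
Qed.

End NormalizedDerivative.

(** * Charts of the wall quotient *)

Lemma celem_qcP (R : realType) N (V : normedModType R) (O : set V) B (g : V -> 'M[R]_(4, N)) :
  (forall k, celem O B (fun x => qc (g x) k)) <-> forall r i, elem O B (fun x => g x r i).
Proof.
split=> [h|h [i b]].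
  move=> r i; have [h0 h1] := h (i, false); have [h2 h3] := h (i, true).
  by move: r; apply: ord4P; [apply: elem_eq h0|apply: elem_eq h1|apply: elem_eq h2|apply: elem_eq h3] => x;
    rewrite qcE.
by case: b; split; [apply: elem_eq (h 2%:R i)|apply: elem_eq (h 3%:R i)|
  apply: elem_eq (h 0 i)|apply: elem_eq (h 1 i)] => x; rewrite qcE.
Qed.

Lemma celem_open (R : realType) (V : normedModType R) (I : finType) (F : {set I}) B (f : V -> I -> Cx R) :
  (forall b, B b -> (forall x, setT x -> differentiable b x) /\
     forall v, exists2 g, elem setT B g & forall x, setT x -> 'D_v b x = g x) ->
  (forall k, celem setT B (f^~ k)) -> open [set x | forall k, k \in F -> f x k != 0].
Proof.
move=> hB cf; rewrite (_ : [set x | _] = [set x | forall k, if k \in F then f x k != 0 else true]).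
  apply: (@open_forall _ _ (fun k => [set x | if k \in F then f x k != 0 else true])) => k.
  case: (k \in F); last by rewrite (_ : [set x | _] = setT); [exact: openT|apply/seteqP].
  rewrite openE => x fx; apply: (open_neq0 _ fx).
  have [h1 h2] := cf k.
  apply: (@eq_continuous_at _ _ _ (fun t => cof (cre (f t k)) (cim (f t k)))) => [t|].
    by rewrite cofK.
  by apply: continuous_cof; apply: (elem_continuous hB).
apply/seteqP; split => x h k; last by move=> kF; have := h k; rewrite kF.
by case: ifP => // /h.
Qed.

Lemma near_all (R : realType) (V : normedModType R) (x : V) (P : V -> Prop) :
  (forall t, P t) -> \forall t \near x, P t.
Proof. by move=> h; exact: nearW. Qed.

Lemma rC_intr (R : realType) (z : int) : rC z%:~R = z%:~R :> Cx R.
Proof. exact: (rmorph_int (real_complex R) z). Qed.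

Lemma rC_mulz (R : realType) (a : R) (z : int) : rC (a *~ z) = rC a *~ z.
Proof. by rewrite -mulrzr rCM rC_intr mulrzr. Qed.

Section WallChart.
Variables (R : realType) (N d : nat) (K : subtorus R N d).
Hypothesis hK : unimodular_subtorus K.
Notation wt := (wt K).
Variables (be : 'rV[Cx R]_d) (H0 : set 'rV[Cx R]_N).
Hypothesis hH0 : Swalls K be H0.
Variable Y0 : 'rV[R]_d.
Hypotheses (hY0 : lie_of K H0 Y0) (hY0n : Y0 != 0).
Variable al : 'rV[R]_d.
Hypothesis hals : forall H, Swalls K be H -> H <> H0 -> ~ wall K H al.
Hypothesis al0 : pairing al Y0 = 0.
Let Z0 := level K al be `&` fixed_by H0.
Variables (q0 : HN R N) (kap : 'I_d -> sidx N) (Y : 'I_d -> 'rV[R]_d) (l0 : 'I_d) (c0 : R).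
Hypotheses (sq0 : ss K al be q0) (wq0 : on_wall K Y0 al q0) (hY : wbasis K kap Y).
Hypothesis kF : forall l, l != l0 -> kap l \in face K al q0.
Hypothesis YE : Y l0 = c0 *: Y0.

Notation L := [set~ l0]%SET.
Notation nw := (near_wall K al q0).
Notation off k := (pairing (wt k) Y0 != 0).

Let inL l : (l \in L) = (l != l0). Proof. by rewrite !inE. Qed.

Let off_fst i b b' : off (i, b) = off (i, b').
Proof. by rewrite !pairing_wt /=; case: b; case: b'; rewrite ?oppr_eq0. Qed.

Let kap_on l : l != l0 -> off (kap l) = false.
Proof. by move=> /kF /wq0 ->; rewrite eqxx. Qed.

Let off_free (k : sidx N) : off k -> bidx kap L k.1 = None.
Proof.
move=> ok; case E: (bidx _ _ _) => [l|//]; have [lL kl] := bidxP E.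
have := kap_on (l := l); rewrite -inL => /(_ lL).
by rewrite [kap l]surjective_pairing kl (off_fst _ _ k.2) -surjective_pairing ok.
Qed.

Let wcoef_l0 k : off k = false -> wcoef K Y k l0 = 0.
Proof.
move=> /eqP ok; have := wcoefK hK k l0 hY; rewrite YE pairingZr ok mulr0 => /eqP.
by rewrite intr_eq0 => /eqP.
Qed.

Let Fs := [set k : sidx N | (bidx kap L k.1 == None) && ~~ off k]%SET.
Notation n := #|Fs|.
Let fl : 'I_n -> sidx N := @enum_val _ (mem Fs).

Let fl_inj : injective fl. Proof. exact: enum_val_inj. Qed.

Let fl_free i : bidx kap L (fl i).1 = None.
Proof. by have := enum_valP i; rewrite inE => /andP[/eqP]. Qed.

Let fl_off i : off (fl i) = false.
Proof. by have := enum_valP i; rewrite inE => /andP[_ /negPf]. Qed.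

Let fl_onto (k : sidx N) : bidx kap L k.1 = None -> off k = false -> exists i, fl i = k.
Proof.
move=> bk kJ; have h : k \in Fs by rewrite inE bk kJ eqxx.
by exists (enum_rank_in h k); rewrite /fl enum_rankK_in.
Qed.

Notation V := 'rV[R]_(n + n).
Let om (x : V) : 'rV[Cx R]_n := \row_i cof (x 0 (lshift n i)) (x 0 (rshift n i)).
Let rv (w : 'rV[Cx R]_n) : V := row_mx (\row_i cre (w 0 i)) (\row_i cim (w 0 i)).

Let omK x : rv (om x) = x.
Proof.
apply/rowP => j; rewrite mxE; case: (splitP j) => i ji; rewrite !mxE /=;
  by apply: (congr1 (x 0)); apply/val_inj.
Qed.

Let rvK w : om (rv w) = w.
Proof. by apply/rowP => i; rewrite mxE row_mxEl row_mxEr !mxE cofK. Qed.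

Let se x := section K kap Y L be fl (om x).
Let sl := slice K kap Y L fl.

Let se_off x k : off k -> crd (se x) k = 0.
Proof.
move=> ok; rewrite crd_mkp fill_free ?off_free //; apply: spread_out => i.
by apply: contraTneq ok => <-; rewrite fl_off.
Qed.

Let se_muC x : muC K (se x) = be.
Proof.
apply: muC_fill => // l; rewrite inL negbK => /eqP ->.
rewrite /bval YE pC_scaler (pC_be0 hH0 hY0 hY0n) mulr0 mul0r.
rewrite /free_sum big1 // => i _; rewrite YE pairingZr.
have [->|oi] := eqVneq (pairing (wt (i, false)) Y0) 0; first by rewrite mulr0 rC0 mulr0.
rewrite spread_out ?mul0r // => j; apply: contraTneq oi => h.
by rewrite -h fl_off.
Qed.

Let Om : set V := [set x | nw (se x)].

Let se_ss x : Om x -> ss K al be (se x).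
Proof. by move=> h; exact: (near_wall_ss sq0 (se_muC x) h). Qed.

Let se_face x k : Om x -> crd (se x) k != 0 -> k \in face K al (se x).
Proof.
move=> h pk; apply: (near_wall_off hH0 hY0 hY0n hals sq0 wq0 (se_muC x) h pk).
by apply/eqP; apply: contraNT pk => ok; rewrite se_off.
Qed.

Let nw_chosen q : nw q -> chosen_neq0 kap L q.
Proof. by move=> h l; rewrite inL => ll; apply: h; exact: kF. Qed.

Let nw_corb q q' : corb K q q' -> nw q -> nw q'.
Proof.
move=> /corb_real[_ [_ _ _ sE]] nq k kF'; rewrite -/(supp q' _) sE; exact: nq.
Qed.

Let i0 := (kap l0).1.
Let cc x k : R := sqn (crd (se x) k) + (k.1 == i0)%:R.

Let cc_ge0 x k : 0 <= cc x k.
Proof. by rewrite addr_ge0 ?sqn_ge0. Qed.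

(* the two extra terms of [cc] keep the Gram matrices non-degenerate and cancel each other *)
Let extra_sum (f : sidx N -> R) z : pairing (wt (kap l0)) z = 0 ->
  (forall k, pairing (wt k) z = 0 -> f k = 1) ->
  \sum_k ((k.1 == i0)%:R * f k) *: wt k = 0.
Proof.
move=> hz hf; rewrite big_sidx big1 // => i _ /=; have [ii|_] := eqVneq i i0; last first.
  by rewrite !mul0r !scale0r addr0.
have h b : pairing (wt (i, b)) z = 0.
  apply/eqP; move: hz; rewrite ii /i0; case: (kap l0) => j b' /=; rewrite !pairing_wt /=.
  by case: b; case: b' => /eqP; rewrite ?oppr_eq0.
rewrite !hf // -[wt (i, true)]/(wt (i, ~~ false)) wt_negb scalerN subrr //.
Qed.

Let kap0_on : pairing (wt (kap l0)) Y0 != 0.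
Proof.
have := hY.1 l0 l0; rewrite YE pairingZr eqxx => h; apply/negP => /eqP h0.
by move: h; rewrite h0 mulr0 => /eqP; rewrite eq_sym oner_eq0.
Qed.

(** On the wall, all terms except the two added at [i0] pair to 0 with [Y0]. These leave
    [exp (2 t) - exp (- 2 t) = 0] up to a non-zero factor, which fixes the exponent along [Y0]. *)
Let kap0_exp x y v : pairing v Y0 = 0 ->
  \sum_k (cc x k * expR (2 * pairing (wt k) y)) *: wt k = v -> pairing (wt (kap l0)) y = 0.
Proof.
move=> v0 vE; have := v0; rewrite -vE pairing_suml big_sidx.
rewrite (bigD1 i0) //= big1 ?addr0 => [|i ii]; last first.
  rewrite !pairingZl /cc /= (negPf ii) !addr0.
  have [h|h] := boolP (off (i, false)).
    by rewrite !se_off // -?(off_fst i false) // /sqn /= !expr0n /= addr0 !mul0r addr0.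
  have h' := h; rewrite (off_fst i false true) in h'.
  by rewrite (eqP (negbNE h)) (eqP (negbNE h')) !mulr0 addr0.
have oi b : off (i0, b).
  by have := kap0_on; rewrite /i0; case: (kap l0) => j b' /=; rewrite (off_fst j b' b).
rewrite !pairingZl /cc /= !se_off // eqxx /sqn /= !expr0n /= !add0r !mul1r.
rewrite !wt_true mulrN -mulrBl => /eqP; rewrite mulf_eq0 (negPf (oi false)) orbF subr_eq0.
move=> /eqP /expR_inj h; have h0 : pairing (wt (i0, false)) y = 0 by move: h; rewrite mulrN; lra.
by rewrite /i0 in h0; move: h0; case: (kap l0) => j [] //=; rewrite wt_true => ->; rewrite oppr0.
Qed.

(** The same terms at [i0] are added to the source and to the target of [kempf_ness]; in the target
    they have equal coefficients at opposite weights and cancel. *)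
Let solution_ex x : exists y, Om x ->
  \sum_k (cc x k * expR (2 * pairing (wt k) y)) *: wt k = pi^-1 *: al.
Proof.
have [Ox|Ox] := pselect (Om x); last by exists 0.
have /ssP[_ Cp] := se_ss Ox; have [c [cge cF aE]] := min_face_coef Cp.
have [|||y yE] := @kempf_ness _ _ _ wt (cc x) (fun k => pi^-1 * c k + (k.1 == i0)%:R) => //.
- by move=> k; rewrite addr_ge0 // mulr_ge0 // invr_ge0 pi_ge0.
- move=> k; rewrite /cc; case: (k.1 == i0).
    by rewrite !ltr_wpDl ?sqn_ge0 // mulr_ge0 // invr_ge0 pi_ge0.
  rewrite !addr0 sqn_gt0 pmulr_rgt0 ?invr_gt0 ?pi_gt0 // cF.
  by apply/idP/idP => [|/min_face_sub //]; exact: se_face.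
exists y => _; rewrite yE aE scaler_sumr.
have := @extra_sum (fun=> 1) 0 (pairing0r _) (fun _ _ => erefl) => h.
transitivity (\sum_k (pi^-1 *: (c k *: wt k) + ((k.1 == i0)%:R * 1) *: wt k)).
  by apply: eq_bigr => k _; rewrite scalerA mulr1 scalerDl.
by rewrite big_split /= h addr0.
Qed.

Let yy : V -> 'rV[R]_d := projT1 (choice solution_ex).

Let yyP x : Om x -> \sum_k (cc x k * expR (2 * pairing (wt k) (yy x))) *: wt k = pi^-1 *: al.
Proof. exact: (projT2 (choice solution_ex) x). Qed.

Let yy0 x : Om x -> pairing (wt (kap l0)) (yy x) = 0.
Proof. by move=> Ox; apply: (kap0_exp _ (yyP Ox)); rewrite pairingZl al0 mulr0. Qed.

Let phi x : 'M[R]_(4, N) := unquat (act (se x) (cexp K (yy x))).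

Let qc_phi x k : qc (phi x) k = crd (se x) k * rC (expR (pairing (wt k) (yy x))).
Proof. by rewrite /qc /phi quatK crd_act sgc_cexp. Qed.

Let phi_corb x : corb K (se x) (quat (phi x)).
Proof.
rewrite /phi quatK; exists (cexp K (yy x)) => //; exists (const_mx 1), (yy x).
split; first exact: torus1.
by apply/rowP => i; rewrite !mxE mul1r.
Qed.

Let phi_nw x : Om x -> nw (quat (phi x)).
Proof. exact: (nw_corb (phi_corb x)). Qed.

Let phi_off x k : off k -> qc (phi x) k = 0.
Proof. by move=> ok; rewrite qc_phi se_off ?mul0r. Qed.

Let phi_Z x : Om x -> rset Z0 (phi x).
Proof.
move=> Ox; split; last by apply/(fixed_H0 hK hH0 hY0 hY0n) => k ok; exact: phi_off.
split; last by have [_ [_ _ -> _]] := corb_real (phi_corb x); exact: se_muC.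
rewrite mu1E.
have h0 := @extra_sum (fun k => expR (2 * pairing (wt k) (yy x))) (yy x) (yy0 Ox).
have {}h0 : \sum_k ((k.1 == i0)%:R * expR (2 * pairing (wt k) (yy x))) *: wt k = 0.
  by apply: h0 => k ->; rewrite mulr0 expR0.
have e : \sum_k sqn (qc (phi x) k) *: wt k = pi^-1 *: al.
  rewrite -(yyP Ox) [RHS](eq_bigr (fun k : sidx N => sqn (qc (phi x) k) *: wt k +
      ((k.1 == i0)%:R * expR (2 * pairing (wt k) (yy x))) *: wt k)).
    by rewrite big_split /= h0 addr0.
  by move=> k _; rewrite -scalerDl /cc mulrDl qc_phi sqnM sqn_rC -expRM_natl.
by rewrite e scalerA mulfV ?scale1r ?gt_eqF ?pi_gt0.
Qed.

Let slice_corb q q' : nw q -> corb K q q' -> sl q = sl q'.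
Proof.
move=> nq /(corb_monE hK hY)[h [h0 hE]]; apply/rowP => i; rewrite [LHS]mxE [RHS]mxE.
rewrite (nrm_mon (L := L) h0 _ (hE (fl i))) => [|l lL]; last by rewrite hE (mon_kap hK hY).
rewrite (_ : mon K Y _ _ = 1) ?mulr1 // /mon big1 // => l _; rewrite inL.
by case: eqVneq => [->|_] /=; rewrite ?exp1rz // wcoef_l0 ?fl_off.
Qed.

Let slice_phi x : Om x -> sl (quat (phi x)) = om x.
Proof.
by move=> Ox; rewrite -(slice_corb Ox (phi_corb x)) /sl /se slice_section.
Qed.

Let Z_off q k : rset Z0 q -> off k -> qc q k = 0.
Proof. by move=> [_ /(fixed_H0 hK hH0 hY0 hY0n) h]; exact: h. Qed.

Let slice_Z q : rset Z0 q -> nw (quat q) ->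
  Om (rv (sl (quat q))) /\ rorb K q (phi (rv (sl (quat q)))).
Proof.
move=> Zq nq; have [[mq cq'] _] := Zq.
have [|_ sc] := section_slice hK hY (be := be) fl_inj cq' (nw_chosen nq).
  move=> k bk kfl; apply: (Z_off Zq); apply/negP => ok.
  have [|i ik] := fl_onto bk; first by rewrite ok.
  by have := kfl i; rewrite ik eqxx.
have seE : se (rv (sl (quat q))) = section K kap Y L be fl (sl (quat q)) by rewrite /se rvK.
rewrite -/sl -seE in sc; have Ox : Om (rv (sl (quat q))) by exact: nw_corb sc nq.
split; first exact: Ox.
suff : korb K (quat q) (quat (phi (rv (sl (quat q))))) by [].
apply: corb_mu1_korb; first exact: (corb_trans hK sc (phi_corb _)).
by have [[-> _] _] := phi_Z Ox.
Qed.

Let B0 (b : V -> R) := exists i j, b = fun x : V => x i j.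

Let hB0 O b : B0 b -> (forall x, O x -> differentiable b x) /\
  forall v, exists2 g, elem O B0 g & forall x, O x -> 'D_v b x = g x.
Proof. exact: coord_base. Qed.

Let om_celem O i : celem O B0 (fun x => om x 0 i).
Proof.
split; apply: (elem_eq (f := fun x : V => x 0 _)).
- by move=> x; rewrite mxE.
- by apply: elem_base; exists 0, (lshift n i).
- by move=> x; rewrite mxE.
- by apply: elem_base; exists 0, (rshift n i).
Qed.

Let se_celem O k : celem O B0 (fun x => crd (se x) k).
Proof.
have sp k' : celem O B0 (fun x => spread fl (om x) k').
  by apply: celem_sum => i; exact: om_celem.
apply: (celem_eq (f := fun x => fill K kap Y L be (spread fl (om x)) k)) => [x|].
  by rewrite crd_mkp.
rewrite /fill; case: (bidx kap L k.1) => [l|]; last exact: sp.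
case: (k == kap l); first exact: celem_cst.
apply: celem_mul; first exact: celem_cst.
apply: celem_add; first exact: celem_cst.
apply: celem_opp; apply: celem_sum => i.
by apply: celem_mul; [exact: celem_mul|exact: celem_cst].
Qed.

Let oOm : open Om.
Proof. exact: (@celem_open R V _ (face K al q0) B0 (fun x k => crd (se x) k) (@hB0 setT) (se_celem setT)). Qed.

Let cc_elem k : elem Om B0 (fun x => cc x k).
Proof. by apply: elem_add; [exact: (elem_sqn (se_celem Om k))|exact: elem_cst]. Qed.

Let se_kap x l : l != l0 -> crd (se x) (kap l) = 1.
Proof. by rewrite -inL; exact: (section_kap hY). Qed.

Let sep (f : sidx N -> R) z : (forall l, 0 < f (kap l)) ->
  (forall k, 0 < f k -> pairing (wt k) z = 0) -> z = 0.
Proof.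
by move=> f0 h; rewrite (wbasis_dual z hY) big1 // => l _; rewrite h ?scale0r.
Qed.

Let cc_sep x z : Om x -> (forall k, 0 < cc x k -> pairing (wt k) z = 0) -> z = 0.
Proof.
move=> Ox; apply: sep => l; rewrite /cc; have [->|ll] := eqVneq l l0.
  by rewrite /i0 eqxx ltr_wpDl ?sqn_ge0.
by rewrite se_kap // ltr_wpDr // sqn_gt0 oner_neq0.
Qed.

Notation B := (implicit_base K yy B0).

Let hB b : B b -> (forall x, Om x -> differentiable b x) /\
  forall v, exists2 g, elem Om B g & forall x, Om x -> 'D_v b x = g x.
Proof. exact: (implicit_baseP oOm cc_ge0 yyP cc_sep (@hB0 Om) cc_elem). Qed.

Let mono f : elem Om B0 f -> elem Om B f.
Proof. by apply: elem_mono => b h; left. Qed.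

Let phi_celem k : celem Om B (fun x => qc (phi x) k).
Proof.
apply: (celem_eq (f := fun x => crd (se x) k * rC (expR (pairing (wt k) (yy x))))) => [x|].
  by rewrite qc_phi.
apply: celem_mul; first by have [h1 h2] := se_celem Om k; split; exact: mono.
by apply: celem_rC; apply: elem_base; right; exists k.
Qed.

Let phi_elem : forall r i, elem Om B (fun x => phi x r i).
Proof. by apply/celem_qcP. Qed.

Let phi_kap x l : l != l0 -> qc (phi x) (kap l) != 0.
Proof. by move=> ll; rewrite qc_phi se_kap // mul1r rC_eq0 gt_eqF ?expR_gt0. Qed.

Let gw x k : R := sqn (qc (phi x) k) + (k.1 == i0)%:R.

Let gm_unit x : gram K (gw x) \in unitmx.
Proof.
apply: gram_unit => [k|z]; first by rewrite addr_ge0 ?sqn_ge0.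
apply: sep => l; rewrite /gw; have [->|ll] := eqVneq l l0.
  by rewrite /i0 eqxx ltr_wpDl ?sqn_ge0.
by rewrite ltr_wpDr // sqn_gt0 phi_kap.
Qed.

Let bb x u : 'rV[R]_d := \sum_k (cre (qc (phi x) k) * cim (qc ('D_u phi x) k) -
  cim (qc (phi x) k) * cre (qc ('D_u phi x) k)) *: wt k.

(** The coefficient of the vertical part of ['D_u phi x]: the normal equations say that subtracting
    the infinitesimal action of [xi x u] leaves a vector orthogonal to the orbit. *)
Let xi x u := bb x u *m invmx (gram K (gw x)).

Let xi_elem u j : exists2 g, elem Om B g & forall x, Om x -> xi x u 0 j = g x.
Proof.
have [f ef fE] := elem_derive_mx hB u phi_elem.
have cf : forall k, celem Om B (fun x => qc (f x) k) by apply/celem_qcP.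
have eG i i' : elem Om B (fun x => gram K (gw x) i i').
  apply: (elem_eq (f := fun x => \sum_k gw x k * ((wt k)^T *m wt k) i i')) => [x|].
    by rewrite summxE; apply: eq_bigr => k _; rewrite [RHS]mxE.
  apply: elem_sum => k; apply: elem_mul; last exact: elem_cst.
  by apply: elem_add; [exact: elem_sqn|exact: elem_cst].
have /choice[I IP] i : exists g, elem Om B g /\
    forall x, Om x -> invmx (gram K (gw x)) i j = g x.
  by have [g eg gE] := elem_invmx eG (fun x _ => gm_unit x) i j; exists g.
exists (fun x => \sum_i (\sum_k (cre (qc (phi x) k) * cim (qc (f x) k) +
    - (cim (qc (phi x) k) * cre (qc (f x) k))) * wt k 0 i) * I i x).
  apply: elem_sum => i; apply: elem_mul; last exact: (IP i).1.
  apply: elem_sum => k; apply: elem_mul; last exact: elem_cst.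
  have [h1 h2] := phi_celem k; have [h3 h4] := cf k.
  by apply: elem_add; [exact: elem_mul|apply: elem_opp; exact: elem_mul].
move=> x Ox; rewrite mxE; apply: eq_bigr => i _; rewrite (IP i).2 //; congr (_ * _).
by rewrite summxE; apply: eq_bigr => k _; rewrite mxE fE.
Qed.

Let phi_diff x : Om x -> differentiable phi x.
Proof. by move=> Ox; apply: differentiable_mx => r i; exact: (elem_diff hB (phi_elem r i)).1. Qed.

Let dphi x u : Om x -> is_derive x u phi ('D_u phi x).
Proof. by move=> Ox; split => //; exact: diff_derivable (phi_diff Ox). Qed.

Let xi_lin x c u v : Om x -> xi x (c *: u + v) = c *: xi x u + xi x v.
Proof.
move=> Ox; have dp := phi_diff Ox; rewrite /xi scalemxAl -mulmxDl.
apply: (congr1 (fun z => z *m _)); rewrite scaler_sumr -big_split; apply: eq_bigr => k _ /=.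
rewrite scalerA -scalerDl; apply: (congr1 (fun z => z *: _)).
by rewrite !deriveE // linearP qcD qcZ creD cimD creZ cimZ; ring.
Qed.

(** Pairing with [Y0] kills everything but the added terms and shows that they contribute 0, so the
    true normal equations hold. *)
Let xi_gram x u : \sum_k (sqn (qc (phi x) k) * pairing (wt k) (xi x u)) *: wt k = bb x u.
Proof.
have E : \sum_k (gw x k * pairing (wt k) (xi x u)) *: wt k = bb x u.
  by rewrite -gramE /xi mulmxKV.
have p0 k : pairing (sqn (qc (phi x) k) *: wt k) Y0 = 0.
  rewrite pairingZl; have [->|ok] := eqVneq (pairing (wt k) Y0) 0; first by rewrite mulr0.
  by rewrite phi_off // /sqn /= expr0n /= addr0 mul0r.
have b0 : pairing (bb x u) Y0 = 0.
  rewrite pairing_suml big1 // => k _; rewrite pairingZl.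
  have [->|ok] := eqVneq (pairing (wt k) Y0) 0; first by rewrite mulr0.
  by rewrite phi_off //= !mul0r subrr mul0r.
have z0 : pairing (wt (kap l0)) (xi x u) = 0.
  have := b0; rewrite -E pairing_suml.
  rewrite (eq_bigr (fun k : sidx N => (k.1 == i0)%:R * (pairing (wt k) (xi x u) * pairing (wt k) Y0))); last first.
    move=> k _; have := p0 k; rewrite !pairingZl => h; rewrite /gw.
    transitivity (sqn (qc (phi x) k) * pairing (wt k) Y0 * pairing (wt k) (xi x u) +
      (k.1 == i0)%:R * (pairing (wt k) (xi x u) * pairing (wt k) Y0)); first by ring.
    by rewrite h mul0r add0r.
  rewrite big_sidx (bigD1 i0) //= big1 ?addr0 => [|i /negPf -> /=]; last by rewrite !mul0r addr0.
  rewrite eqxx !mul1r !wt_true mulrNN -mulr2n => /eqP; rewrite mulrn_eq0 /= mulf_eq0.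
  have := kap0_on; rewrite /i0; case: (kap l0) => j b /=.
  rewrite (off_fst j b false) => /negPf -> /=; rewrite orbF => /eqP h.
  by case: b => //; rewrite wt_true h oppr0.
rewrite -E; apply/eqP; rewrite eq_sym -subr_eq0 -sumrB; apply/eqP.
transitivity (\sum_k ((k.1 == i0)%:R * pairing (wt k) (xi x u)) *: wt k).
  by apply: eq_bigr => k _; rewrite -scalerBl /gw; congr (_ *: _); ring.
rewrite big1 // => -[i b] _ /=; have [ii|_] := eqVneq i i0; last by rewrite mul0r scale0r.
suff -> : pairing (wt (i, b)) (xi x u) = 0 by rewrite mulr0 scale0r.
move: z0; rewrite ii /i0; case: (kap l0) => j [] /=; case: b => //; rewrite ?wt_true => h;
  by [apply/eqP; rewrite -oppr_eq0 h|rewrite h oppr0].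
Qed.

Notation lf := (hlift K phi xi).

Let lf_ortho x u y : Om x -> dotq (lf x u) (rotq K y (phi x)) = 0.
Proof.
move=> Ox; rewrite /hlift dotqBl !dotq_rotq; apply/eqP; rewrite subr_eq0; apply/eqP.
transitivity (pairing (bb x u) y).
  by rewrite pairing_suml; apply: eq_bigr => k _; rewrite pairingZl mulrC.
rewrite -xi_gram pairing_suml; apply: eq_bigr => k _; rewrite pairingZl qc_rotq !(creM, cimM) /= /sqn.
ring.
Qed.

Let near_Z x : Om x -> \forall t \near x, level K al be (quat (phi t)).
Proof.
move=> Ox; have := open_nbhs_nbhs (conj oOm Ox).
by apply: filterS => t Ot; have [] := phi_Z Ot.
Qed.

Let lf_dmuC x u : Om x -> dmuC K (phi x) (lf x u).
Proof.
move=> Ox; apply: dmuC_sub; last exact: dmuC_rotq.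
exact: (level_dmuC (near_Z Ox) (dphi u Ox)).
Qed.

Let lf_dmu1C x u : Om x -> dmu1C K (phi x) (lf x u).
Proof.
move=> Ox; apply/dmu1CP; split=> [|y]; last exact: lf_ortho.
apply: dmu1_sub; last exact: dmu1_rotq.
exact: (level_dmu1 (near_Z Ox) (dphi u Ox)).
Qed.

Let dphi_off x u k : Om x -> off k -> qc ('D_u phi x) k = 0.
Proof.
move=> Ox ok; have h := (is_derive_qc phi x u _).1 (dphi u Ox) k.
apply: (is_cderive_uniq h); apply: is_cderive_eq (is_cderive_cst x u 0) => t.
by rewrite phi_off.
Qed.

Let lf_off x u k : Om x -> off k -> qc (lf x u) k = 0.
Proof. by move=> Ox ok; rewrite /hlift qcB qc_rotq phi_off // mulr0 dphi_off // subr0. Qed.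

Notation dn := (dnrm K kap Y L).

Let dnB p v w k : dn p (v - w) k = dn p v k - dn p w k.
Proof.
rewrite /dnrm qcB (eq_bigr (fun l => (qc v (kap l) / qc p (kap l)) *~ wcoef K Y k l -
  (qc w (kap l) / qc p (kap l)) *~ wcoef K Y k l)); first by rewrite sumrB; ring.
by move=> l _; rewrite qcB mulrBl mulrzBl.
Qed.

Let dn_rotq x y k : off k = false -> dn (phi x) (rotq K y (phi x)) k = 0.
Proof.
move=> ok; rewrite /dnrm qc_rotq.
have -> : \sum_(l in L) (qc (rotq K y (phi x)) (kap l) / qc (phi x) (kap l)) *~ wcoef K Y k l =
    'i * rC (pairing (wt k) y).
  rewrite [in RHS](wt_expand hK hY) [in RHS](bigD1 l0) //= wcoef_l0 // mulr0z add0r rC_sum mulr_sumr.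
  apply: eq_big => [l|l]; rewrite inL // => ll.
  by rewrite qc_rotq mulfK ?phi_kap // rC_mulz -mulrzAr.
by ring.
Qed.

Let dn_phi x u i : Om x -> nrm_scale K kap Y L (phi x) (fl i) * dn (phi x) ('D_u phi x) (fl i) = om u 0 i.
Proof.
move=> Ox; have pc : chosen_neq0 kap L (quat (phi x)) by apply: nw_chosen; exact: phi_nw.
have h := is_cderive_nrm K Y (fl i) (dphi u Ox) pc.
have h' : is_cderive x u (fun t => om t 0 i) (om u 0 i).
  rewrite [om u 0 i]mxE.
  apply: (is_cderive_eq (f := fun t : V => cof (t 0 (lshift n i)) (t 0 (rshift n i)))) => [t|].
    by rewrite mxE.
  have hid := (is_derive_mx id x u u).1 (is_derive_id x u).
  by apply: is_cderive_cof; exact: hid.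
apply: (is_cderive_uniq h); apply: is_cderive_near h'.
have := open_nbhs_nbhs (conj oOm Ox); apply: filterS => t Ot.
by rewrite -(slice_phi Ot) mxE.
Qed.

(* a tangent vector killed by the linearised equations of the slice is tangent to the orbit *)
Let kernel x v : Om x -> (forall k, off k -> qc v k = 0) -> dmu1 K (phi x) v ->
  dmuC K (phi x) v -> (forall i, dn (phi x) v (fl i) = 0) -> exists y, v = rotq K y (phi x).
Proof.
move=> Ox v0 v1 vC vfl; pose p := phi x.
(* Logarithmic velocities of the normalised coordinates; [S] extends them to all weights, and the
   claim becomes [v = p S] with purely imaginary effect on the support. *)
pose tau l := qc v (kap l) / qc p (kap l).
pose S k := \sum_(l in L) tau l *~ wcoef K Y k l.
have Sneg i : S (i, true) = - S (i, false).
  rewrite /S -sumrN; apply: eq_bigr => l _.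
  by rewrite -[true]/(~~ false) (wcoef_negb hK _ _ _ hY) mulrNz.
have Skap l : l != l0 -> S (kap l) = tau l.
  move=> ll; rewrite /S (bigD1 l) ?inL //= (wcoef_kap hK _ _ hY) eqxx mulr1z big1 ?addr0 //.
  by move=> m /andP[_ ml]; rewrite (wcoef_kap hK _ _ hY) eq_sym (negPf ml) mulr0z.
have dn_kap l : l != l0 -> dn p v (kap l) = 0.
  by move=> ll; rewrite /dnrm -/(S _) Skap // /tau mulrC divfK ?subrr // phi_kap.
have qS k : qc v k = dn p v k + qc p k * S k by rewrite /dnrm -/(S k) subrK.
have dn0 k : off k = false -> dn p v k = 0.
  move=> ok; case E : (bidx kap L k.1) => [l|]; last first.
    by have [i <-] := fl_onto E ok; exact: vfl.
  have [lL kl] := bidxP E; have ll : l != l0 by rewrite -inL.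
  have [<-|kk] := eqVneq (kap l) k; first exact: dn_kap.
  (* In the equation for [Y l] the products at free indices drop out, which leaves one linear
     equation for the partner of [kap l]. *)
  have := vC (Y l); rewrite (bigD1 k.1) //= big1 ?addr0.
    rewrite -kl pairing_kap_sgn // eqxx mulr1 => /eqP; rewrite mulf_eq0 => /orP[|].
      by rewrite rC_eq0 /kap_sgn; case: (kap l).2; rewrite ?oppr_eq0 oner_eq0.
    rewrite !qS Sneg => /eqP h.
    have {h} h : qc p ((kap l).1, false) * dn p v ((kap l).1, true) +
        dn p v ((kap l).1, false) * qc p ((kap l).1, true) = 0 by rewrite -h; ring.
    move: kl kk h (dn_kap l ll) (phi_kap x ll); case: (kap l) => j b; case: k ok E => j' b' _ _ /= <-.
    rewrite xpair_eqE eqxx /= -/p; case: b; case: b' => //= _ h e pk; move: h; rewrite e.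
      by rewrite mulr0 add0r => /eqP; rewrite mulf_eq0 (negPf pk) orbF => /eqP.
    by rewrite mul0r addr0 => /eqP; rewrite mulf_eq0 (negPf pk) => /eqP.
  move=> i ik; case Ei : (bidx kap L i) => [m|].
    have [mL mi] := bidxP Ei; rewrite -mi pairing_kap_sgn //.
    have [ml|_] := eqVneq m l; last by rewrite mulr0 rC0 mul0r.
    by move: ik; rewrite -mi ml kl eqxx.
  have [oi|oi] := boolP (off (i, false)).
    by rewrite !(v0 (i, _)) ?mulr0 ?mul0r ?addr0 ?mulr0 // -?(off_fst i false).
  have oi' : off (i, true) = false by rewrite -(off_fst i false); exact: negbTE.
  have [a ia] := fl_onto (k := (i, false)) Ei (negbTE oi).
  have [b ib] := fl_onto (k := (i, true)) Ei oi'.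
  by rewrite !qS -ia -ib !vfl ia ib Sneg -/p; ring.
(* Real and imaginary parts of [S] are the pairings with [rho] and [eta]. Tested on [rho], [dmu1] is
   a sum of squares, so [rho] acts trivially on the support and [eta] generates [v]. *)
pose rho : 'rV[R]_d := \sum_(l in L) cre (tau l) *: Y l.
pose eta : 'rV[R]_d := \sum_(l in L) cim (tau l) *: Y l.
have crez (c : Cx R) (z : int) : cre (c *~ z) = cre c * z%:~R /\ cim (c *~ z) = cim c * z%:~R.
  have -> : c *~ z = rC z%:~R * c by rewrite -mulrzr rC_intr mulrC.
  by rewrite creZ cimZ; split; rewrite mulrC.
have Sre k : cre (S k) = pairing (wt k) rho.
  rewrite cre_sum pairing_sumr; apply: eq_bigr => l _; rewrite pairingZr (crez _ _).1.
  by rewrite (wcoefK hK _ _ hY).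
have Sim k : cim (S k) = pairing (wt k) eta.
  rewrite cim_sum pairing_sumr; apply: eq_bigr => l _; rewrite pairingZr (crez _ _).2.
  by rewrite (wcoefK hK _ _ hY).
have vE k : qc v k = qc p k * S k.
  have [ok|/negbTE ok] := boolP (off k); first by rewrite v0 // /p phi_off // mul0r.
  by rewrite qS dn0 // add0r.
have rho0 k : qc p k != 0 -> pairing (wt k) rho = 0.
  have := v1 rho; rewrite (eq_bigr (fun k => sqn (qc p k) * pairing (wt k) rho ^+ 2)); last first.
    by move=> j _; rewrite -/p vE !(creM, cimM) Sre /sqn; ring.
  move=> /eqP; rewrite psumr_eq0 => [/allP /(_ k (mem_index_enum _))|j _]; last first.
    by rewrite mulr_ge0 ?sqn_ge0 ?sqr_ge0.
  by rewrite /= mulf_eq0 sqn_eq0 sqrf_eq0 => /orP[/eqP -> /eqP|/eqP].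
exists eta; apply: qc_inj => k; rewrite qc_rotq vE.
have [->|pk] := eqVneq (qc (phi x) k) 0; first by rewrite mul0r mulr0.
rewrite mulrC; congr (_ * _); apply: Cx_eqP; rewrite ?Sre ?Sim ?rho0 // ?creM ?cimM /=; ring.
Qed.

Let korb_level q q' : korb K q q' -> level K al be q -> level K al be q'.
Proof.
move=> h [h1 h2]; have [_ [_ _ mE _]] := corb_real (korb_corb h).
split; last by rewrite mE.
have [g Kg ->] := h; rewrite -h1 !mu1E; congr (_ *: _); apply: eq_bigr => k _.
by rewrite crd_act sqnM (sqn_sgc k Kg) mulr1.
Qed.

Let korb_Z q q' : rorb K q q' -> rset Z0 q -> rset Z0 q'.
Proof.
move=> h [h1 h2]; split; first exact: (korb_level h h1).
apply/(fixed_H0 hK hH0 hY0 hY0n) => k ok; have [g Kg qE] := h.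
rewrite qE crd_act (_ : crd (quat q) k = 0) ?mul0r //.
by have /(fixed_H0 hK hH0 hY0 hY0n) h3 := h2; exact: h3.
Qed.

(** A curve in the orbit with velocity [rotq K y p] at 0; the factor [1 / (2 pi)] compensates the
    normalisation of [texp]. *)
Let turn y (t : R) (p : 'M[R]_(4, N)) : 'M[R]_(4, N) :=
  unquat (act (quat p) (texp (t *: k_incl K ((2 * pi)^-1 *: y)))).

Let qc_turn y t p k : qc (turn y t p) k =
  qc p k * cexpi (t * ((2 * pi)^-1 * pairing (wt k) y)).
Proof. by rewrite /qc quatK crd_act k_inclZ sgc_texp !pairingZr. Qed.

Let turn_orb y t p : rorb K p (turn y t p).
Proof.
have : korb K (quat p) (quat (turn y t p)); last by [].
by rewrite /turn quatK; exists (texp (t *: k_incl K ((2 * pi)^-1 *: y))); first exact: torus_texpZ.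
Qed.

Let turn0 y p : turn y 0 p = p.
Proof. by apply: qc_inj => k; rewrite qc_turn mul0r cexpi0 mulr1. Qed.

Let dturn y (g : R -> 'M[R]_(4, N)) l : is_derive (0 : R) (1 : R) g l ->
  is_derive (0 : R) (1 : R) (fun t => turn y t (g t)) (l + rotq K y (g 0)).
Proof.
rewrite !is_derive_qc => h k; rewrite qcD qc_rotq.
have h2 := is_cderiveM (h k) (is_clog_cexpi ((2 * pi)^-1 * pairing (wt k) y)).
apply: (is_cderive_eq (f := fun t => qc (g t) k * cexpi (t * ((2 * pi)^-1 * pairing (wt k) y)))).
  by move=> t; rewrite qc_turn.
have e : 2 * pi * ((2 * pi)^-1 * pairing (wt k) y) = pairing (wt k) y.
  by rewrite mulVKf // mulf_neq0 // gt_eqF ?pi_gt0.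
by move: h2; rewrite e mul0r cexpi0 mul1r mulr1 addrC [X in _ + X]mulrC.
Qed.

Let curve_conds x v (gam : R -> 'M[R]_(4, N)) : Om x -> gam 0 = phi x ->
  (forall t, rset Z0 (gam t)) -> is_derive (0 : R) (1 : R) gam v ->
  [/\ forall k, off k -> qc v k = 0, dmu1 K (phi x) v & dmuC K (phi x) v].
Proof.
move=> Ox g0 gZ dg; rewrite -g0; split=> [k ok||].
- have h := (is_derive_qc gam 0 1 v).1 dg k.
  apply: (is_cderive_uniq h); apply: is_cderive_eq (is_cderive_cst (0 : R) (1 : R) 0) => t.
  by rewrite (Z_off (gZ t) ok).
- exact: (level_dmu1 (near_all _ (fun t => (gZ t).1)) dg).
- exact: (level_dmuC (near_all _ (fun t => (gZ t).1)) dg).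
Qed.

(** The slice coordinates are constant along a curve in the orbit, so its velocity meets the
    hypotheses of [kernel]. *)
Let vertP x v : Om x -> vertical (rorb K) (phi x) v <-> exists y, v = rotq K y (phi x).
Proof.
move=> Ox; split=> [[gam [g0 go dg]]|[y ->]]; last first.
  exists (fun t => turn y t (phi x)); split=> [|t|]; [exact: turn0|exact: turn_orb|].
  by have := dturn y (is_derive_cst (phi x) (0 : R) (1 : R)); rewrite add0r.
have gZ t : rset Z0 (gam t) by apply: korb_Z (phi_Z Ox).
have [v0 v1 vC] := curve_conds Ox g0 gZ dg.
apply: kernel => // i.
have pc : chosen_neq0 kap L (quat (gam 0)) by rewrite g0; apply: nw_chosen; exact: phi_nw.
have h := is_cderive_nrm K Y (fl i) dg pc.
have e : nrm_scale K kap Y L (gam 0) (fl i) * dn (gam 0) v (fl i) = 0.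
  apply: (is_cderive_uniq h).
  apply: is_cderive_eq (is_cderive_cst (0 : R) (1 : R) (nrm K kap Y L (quat (phi x)) (fl i))) => t.
  have := slice_corb (phi_nw Ox) (korb_corb (go t)) => /rowP /(_ i).
  by rewrite [LHS]mxE [RHS]mxE.
by move/eqP: e; rewrite mulf_eq0 (negPf (nrm_scale_neq0 _ _ _ pc)) g0 => /eqP.
Qed.

Let lf_horizontal x u : Om x -> horizontal (rset Z0) (rorb K) (phi x) (lf x u).
Proof.
move=> Ox; split=> [|v /(vertP _ Ox)[y ->]]; last exact: lf_ortho.
pose g (t : R) := turn (- xi x u) t (phi (t *: u + x)).
(* A tangent curve must stay in the level set at all times, hence the constant default once the
   chart domain is left. Turning by [- xi x u] removes the vertical part of the velocity. *)
pose gam (t : R) := if `[< Om (t *: u + x) >] then g t else phi x.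
have O0 : Om ((0 : R) *: u + x) by rewrite scale0r add0r.
exists gam; split=> [|t|].
- by rewrite /gam (asboolT O0) /g turn0 scale0r add0r.
- rewrite /gam; case: asboolP => [Ot|_]; last exact: phi_Z.
  exact: (korb_Z (turn_orb _ _ _) (phi_Z Ot)).
have dl : is_derive (0 : R) (1 : R) (fun t => phi (t *: u + x)) ('D_u phi x).
  by apply: line_is_derive; rewrite scale0r add0r; exact: dphi.
have := dturn (- xi x u) dl; rewrite scale0r add0r rotqNl => h.
apply: is_derive_near h.
have c : {for (0 : R), continuous (fun t : R => t *: u + x)}.
  by apply: cvgD; [exact: scalel_continuous|exact: cvg_cst].
have H := c _ (open_nbhs_nbhs (conj oOm O0)).
apply: (@filterS _ _ (nbhs_filter (0 : R)) _ _ _ H) => t Ot.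
by rewrite /gam (asboolT Ot).
Qed.

(** The candidate [u] is read off from the slice coordinates. The difference [h - lf x u] is then
    killed by them, hence vertical by [kernel]; it is also orthogonal to the orbit, so it is 0. *)
Let conds_lift x h : Om x -> (forall k, off k -> qc h k = 0) -> dmu1C K (phi x) h ->
  dmuC K (phi x) h -> exists u, h = lf x u.
Proof.
move=> Ox h0 h1 hC; set sc := nrm_scale K kap Y L (phi x).
pose u := rv (\row_i (sc (fl i) * dn (phi x) h (fl i))); exists u.
have pc : chosen_neq0 kap L (quat (phi x)) by apply: nw_chosen; exact: phi_nw.
pose v := h - lf x u.
have v1 : dmu1C K (phi x) v by apply: dmu1C_sub => //; exact: lf_dmu1C.
have [v1' vo] := (dmu1CP _ _ _).1 v1.
have [||||y vE] := kernel (x := x) (v := v) Ox => //.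
- by move=> k ok; rewrite qcB h0 // lf_off // subrr.
- by apply: dmuC_sub => //; exact: lf_dmuC.
- move=> i; rewrite dnB [hlift _ _ _ _ _]/hlift dnB dn_rotq ?fl_off // subr0.
  apply/eqP; rewrite subr_eq0; apply/eqP; apply: (mulfI (nrm_scale_neq0 K Y (fl i) pc)).
  by rewrite dn_phi // /u rvK mxE.
apply/eqP; rewrite -subr_eq0 -/v; apply/eqP; apply: dotq_eq0.
by rewrite {2}vE vo.
Qed.

Let horP x h : Om x -> horizontal (rset Z0) (rorb K) (phi x) h <-> exists u, h = lf x u.
Proof.
move=> Ox; split=> [[[gam [g0 gZ dg]] ho]|[u ->]]; last exact: lf_horizontal.
have [h0 h1 hC] := curve_conds Ox g0 gZ dg.
apply: conds_lift => //; apply/dmu1CP; split => // y.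
by apply: ho; apply/(vertP _ Ox); exists y.
Qed.

Let lf_rcstr x a w : Om x -> exists w', rcstr a (lf x w) = lf x w'.
Proof.
move=> Ox.
pose P v := [/\ forall k, off k -> qc v k = 0, dmu1C K (phi x) v & dmuC K (phi x) v].
have [] : P (rcstr a (lf x w)); last exact: conds_lift.
apply: rcstrP; last by split=> [k ok||]; [exact: lf_off|exact: lf_dmu1C|exact: lf_dmuC].
- move=> v [v0 v1 vC]; split=> [k ok||]; [|exact: dmu1C_J1|exact: dmuC_J1].
  by rewrite qc_J1 v0 // mulr0.
- move=> v [v0 v1 vC]; split=> [[i b] ok||]; [|exact: dmu1C_J2|exact: dmuC_J2].
  rewrite qc_J2 /= !v0 ?conjC0 ?oppr0 ?if_same //; by rewrite (off_fst i _ b).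
Qed.

Let lf_inj x u : Om x -> lf x u = 0 -> u = 0.
Proof.
move=> Ox /eqP; rewrite subr_eq0 => /eqP e.
have o0 i : om u 0 i = 0 by rewrite -(dn_phi u i Ox) e dn_rotq ?fl_off // mulr0.
have o1 i : om 0 0 i = 0 by rewrite !mxE.
by rewrite -(omK u) -(omK 0); apply: (congr1 rv); apply/rowP => i; rewrite o0 o1.
Qed.

Let psi_smooth : smooth_on [set q : 'M[R]_(4, N) | nw (quat q)] (fun q => rv (sl (quat q))).
Proof.
pose B1 (b : 'M[R]_(4, N) -> R) := exists i j, b = fun x : 'M[R]_(4, N) => x i j.
have hB1 O b : B1 b -> (forall x, O x -> differentiable b x) /\
  forall v, exists2 g, elem O B1 g & forall x, O x -> 'D_v b x = g x by exact: coord_base.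
have eq k O : celem O B1 (fun q => qc q k).
  by move: k; apply/celem_qcP => r i; apply: elem_base; exists r, i.
pose O := [set q : 'M[R]_(4, N) | nw (quat q)].
have oO : open O.
  exact: (@celem_open R _ _ (face K al q0) B1 (fun q k => qc q k) (hB1 setT) (eq^~ setT)).
have en k : celem O B1 (fun q => nrm K kap Y L (quat q) k).
  apply: celem_mul; first exact: eq.
  apply: celem_prod => l; case lL : (l \in L); last first.
    by apply: celem_eq (celem_cst O B1 1) => q; rewrite exp1rz.
  have q0' q : O q -> qc q (kap l) != 0 by move=> /nw_chosen; apply.
  apply: celem_expz => [|q Oq]; last by rewrite invr_eq0 q0'.
  by apply: celem_inv; first exact: eq.
apply: (elem_smooth oO (hB1 O)) => i j.
case: (splitP j) => a ja.
  apply: (elem_eq _ (en (fl a)).1) => q.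
  by rewrite (_ : j = lshift n a) ?row_mxEl ?mxE //; apply/val_inj.
apply: (elem_eq _ (en (fl a)).2) => q.
by rewrite (_ : j = rshift n a) ?row_mxEr ?mxE //; apply/val_inj.
Qed.

Lemma wall_chart (q : 'M[R]_(4, N)) : quat q = q0 -> rset Z0 q ->
  exists (Om : set 'rV[R]_(n + n)) (phi : 'rV[R]_(n + n) -> 'M[R]_(4, N)),
    [/\ quotient_chart (rset Z0) (rorb K) Om phi, hyperkahler_chart (rset Z0) (rorb K) Om phi &
        exists2 x, Om x & rorb K q (phi x)].
Proof.
move=> qE Zq; exists Om, phi; split; last first.
- have nq : nw (quat q) by rewrite qE => k; exact: face_supp.
  by have [Ox xo] := slice_Z Zq nq; exists (rv (sl (quat q))).
- exists lf; split=> [u|x Ox].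
    exact: (hlift_smooth K oOm hB phi_elem xi_elem).
  split=> [u|u v|h|a h|].
  + split; first exact: lf_horizontal.
    by apply/(vertP _ Ox); exists (xi x u); rewrite /hlift subKr.
  + move=> e; apply/eqP; rewrite -subr_eq0; apply/eqP; apply: (lf_inj Ox).
    have := hlift_lin K hB phi_elem xi_lin (-1) v u Ox.
    by rewrite !scaleN1r addrC [RHS]addrC e subrr.
  + by move/(horP _ Ox).
  + move=> /(horP _ Ox)[u ->]; apply/(horP _ Ox).
    by have [w ->] := lf_rcstr a u Ox; exists w.
  exact: (connection oOm hB phi_elem xi_elem xi_lin lf_ortho lf_inj lf_rcstr Ox).
split=> [|_ [x Ox <-]|x y Ox Oy h|x Ox].
- exact: (elem_smooth oOm hB phi_elem).
- exact: phi_Z.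
- have h' : korb K (quat (phi x)) (quat (phi y)) := h.
  have e : om x = om y.
    apply: (etrans (esym (slice_phi Ox))); apply: etrans (slice_phi Oy).
    exact: (slice_corb (phi_nw Ox) (korb_corb h')).
  by rewrite -(omK x) -(omK y) e.
exists [set q | nw (quat q)], (fun q => rv (sl (quat q))); split.
- exact: psi_smooth.
- exact: phi_nw.
- by move=> q' nq' Zq'; exact: slice_Z.
Qed.

(** The charts around different points use different bases, but a manifold must have one dimension:
    of the indices on the wall, [d - 1] are taken by the basis and each other one gives two free
    coordinates. *)
Lemma wall_dimension : n = (2 * (#|[set i : 'I_N | ~~ off (i, false)]%SET| - d.-1))%N.
Proof.
pose I := [set i : 'I_N | (bidx kap L i == None) && ~~ off (i, false)]%SET.
have -> : n = #|finset.setX I [set: bool]%SET|.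
  by apply: eq_card => -[i b]; rewrite !inE andbT (off_fst i b false).
rewrite cardsX cardsT card_bool mulnC; congr (2 * _)%N.
have -> : #|[set i : 'I_N | ~~ off (i, false)]%SET| = #|I :|: [set (kap l).1 | l in L]%SET|.
  apply: eq_card => i; rewrite !inE; case E : (bidx kap L i) => [l|] /=; last first.
    rewrite ?eqxx /=; apply/idP/orP => [->|[//|/imsetP[l lL il]]]; first by left.
    by rewrite il (bidx_kap hY lL) in E.
  have [lL kl] := bidxP E; have ll : l != l0 by rewrite -inL.
  have -> : ~~ off (i, false).
    by rewrite -kl (off_fst _ false (kap l).2) -surjective_pairing kap_on.
  by apply/esym/imsetP; exists l.
rewrite cardsU (_ : I :&: _ = finset.set0) ?cards0 ?subn0; last first.
  apply/setP => i; rewrite !inE; apply/negP => /andP[/andP[/eqP E _] /imsetP[l lL il]].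
  by rewrite il (bidx_kap hY lL) in E.
rewrite card_imset ?cardsC1 ?card_ord ?addnK // => l m; exact: (kap1_inj hY).
Qed.

End WallChart.

(** * The wall quotient as a toric quotient *)

Lemma row_space_connected (R : realType) n : connected [set: 'rV[R]_n].
Proof.
pose seg (v : 'rV[R]_n) := [set t *: v | t in [set: R]].
rewrite (_ : [set: 'rV[R]_n] = \bigcup_(v in [set: 'rV[R]_n]) seg v); last first.
  by apply/esym/seteqP; split => // v _; exists v => //; exists 1 => //; rewrite scale1r.
apply: bigcup_connected; first by exists 0 => v _; exists 0 => //; rewrite scale0r.
move=> v _; apply: connected_continuous_connected.
  by apply/connected_intervalP => x y _ _ z.
by apply: continuous_subspaceT; exact: scalel_continuous.
Qed.

Section StabilizedTorus.
Variables (R : realType) (N d : nat) (K : subtorus R N d).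
Hypothesis hK : unimodular_subtorus K.
Notation wt := (wt K).
Variables (kap : 'I_d -> sidx N) (Y : 'I_d -> 'rV[R]_d) (l0 : 'I_d) (c0 : R) (Y0 : 'rV[R]_d).
Hypotheses (hY : wbasis K kap Y) (c0n : c0 != 0) (YE : Y l0 = c0 *: Y0).
Variable J0 : {set 'I_N}.
Hypothesis J0E : forall k : sidx N, (k.1 \in J0) = (pairing (wt k) Y0 != 0).

Let on_l0 (k : sidx N) : k.1 \notin J0 -> wcoef K Y k l0 = 0.
Proof.
rewrite J0E negbK => /eqP ok; have := wcoefK hK k l0 hY; rewrite YE pairingZr ok mulr0 => /eqP.
by rewrite intr_eq0 => /eqP.
Qed.

Let kap_on l : l != l0 -> (kap l).1 \notin J0.
Proof.
move=> ll; rewrite J0E negbK; have := hY.1 l l0; rewrite (negPf ll) YE pairingZr => /eqP.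
by rewrite mulf_eq0 (negPf c0n).
Qed.

Let mon_on (h h' : 'I_d -> Cx R) (k : sidx N) : k.1 \notin J0 -> (forall l, l != l0 -> h l = h' l) ->
  mon K Y h k = mon K Y h' k.
Proof.
move=> ok e; apply: eq_bigr => l _; have [->|ll] := eqVneq l l0; last by rewrite e.
by rewrite on_l0.
Qed.

Definition stab_torus : set 'rV[Cx R]_N :=
  [set g | (forall i, `|g 0 i| = 1) /\ exists2 h, torus K h & forall i, i \notin J0 -> g 0 i = h 0 i].

(** The rows span the sum of both Lie algebras, which meet: [Y0] is supported on [J0]. So a basis
    has to be extracted, and the dimension is a rank. *)
Definition stab_mx : 'M[R]_(d + N, N) := col_mx (tlie K) (diag_mx (\row_i (i \in J0)%:R)).
Notation d' := (\rank stab_mx).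
Definition stab_lie : 'M[R]_(d', N) := row_base stab_mx.

Let stab_sgc (g h : 'rV[Cx R]_N) (k : sidx N) : (forall i, i \notin J0 -> g 0 i = h 0 i) -> k.1 \notin J0 ->
  sgc g k = sgc h k.
Proof. by move=> e kJ; rewrite /sgc e. Qed.

(** Characters on the wall have exponent 0 at [l0], so off [J0] they are monomials in the basis
    characters on the wall. This replaces the existential definition by closed equations. *)
Let stab_mon g i : stab_torus g -> i \notin J0 ->
  g 0 i = mon K Y (fun l => if l == l0 then 1 else sgc g (kap l)) (i, false).
Proof.
move=> [_ [h Kh e]] iJ; rewrite e // -[LHS]/(sgc h (i, false)) (torus_monE hK hY _ Kh).
apply: mon_on => // l ll; rewrite (negPf ll); apply/esym; apply: stab_sgc => //.
exact: kap_on.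
Qed.

Let mon_stab (g : 'rV[Cx R]_N) : (forall i, `|g 0 i| = 1) ->
  (forall i, i \notin J0 -> g 0 i = mon K Y (fun l => if l == l0 then 1 else sgc g (kap l)) (i, false)) ->
  stab_torus g.
Proof.
move=> g1 e; split => //.
exists (\row_i mon K Y (fun l => if l == l0 then 1 else sgc g (kap l)) (i, false)).
  apply: (mon_torus hK hY) => l; case: (l == l0); first by rewrite -rC1 sqn_rC expr1n.
  rewrite /sgc; have /norm1_sqn n1 := g1 (kap l).1; case: (kap l).2 => //.
  by apply/norm1_sqn; rewrite normfV g1 invr1.
by move=> i iJ; rewrite mxE; exact: e.
Qed.

Lemma stab_torus_closed : closed stab_torus.
Proof.
move=> g cg.
have cc i : {for g, continuous (fun g : 'rV[Cx R]_N => g 0 i)} by exact: coord_continuous.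
have g1 i : `|g 0 i| = 1.
  apply: (@closure_const _ _ g stab_torus (fun g : 'rV[Cx R]_N => `|g 0 i|)) => //.
    apply: (@cvg_comp _ _ _ (fun g : 'rV[Cx R]_N => g 0 i) (fun c : Cx R => `|c|)); first exact: cc.
    exact: norm_continuous.
  by move=> h [].
have g0 i : g 0 i != 0 by rewrite -normr_eq0 g1 oner_neq0.
pose f (g : 'rV[Cx R]_N) l := if l == l0 then 1 else sgc g (kap l).
have f0 (h : 'rV[Cx R]_N) l : (forall i, h 0 i != 0) -> f h l != 0.
  move=> h0; rewrite /f; case: (l == l0); first exact: oner_neq0.
  by rewrite /sgc; case: (kap l).2; rewrite ?invr_eq0 h0.
apply: mon_stab => // i iJ.
have m0 : mon K Y (f g) (i, false) != 0 by apply: mon_neq0 => l; exact: f0.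
apply: (mulIf (_ : (mon K Y (f g) (i, false))^-1 != 0)); first by rewrite invr_eq0.
rewrite [RHS]mulfV //.
apply: (@closure_const _ _ g stab_torus (fun g : 'rV[Cx R]_N => g 0 i * (mon K Y (f g) (i, false))^-1)) => //.
  apply: continuous_mul; first exact: cc.
  apply: continuous_inv => //; apply: continuous_bigprod => l _; apply: continuous_expz; last exact: f0.
  rewrite /f; case: (l == l0); first exact: cst_continuous.
  by rewrite /sgc; case: (kap l).2; [apply: continuous_inv => //|]; exact: cc.
move=> h sh; have h0 : mon K Y (f h) (i, false) != 0.
  by apply: mon_neq0 => l; apply: f0 => j; rewrite -normr_eq0 sh.1 oner_neq0.
exact: (etrans (congr1 (fun c => c * _) (stab_mon sh iJ)) (mulfV h0)).
Qed.

Let torus_surj h : torus K h -> exists y, h = texp (k_incl K y).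
Proof.
move=> Kh.
have /choice[th thE] l : exists t, sgc h (kap l) = cexpi t.
  by apply: cexpi_surj; exact: (sqn_sgc _ Kh).
exists (\sum_l th l *: Y l); rewrite (texp_mon hK hY); apply/rowP => i; rewrite mxE.
rewrite -[LHS]/(sgc h (i, false)) (torus_monE hK hY _ Kh); apply: eq_bigr => l _.
by rewrite (wbasis_pairing hY) thE.
Qed.

Lemma stab_torus_connected : connected stab_torus.
Proof.
pose F (z : 'rV[R]_(d + N)) : 'rV[R]_N :=
  \row_i if i \in J0 then z 0 (rshift d i) else \sum_j z 0 (lshift N j) * tlie K j i.
have cF : continuous F.
  move=> z; apply: continuous_mx => i j; rewrite (_ : (fun t => F t i j) =
    fun t => if j \in J0 then t 0 (rshift d j) else \sum_k t 0 (lshift N k) * tlie K k j); last first.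
    by apply/funext => t; rewrite mxE.
  case: (j \in J0); first exact: coord_continuous.
  apply: continuous_bigsum => k _; apply: continuous_mul; [exact: coord_continuous|exact: cst_continuous].
have FE y X i : F (row_mx y X) 0 i = if i \in J0 then X 0 i else k_incl K y 0 i.
  by rewrite mxE row_mxEr; case: ifP => // _; rewrite mxE; apply: eq_bigr => j _; rewrite row_mxEl.
rewrite (_ : stab_torus = (@texp R N \o F) @` [set: 'rV[R]_(d + N)]).
  apply: connected_continuous_connected; first exact: row_space_connected.
  apply: continuous_subspaceT => z; apply: continuous_comp; first exact: cF.
  exact: texp_continuous.
apply/seteqP; split => [g [g1 [h Kh e]]|_ [z _ <-]].
  have [y yE] := torus_surj Kh.
  have /choice[X XE] i : exists t, g 0 i = cexpi t by apply: cexpi_surj; apply/norm1_sqn.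
  exists (row_mx y (\row_i X i)) => //; apply/rowP => i; rewrite /= texpE FE mxE.
  by case: ifP => iJ; [rewrite XE|rewrite e ?iJ // yE texpE].
split=> [i|]; first by apply/norm1_sqn; rewrite texpE sqn_cexpi.
exists (texp (k_incl K (lsubmx z))); first exact: torus_texp.
by move=> i iJ; rewrite /= -{1}(hsubmxK z) !texpE FE (negPf iJ).
Qed.

(** Conversely, [y] is built from the coordinates of [X] at the basis weights on the wall. By the
    monomial equations, [X] and [k_incl K y] give the same one-parameter characters off [J0], hence
    agree there. *)
Lemma stab_lieP (X : 'rV[R]_N) : (X <= stab_lie)%MS <-> forall t : R, stab_torus (texp (t *: X)).
Proof.
have dE (Z : 'rV[R]_N) i : (Z *m diag_mx (\row_i (i \in J0)%:R)) 0 i = Z 0 i * (i \in J0)%:R.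
  by rewrite mul_mx_diag !mxE.
rewrite eq_row_base -addsmxE; split.
  move=> /sub_addsmxP[[y Z] /= ->] t; split=> [i|]; first by apply/norm1_sqn; rewrite texpE sqn_cexpi.
  exists (texp (t *: k_incl K y)); first exact: torus_texpZ.
  move=> i iJ; rewrite !texpE; congr cexpi; rewrite [LHS]mxE [RHS]mxE; congr (_ * _).
  by rewrite [LHS]mxE dE (negPf iJ) mulr0 addr0.
move=> h; pose xs (k : sidx N) : R := if k.2 then - X 0 k.1 else X 0 k.1.
have sgE t k : sgc (texp (t *: X)) k = cexpi (t * xs k).
  by rewrite /sgc texpE mxE /xs; case: ifP => _; rewrite ?mulrN ?cexpiN.
pose y := \sum_l (if l == l0 then 0 else xs (kap l)) *: Y l.
have e i : i \notin J0 -> X 0 i = k_incl K y 0 i.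
  move=> iJ; apply/eqP; rewrite -subr_eq0; apply/eqP; apply: cexpi_triv => t.
  rewrite mulrBr cexpiD cexpiN -[t * X 0 i]/(t * xs (i, false)) -sgE.
  have <- : sgc (texp (t *: X)) (i, false) = cexpi (t * k_incl K y 0 i).
    rewrite -[LHS]/(texp (t *: X) 0 i) (stab_mon (h t)) // -pairing_iotau -pairingZr.
    rewrite -[iotau K i]/(wt (i, false)) (cexpi_mon hK hY); apply: mon_on => // l ll.
    by rewrite (negPf ll) sgE pairingZr (wbasis_pairing hY) (negPf ll).
  by rewrite mulfV // sgE cexpi_neq0.
apply/sub_addsmxP; exists (y, X - k_incl K y) => /=; apply/rowP => i.
rewrite [RHS]mxE dE !mxE -/(k_incl K y); have [iJ|iJ] := boolP (i \in J0).
  by rewrite mulr1 addrC subrK.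
by rewrite mulr0 addr0 (e i iJ) /k_incl mxE.
Qed.

Lemma stab_subtorus : exists K' : subtorus R N d', torus K' = stab_torus /\ tlie K' = stab_lie.
Proof.
unshelve eexists.
  apply: (@Subtorus R N d' stab_torus stab_lie).
  - by move=> g [].
  - split=> [i|]; first by rewrite mxE normr1.
    by exists (const_mx 1) => //; exact: torus1.
  - move=> g g' [g1 [h Kh e]] [g1' [h' Kh' e']]; split=> [i|]; first by rewrite mxE normrM g1 g1' mulr1.
    by exists (tmul h h') => [|i iJ]; [exact: torusM|rewrite !mxE e // e'].
  - move=> g [g1 [h Kh e]]; split=> [i|]; first by rewrite mxE normfV g1 invr1.
    by exists (tinv h) => [|i iJ]; [exact: torusV|rewrite !mxE e].
  - exact: stab_torus_closed.
  - exact: stab_torus_connected.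
  - exact: row_base_free.
  - exact: stab_lieP.
by [].
Qed.

Lemma stab_ortho (u : 'rV[R]_N) : u *m stab_lie^T = 0 <->
  u *m (tlie K)^T = 0 /\ forall i, i \in J0 -> u 0 i = 0.
Proof.
have E m (A : 'M[R]_(m, N)) : u *m A^T = 0 <-> (A <= kermx u^T)%MS.
  split=> [h|/sub_kermxP h]; last by apply: trmx_inj; rewrite trmx_mul trmxK h trmx0.
  by apply/sub_kermxP; apply: trmx_inj; rewrite trmx_mul trmxK h trmx0.
rewrite !E eq_row_base col_mx_sub; split=> [/andP[h1 /sub_kermxP h2]|[h1 h2]].
  split => // i iJ; have /matrixP/(_ i 0) := h2.
  by rewrite mul_diag_mx !mxE iJ mul1r.
apply/andP; split => //; apply/sub_kermxP; apply/matrixP => i j; rewrite mul_diag_mx !mxE.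
by rewrite ord1; case: (boolP (i \in J0)) => [/h2 ->|_]; rewrite ?mulr0 ?mul0r.
Qed.

(** Supplies the parameters of the larger torus: a representative that vanishes on [J0] turns the
    level equations into those of [K] together with vanishing on [J0]. *)
Lemma on_wall_lift v : pairing v Y0 = 0 ->
  exists a : 'rV[R]_N, a *m (tlie K)^T = v /\ forall i, i \in J0 -> a 0 i = 0.
Proof.
move=> v0.
pose a := \sum_(l | l != l0) (pairing v (Y l) * kap_sgn R kap l) *: delta_mx 0 (kap l).1 : 'rV[R]_N.
exists a; split=> [|i iJ].
  rewrite [RHS](hY.2 v) (bigD1 l0) //= YE pairingZr v0 mulr0 scale0r add0r mulmx_suml.
  apply: eq_bigr => l ll; rewrite -scalemxAl -rowE -tr_col -/(iotau K _) -scalerA; congr (_ *: _).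
  by rewrite /wt /kap_sgn; case: (kap l) => j [] /=; rewrite ?scaleN1r ?scale1r.
rewrite summxE big1 // => l ll; rewrite !mxE; case: (i =P (kap l).1) => [il|_]; last by rewrite ?andbF mulr0.
by have := kap_on ll; rewrite -il iJ.
Qed.

End StabilizedTorus.

Lemma mu1_mx (R : realType) N d (K : subtorus R N d) p :
  mu1 K p = pi *: ((\row_i (sqn (p.1 0 i) - sqn (p.2 0 i))) *m (tlie K)^T).
Proof.
congr (_ *: _); rewrite mulmx_sum_row; apply: eq_bigr => i _.
by rewrite mxE -tr_col.
Qed.

Lemma muC_mx (R : realType) N d (K : subtorus R N d) p :
  muC K p = (- 2 * rC pi * 'i) *: \row_j cof
    (((\row_i cre (p.1 0 i * p.2 0 i)) *m (tlie K)^T) 0 j)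
    (((\row_i cim (p.1 0 i * p.2 0 i)) *m (tlie K)^T) 0 j).
Proof.
congr (_ *: _); apply/rowP => j; rewrite summxE [RHS]mxE; apply: Cx_eqP => /=.
  rewrite cre_sum [RHS]mxE; apply: eq_bigr => i _.
  by rewrite !mxE mulrC creZ mulrC.
rewrite cim_sum [RHS]mxE; apply: eq_bigr => i _.
by rewrite !mxE mulrC cimZ mulrC.
Qed.

(** The structure depends on the group only through its orbits in [Z], which allows [K] to be
    replaced by the larger torus. *)
Lemma hyperkahler_quotient_orb (R : realType) N (Z : set 'M[R]_(4, N)) orb orb' :
  (forall q, Z q -> orb q = orb' q) -> hyperkahler_quotient Z orb -> hyperkahler_quotient Z orb'.
Proof.
move=> oE [m h]; exists m => p Zp; have [Om [phi [qc [lift [ls hl]] [x Ox px]]]] := h p Zp.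
have [s1 s2 s3 s4] := qc.
have Zphi y : Om y -> Z (phi y) by move=> Oy; apply: s2; exists y.
exists Om, phi; split; last by exists x => //; rewrite -oE.
  split => //; first by move=> y z Oy Oz; rewrite -oE; [exact: s3|exact: Zphi].
  move=> y Oy; have [P [psi [p1 p2 p3]]] := s4 y Oy; exists P, psi; split => // q Oq Zq.
  by rewrite -oE //; exact: p3.
exists lift; split => // y Oy; have := hl y Oy.
have ve : vertical orb (phi y) = vertical orb' (phi y).
  by rewrite /vertical oE //; exact: Zphi.
have he : horizontal Z orb (phi y) = horizontal Z orb' (phi y).
  by apply/funext => v; rewrite /horizontal ve.
by rewrite ve he.
Qed.

Lemma smooth_on_id (R : realType) m n : smooth_on [set: 'M[R]_(m, n)] id.
Proof.
apply: (elem_smooth openT (@coord_base R m n setT)) => i j.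
by apply: elem_base; exists i, j.
Qed.

Lemma hyperkahler_iso_id (R : realType) N (Z : set 'M[R]_(4, N)) orb orb' :
  (forall q, Z q -> orb q = orb' q) -> (forall q, Z q -> orb' q q) ->
  hyperkahler_iso Z orb Z orb' id.
Proof.
move=> oE refl; split=> [//|p q Zp Zq|q Zq|q Zq]; first by rewrite oE.
  by exists q => //; exact: refl.
have ve : vertical orb q = vertical orb' q by rewrite /vertical oE.
have he : horizontal Z orb q = horizontal Z orb' q by apply/funext => v; rewrite /horizontal ve.
exists setT, id, id; split => //; first exact: smooth_on_id.
- by move=> p _ Zp; split => //; exact: refl.
- by move=> h; rewrite he => hh; split=> //; rewrite derive_id subrr; exists (cst q); split=> [//|t|];
    [exact: refl|exact: is_derive_cst].
- by move=> h hh; exists h; rewrite ?he.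
Qed.

(** * The hyperkaehler structure and the torus of the wall quotient *)

Section WallQuotient.
Variables (R : realType) (N d : nat) (K : subtorus R N d).
Hypothesis hK : unimodular_subtorus K.
Notation wt := (wt K).
Variables (be : 'rV[Cx R]_d) (H0 : set 'rV[Cx R]_N).
Hypothesis hH0 : Swalls K be H0.
Variable Y0 : 'rV[R]_d.
Hypotheses (hY0 : lie_of K H0 Y0) (hY0n : Y0 != 0).
Variable al : 'rV[R]_d.
Hypothesis hals : forall H, Swalls K be H -> H <> H0 -> ~ wall K H al.
Hypothesis al0 : pairing al Y0 = 0.
Let Z0 := level K al be `&` fixed_by H0.

Let J0 := [set i : 'I_N | pairing (wt (i, false)) Y0 != 0]%SET.

Let J0E (k : sidx N) : (k.1 \in J0) = (pairing (wt k) Y0 != 0).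
Proof. by rewrite inE !pairing_wt; case: k => i [] //=; rewrite oppr_eq0. Qed.

(** Built from the point defining [H0] and not from a point of the level set, which might be
    empty. *)
Lemma wall_basis_ex : exists kap Y l0 c, [/\ wbasis K kap Y, c != 0 & Y l0 = c *: Y0].
Proof.
have [[[p0 H0E] _] _] := hH0.
have [kap [Y [L [hY LF LP]]]] := extend_wbasis K (fun k => crd p0 k != 0).
have [l0 l0L] : exists l0, l0 \notin L.
  apply: contrapT => /forallNP h; move: hY0n; rewrite (wbasis_dual Y0 hY) big1 ?eqxx // => l _.
  have lL : l \in L by apply/negPn/negP/h.
  have := hY0; rewrite H0E => /lie_isotropy h'.
  by rewrite h' ?scale0r //; exact: LF.
have : lie_of K H0 (Y l0) by rewrite H0E; apply/lie_isotropy => k pk; exact: LP.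
rewrite (lie_H0 hH0 hY0 hY0n) => -[c _ cE].
exists kap, Y, l0, c; split => //; apply: contraNneq (wbasis_neq0 l0 hY) => c0.
by rewrite -cE c0 scale0r.
Qed.

Lemma wall_quotient : hyperkahler_quotient (rset Z0) (rorb K).
Proof.
pose n := (2 * (#|[set i : 'I_N | ~~ (pairing (wt (i, false)) Y0 != 0)%R]%SET| - d.-1))%N.
exists (n + n)%N => q Zq.
have [k0 k00] : exists k0, pairing (wt k0) Y0 != 0.
  apply: contrapT => /forallNP h; move/eqP: hY0n; apply; apply: (wt_sep (K := K)) => k.
  by apply/eqP/negPn/negP/h.
have [lq fq] := Zq; have [sq lim sf] := level_face lq.
have wq : on_wall K Y0 al (quat q).
  move=> k; rewrite -sf => qk; apply/eqP; apply: contraNT qk => ok.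
  by have /(fixed_H0 hK hH0 hY0 hY0n) -> := fq.
have [kap [Y [l0 [hY _ kF YE]]]] := wall_basis hH0 hY0 hY0n hals sq wq k00.
rewrite /n -(wall_dimension wq hY kF).
exact: (wall_chart hK hH0 hY0 hY0n hals al0 sq wq hY kF YE (erefl _) Zq).
Qed.

Lemma wall_toric : toric_hyperkahler_manifold K Z0.
Proof.
have [kap [Y [l0 [c0 [hY c0n YE]]]]] := wall_basis_ex.
have [K' [tE lE]] := stab_subtorus hK hY c0n YE J0E.
have lift v (h : pairing v Y0 = 0) := on_wall_lift hY c0n YE J0E h.
pose f : Cx R := - 2 * rC pi * 'i; have f0 : f != 0 by exact: muC_factor_neq0.
pose bf := f^-1 *: be; have [br0 bi0] : pairing (map_mx (@cre R) bf) Y0 = 0 /\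
    pairing (map_mx (@cim R) bf) Y0 = 0.
  by apply/pC_eq0; rewrite pC_scale (pC_be0 hH0 hY0 hY0n) mulr0.
have [|a [aE a0]] := lift (pi^-1 *: al); first by rewrite pairingZl al0 mulr0.
have [br [brE br0']] := lift _ br0; have [bi [biE bi0']] := lift _ bi0.
pose T := stab_lie K J0; pose rowc m (u v : 'rV[R]_m) : 'rV[Cx R]_m := f *: \row_j cof (u 0 j) (v 0 j).
have rowcP m (u v u' v' : 'rV[R]_m) : rowc m u v = rowc m u' v' <-> u = u' /\ v = v'.
  split=> [/(scalerI f0)/rowP h|[-> ->] //].
  by split; apply/rowP => j; have := h j; rewrite !mxE => /cof_inj[].
have solve (s v : 'rV[R]_N) u : v *m (tlie K)^T = u -> (forall i, i \in J0 -> v 0 i = 0) ->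
    s *m T^T = v *m T^T <-> s *m (tlie K)^T = u /\ forall i, i \in J0 -> s 0 i = 0.
  move=> vE v0; split=> [/eqP|[h1 h2]].
    rewrite -subr_eq0 -mulmxBl => /eqP /stab_ortho[/eqP]; rewrite mulmxBl subr_eq0 => /eqP h1 h2.
    by split=> [|i iJ]; [rewrite h1|have := h2 i iJ; rewrite !mxE v0 // subr0].
  apply/eqP; rewrite -subr_eq0 -mulmxBl; apply/eqP/stab_ortho; rewrite mulmxBl h1 vE subrr.
  by split => // i iJ; rewrite !mxE h2 // v0 // subr0.
have beE : be = rowc _ (br *m (tlie K)^T) (bi *m (tlie K)^T).
  rewrite brE biE /rowc (_ : \row__ _ = bf) ?scalerA ?mulfV ?scale1r //.
  by apply/rowP => j; rewrite !mxE cofK.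
have levelE : level K' (pi *: (a *m T^T)) (rowc _ (br *m T^T) (bi *m T^T)) = Z0.
  have pi0 : pi != 0 :> R by rewrite gt_eqF ?pi_gt0.
  have al_eq (u : 'rV[R]_d) : pi *: u = al <-> u = pi^-1 *: al.
    by split=> [<-|->]; rewrite scalerA ?mulVf ?mulfV ?scale1r.
  apply/seteqP; split => p.
    move=> [h1 h2]; move: h1; rewrite mu1_mx lE => /(scalerI pi0) /(solve _ _ _ aE a0)[m1 m0].
    move: h2; rewrite muC_mx lE => /rowcP[/(solve _ _ _ brE br0')[r1 r0] /(solve _ _ _ biE bi0')[i1 ii0]].
    split; first split.
    - by rewrite mu1_mx; apply/al_eq.
    - by rewrite muC_mx beE; apply/rowcP; rewrite r1 i1 brE biE.
    apply/(fixed_H0 hK hH0 hY0 hY0n) => k; rewrite -J0E => kJ.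
    (* At an index of [J0] the equations read [|z|^2 = |w|^2] and [z w = 0], so both coordinates
       vanish. *)
    have /eqP := m0 _ kJ; have := r0 _ kJ; have := ii0 _ kJ; rewrite !mxE subr_eq0.
    move=> him hre /eqP e; have /eqP : p.1 0 k.1 * p.2 0 k.1 = 0 by apply: Cx_eqP.
    have zz (c : Cx R) : sqn c = 0 -> c = 0 by move=> /eqP; rewrite sqn_eq0 => /eqP.
    have s0 : sqn (0 : Cx R) = 0 by apply/eqP; rewrite sqn_eq0.
    rewrite mulf_eq0 => /orP[] /eqP z0; rewrite z0 s0 in e; rewrite /crd; case: ifP => _ //; exact: zz.
  move=> [[h1 h2] /(fixed_H0 hK hH0 hY0 hY0n) h0].
  have z0 i : i \in J0 -> p.1 0 i = 0 /\ p.2 0 i = 0.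
    move=> iJ; split; [apply: (h0 (i, false))|apply: (h0 (i, true))]; by rewrite -J0E.
  split.
    rewrite mu1_mx lE; apply: congr1; apply/(solve _ _ _ aE a0).
    split=> [|i iJ]; first by apply/al_eq; rewrite -mu1_mx.
    by have [e1 e2] := z0 i iJ; rewrite mxE e1 e2 subrr.
  move: h2; rewrite !muC_mx lE beE => /rowcP[e1 e2]; apply/rowcP; split.
    apply/(solve _ _ _ brE br0'); rewrite e1 brE; split => // i iJ.
    by have [e3 e4] := z0 i iJ; rewrite mxE e3 mul0r.
  apply/(solve _ _ _ biE bi0'); rewrite e2 biE; split => // i iJ.
  by have [e3 e4] := z0 i iJ; rewrite mxE e3 mul0r.
have orbE q : rset Z0 q -> rorb K q = rorb K' q.
  move=> [_ /(fixed_H0 hK hH0 hY0 hY0n) h0]; apply: (congr1 (@rset R N)); apply/seteqP; split => p.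
    move=> [g Kg ->]; exists g => //; rewrite tE; split=> [i|]; first exact: (torus_unit Kg).
    by exists g.
  rewrite /korb /= tE => -[g [g1 [h Kh e]] ->]; exists h => //; apply: crd_inj => k; rewrite !crd_act.
  have [kJ|kJ] := boolP (k.1 \in J0); first by rewrite h0 -?J0E // !mul0r.
  by rewrite /sgc e.
exists N, (\rank (stab_mx K J0)), K', (pi *: (a *m T^T)), (rowc _ (br *m T^T) (bi *m T^T)).
rewrite levelE; split.
  exact: (hyperkahler_quotient_orb orbE wall_quotient).
exists id; apply: hyperkahler_iso_id => // q Zq.
by rewrite -orbE //; exact: korb_refl.
Qed.

End WallQuotient.

Theorem theorem6p4 (R : realType) (N d : nat) (K : subtorus R N d)
    (hK : unimodular_subtorus K)
    (be : 'rV[Cx R]_d)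
    (Cp Cm : set 'rV[R]_d) (hCp : chamber K be Cp) (hCm : chamber K be Cm)
    (H0 : set 'rV[Cx R]_N) (hH0 : Swalls K be H0)
    (hnext : next_across K H0 Cm Cp)
    (Y0 : 'rV[R]_d) (hY0 : lie_of K H0 Y0) (hY0n : Y0 != 0)
    (J0 : {set 'I_N}) (hJ0 : J0 = [set i | k_incl K Y0 0 i != 0]%SET)
    (ap am al : 'rV[R]_d) (hap : Cp ap) (ham : Cm am)
    (hal : closure Cp al) (hal0 : wall K H0 al)
    (hals : forall H, Swalls K be H -> H <> H0 -> ~ wall K H al) :
  let Z0 := level K al be `&` fixed_by H0 in
  let V0 := korb K @` Z0 in
  let X := Xspace K al be in
  let f := natural_map K al be in
  (* (1) *)
  toric_hyperkahler_manifold K Z0 /\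
  forall a, a = ap \/ a = am ->
    let Xa := Xspace K a be in
    let Va := pts Xa `&` f @^-1` V0 in
    [/\ (* (2) *)
        [/\ ss K a be `<=` ss K al be,
            hol_map Xa X f &
            forall p, ss K a be p -> f (cls K a be p) = cls K al be p],
        (* (3) *)
        fiber_bundle (sub_space Xa Va) (sub_space X V0) (CP R #|J0|.-1) f,
        has_codim Xa Va #|J0|.-1 &
        (* (4) *)
        biholomorphic (sub_space Xa (pts Xa `\` Va))
          (sub_space X (pts X `\` V0)) f].
Proof.
move=> Z0 V0 X f; have al0 := pairing_al0 hH0 hY0 hY0n hal0.
split; first exact: (wall_toric hK hH0 hY0 hY0n hals al0).
(* Both sides are treated together. [hsub], [hgen], [hint] and [hwall] express the position of [a]
   next to the wall, and hold for [ap] and for [am]. *)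
move=> a ha Xa Va.
have ga : generic_locus K be a.
  by case: ha => ->; [exact: (chamber_generic hCp)|exact: (chamber_generic hCm)].
have a0 := generic_neq0 ga hH0 (lie_H0 hH0 hY0 hY0n).
have hsub p : ss K a be p -> ss K al be p.
  exact: (next_ss_sub hCp hCm hH0 hnext hY0 hY0n hap ham hal hal0 ha).
have hgen p : ss K a be p -> limpt K a p = p.
  move=> sp; have [sf _] := generic_face ga sp; apply: crd_inj => k.
  by rewrite crd_restr -sf /supp; case: eqP.
have hint p := interior_ss hCp hCm hH0 hnext hY0 hY0n hap ham hal hal0 (p := p) ha.
have hwall p : ss K al be p -> on_wall K Y0 al p ->
    ss K a be p <-> exists2 k, supp p k & 0 < pairing (wt K k) Y0 * pairing a Y0.
  move=> sp wp; apply: (wall_ss hCp hCm hH0 hnext hY0 hY0n hap ham hal hal0 ha sp wp).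
  exact: (on_wall_sep hH0 hY0 hY0n hals sp wp).
split.
- split=> [//||p sp]; first exact: (natural_hol_map hK hsub hgen).
  exact: (f_cls hK hsub hgen sp).
- exact: (wall_bundle hK hH0 hY0 hY0n hals a0 al0 hsub hgen hwall hJ0).
- exact: (wall_codim hK hH0 hY0 hY0n hals a0 al0 hsub hgen hwall hint hJ0).
- exact: (natural_biholomorphic hK hH0 hY0 hY0n hals hsub hgen hint).
Qed.
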